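(* Let $\mathcal X$ be a complex Banach space, $s<0$, $0<p<\infty$ and $1\le q<\infty$. Then $$F^s_{p,q}(\mathcal X)=H^p\cdot F^s_{\infty,q}(\mathcal X).$$ Moreover, for every $f\in F^s_{p,q}(\mathcal X)$ the factorization $f=gh$ (with $g\in H^p$, $h\in F^s_{\infty,q}(\mathcal X)$ and $\|g\|_{H^p}\|h\|_{F^s_{\infty,q}(\mathcal X)}\le C\|f\|_{F^s_{p,q}(\mathcal X)}$, $C$ independent of $f$) can be chosen with $g$ an outer function.
   Context: Notation: $\mathbb D=\{w\in\mathbb C:|w|<1\}$, $\mathbb T=\{\zeta\in\mathbb C:|\zeta|=1\}$, $\zeta_x=e^{2\pi i x}$ ($x\in\mathbb R$); integrals $\int_{\mathbb T}\cdots\,dx$ are with respect to normalized arc length (total mass $1$), and for an arc $I\subset\mathbb T$, $|I|$ is its normalized length. For a complex Banach space $\mathcal X$, $\mathcal A(\mathcal X)$ is the space of analytic functions $\mathbb D\to\mathcal X$. For $0<p<\infty$, $H^p(\mathcal X)$ is the space of $f\in\mathcal A(\mathcal X)$ with $\|f\|_{H^p(\mathcal X)}=\sup_{0<r<1}\big(\int_{\mathbb T}\|f(r\zeta_x)\|_{\mathcal X}^p\,dx\big)^{1/p}<\infty$; $H^p=H^p(\mathbb C)$. An outer function is one of the form $g(w)=\lambda\exp\big(\int_{\mathbb T}\frac{\zeta_x+w}{\zeta_x-w}\log u(\zeta_x)\,dx\big)$ with $|\lambda|=1$, $u\ge0$, $\log u\in L^1(\mathbb T)$. Dyadic arcs $\mathcal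 D(\mathbb T)$: images under $x\mapsto\zeta_x$ of the intervals $[2^{-j}k,2^{-j}(k+1))$, $j\ge0$, $0\le k\le 2^j-1$. Stolz angle: $\Gamma(\zeta_x)$ is the convex hull of $\{\zeta_x\}\cup\{w:|w|=1/2\}$. Tent over $E\subset\mathbb T$: $T(E)=\mathbb D\setminus\bigcup_{\zeta\notin E}\Gamma(\zeta)$. For measurable $F:\mathbb D\to\mathbb C$ and $0<q<\infty$, $A_qF(\zeta_x)=\big(\int_{\Gamma(\zeta_x)}|F(z)|^q(1-|z|)^{-2}\,dA(z)\big)^{1/q}$. Tent spaces: for $0<p<\infty$, $T_{p,q}$ consists of $F$ with $\|F\|_{T_{p,q}}=\|A_qF\|_{L^p(\mathbb T)}<\infty$; $T_{\infty,q}$ consists of $F$ with $\|F\|_{T_{\infty,q}}^q=\sup_{I\in\mathcal D(\mathbb T)}\frac1{|I|}\int_{T(I)}|F(z)|^q(1-|z|)^{-1}dA(z)<\infty$. $T_{p,q}(\mathcal X)$ ($0<p\le\infty$) is the set of strongly measurable $F:\mathbb D\to\mathcal X$ with $\|F(\cdot)\|_{\mathcal X}\in T_{p,q}$, normed by $\|F\|_{T_{p,q}(\mathcal X)}=\|\,\|F\|_{\mathcal X}\|_{T_{p,q}}$. Triebel–Lizorkin spaces for $s<0$, $0<p\le\infty$, $1\le q<\infty$: $F^s_{p,q}(\mathcal X)$ is the space of $f\in\mathcal A(\mathcal X)$ with $\|f\|_{F^s_{p,q}(\mathcal X)}:=\|(1-|z|)^{-s}f(z)\|_{T_{p,q}(\mathcal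 X)}<\infty$ (this is the paper's definition $\|(1-|z|)^{\alpha-s}D^\alpha f\|_{T_{p,q}(\mathcal X)}$ with the admissible choice $\alpha=0$); $F^s_{p,q}=F^s_{p,q}(\mathbb C)$. Product notation: for (quasi-)normed spaces $X,X_1,X_2$ of functions on $\mathbb D$, $X\subset X_1\cdot X_2$ means every $f\in X$ can be written $f=f_1f_2$ with $f_i\in X_i$ and $\sup_{f\ne0}\inf_{f_1f_2=f}\|f_1\|_{X_1}\|f_2\|_{X_2}/\|f\|_X<\infty$; $X_1\cdot X_2\subset X$ means $f_1f_2\in X$ for all $f_i\in X_i$ with $\|f_1f_2\|_X\le C\|f_1\|_{X_1}\|f_2\|_{X_2}$; $X=X_1\cdot X_2$ means both. Products of a scalar and a vector-valued function are pointwise. *)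

(* Defs.v *)
From HB Require Import structures.
From mathcomp Require Import all_boot all_order all_algebra.
From mathcomp Require Import all_classical all_reals all_analysis.
From mathcomp Require Import complex.
Set Implicit Arguments. Unset Strict Implicit. Unset Printing Implicit Defensive.
Import Order.TTheory GRing.Theory Num.Theory.
Import numFieldNormedType.Exports.
Local Open Scope ring_scope.
Local Open Scope classical_set_scope.

(* The complex field C = R[i] over a real type R, seen as a numClosedFieldType,
   hence (via numFieldNormedType) a complete normed field over itself. *)
Definition CC (R : realType) : numClosedFieldType := R[i].

Definition cRe {R : realType} (z : CC R) : R := @complex.Re R z.
Definition cIm {R : realType} (z : CC R) : R := @complex.Im R z.

(* The norm of a normed space over C, as a real number (the library norm takes
   values in C itself, with vanishing imaginary part). *)
Definition rnorm {R : realType} {V : normedModType (CC R)} (v : V) : R :=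
  cRe (`|v| : CC R).

Definition rC {R : realType} (x : R) : CC R := (x%:C)%C.
Definition toC {R : realType} (p : R * R) : CC R := (p.1 +i* p.2)%C.

Definition zeta {R : realType} (x : R) : CC R :=
  ((cos (2 * pi * x)) +i* (sin (2 * pi * x)))%C.

Definition cexp {R : realType} (z : CC R) : CC R :=
  ((expR (cRe z) * cos (cIm z)) +i* (expR (cRe z) * sin (cIm z)))%C.

Definition disc {R : realType} : set (CC R) := [set z | rnorm z < 1].
Definition circle {R : realType} : set (CC R) := [set z | rnorm z = 1].

Definition analytic {R : realType} {X : normedModType (CC R)} (f : CC R -> X) : Prop :=
  forall z : CC R, disc z -> derivable f z 1.

(* Lebesgue integral w.r.t. normalized arc length on T, parametrized by x in [0,1] *)
Definition arc_int {R : realType} (g : R -> \bar R) : \bar R :=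
  (\int[@lebesgue_measure R]_(x in `[0%R, 1%R]) g x)%E.

Definition area_int {R : realType} (S : set (CC R)) (G : CC R -> \bar R) : \bar R :=
  (\int[(@lebesgue_measure R \x @lebesgue_measure R)%E]_(p in toC @^-1` S) G (toC p))%E.

Definition convexC {R : realType} (A : set (CC R)) : Prop :=
  forall (a b : CC R) (t : R), 0 <= t <= 1 -> A a -> A b ->
    A (rC t * a + rC (1 - t) * b).
Definition conv_hull {R : realType} (A : set (CC R)) : set (CC R) :=
  [set z | forall K : set (CC R), A `<=` K -> convexC K -> K z].

Definition stolz {R : realType} (zt : CC R) : set (CC R) :=
  conv_hull ([set zt] `|` [set w | rnorm w = 2^-1]).

Definition tent {R : realType} (E : set (CC R)) : set (CC R) :=
  disc `\` \bigcup_(zt in circle `\` E) stolz zt.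

(* dyadic arc of generation j, number k (k < 2^j): image of [k 2^-j, (k+1) 2^-j);
   its normalized length is 2^-j *)
Definition dyadic_arc {R : realType} (j k : nat) : set (CC R) :=
  zeta @` `[(k%:R / (2 ^+ j)) : R, (k.+1%:R / (2 ^+ j))[.

Definition Aq {R : realType} (q : R) (F : CC R -> R) (zt : CC R) : \bar R :=
  ((area_int (stolz zt)
      (fun z => (powR (F z) q * powR (1 - rnorm z) (-2))%:E)) `^ (q^-1))%E.

Definition tent_norm {R : realType} (p q : R) (F : CC R -> R) : \bar R :=
  ((arc_int (fun x => (Aq q F (zeta x)) `^ p)) `^ (p^-1))%E.

Definition tent_norm_inf {R : realType} (q : R) (F : CC R -> R) : \bar R :=
  ((ereal_sup [set y : \bar R | exists j k : nat, (k < 2 ^ j)%N /\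
      y = (((2 ^+ j : R)%:E) *
           area_int (tent (dyadic_arc j k))
             (fun z => (powR (F z) q * powR (1 - rnorm z) (-1))%:E))%E])
     `^ (q^-1))%E.

Definition TLweight {R : realType} {X : normedModType (CC R)} (s : R) (f : CC R -> X)
  : CC R -> R :=
  fun z => powR (1 - rnorm z) (- s) * rnorm (f z).

Definition TL_norm {R : realType} {X : normedModType (CC R)} (s p q : R) (f : CC R -> X)
  : \bar R := tent_norm p q (TLweight s f).
Definition TL_norm_inf {R : realType} {X : normedModType (CC R)} (s q : R) (f : CC R -> X)
  : \bar R := tent_norm_inf q (TLweight s f).
Definition inTL {R : realType} {X : normedModType (CC R)} (s p q : R) (f : CC R -> X) : Prop :=
  analytic f /\ (TL_norm s p q f < +oo)%E.
Definition inTL_inf {R : realType} {X : normedModType (CC R)} (s q : R) (f : CC R -> X) : Prop :=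
  analytic f /\ (TL_norm_inf s q f < +oo)%E.

Definition Hp_norm {R : realType} (p : R) (g : CC R -> CC R) : \bar R :=
  ereal_sup [set y : \bar R | exists r : R, 0 < r < 1 /\
     y = ((arc_int (fun x => (powR (rnorm (g (rC r * zeta x))) p)%:E)) `^ (p^-1))%E].
Definition inHp {R : realType} (p : R) (g : CC R -> CC R) : Prop :=
  analytic g /\ (Hp_norm p g < +oo)%E.

Definition cint {R : realType} (h : R -> CC R) : CC R :=
  (Rintegral (@lebesgue_measure R) `[0%R, 1%R] (fun x => cRe (h x))
   +i* Rintegral (@lebesgue_measure R) `[0%R, 1%R] (fun x => cIm (h x)))%C.

(* outer function: g(w) = lambda exp( \int_T (zeta+w)/(zeta-w) log u(zeta) dx ) on D,
   |lambda| = 1, u >= 0 on T, log u in L^1(T) (in particular u > 0 a.e.) *)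
Definition outer {R : realType} (g : CC R -> CC R) : Prop :=
  exists (lam : CC R) (u : CC R -> R),
    rnorm lam = 1 /\
    (forall x : R, 0 <= u (zeta x)) /\
    (@lebesgue_measure R).-negligible (`[0%R, 1%R] `&` [set x | u (zeta x) = 0]) /\
    (@lebesgue_measure R).-integrable `[0%R, 1%R] (fun x => (ln (u (zeta x)))%:E) /\
    (forall w : CC R, disc w ->
       g w = lam * cexp (cint (fun x =>
                 (zeta x + w) / (zeta x - w) * rC (ln (u (zeta x)))))).

(* Main.v *)
(* Let A(x) be the q-th power of the area function of f
   at zeta_x, so that the norm of f is the L^p norm of A^(1/q). For the second
   inclusion put v = A^(p/(2q)) + tau and take for g the outer function whose
   modulus is (Mv)^(2/p), M a maximal function. As M is bounded on L^2, g lies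
   in H^p. A lower bound for Poisson integrals of log Mv shows that |g(z)|^(p/2)
   dominates the mean of v over the set of boundary points that see z, and
   Jensen and Tonelli bound the tent masses of h = f / g.

   For the first inclusion let g_r(z) = g(rz). Subharmonicity gives
   |g_r(z)|^(p/2) <= C M(|g_r|^(p/2))(zeta_x) whenever z is near zeta_x, so that
   |g_r|^q is dominated by a function increasing down the dyadic tree, and the
   power bound for the sum over the branches of a tree reduces the claim to the
   L^2 bound for M, provided the mass (1-|z|)^(-sq-1) |h|^q dA of a disc of
   radius d centred on the circle is O(d). The tents over dyadic arcs do not
   contain such discs: near a dyadic point xi no small dyadic tent meets the
   nontangential region at xi. There h is bounded by a Phragmen-Lindelof
   argument from its bounds on both sides of that region; since s < 0, the
   resulting bound |h(z)| = O(|xi - z|^s) is integrable against the weight.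
   Fatou's lemma lets r tend to 1. *)
Require Import Defs.
From HB Require Import structures.
From mathcomp Require Import all_boot all_order all_algebra.
From mathcomp Require Import all_classical all_reals all_analysis.
From mathcomp Require Import complex measurable_realfun.
From mathcomp Require Import ring lra zify.
Import Order.TTheory GRing.Theory Num.Theory.
Import numFieldNormedType.Exports.
Local Open Scope ring_scope.
Local Open Scope classical_set_scope.
Set Implicit Arguments. Unset Strict Implicit. Unset Printing Implicit Defensive.

(** * Complex derivatives *)

(** The exponents are arranged so that only the L^2 bound for M is used, for every p: the outer
    function and the subharmonic majorant both live at the exponent p/2. The summand tau, tuned to
    the norm of f, keeps v away from 0, so that log Mv is integrable and negative powers of v are
    bounded. Values in X enter only through norms: Goursat's theorem is proved for midpoint Riemann
    sums, it yields a maximum principle, and dividing by an outer function turns that into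
    subharmonicity of log |k|. The Poisson bounds are for functions analytic across the circle,
    whence the dilations g_r; cutting off at depth 2^(-n) makes the tree finite, with constants
    independent of r and n. Near a dyadic xi the obstacle is a point seen from both sides. Off a
    cone at xi wider than the Stolz angle a point is seen from one side only; inside the cone there
    is just a crude bound from a coarse arc, improved scale by scale towards xi, each scale being
    controlled by the two sides and by the larger scales. *)

Section rnorm_theory.
Context {R : realType}.
Implicit Types (z w : CC R) (X : normedModType (CC R)).

Lemma rnormE z : rnorm z = Num.sqrt (cRe z ^+ 2 + cIm z ^+ 2).
Proof. by case: z => a b; rewrite /rnorm /cRe /cIm. Qed.

Lemma normr_rC X (v : X) : `|v| = rC (rnorm v) :> CC R.
Proof.
have := normr_ge0 v; rewrite /rnorm /rC /cRe; case: (`|v|) => a b.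
by rewrite lecE /= => /andP[/eqP -> _].
Qed.

Lemma rnorm_ge0 X (v : X) : 0 <= rnorm v.
Proof. by have := normr_ge0 v; rewrite normr_rC /rC lecR. Qed.

Lemma ler_rnormD X (v w : X) : rnorm (v + w) <= rnorm v + rnorm w.
Proof. by have := ler_normD v w; rewrite !normr_rC /rC -rmorphD lecR. Qed.

Lemma rnormN X (v : X) : rnorm (- v) = rnorm v.
Proof. by rewrite /rnorm normrN. Qed.

Lemma rnormB X (v w : X) : rnorm (v - w) = rnorm (w - v).
Proof. by rewrite -rnormN opprB. Qed.

Lemma ler_rnormB X (v w : X) : rnorm v - rnorm w <= rnorm (v - w).
Proof. by rewrite lerBlDr (le_trans _ (ler_rnormD _ _))// subrK. Qed.

Lemma rnorm0 X : rnorm (0 : X) = 0.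
Proof. by rewrite /rnorm normr0. Qed.

Lemma rnorm_eq0 X (v : X) : (rnorm v == 0) = (v == 0).
Proof.
rewrite -(@normr_eq0 _ X) normr_rC /rC; apply/eqP/eqP => [->//|].
by move=> /(congr1 (@complex.Re R)).
Qed.

Lemma rnormZ X z (v : X) : rnorm (z *: v) = rnorm z * rnorm v.
Proof.
have := @normrZ (CC R) X z v; rewrite !normr_rC /rC -rmorphM.
by move=> /(congr1 (@complex.Re R)).
Qed.

Lemma rnormM z w : rnorm (z * w) = rnorm z * rnorm w.
Proof. exact: (rnormZ z (w : (CC R)^o)). Qed.

Lemma rnorm1 : rnorm (1 : CC R) = 1.
Proof. by rewrite /rnorm normr1. Qed.

Lemma rnormV z : rnorm z^-1 = (rnorm z)^-1.
Proof.
have [->|z0] := eqVneq z 0; first by rewrite invr0 rnorm0 invr0.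
have rz : rnorm z != 0 by rewrite rnorm_eq0.
by apply: (mulfI rz); rewrite -rnormM divff// rnorm1 divff.
Qed.

Lemma rnormX z n : rnorm (z ^+ n) = rnorm z ^+ n.
Proof. by elim: n => [|n IH]; rewrite ?expr0 ?rnorm1// !exprS rnormM IH. Qed.

Lemma rnorm_rC (x : R) : rnorm (rC x) = `|x|.
Proof. by rewrite rnormE /rC /cRe /cIm /= expr0n addr0 sqrtr_sqr. Qed.

Lemma cRe_le z : `|cRe z| <= rnorm z.
Proof.
by rewrite rnormE -sqrtr_sqr ler_sqrt ?addr_ge0 ?sqr_ge0// lerDl sqr_ge0.
Qed.

Lemma cIm_le z : `|cIm z| <= rnorm z.
Proof.
by rewrite rnormE -sqrtr_sqr ler_sqrt ?addr_ge0 ?sqr_ge0// lerDr sqr_ge0.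
Qed.

Lemma rnorm_le z : rnorm z <= `|cRe z| + `|cIm z|.
Proof.
rewrite rnormE -[leRHS]ger0_norm ?addr_ge0// -sqrtr_sqr ler_sqrt ?sqr_ge0//.
by rewrite sqrrD !real_normK ?num_real// lerD2r lerDl mulrn_wge0// mulr_ge0.
Qed.

Lemma rnorm_sqr z : rnorm z ^+ 2 = cRe z ^+ 2 + cIm z ^+ 2.
Proof. by rewrite rnormE sqr_sqrtr// addr_ge0 ?sqr_ge0. Qed.

Lemma cReD z w : cRe (z + w) = cRe z + cRe w. Proof. by case: z w => [? ?] []. Qed.
Lemma cImD z w : cIm (z + w) = cIm z + cIm w. Proof. by case: z w => [? ?] []. Qed.
Lemma cReN z : cRe (- z) = - cRe z. Proof. by case: z. Qed.
Lemma cImN z : cIm (- z) = - cIm z. Proof. by case: z. Qed.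
Lemma cReM z w : cRe (z * w) = cRe z * cRe w - cIm z * cIm w.
Proof. by case: z w => [? ?] []. Qed.
Lemma cImM z w : cIm (z * w) = cRe z * cIm w + cIm z * cRe w.
Proof. by case: z w => [a b] [c d]; rewrite /cIm /= addrC. Qed.
Lemma cRe_rC (x : R) : cRe (rC x) = x. Proof. by []. Qed.
Lemma cIm_rC (x : R) : cIm (rC x) = 0. Proof. by []. Qed.
Lemma cRe1 : cRe (1 : CC R) = 1. Proof. by []. Qed.
Lemma cIm1 : cIm (1 : CC R) = 0. Proof. by []. Qed.
Lemma cRe0 : cRe (0 : CC R) = 0. Proof. by []. Qed.
Lemma cIm0 : cIm (0 : CC R) = 0. Proof. by []. Qed.
Definition ccE := (cReD, cImD, cReN, cImN, cReM, cImM, cRe_rC, cIm_rC, cRe1, cIm1, cRe0, cIm0).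

Lemma CC_eq z w : cRe z = cRe w -> cIm z = cIm w -> z = w.
Proof. by case: z w => [a b] [c d]; rewrite /cRe /cIm /= => -> ->. Qed.

Lemma rCM (x y : R) : rC (x * y) = rC x * rC y. Proof. exact: rmorphM. Qed.
Lemma rCD (x y : R) : rC (x + y) = rC x + rC y. Proof. exact: rmorphD. Qed.
Lemma rCN (x : R) : rC (- x) = - rC x. Proof. exact: rmorphN. Qed.
Lemma rC0 : rC 0 = 0 :> CC R. Proof. by []. Qed.
Lemma rC1 : rC 1 = 1 :> CC R. Proof. by []. Qed.
Lemma rCV (x : R) : rC x^-1 = (rC x)^-1. Proof. exact: fmorphV. Qed.

End rnorm_theory.

Section has_cderiv.
Context {R : realType}.
Implicit Types (z w : CC R).

(** A first-order expansion with linear error: no division by the increment occurs, so the product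
    and chain rules are plain norm estimates, for values in [X] as well. *)
Definition has_cderiv (X : normedModType (CC R)) (f : CC R -> X) z (d : X) :=
  forall e : R, 0 < e -> exists2 r : R, 0 < r & forall h : CC R, rnorm h < r ->
    rnorm (f (z + h) - f z - h *: d) <= e * rnorm h.

Lemma derivable_has_cderiv (X : normedModType (CC R)) (f : CC R -> X) z :
  derivable f z 1 -> has_cderiv f z ('D_1 f z).
Proof.
move=> df e e0; have := df; rewrite -/('D_1 f z).
have : (fun h : CC R => h^-1 *: (f (h *: 1 + z) - f z)) @ 0^' --> 'D_1 f z.
  exact: df.
move=> /cvgrPdist_le /(_ (rC e)).
have rCe0 : 0 < rC e by rewrite /rC ltcR.
move=> /(_ rCe0); rewrite near_withinE => /nbhs_normP[r /= r0 H] _.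
(* The radius comes from a filter over [CC R]: a positive element there is the embedding of its own
   real norm. *)
have rr : r = rC (rnorm (r : (CC R)^o)).
  by rewrite -(@normr_rC R (CC R)^o r) gtr0_norm.
have r0' : 0 < rnorm (r : (CC R)^o).
  by have := r0; rewrite {1}rr /rC ltcR.
exists (rnorm (r : (CC R)^o)) => // h hr.
have [->|h0] := eqVneq h 0.
  by rewrite addr0 subrr sub0r scale0r oppr0 !rnorm0 mulr0.
have := H h; rewrite /= sub0r normrN => /(_ _ h0).
have -> : `|h| < r.
  by rewrite rr (@normr_rC R (CC R)^o h) /rC ltcR.
move=> /(_ isT); rewrite (normr_rC (_ - _)) /rC lecR => H1.
have -> : f (z + h) - f z - h *: 'D_1 f z = - h *: ('D_1 f z - h^-1 *: (f (h *: 1 + z) - f z)).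
  rewrite scaleNr scalerBr opprB scalerA divff// scale1r addrC (addrC z).
  rewrite (_ : h *: 1 = h)//; first by rewrite addrC.
  exact: mulr1.
by rewrite rnormZ rnormN mulrC ler_wpM2r// rnorm_ge0.
Qed.

Lemma has_cderiv_derivable (X : normedModType (CC R)) (f : CC R -> X) z d :
  has_cderiv f z d -> derivable f z 1.
Proof.
move=> H; apply/cvg_ex; exists d; apply/cvgrPdist_le => e e0.
have ee : e = rC (rnorm (e : (CC R)^o)).
  by rewrite -(@normr_rC R (CC R)^o e) gtr0_norm.
have e0' : 0 < rnorm (e : (CC R)^o) by have := e0; rewrite {1}ee /rC ltcR.
have [r r0 Hr] := H _ e0'.
rewrite near_withinE; apply/nbhs_normP; exists (rC r); first by rewrite /= /rC ltcR.
move=> h /=; rewrite sub0r normrN (@normr_rC R (CC R)^o h) /rC ltcR => hr h0.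
have {Hr} := Hr _ hr.
have -> : f (z + h) - f z - h *: d = - h *: (d - h^-1 *: (f (h *: 1 + z) - f z)).
  rewrite scaleNr scalerBr opprB scalerA divff// scale1r (addrC z).
  by rewrite (_ : h *: 1 = h)//; exact: mulr1.
rewrite rnormZ rnormN mulrC ler_pM2r; last first.
  by rewrite lt_neqAle rnorm_ge0 andbT eq_sym rnorm_eq0.
by move=> ?; rewrite normr_rC ee /rC lecR.
Qed.

Lemma has_cderiv_cont (X : normedModType (CC R)) (f : CC R -> X) z d : has_cderiv f z d ->
  forall e : R, 0 < e -> exists2 r : R, 0 < r & forall h : CC R, rnorm h < r ->
    rnorm (f (z + h) - f z) <= e.
Proof.
move=> H e e0; have [r r0 Hr] := H _ ltr01.
have K0 : 0 < 1 + rnorm d by rewrite ltr_pwDl// rnorm_ge0.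
exists (Num.min r (e / (1 + rnorm d))).
  by rewrite lt_min r0 divr_gt0.
move=> h; rewrite lt_min => /andP[/Hr H1 H2].
have -> : f (z + h) - f z = (f (z + h) - f z - h *: d) + h *: d by rewrite subrK.
rewrite (le_trans (ler_rnormD _ _))// rnormZ (le_trans (lerD H1 (lexx _)))//.
by rewrite mul1r -{1}(mulr1 (rnorm h)) -mulrDr -ler_pdivlMr// ltW.
Qed.

End has_cderiv.

Section cderiv_rules.
Context {R : realType}.
Implicit Types (z w : CC R).

Lemma has_cderiv_cst (X : normedModType (CC R)) (c : X) z : has_cderiv (fun=> c) z 0.
Proof.
move=> e e0; exists 1 => // h _.
by rewrite subrr scaler0 subrr rnorm0 mulr_ge0 ?(ltW e0) ?rnorm_ge0.
Qed.

Lemma has_cderiv_id z : has_cderiv (fun w : CC R => w) z 1.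
Proof.
move=> e e0; exists 1 => // h _.
have -> : z + h - z - h *: 1 = 0.
  by rewrite (_ : h *: 1 = h); [rewrite (addrC z) addrK subrr|exact: mulr1].
by rewrite rnorm0 mulr_ge0 ?(ltW e0) ?rnorm_ge0.
Qed.

Lemma has_cderivD (X : normedModType (CC R)) (f g : CC R -> X) z a b :
  has_cderiv f z a -> has_cderiv g z b -> has_cderiv (fun w => f w + g w) z (a + b).
Proof.
move=> F G e e0; have e20 : 0 < e / 2 by rewrite divr_gt0.
have [r r0 Hr] := F _ e20; have [r' r0' Hr'] := G _ e20.
exists (Num.min r r'); first by rewrite lt_min r0.
move=> h; rewrite lt_min => /andP[/Hr H1 /Hr' H2].
have -> : f (z + h) + g (z + h) - (f z + g z) - h *: (a + b) =
  (f (z + h) - f z - h *: a) + (g (z + h) - g z - h *: b).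
  by rewrite scalerDr !opprD [in LHS](addrACA (f (z + h))) [RHS]addrACA.
by rewrite (le_trans (ler_rnormD _ _))// (le_trans (lerD H1 H2))// -mulrDl -splitr.
Qed.

Lemma has_cderivZ (X : normedModType (CC R)) (g : CC R -> CC R) (f : CC R -> X) z (a : (CC R)) b :
  has_cderiv (g : CC R -> CC R) z a -> has_cderiv f z b ->
  has_cderiv (fun w => g w *: f w) z (a *: f z + g z *: b).
Proof.
move=> G F e e0.
(* The three error terms have coefficients [rnorm (g z) + 1], [rnorm (f z)] and [rnorm b], which add
   up to [K - 1]. *)
pose K := 1 + rnorm (f z) + (rnorm (g z) + 1) + rnorm b.
have K0 : 0 < K.
  by have := rnorm_ge0 (f z); have := rnorm_ge0 (g z); have := rnorm_ge0 b; rewrite /K; lra.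
have ek : 0 < e / K by rewrite divr_gt0.
have [r r0 Hr] := F _ ek; have [r' r0' Hr'] := G _ ek.
have [r1 r10 Hr1] := has_cderiv_cont G ltr01.
have [r2 r20 Hr2] := has_cderiv_cont G ek.
exists (Num.min (Num.min r r') (Num.min r1 r2)); first by rewrite !lt_min r0 r0' r10.
move=> h; rewrite !lt_min => /andP[/andP[/Hr H1 /Hr' H2] /andP[/Hr1 H3 /Hr2 H4]].
have -> : g (z + h) *: f (z + h) - g z *: f z - h *: (a *: f z + g z *: b) =
  g (z + h) *: (f (z + h) - f z - h *: b) + (g (z + h) - g z - h * a) *: f z
   + (g (z + h) - g z) *: (h *: b).
  rewrite !scalerBr !scalerBl !scalerDr !scalerA !opprD (mulrC h (g z)).
  rewrite -!addrA; congr (_ + _).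
  rewrite [RHS]addrCA [X in _ = - _ + X]addrCA.
  rewrite [LHS]addrC [RHS]addrC -[LHS]addrA.
  set A := g (z + h) *: f z; set B := _ *: b; set C := _ *: f z; set D := _ *: f z; set E := _ *: b.
  rewrite (addrC (- B)) -!addrA [X in _ = _ + (_ + X)]addrCA.
  by rewrite addNKr (addrCA E) subrr addr0.
have G1 : rnorm (g (z + h)) <= rnorm (g z) + 1.
  rewrite -[g (z + h)](subrK (g z)) (le_trans (ler_rnormD _ _))// addrC lerD2l.
  exact: H3.

rewrite (@le_trans _ _ ((rnorm (g z) + 1) * (e / K * rnorm h) + (e / K * rnorm h) * rnorm (f z) + e / K * (rnorm h * rnorm b)))//.
  rewrite (le_trans (ler_rnormD _ _))// lerD//.
    rewrite (le_trans (ler_rnormD _ _))// lerD// rnormZ ler_pM ?rnorm_ge0//.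
  by rewrite !rnormZ ler_pM ?mulr_ge0 ?rnorm_ge0.
have -> : (rnorm (g z) + 1) * (e / K * rnorm h) + (e / K * rnorm h) * rnorm (f z) + e / K * (rnorm h * rnorm b)
  = (e * rnorm h) * ((K - 1) / K) by rewrite /K; ring.
rewrite ler_piMr ?mulr_ge0 ?(ltW e0) ?rnorm_ge0//.
by rewrite ler_pdivrMr// mul1r gerBl.
Qed.

Lemma has_cderiv_comp (X : normedModType (CC R)) (g : CC R -> CC R) (f : CC R -> X) z (a : CC R) b :
  has_cderiv (g : CC R -> CC R) z a -> has_cderiv f (g z) b ->
  has_cderiv (fun w => f (g w)) z (a *: b).
Proof.
move=> G F e e0.
pose K := 1 + rnorm a + rnorm b.
have K0 : 0 < K by rewrite /K ltr_wpDr ?rnorm_ge0// ltr_wpDr ?rnorm_ge0.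
have ek : 0 < e / K by rewrite divr_gt0.
have [r r0 Hr] := F _ ek.
have [r1 r10 Hr1] := G _ ltr01.
have [r2 r20 Hr2] := G _ ek.
exists (Num.min (Num.min r1 r2) (r / K)); first by rewrite !lt_min r10 r20 divr_gt0.
move=> h; rewrite !lt_min => /andP[/andP[/Hr1 H1 /Hr2 H2]]; rewrite ltr_pdivlMr// => H3.
set k := g (z + h) - g z.
have kh : rnorm k <= rnorm h * (1 + rnorm a).
  have -> : k = (k - h * a) + h * a by rewrite subrK.
  rewrite (le_trans (ler_rnormD _ _))// mulrDr lerD//; last by rewrite rnormM.
  by rewrite mulr1 -[leRHS]mul1r.
have kr : rnorm k < r.
  rewrite (le_lt_trans kh)// (le_lt_trans _ H3)// ler_wpM2l ?rnorm_ge0//.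
  by rewrite /K lerDl rnorm_ge0.
have H4 : rnorm (f (g (z + h)) - f (g z) - k *: b) <= e / K * rnorm k.
  by have := Hr _ kr; rewrite (_ : g z + k = g (z + h))// /k addrC subrK.
have -> : f (g (z + h)) - f (g z) - h *: (a *: b) =
  (f (g (z + h)) - f (g z) - k *: b) + (k - h * a) *: b.
  by rewrite (scalerBl k) scalerA addrA subrK.
rewrite (le_trans (ler_rnormD _ _))// rnormZ.
rewrite (@le_trans _ _ (e / K * (rnorm h * (1 + rnorm a)) + e / K * rnorm h * rnorm b))//.
  rewrite lerD//.
    by rewrite (le_trans H4)// ler_wpM2l// ltW.
  by rewrite ler_wpM2r ?rnorm_ge0.
have -> : e / K * (rnorm h * (1 + rnorm a)) + e / K * rnorm h * rnorm b = e * rnorm h * (K / K) by rewrite /K; ring.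
by rewrite divff ?gt_eqF// mulr1.
Qed.

Lemma has_cderivV z : z != 0 -> has_cderiv (fun w : CC R => w^-1) z (- z ^- 2).
Proof.
move=> z0 e e0; have nz : 0 < rnorm z by rewrite lt_neqAle rnorm_ge0 andbT eq_sym rnorm_eq0.
(* The error is [h ^+ 2 / (z ^+ 2 * (z + h))]; the first radius keeps [rnorm (z + h)] above
   [rnorm z / 2], the second makes the quotient at most [e * rnorm h]. *)
exists (Num.min (rnorm z / 2) (e * rnorm z ^+ 3 / 2)).
  by rewrite lt_min !divr_gt0// mulr_gt0// exprn_gt0.
move=> h; rewrite lt_min => /andP[h1 h2].
have zh2 : rnorm z / 2 <= rnorm (z + h).
  have := ler_rnormB z (- h); rewrite opprK rnormN; lra.
have zh0 : z + h != 0.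
  by rewrite -rnorm_eq0 gt_eqF// (lt_le_trans _ zh2)// divr_gt0.
have -> : (z + h)^-1 - z^-1 - h *: (- z ^- 2) = h ^+ 2 / (z ^+ 2 * (z + h)).
  rewrite [_ *: _](_ : _ = h * - z ^- 2)//.
  by field; rewrite z0 zh0.
rewrite rnormM rnormV rnormM !rnormX ler_pdivrMr; last first.
  by rewrite mulr_gt0 ?exprn_gt0// (lt_le_trans _ zh2)// divr_gt0.
rewrite expr2 (mulrC e) -!mulrA ler_wpM2l ?rnorm_ge0//.
rewrite (le_trans (ltW h2))// -mulrA ler_wpM2l ?(ltW e0)//.
by rewrite exprS expr2 -!mulrA !ler_pM2l.
Qed.

Lemma has_cderiv_unique_ext (X : normedModType (CC R)) (f g : CC R -> X) z d :
  f =1 g -> has_cderiv f z d -> has_cderiv g z d.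
Proof. by move=> /funext ->. Qed.

Lemma cexpD z w : cexp (z + w) = cexp z * cexp w.
Proof.
by case: z w => [a b] [c d]; apply: CC_eq; rewrite /cexp /cRe /cIm /= expRD ?cosD ?sinD; ring.
Qed.

Lemma cRe_cexp z : cRe (cexp z) = expR (cRe z) * cos (cIm z). Proof. by []. Qed.
Lemma cIm_cexp z : cIm (cexp z) = expR (cRe z) * sin (cIm z). Proof. by []. Qed.

Lemma rnorm_cexp z : rnorm (cexp z) = expR (cRe z).
Proof.
rewrite rnormE /cexp /cRe /cIm /= !exprMn -mulrDr cos2Dsin2 mulr1 sqrtr_sqr.
by rewrite ger0_norm// expR_ge0.
Qed.

Lemma cexp0 : cexp 0 = 1 :> CC R.
Proof. by apply: CC_eq; rewrite /cexp /cRe /cIm /= expR0 ?cos0 ?sin0; ring. Qed.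

Lemma cexp_neq0 z : cexp z != 0.
Proof. by rewrite -rnorm_eq0 rnorm_cexp gt_eqF// expR_gt0. Qed.

Lemma real_oD (f : R -> R) (d : R) : is_derive (0:R) 1 f d ->
  forall e : R, 0 < e -> exists2 r : R, 0 < r & forall h : R, `|h| < r ->
    `|f h - f 0 - h * d| <= e * `|h|.
Proof.
move=> [df <-] e e0.
have : (fun h : R => h^-1 *: (f (h *: 1 + 0) - f 0)) @ 0^' --> 'D_1 f 0.
  exact: df.
move=> /cvgrPdist_le /(_ _ e0); rewrite near_withinE => /nbhs_normP[r /= r0 H].
exists r => // h hr.
have [->|h0] := eqVneq h 0; first by rewrite subrr mul0r subr0 normr0 mulr0.
have := H h; rewrite /= sub0r normrN hr => /(_ isT h0).
rewrite addr0 (_ : h%:A = h); last exact: mulr1.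
have -> : f h - f 0 - h * 'D_1 f 0 = - h * ('D_1 f 0 - h^-1 *: (f h - f 0)).
  by rewrite [_ *: _](_ : _ = h^-1 * (f h - f 0))//; field.
by move=> H1; rewrite normrM normrN mulrC ler_wpM2r.
Qed.

Lemma has_cderiv_cexp z : has_cderiv (cexp : CC R -> CC R) z (cexp z).
Proof.
(* The addition formula moves the derivative to 0, where only the real functions exp, cos and sin
   enter. *)
suff H0 : has_cderiv (cexp : CC R -> CC R) 0 1.
  move=> e e0; have nz : 0 < rnorm (cexp z) by rewrite rnorm_cexp expR_gt0.
  have [r r0 H] := H0 _ (divr_gt0 e0 nz).
  exists r => // h /H.
  have -> : cexp (z + h) - cexp z - h *: cexp z = cexp z * (cexp (0 + h) - cexp 0 - h *: 1).
    have sc (x : CC R) : h *: x = h * x by [].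
    by rewrite cexpD add0r cexp0 !sc; ring.
  by rewrite rnormM mulrAC ler_pdivlMr// mulrC.
(* The four error terms below add up to at most [9 * e' * n], whence the divisor 10. *)
move=> e e0; have [e' [e'0 e1 e10]] : exists e', [/\ 0 < e', e' <= 1 & e' <= e / 10].
  exists (Num.min 1 (e / 10)); split; last 2 first.
  - by rewrite ge_min lexx.
  - by rewrite ge_min lexx orbT.
  by rewrite lt_min ltr01 divr_gt0.
have [r1 r10 H1] := real_oD (is_derive_expR 0) e'0.
have [r2 r20 H2] := real_oD (is_derive_cos 0) e'0.
have [r3 r30 H3] := real_oD (is_derive_sin 0) e'0.
exists (Num.min (Num.min r1 r2) (Num.min r3 e')); first by rewrite !lt_min r10 r20 r30 e'0.
move=> h; rewrite !lt_min => /andP[/andP[h1 h2] /andP[h3 h4]].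
set a := cRe h; set b := cIm h; set n := rnorm h in h1 h2 h3 h4 *.
have an : `|a| <= n by exact: cRe_le.
have bn : `|b| <= n by exact: cIm_le.
have := H1 a (le_lt_trans an h1); rewrite expR0 mulr1 => A.
have := H2 b (le_lt_trans bn h2); rewrite cos0 sin0 oppr0 mulr0 subr0 => B.
have := H3 b (le_lt_trans bn h3); rewrite sin0 cos0 mulr1 subr0 => C.
have n0 : 0 <= n by exact: rnorm_ge0.

have A' : `|expR a - 1 - a| <= e' * n by rewrite (le_trans A)// ler_wpM2l// ltW.
have B' : `|cos b - 1| <= e' * n by rewrite (le_trans B)// ler_wpM2l// ltW.
have C' : `|sin b - b| <= e' * n by rewrite (le_trans C)// ler_wpM2l// ltW.
set E := expR a - 1 - a in A'.
have eE : expR a = 1 + a + E by rewrite /E; ring.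
have n1 : n <= 1 by rewrite ltW// (lt_le_trans h4).
have nn : n * n <= e' * n by rewrite ler_wpM2r// ltW.
have exp4 : `|expR a| <= 3.
  rewrite eE (le_trans (ler_normD _ _))// (le_trans (lerD (ler_normD _ _) (lexx _)))//.
  rewrite normr1; have := le_trans an n1.
  have : e' * n <= 1 by rewrite -[leRHS]mulr1 ler_pM// ltW.
  clear H1 H2 H3 A B C B' C' bn h1 h2 h3 eE r10 r20 r30 nn; lra.
rewrite add0r cexp0 [h *: 1](_ : _ = h); last exact: mulr1.
rewrite (le_trans (rnorm_le _))// !ccE cRe_cexp cIm_cexp -/a -/b.
have -> : expR a * cos b - 1 - a = E + expR a * (cos b - 1) by rewrite eE; ring.
have -> : expR a * sin b + - 0 - b = expR a * (sin b - b) + (a + E) * b by rewrite eE; ring.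
have T1 : `|expR a * (cos b - 1)| <= 3 * (e' * n) by rewrite normrM ler_pM.
have T2 : `|expR a * (sin b - b)| <= 3 * (e' * n) by rewrite normrM ler_pM.
have T3 : `|(a + E) * b| <= 2 * (e' * n).
  rewrite normrM (@le_trans _ _ ((n + e' * n) * n))//.
    by rewrite ler_pM// (le_trans (ler_normD _ _))// lerD.
  have : (e' * n) * n <= e' * n * 1 by rewrite ler_wpM2l// mulr_ge0// ltW.
  clear H1 H2 H3 A B C A' B' C' an bn h1 h2 h3 exp4 eE r10 r20 r30 T1 T2; lra.
have : 0 <= e' * n by rewrite mulr_ge0// ltW.
have := ler_normD E (expR a * (cos b - 1)).
have := ler_normD (expR a * (sin b - b)) ((a + E) * b).
have : 10 * (e' * n) <= e * n by rewrite mulrA ler_wpM2r// mulrC -ler_pdivlMr.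
clear H1 H2 H3 A B C B' C' an bn h1 h2 h3 h4 nn n1 n0 exp4 e1 e10 eE r10 r20 r30; lra.
Qed.

End cderiv_rules.

(** * Goursat theorem and maximum principle *)

Section goursat.
Context {R : realType} {X : normedModType (CC R)}.
Implicit Types (p q r z w : CC R) (F G : CC R -> X).

Definition mid p q : CC R := (p + q) / 2.

(* Midpoint Riemann sums for the integral of F over the segment from p to q. *)
Fixpoint seg F n p q : X :=
  if n is n'.+1 then seg F n' p (mid p q) + seg F n' (mid p q) q
  else (q - p) *: F (mid p q).

Definition tri F n p q r : X := seg F n p q + seg F n q r + seg F n r p.

Lemma midC p q : mid p q = mid q p. Proof. by rewrite /mid addrC. Qed.

Lemma seg_anti F n p q : seg F n q p = - seg F n p q.
Proof.
elim: n p q => [|n IH] p q /=; first by rewrite midC -scaleNr opprB.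
by rewrite midC opprD addrC -!IH.
Qed.

(** Exact at every level of the Riemann sums: the inner edges are run twice in opposite directions
    and cancel by [seg_anti]. *)
Lemma triS F n p q r : tri F n.+1 p q r =
  tri F n p (mid p q) (mid r p) + tri F n (mid p q) q (mid q r)
  + tri F n (mid r p) (mid q r) r + tri F n (mid q r) (mid r p) (mid p q).
Proof.
rewrite /tri /=.
rewrite (seg_anti F n (mid p q) (mid r p)) (seg_anti F n (mid q r) (mid p q)).
rewrite (seg_anti F n (mid r p) (mid q r)).
set A := seg F n p _; set B := seg F n _ q; set C := seg F n q _; set D := seg F n _ r.
set E := seg F n r _; set G := seg F n _ p.
set a := seg F n (mid p q) _; set b := seg F n (mid q r) _; set c := seg F n (mid r p) _.
have -> : - c - a - b = - (a + b + c) by rewrite -addrA addrC !opprD.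
rewrite (addrAC A a) -(addrA c) (addrC c) (addrACA (A + G)).
rewrite (addrACA (A + G + (B + C))) addrK.
by rewrite (addrACA A G) (addrC G C) -[RHS]addrA (addrACA C) (addrC G E) addrA.
Qed.

Lemma segB F G n p q : seg (fun w => F w - G w) n p q = seg F n p q - seg G n p q.
Proof.
elim: n p q => [|n IH] p q /=; first by rewrite scalerBr.
by rewrite !IH opprD addrACA.
Qed.

(** The midpoint rule is exact on affine functions, so in [goursat] the affine part of the integrand
    drops out at every level, without a limit. *)
Lemma seg_affine (A B : X) (z0 : CC R) n p q :
  seg (fun w => A + (w - z0) *: B) n p q = (q - p) *: (A + (mid p q - z0) *: B).
Proof.
elim: n p q => [//|n IH] p q /=.
rewrite !IH !scalerDr !scalerA addrACA -!scalerDl; congr (_ *: _ + _ *: _).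
  by ring.
by rewrite /mid; field.
Qed.

Lemma tri_affine (A B : X) (z0 : CC R) n p q r :
  tri (fun w => A + (w - z0) *: B) n p q r = 0.
Proof.
have L (u v u' v' : CC R) : u *: A + v *: B + (u' *: A + v' *: B) = (u + u') *: A + (v + v') *: B.
  by rewrite addrACA -!scalerDl.
rewrite /tri !seg_affine !scalerDr !scalerA !L.
rewrite (_ : q - p + (r - q) + (p - r) = 0); last by ring.
by rewrite (_ : _ + _ + _ = 0 :> CC R) ?scale0r ?addr0//; rewrite /mid; field.
Qed.

Lemma triB F G n p q r : tri (fun w => F w - G w) n p q r = tri F n p q r - tri G n p q r.
Proof. by rewrite /tri !segB -!addrA opprD; rewrite !addrA (addrAC _ (- seg G n p q)) opprD !addrA; do 2 (rewrite (addrAC _ (- _) (seg F n r p))); rewrite -!addrA. Qed.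

(** Every sample point of [seg] is an iterated midpoint of the end points, so convexity enters in
    this weak form. *)
Definition mid_closed (S : set (CC R)) := forall p q, S p -> S q -> S (mid p q).

Lemma seg_bound F (S : set (CC R)) (M : R) n p q : mid_closed S ->
  (forall w, S w -> rnorm (F w) <= M) -> S p -> S q ->
  rnorm (seg F n p q) <= rnorm (q - p) * M.
Proof.
move=> Sm SM; elim: n p q => [|n IH] p q Sp Sq /=.
  by rewrite rnormZ ler_wpM2l ?rnorm_ge0// SM//; apply: Sm.
have Sm' := Sm _ _ Sp Sq.
rewrite (le_trans (ler_rnormD _ _))// (le_trans (lerD (IH _ _ Sp Sm') (IH _ _ Sm' Sq)))//.
have -> : mid p q - p = (q - p) * rC 2^-1.
  by rewrite rCV [rC 2](_ : _ = 2) /mid; [field|rewrite /rC rmorphMn].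
have -> : q - mid p q = (q - p) * rC 2^-1.
  by rewrite rCV [rC 2](_ : _ = 2) /mid; [field|rewrite /rC rmorphMn].
by rewrite rnormM rnorm_rC gtr0_norm//; lra.
Qed.

Lemma mid_closed_ball (a : CC R) (d : R) : mid_closed [set w | rnorm (w - a) <= d].
Proof.
move=> p q /= hp hq.
have -> : mid p q - a = (p - a) * rC 2^-1 + (q - a) * rC 2^-1.
  by rewrite rCV [rC 2](_ : _ = 2) /mid; [field|rewrite /rC rmorphMn].
rewrite (le_trans (ler_rnormD _ _))// !rnormM rnorm_rC gtr0_norm//.
by rewrite -mulrDl ler_pdivrMr// mulr_natr mulr2n lerD.
Qed.

End goursat.

Section limits.
Context {R : realType}.

Lemma pow2_big (x : R) : exists k : nat, x < 2 ^+ k.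
Proof.
exists (Num.bound `|x|); apply: (le_lt_trans (ler_norm x)).
rewrite (lt_le_trans (archi_boundP (normr_ge0 x)))// -natrX ler_nat.
exact/ltnW/ltn_expl.
Qed.

(** The intervals of radius [2 * C / 2 ^+ k] around [x k] are nested, and the supremum of their left
    ends lies in all of them. *)
Lemma dyadic_cauchy (x : nat -> R) (C : R) :
  (forall k, `|x k.+1 - x k| <= C / 2 ^+ k) ->
  exists l, forall k, `|l - x k| <= 2 * C / 2 ^+ k.
Proof.
move=> H.
have p2 k : 0 < (2:R) ^+ k by rewrite exprn_gt0.
have C0 : 0 <= C by have := le_trans (normr_ge0 _) (H 0%N); rewrite expr0 divr1.
pose y k := x k - 2 * C / 2 ^+ k; pose z k := x k + 2 * C / 2 ^+ k.
have hk k : 2 * C / 2 ^+ k = C / 2 ^+ k + 2 * C / 2 ^+ k.+1.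
  by rewrite exprS; field; rewrite gt_eqF.
have yS k : y k <= y k.+1.
  by have := H k; rewrite /y hk ler_norml; lra.
have zS k : z k.+1 <= z k.
  by have := H k; have := hk k; rewrite /z ler_norml; lra.
have ym := homo_leq (@lexx _ R) (@le_trans _ R) yS.
have zm k j : (k <= j)%N -> z j <= z k.
  by move: k j; apply: (homo_leq (r := fun a b => b <= a)) => // a b c ab bc; exact: le_trans bc ab.
have yz k : y k <= z k.
  have : 0 <= 2 * C / 2 ^+ k by rewrite divr_ge0 ?mulr_ge0 ?(ltW (p2 _)).
  by rewrite /y /z; lra.
have yz' k j : y k <= z j.
  have [kj|jk] := leqP k j; first by rewrite (le_trans (ym _ _ kj))// yz.
  by rewrite (le_trans (yz _))// zm// ltnW.
have hs : has_sup (range y).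
  by split; [exists (y 0%N), 0%N|exists (z 0%N) => _ [k _ <-]; exact: yz'].
exists (sup (range y)) => k.
have h1 : y k <= sup (range y) by apply: ub_le_sup; [exact: hs.2|exists k].
have h2 : sup (range y) <= z k.
  by apply: ge_sup; [exact: hs.1|move=> _ [j _ <-]; exact: yz'].
by rewrite ler_norml; rewrite /y in h1; rewrite /z in h2; apply/andP; split; lra.
Qed.

Lemma dyadic_cauchyC (x : nat -> CC R) (C : R) :
  (forall k, rnorm (x k.+1 - x k) <= C / 2 ^+ k) ->
  exists l, forall k, rnorm (l - x k) <= 4 * C / 2 ^+ k.
Proof.
move=> H.
have [a Ha] : exists l, forall k, `|l - cRe (x k)| <= 2 * C / 2 ^+ k.
  by apply: dyadic_cauchy => k; rewrite (le_trans _ (H k))// -cReN -cReD cRe_le.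
have [b Hb] : exists l, forall k, `|l - cIm (x k)| <= 2 * C / 2 ^+ k.
  by apply: dyadic_cauchy => k; rewrite (le_trans _ (H k))// -cImN -cImD cIm_le.
exists (a +i* b)%C => k; rewrite (le_trans (rnorm_le _))// !ccE.
by rewrite (le_trans (lerD (Ha k) (Hb k)))// -mulrDl -mulrDl -natrD.
Qed.

End limits.

Section goursat_thm.
Context {R : realType} {X : normedModType (CC R)}.
Implicit Types (p q r z w : CC R) (F G : CC R -> X).
Variables (F : CC R -> X) (K : set (CC R)).
Hypothesis Kmid : mid_closed K.
Hypothesis Kcl : forall z, (forall e : R, 0 < e -> exists2 w, K w & rnorm (z - w) <= e) -> K z.
Hypothesis Fd : forall z, K z -> exists d, has_cderiv F z d.

Let T3 := (CC R * CC R * CC R)%type.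
Let tsize (t : T3) : R := rnorm (t.1.2 - t.1.1) + rnorm (t.2 - t.1.2) + rnorm (t.1.1 - t.2).
(** Largeness of the integral over a triangle, without an integral: the Riemann sums exceed [c] at
    arbitrarily fine levels. *)
Let bad (c : R) (t : T3) := forall N, exists2 n, (N <= n)%N & c < rnorm (tri F n t.1.1 t.1.2 t.2).
Let inK (t : T3) := [/\ K t.1.1, K t.1.2 & K t.2].

Let rC2V : rC 2^-1 = 2^-1 :> CC R.
Proof. by rewrite rCV [rC 2](_ : _ = 2)// /rC rmorphMn. Qed.

Let goursat_step (c : R) (t : T3) : inK t -> bad (4 * c) t ->
  exists t' : T3, [/\ inK t', bad c t', tsize t' = tsize t / 2 & rnorm (t'.1.1 - t.1.1) <= tsize t].
Proof.
case: t => [[p q] r] [/= Kp Kq Kr] Hbad.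
have [Kpq Kqr Krp] : [/\ K (mid p q), K (mid q r) & K (mid r p)] by split; apply: Kmid.
have [s1 s2 s3] : [/\ 0 <= rnorm (q - p), 0 <= rnorm (r - q) & 0 <= rnorm (p - r)].
  by split; exact: rnorm_ge0.
have tr (u v : CC R) (w : R) : v = - u * rC 2^-1 \/ v = u * rC 2^-1 -> rnorm u = w -> rnorm v = w / 2.
  by move=> [->|->] <-; rewrite rnormM rnorm_rC gtr0_norm// rnormN.
pose t1 : T3 := (p, mid p q, mid r p).
pose t2 : T3 := (mid p q, q, mid q r).
pose t3 : T3 := (mid r p, mid q r, r).
pose t4 : T3 := (mid q r, mid r p, mid p q).
have P1 : rnorm (mid p q - p) = rnorm (q - p) / 2.
  by apply: (tr (q - p)) => //; right; rewrite rC2V /mid; field.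
have P2 : rnorm (q - mid p q) = rnorm (q - p) / 2.
  by apply: (tr (q - p)) => //; right; rewrite rC2V /mid; field.
have P3 : rnorm (mid q r - q) = rnorm (r - q) / 2.
  by apply: (tr (r - q)) => //; right; rewrite rC2V /mid; field.
have P4 : rnorm (r - mid q r) = rnorm (r - q) / 2.
  by apply: (tr (r - q)) => //; right; rewrite rC2V /mid; field.
have P5 : rnorm (mid r p - r) = rnorm (p - r) / 2.
  by apply: (tr (p - r)) => //; right; rewrite rC2V /mid; field.
have P6 : rnorm (p - mid r p) = rnorm (p - r) / 2.
  by apply: (tr (p - r)) => //; right; rewrite rC2V /mid; field.
have Q1 : rnorm (mid r p - mid p q) = rnorm (r - q) / 2.
  by apply: (tr (r - q)) => //; right; rewrite rC2V /mid; field.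
have Q2 : rnorm (mid p q - mid q r) = rnorm (p - r) / 2.
  by apply: (tr (p - r)) => //; right; rewrite rC2V /mid; field.
have Q3 : rnorm (mid q r - mid r p) = rnorm (q - p) / 2.
  by apply: (tr (q - p)) => //; right; rewrite rC2V /mid; field.
have sz1 : tsize t1 = tsize (p, q, r) / 2 by rewrite /tsize /= P1 Q1 P6; ring.
have sz2 : tsize t2 = tsize (p, q, r) / 2 by rewrite /tsize /= P2 P3 Q2; ring.
have sz3 : tsize t3 = tsize (p, q, r) / 2 by rewrite /tsize /= Q3 P4 P5; ring.
have sz4 : tsize t4 = tsize (p, q, r) / 2.
  rewrite /tsize /= (rnormB (mid r p) (mid q r)) Q3 (rnormB (mid p q) (mid r p)) Q1.
  by rewrite (rnormB (mid q r) (mid p q)) Q2; ring.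
have [|B1] := pselect (bad c t1).
  by move=> B; exists t1; split => //; rewrite /= subrr rnorm0 /tsize /=; lra.
have [|B2] := pselect (bad c t2).
  by move=> B; exists t2; split => //; rewrite /= P1 /tsize /=; lra.
have [|B3] := pselect (bad c t3).
  by move=> B; exists t3; split => //; rewrite /= rnormB P6 /tsize /=; lra.
have [|B4] := pselect (bad c t4).
  move=> B; exists t4; split => //; rewrite /tsize /=.
  rewrite (_ : mid q r - p = (mid q r - mid p q) + (mid p q - p)); last by rewrite addrA subrK.
  by rewrite (le_trans (ler_rnormD _ _))// rnormB Q2 P1; lra.
(* Were all four small triangles eventually at most [c], [triS] would keep the large one at most
   [4 * c]; the successor in the level below leaves one subdivision to spend. *)
exfalso.
have nb t : ~ bad c t -> exists N, forall n, (N <= n)%N -> rnorm (tri F n t.1.1 t.1.2 t.2) <= c.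
  move=> /existsNP[N HN]; exists N => n Nn; rewrite leNgt; apply/negP => H.
  by apply: HN; exists n.
have [N1 H1] := nb _ B1; have [N2 H2] := nb _ B2; have [N3 H3] := nb _ B3; have [N4 H4] := nb _ B4.
have [[//|n] Nn] := Hbad (maxn (maxn N1 N2) (maxn N3 N4)).+1.
rewrite ltnS !geq_max in Nn; case/andP: Nn => /andP[n1 n2] /andP[n3 n4].
rewrite triS ltNge => /negP; apply.
have := H1 _ n1; have := H2 _ n2; have := H3 _ n3; have := H4 _ n4 => /=.
move=> h4 h3 h2 h1.
rewrite (le_trans (ler_rnormD _ _))// (le_trans (lerD (ler_rnormD _ _) (lexx _)))//.
rewrite (le_trans (lerD (lerD (ler_rnormD _ _) (lexx _)) (lexx _)))//.
lra.
Qed.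

Lemma goursat p q r : K p -> K q -> K r -> forall e : R, 0 < e ->
  exists N, forall n, (N <= n)%N -> rnorm (tri F n p q r) <= e.
Proof.
move=> Kp Kq Kr e e0; apply: contrapT => /forallNP H.
have Hbad : bad e (p, q, r).
  move=> N; have /existsNP[n /not_implyP[Nn /negP]] := H N.
  by rewrite -ltNge => ?; exists n.
pose s0 := tsize (p, q, r).
have p2 k : 0 < (2:R) ^+ k by rewrite exprn_gt0.
have p4 k : 0 < (4:R) ^+ k by rewrite exprn_gt0.
have s00 : 0 <= s0 by rewrite !addr_ge0 ?rnorm_ge0.
pose P k (t : T3) := [/\ inK t, bad (e / 4 ^+ k) t & tsize t = s0 / 2 ^+ k].
have step k (t : T3) : P k t -> {t' : T3 | P k.+1 t' /\ rnorm (t'.1.1 - t.1.1) <= s0 / 2 ^+ k}.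
  move=> [Kt Bt St]; apply: cid.
  have Bt' : bad (4 * (e / 4 ^+ k.+1)) t.
    by rewrite (_ : 4 * _ = e / 4 ^+ k)// exprS; field; rewrite gt_eqF.
  have [t' [K' B' S' D']] := goursat_step Kt Bt'.
  exists t'; rewrite -St; split => //; split => //.
  by rewrite S' St exprS; field; rewrite gt_eqF.
have P0 : P 0%N (p, q, r) by rewrite /P !expr0 !divr1.
pose f := fix f k : {t : T3 | P k t} := match k with
  | 0%N => exist (P 0%N) _ P0
  | k'.+1 => exist (P k'.+1) (sval (step k' (sval (f k')) (svalP (f k'))))
        (svalP (step k' (sval (f k')) (svalP (f k')))).1
  end.
pose t k := sval (f k).
have tP k : P k (t k) by exact: svalP.
have tD k : rnorm ((t k.+1).1.1 - (t k).1.1) <= s0 / 2 ^+ k.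
  exact: (svalP (step k (sval (f k)) (svalP (f k)))).2.
have [z0 Hz0] := dyadic_cauchyC tD.
have small (c d : R) : 0 <= c -> 0 < d -> exists k : nat, c / 2 ^+ k < d.
  move=> c0 d0; have [k Hk] := pow2_big (c / d).
  by exists k; rewrite ltr_pdivrMr// mulrC -ltr_pdivrMr.
have Kz0 : K z0.
  apply: Kcl => d d0; have [k Hk] := small (4 * s0) d (mulr_ge0 (ler0n _ _) s00) d0.
  exists (t k).1.1; first by have [[]] := tP k.
  by rewrite (le_trans (Hz0 k))// ltW.
have [D HD] := Fd Kz0.
(* At stage [k] the perimeter is [s0 / 2 ^+ k] and the triangle lies within [5 * s0 / 2 ^+ k] of
   [z0] (4 from [dyadic_cauchyC], 1 from the triangle), so the sum is at most
   [eps * (5 * s0 ^+ 2) / 4 ^+ k]. *)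
pose eps := e / (5 * s0 ^+ 2 + 1).
have den0 : 0 < 5 * s0 ^+ 2 + 1 by rewrite ltr_wpDl// mulr_ge0// exprn_ge0.
have eps0 : 0 < eps by rewrite divr_gt0.
have [d d0 Hd] := HD _ eps0.
have [k Hk] := small (5 * s0) d (mulr_ge0 (ler0n _ _) s00) d0.
have [[K1 K2 K3] Bk Sk] := tP k.
have [n _ Hn] := Bk 0%N.
pose a := (t k).1.1.
pose S := [set w : CC R | rnorm (w - a) <= s0 / 2 ^+ k].
pose A := fun w : CC R => F z0 + (w - z0) *: D.
have Sb w : S w -> rnorm (F w - A w) <= eps * (5 * s0 / 2 ^+ k).
  move=> Sw; have wz : rnorm (w - z0) <= 5 * s0 / 2 ^+ k.
    rewrite (_ : w - z0 = (w - a) + (a - z0)); last by rewrite addrA subrK.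
    rewrite (le_trans (ler_rnormD _ _))// (rnormB a).
    rewrite (le_trans (lerD Sw (Hz0 k)))//.
    by rewrite -mulrDl ler_pM2r ?invr_gt0//; lra.
  have := Hd (w - z0); rewrite (le_lt_trans wz Hk) => /(_ isT).
  rewrite (addrC z0) subrK => H1; rewrite /A opprD addrA (le_trans H1)//.
  by rewrite ler_wpM2l// ltW.
have tri0 : tri A n (t k).1.1 (t k).1.2 (t k).2 = 0 by exact: tri_affine.
have := Hn; rewrite ltNge => /negP; apply.
rewrite -[tri F _ _ _ _]subr0 -tri0 -triB /tri.
have [n1 n2 n3] : [/\ 0 <= rnorm ((t k).1.2 - (t k).1.1), 0 <= rnorm ((t k).2 - (t k).1.2)
  & 0 <= rnorm ((t k).1.1 - (t k).2)] by split; exact: rnorm_ge0.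
have [S1 S2 S3] : [/\ S (t k).1.1, S (t k).1.2 & S (t k).2].
  rewrite /S /= /a; split; rewrite ?subrr ?rnorm0 ?divr_ge0// ?(ltW (p2 _))//.
    by rewrite -Sk /tsize; lra.
  by rewrite -Sk /tsize rnormB; lra.
have Sm : mid_closed S by exact: mid_closed_ball.
rewrite (le_trans (ler_rnormD _ _))// (le_trans (lerD (ler_rnormD _ _) (lexx _)))//.
rewrite (le_trans (lerD (lerD (seg_bound n Sm Sb S1 S2) (seg_bound n Sm Sb S2 S3)) (seg_bound n Sm Sb S3 S1)))//.
rewrite -!mulrDl; have -> : rnorm ((t k).1.2 - (t k).1.1) + rnorm ((t k).2 - (t k).1.2)
  + rnorm ((t k).1.1 - (t k).2) = s0 / 2 ^+ k by rewrite -Sk.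
have -> : (4:R) ^+ k = 2 ^+ k * 2 ^+ k by rewrite -exprMn; congr (_ ^+ _); ring.
rewrite [leLHS](_ : _ = eps * (5 * s0 ^+ 2) / (2 ^+ k * 2 ^+ k)); last by field; rewrite gt_eqF.
rewrite ler_pM2r ?invr_gt0 ?mulr_gt0//.
rewrite /eps mulrAC ler_pdivrMr// ler_pM2l//; lra.
Qed.

End goursat_thm.

(** * The maximum principle on the disc *)

Section max_modulus.
Context {R : realType}.
Implicit Types (z w : CC R).

Definition cconj z : CC R := ((cRe z) +i* (- cIm z))%C.

Lemma cRe_cconj z : cRe (cconj z) = cRe z. Proof. by []. Qed.
Lemma cIm_cconj z : cIm (cconj z) = - cIm z. Proof. by []. Qed.

Lemma rnorm_cconj z : rnorm (cconj z) = rnorm z.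
Proof. by rewrite !rnormE cRe_cconj cIm_cconj sqrrN. Qed.

Lemma mul_cconj z : z * cconj z = rC (rnorm z ^+ 2).
Proof. by apply: CC_eq; rewrite !ccE cRe_cconj cIm_cconj ?rnorm_sqr; ring. Qed.

Lemma rC2V : rC 2^-1 = 2^-1 :> CC R.
Proof. by rewrite rCV [rC 2](_ : _ = 2)// /rC rmorphMn. Qed.

Lemma cRe_mid z w : cRe (mid z w) = (cRe z + cRe w) / 2.
Proof. by rewrite /mid -rC2V !ccE mulr0 subr0. Qed.

Lemma seg_shift (X : normedModType (CC R)) (F : CC R -> X) n p q t :
  seg F n (p + t) (q + t) = seg (fun w => F (w + t)) n p q.
Proof.
have mt (a b : CC R) : mid (a + t) (b + t) = mid a b + t by rewrite /mid; field.
elim: n p q => [|n IH] p q /=; rewrite mt; first by rewrite opprD addrACA subrr addr0.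
by rewrite !IH.
Qed.

Lemma seg_cst (X : normedModType (CC R)) (A : X) n p q : seg (fun=> A) n p q = (q - p) *: A.
Proof.
have := @seg_affine R X A 0 0 n p q; rewrite scaler0 addr0 => <-.
by congr seg; apply/funext => w; rewrite scaler0 addr0.
Qed.

(** In the coordinate [f (cexp z)] circles become vertical segments of length [2 * pi], and the
    horizontal sides of a rectangle cancel by periodicity. Goursat on its two triangles identifies
    the means over the circles of radii [r1] and [r] up to an error; the first mean is close to
    [f 0]. *)
Lemma max_modulus0 (X : normedModType (CC R)) (f : CC R -> X) (rho r M : R) :
  (forall z, rnorm z < rho -> exists d, has_cderiv f z d) ->
  0 < r < rho -> (forall w, rnorm w = r -> rnorm (f w) <= M) -> rnorm (f 0) <= M.
Proof.
move=> Df /andP[r0 rrho] HM; apply/ler_addgt0Pr => e e0.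
have e20 : 0 < e / 2 by rewrite divr_gt0.
have rho0 : 0 < rho by exact: lt_trans rrho.
have [d0 Hd0] := Df 0 ltac:(by rewrite rnorm0).
have [r' r'0 Hr'] := has_cderiv_cont Hd0 e20.
pose r1 := Num.min r r' / 2.
have r10 : 0 < r1 by rewrite divr_gt0// lt_min r0.
have r1r : r1 <= r.
  by rewrite ler_pdivrMr// ge_min; apply/orP; left; rewrite ler_peMr ?ltW// ltr1n.
have r1r' : r1 < r'.
  by rewrite ltr_pdivrMr// gt_min; apply/orP; right; rewrite ltr_pMr// ltr1n.
pose K := [set z : CC R | cRe z <= ln r].
have Kmid : mid_closed K.
  by move=> p q; rewrite /K /mkset cRe_mid => hp hq; lra.
have Kcl z : (forall e : R, 0 < e -> exists2 w, K w & rnorm (z - w) <= e) -> K z.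
  move=> H; rewrite /K /= leNgt; apply/negP => zr.
  have [|w Kw zw] := H ((cRe z - ln r) / 2); first by rewrite divr_gt0// subr_gt0.
  have := le_trans (ler_norm _) (le_trans (cRe_le (z - w)) zw).
  rewrite !ccE; rewrite /K /= in Kw; lra.
pose F z := f (cexp z).
have Fd z : K z -> exists d, has_cderiv F z d.
  move=> Kz; have [|d Hd] := Df (cexp z).
    by rewrite rnorm_cexp (le_lt_trans _ rrho)// -[leRHS]lnK ?ler_expR.
  by eexists; apply: has_cderiv_comp (has_cderiv_cexp z) Hd.
pose T : CC R := (0 +i* (2 * pi))%C.
have FT z : F (z + T) = F z.
  rewrite /F cexpD (_ : cexp T = 1) ?mulr1//.
  apply: CC_eq; rewrite ?cRe_cexp ?cIm_cexp /cRe /cIm /= expR0 mul1r.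
    by rewrite mulr_natl cos2pi.
  by rewrite mulr_natl sin2pi.
pose A : CC R := rC (ln r1); pose B : CC R := rC (ln r).
have rT : rnorm T = 2 * pi.
  by rewrite rnormE /cRe /cIm /= expr0n add0r sqrtr_sqr ger0_norm// mulr_ge0// pi_ge0.
have lnr1 : ln r1 <= ln r by rewrite ler_ln.
have KA : K A by [].
have KB : K B by exact: lexx.
have KAT : K (A + T) by rewrite /K /mkset ccE addr0.
have KBT : K (B + T) by rewrite /K /mkset ccE addr0.
(* The errors are [2 * pi * (e / 2)] and [e]; together they fit into [2 * pi * e] because
   [pi >= 1]. *)
have pi1 : 1 <= (pi : R) by rewrite (le_trans _ (pi_ge2 _))// ler1n.
have [N1 H1] := goursat Kmid Kcl Fd KA KB KBT e20.
have [N2 H2] := goursat Kmid Kcl Fd KA KBT KAT e20.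
pose n := maxn N1 N2.
have {}H1 := H1 n (leq_maxl _ _); have {}H2 := H2 n (leq_maxr _ _).
have E : tri F n A B (B + T) + tri F n A (B + T) (A + T) =
   seg F n B (B + T) - seg F n A (A + T).
  rewrite /tri (seg_shift F n B A T) (_ : (fun w => F (w + T)) = F); last exact/funext.
  rewrite (seg_anti F n A B) (seg_anti F n A (A + T)) (seg_anti F n A (B + T)).
  by rewrite !addrA subrK (addrC (seg F n A B)) addrK.
have {H1 H2}H : rnorm (seg F n B (B + T) - seg F n A (A + T)) <= e.
  by rewrite -E (le_trans (ler_rnormD _ _))// (splitr e) lerD.
have Sv (c : R) : mid_closed [set z : CC R | cRe z = c].
  by move=> p q; rewrite /mkset cRe_mid => -> ->; field.
have HB : rnorm (seg F n B (B + T)) <= 2 * pi * M.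
  have := @seg_bound R X F _ M n B (B + T) (Sv (ln r)) _ (erefl _).
  rewrite addrAC subrr add0r rT; apply; last by rewrite /mkset ccE addr0.
  by move=> w /= Ew; apply: HM; rewrite rnorm_cexp Ew lnK.
have HA : rnorm (seg F n A (A + T) - T *: f 0) <= 2 * pi * (e / 2).
  have <- : seg (fun=> f 0) n A (A + T) = T *: f 0 by rewrite seg_cst addrAC subrr add0r.
  rewrite -segB.
  have := @seg_bound R X (fun w => F w - f 0) _ (e / 2) n A (A + T) (Sv (ln r1)) _ (erefl _).
  rewrite addrAC subrr add0r rT; apply; last by rewrite /mkset ccE addr0.
  move=> w /= Ew; have := Hr' (cexp w); rewrite add0r; apply.
  by rewrite rnorm_cexp Ew lnK.
have : rnorm (T *: f 0) <= 2 * pi * (e / 2) + e + 2 * pi * M.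
  have -> : T *: f 0 = - (seg F n A (A + T) - T *: f 0)
    + - (seg F n B (B + T) - seg F n A (A + T)) + seg F n B (B + T).
    by rewrite !opprB addrA subrK subrK.
  rewrite (le_trans (ler_rnormD _ _))// lerD// (le_trans (ler_rnormD _ _))//.
  by rewrite !rnormN lerD.
rewrite rnormZ rT => H3.
have p0 : 0 < 2 * (pi:R) by rewrite mulr_gt0// pi_gt0.
rewrite -(ler_pM2l p0) (le_trans H3)//.
have : 1 * e <= pi * e by rewrite ler_wpM2r// ltW.
lra.
Qed.

Definition moebius z w : CC R := (w + z) / (1 + cconj z * w).

(** A Moebius map carries 0 to [z], which reduces the claim to [max_modulus0] on a circle so close
    to the unit circle that its image lies in the ring where the hypothesis holds. *)
Lemma max_disc (X : normedModType (CC R)) (f : CC R -> X) (M : R) :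
  (forall z, rnorm z < 1 -> exists d, has_cderiv f z d) ->
  (forall e : R, 0 < e -> exists2 k : R, k < 1 &
     forall z, k < rnorm z < 1 -> rnorm (f z) <= M + e) ->
  forall z, rnorm z < 1 -> rnorm (f z) <= M.
Proof.
move=> Df HM z z1; apply/ler_addgt0Pr => e e0.
have [k0 k01 Hk0] := HM e e0.
pose k := Num.max k0 0.
have k1 : k < 1 by rewrite gt_max k01 ltr01.
have k_ge0 : 0 <= k by rewrite le_max lexx orbT.
have Hk w : k < rnorm w < 1 -> rnorm (f w) <= M + e.
  by move=> /andP[kw w1]; apply: Hk0; rewrite w1 andbT (le_lt_trans _ kw)// le_max lexx.
have z0 : 0 <= rnorm z by exact: rnorm_ge0.
have den w : rnorm w < 1 -> 1 - rnorm z <= rnorm (1 + cconj z * w).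
  move=> w1; have := ler_rnormB (1 : CC R) (- (cconj z * w)).
  rewrite opprK rnormN rnorm1 rnormM rnorm_cconj; apply: le_trans.
  by rewrite lerB// ler_piMr// ltW.
have den0 w : rnorm w < 1 -> 1 + cconj z * w != 0.
  by move=> w1; rewrite -rnorm_eq0 gt_eqF// (lt_le_trans _ (den _ w1))// subr_gt0.
have key w : rnorm w < 1 -> 1 - rnorm (moebius z w) ^+ 2 =
    (1 - rnorm z ^+ 2) * (1 - rnorm w ^+ 2) / rnorm (1 + cconj z * w) ^+ 2.
  move=> w1; have d0 : rnorm (1 + cconj z * w) != 0 by rewrite rnorm_eq0 den0.
  rewrite /moebius rnormM rnormV exprMn exprVn.
  apply: (mulIf (expf_neq0 2 d0)); rewrite mulrBl !mulfVK ?expf_neq0// mul1r.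
  by rewrite !rnorm_sqr !ccE cRe_cconj cIm_cconj; ring.
have z2 : 0 < 1 - rnorm z ^+ 2 <= 1.
  by rewrite subr_gt0 expr_lt1// z1 gerBl exprn_ge0.
have mo1 w : rnorm w < 1 -> rnorm (moebius z w) < 1.
  move=> w1; rewrite -(@expr_lt1 _ 2)// ?rnorm_ge0// -subr_gt0 key//.
  rewrite divr_gt0 ?exprn_gt0 ?mulr_gt0//; [by case/andP: z2| |].
    by rewrite subr_gt0 expr_lt1// rnorm_ge0.
  by rewrite (lt_le_trans _ (den _ w1))// subr_gt0.
have -> : f z = f (moebius z 0) by rewrite /moebius add0r mulr0 addr0 divr1.
(* By [key], [1 - rnorm (moebius z w) ^+ 2] is at most [(1 - rnorm w ^+ 2) / (1 - rnorm z) ^+ 2]; on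
   the circle of radius [1 - a / 4] this is below [1 - k]. *)
have a0 : 0 < (1 - k) * (1 - rnorm z) ^+ 2 by rewrite mulr_gt0 ?exprn_gt0 ?subr_gt0.
have a1 : (1 - k) * (1 - rnorm z) ^+ 2 <= 1.
  by rewrite mulr_ile1 ?subr_ge0 ?gerBl ?exprn_ge0 ?exprn_ile1 ?subr_ge0 ?gerBl// ltW.
set a := _ * _ in a0 a1.
apply: (@max_modulus0 X (fun w => f (moebius z w)) 1 (1 - a / 4)).
- move=> w w1; have [d Hd] := Df _ (mo1 _ w1).
  have H1 : has_cderiv (fun w => 1 + cconj z * w) w (0 + (0 *: w + cconj z *: 1)).
    apply: has_cderivD; first exact: has_cderiv_cst.
    exact: (has_cderivZ (has_cderiv_cst _ _) (has_cderiv_id w)).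
  have H2 := has_cderiv_comp H1 (has_cderivV (den0 _ w1)).
  have H3 := has_cderivD (has_cderiv_id w) (has_cderiv_cst z w).
  have H4 := has_cderivZ H3 H2.
  by eexists; exact: (has_cderiv_comp H4 Hd).
- lra.
- move=> w wr; have w1 : rnorm w < 1 by rewrite wr; lra.
  apply: Hk; rewrite mo1// andbT.
  have m0 : 0 <= rnorm (moebius z w) by exact: rnorm_ge0.
  apply: (@lt_le_trans _ _ (rnorm (moebius z w) ^+ 2)); last first.
    by rewrite expr2 ler_piMl// ltW// mo1.
  suff : 1 - rnorm (moebius z w) ^+ 2 < 1 - k by lra.
  have zz : 0 < 1 - rnorm z by rewrite subr_gt0.
  have dd := den _ w1.
  rewrite key// ltr_pdivrMr; last by rewrite exprn_gt0// (lt_le_trans zz).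
  apply: (@lt_le_trans _ _ a); last first.
    by rewrite /a ler_pM2l ?subr_gt0// ler_sqr// nnegrE ltW// (lt_le_trans zz).
  case/andP: z2 => z20 z21.
  have h : 1 - rnorm w ^+ 2 < a.
    rewrite wr; have -> : 1 - (1 - a / 4) ^+ 2 = a * (1/2) - (a/4)^+2 by field.
    have : 0 <= (a / 4) ^+ 2 by rewrite exprn_ge0// divr_ge0// ltW.
    lra.
  apply: (le_lt_trans _ h); rewrite ler_piMl//.
  by rewrite subr_ge0 exprn_ile1// ?rnorm_ge0// ltW.
Qed.

End max_modulus.

(** * Boundary integrals and the Herglotz kernel *)

Section measurability_toolkit.
Context {R : realType}.

Lemma measurable_invr : measurable_fun setT (fun x : R => x^-1).
Proof.
have -> : (fun x : R => x^-1) = (fun x => x * powR (x ^+ 2) (-1)).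
  apply/funext => x; rewrite powR_inv1 ?sqr_ge0//.
  have [->|x0] := eqVneq x 0; first by rewrite invr0 mul0r.
  by rewrite expr2 invfM mulrA divff// mul1r.
apply: measurable_funM => //.
by apply: (measurableT_comp (measurable_powR (-1))); apply: measurable_funX.
Qed.

Lemma measurable_sin : measurable_fun setT (@sin R).
Proof. apply: continuous_measurable_fun; exact: continuous_sin. Qed.

Lemma measurable_cos : measurable_fun setT (@cos R).
Proof. apply: continuous_measurable_fun; exact: continuous_cos. Qed.

Definition cmeas d (T : measurableType d) (F : T -> CC R) :=
  measurable_fun setT (fun t => cRe (F t)) /\ measurable_fun setT (fun t => cIm (F t)).

Section closure.
Context d (T : measurableType d).
Implicit Types F G : T -> CC R.

Lemma cmeas_cst (c : CC R) : cmeas (fun _ : T => c).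
Proof. by split; exact: measurable_cst. Qed.

Lemma cmeasD F G : cmeas F -> cmeas G -> cmeas (fun t => F t + G t).
Proof.
move=> [F1 F2] [G1 G2]; split.
  by under eq_fun do rewrite cReD; exact: measurable_funD.
by under eq_fun do rewrite cImD; exact: measurable_funD.
Qed.

Lemma cmeasN F : cmeas F -> cmeas (fun t => - F t).
Proof.
move=> [F1 F2]; split.
  by under eq_fun do rewrite cReN; exact: measurable_funN.
by under eq_fun do rewrite cImN; exact: measurable_funN.
Qed.

Lemma cmeasB F G : cmeas F -> cmeas G -> cmeas (fun t => F t - G t).
Proof. by move=> HF HG; apply: cmeasD => //; exact: cmeasN. Qed.

Lemma cmeasM F G : cmeas F -> cmeas G -> cmeas (fun t => F t * G t).
Proof.
move=> [F1 F2] [G1 G2]; split.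
  by under eq_fun do rewrite cReM; apply: measurable_funB; exact: measurable_funM.
by under eq_fun do rewrite cImM; apply: measurable_funD; exact: measurable_funM.
Qed.

Lemma cmeas_rC (f : T -> R) : measurable_fun setT f -> cmeas (fun t => rC (f t)).
Proof. by move=> mf; split => //; exact: measurable_cst. Qed.

Lemma measurable_rnorm F : cmeas F -> measurable_fun setT (fun t => rnorm (F t)).
Proof.
move=> [F1 F2]; under eq_fun do rewrite rnormE.
have -> : (fun t => Num.sqrt (cRe (F t) ^+ 2 + cIm (F t) ^+ 2)) =
  (fun t => powR (cRe (F t) ^+ 2 + cIm (F t) ^+ 2) 2^-1).
  by apply/funext => t; rewrite powR12_sqrt// addr_ge0 ?sqr_ge0.
apply: (measurableT_comp (measurable_powR _)).
by apply: measurable_funD; exact: measurable_funX.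
Qed.

Lemma CCV (z : CC R) : z^-1 = cconj z * rC (rnorm z ^- 2).
Proof.
have [->|z0] := eqVneq z 0.
  by rewrite invr0 rnorm0 expr0n invr0 rC0 mulr0.
apply: (mulfI z0); rewrite divff// mulrA mul_cconj -rCM divff//.
by rewrite expf_neq0// rnorm_eq0.
Qed.

Lemma cmeas_cconj F : cmeas F -> cmeas (fun t => cconj (F t)).
Proof.
move=> [F1 F2]; split; first by under eq_fun do rewrite cRe_cconj.
by under eq_fun do rewrite cIm_cconj; exact: measurable_funN.
Qed.

Lemma cmeasV F : cmeas F -> cmeas (fun t => (F t)^-1).
Proof.
move=> mF; under [X in cmeas X]eq_fun do rewrite CCV.
apply: cmeasM; first exact: cmeas_cconj.
apply: cmeas_rC; apply: (measurableT_comp measurable_invr).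
by apply: measurable_funX; exact: measurable_rnorm.
Qed.

Lemma cmeas_zeta (f : T -> R) : measurable_fun setT f -> cmeas (fun t => zeta (f t)).
Proof.
move=> mf; split; rewrite /zeta /cRe /cIm /=.
  by apply: (measurableT_comp measurable_cos); apply: measurable_funM.
by apply: (measurableT_comp measurable_sin); apply: measurable_funM.
Qed.

End closure.

Local Notation RM := (measurableTypeR R).

Lemma measurable_RM : measurable_fun setT (fun x : RM => x : R).
Proof. exact: (@measurable_id _ RM). Qed.

Lemma cmeas_toC : @cmeas _ (RM * RM)%type (@toC R).
Proof. by split; rewrite /toC /cRe /cIm /=; [exact: (@measurable_fst _ _ RM RM)|exact: (@measurable_snd _ _ RM RM)]. Qed.

Lemma cmeas_zetaR : @cmeas _ RM (@zeta R).
Proof. exact: cmeas_zeta measurable_RM. Qed.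

Lemma cmeas_comp d (T : measurableType d) d' (T' : measurableType d') (F : T -> CC R) (f : T' -> T) :
  cmeas F -> measurable_fun setT f -> cmeas (F \o f).
Proof. by move=> [F1 F2] mf; split; [exact: measurableT_comp F1 mf|exact: measurableT_comp F2 mf]. Qed.

End measurability_toolkit.

Section zeta_theory.
Context {R : realType}.

Lemma zetaD (x y : R) : zeta (x + y) = zeta x * zeta y.
Proof. by apply: CC_eq; rewrite /zeta /cRe /cIm /= mulrDr ?cosD ?sinD; ring. Qed.

Lemma zeta0 : zeta 0 = 1 :> CC R.
Proof. by apply: CC_eq; rewrite /zeta /cRe /cIm /= mulr0 ?cos0 ?sin0. Qed.

Lemma zeta1 : zeta 1 = 1 :> CC R.
Proof.
by apply: CC_eq; rewrite /zeta /cRe /cIm /= mulr1 mulr_natl ?cos2pi ?sin2pi.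
Qed.

Lemma zetaN (x : R) : zeta (- x) = cconj (zeta x).
Proof. by apply: CC_eq; rewrite /zeta /cconj /cRe /cIm /= mulrN ?cosN ?sinN. Qed.

Lemma zetaMn (x : R) n : zeta (n%:R * x) = zeta x ^+ n.
Proof. by elim: n => [|n IH]; rewrite ?mul0r ?zeta0// -natr1 mulrDl mul1r zetaD IH exprSr. Qed.

Lemma rnorm_zeta (x : R) : rnorm (zeta x) = 1.
Proof. by rewrite rnormE /zeta /cRe /cIm /= cos2Dsin2 sqrtr1. Qed.

Lemma zeta_sub_neq0 (x : R) (w : CC R) : rnorm w < 1 -> zeta x - w != 0.
Proof.
move=> w1; rewrite -rnorm_eq0 gt_eqF// (lt_le_trans _ (ler_rnormB _ _))//.
by rewrite rnorm_zeta subr_gt0.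
Qed.

Lemma zeta_sub_ge (x : R) (w : CC R) : 1 - rnorm w <= rnorm (zeta x - w).
Proof. by rewrite (le_trans _ (ler_rnormB _ _))// rnorm_zeta. Qed.

Lemma zeta_surj (z : CC R) : rnorm z = 1 -> exists2 x : R, 0 <= x < 1 & z = zeta x.
Proof.
move=> z1; have p0 := @pi_gt0 R.
have z2 : cRe z ^+ 2 + cIm z ^+ 2 = 1 by rewrite -rnorm_sqr z1 expr1n.
have a1 : -1 <= cRe z <= 1 by rewrite -ler_norml -z1 cRe_le.
have sa : sin (acos (cRe z)) = `|cIm z|.
  by rewrite sin_acos// (_ : 1 - _ = cIm z ^+ 2) ?sqrtr_sqr//; lra.
have [h0|h0] := leP 0 (cIm z).
  exists (acos (cRe z) / (2 * pi)).
    rewrite divr_ge0 ?acos_ge0 ?mulr_ge0 ?pi_ge0//= ltr_pdivrMr ?mulr_gt0// mul1r.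
    by rewrite (le_lt_trans (acos_lepi a1))//; lra.
  have e : 2 * pi * (acos (cRe z) / (2 * pi)) = acos (cRe z) by rewrite mulrCA divff ?mulr1// gt_eqF// mulr_gt0.
  apply: CC_eq; rewrite /zeta [RHS]/= e ?acosK ?in_itv//=.
  by rewrite sa ger0_norm.
exists (1 - acos (cRe z) / (2 * pi)).
  have : 0 < acos (cRe z).
    rewrite acos_gt0//; case/andP: a1 => -> /=; rewrite lt_neqAle => ->; rewrite andbT.
    apply/eqP => e; move: z2; rewrite e; have : 0 < cIm z ^+ 2 by rewrite expr2 nmulr_rgt0.
    lra.
  move=> ac0; have := acos_lepi a1 => ac1.
  rewrite subr_ge0 ler_pdivrMr ?mulr_gt0// mul1r gtrBl divr_gt0 ?mulr_gt0//.
  by rewrite andbT; lra.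
rewrite zetaD zeta1 mul1r zetaN.
have e : 2 * pi * (acos (cRe z) / (2 * pi)) = acos (cRe z) by rewrite mulrCA divff ?mulr1// gt_eqF// mulr_gt0.
apply: CC_eq; rewrite ?cRe_cconj ?cIm_cconj /zeta [RHS]/= e ?acosK ?in_itv//=.
by rewrite sa ltr0_norm// opprK.
Qed.

End zeta_theory.

Section integrals01.
Context {R : realType}.
Local Notation mu := (@lebesgue_measure R).

Local Notation RM := (measurableTypeR R).
Definition I01 : set RM := `[0%R, 1%R]%classic.
Definition itg (f : R -> R) := mu.-integrable I01 (EFin \o f).
Definition Int (f : R -> R) : R := Rintegral mu I01 f.

Lemma mI01 : measurable I01. Proof. exact: measurable_itv. Qed.
Lemma muI01 : mu I01 = 1%E.
Proof. by rewrite /I01 lebesgue_measure_itv/= lte_fin ltr01 -EFinD subr0. Qed.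

Lemma itg_meas f : itg f -> measurable_fun I01 f.
Proof. by move=> /measurable_int/measurable_EFinP. Qed.

Lemma itg_le (f g : R -> R) : measurable_fun I01 f -> (forall x, I01 x -> `|f x| <= g x) ->
  itg g -> itg f.
Proof.
move=> mf fg ig; apply: (le_integrable mI01 _ _ ig); first exact/measurable_EFinP.
move=> x Ix /=; rewrite lee_fin (le_trans (fg _ Ix))// ler_norm//.
Qed.

Lemma itg_cst (c : R) : itg (fun=> c).
Proof.
apply/integrableP; split; first exact: measurable_cst.
rewrite (eq_integral (cst `|c|%:E)); last by move=> x _.
have -> : (\int[mu]_(x in I01) cst `|c|%:E x = `|c|%:E * mu I01)%E by exact: (integral_cst mu mI01).
by rewrite muI01 mule1 ltry.
Qed.

Lemma itg_bnd (f : R -> R) (M : R) : measurable_fun I01 f -> (forall x, I01 x -> `|f x| <= M) -> itg f.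
Proof. by move=> mf fM; apply: (itg_le mf fM); exact: itg_cst. Qed.

Lemma itgD f g : itg f -> itg g -> itg (fun x => f x + g x).
Proof. by move=> i1 i2; have := integrableD mI01 i1 i2. Qed.
Lemma itgB f g : itg f -> itg g -> itg (fun x => f x - g x).
Proof. by move=> i1 i2; have := integrableB mI01 i1 i2. Qed.
Lemma itgZ c f : itg f -> itg (fun x => c * f x).
Proof. by move=> i1; have := integrableZl mI01 c i1. Qed.
Lemma itg_abs f : itg f -> itg (fun x => `|f x|).
Proof. by move=> i1; have := integrable_abse i1. Qed.

Lemma eq_itg f g : (forall x, I01 x -> f x = g x) -> itg f -> itg g.
Proof.
by move=> fg; apply: (eq_integrable mI01) => x /set_mem Ix /=; rewrite fg.
Qed.
Lemma eq_Int f g : (forall x, I01 x -> f x = g x) -> Int f = Int g.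
Proof. by move=> fg; apply: eq_Rintegral => x /set_mem; exact: fg. Qed.
Lemma Int_cst (c : R) : Int (fun=> c) = c.
Proof.
have -> : Int (fun=> c) = c * fine (mu I01) by exact: (Rintegral_cst mu mI01).
by rewrite muI01 mulr1.
Qed.
Lemma IntD f g : itg f -> itg g -> Int (fun x => f x + g x) = Int f + Int g.
Proof. exact: (RintegralD mI01). Qed.
Lemma IntB f g : itg f -> itg g -> Int (fun x => f x - g x) = Int f - Int g.
Proof. exact: (RintegralB mI01). Qed.
Lemma IntZ c f : itg f -> Int (fun x => c * f x) = c * Int f.
Proof. exact: (RintegralZl _ mI01). Qed.
Lemma Int_le f g : itg f -> itg g -> (forall x, I01 x -> f x <= g x) -> Int f <= Int g.
Proof. exact: (le_Rintegral mI01). Qed.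
Lemma Int_abs f : itg f -> `|Int f| <= Int (fun x => `|f x|).
Proof. exact: (le_normr_Rintegral mI01). Qed.
Lemma Int_ge0 f : (forall x, I01 x -> 0 <= f x) -> 0 <= Int f.
Proof. exact: Rintegral_ge0. Qed.
Lemma Int_EFin f : itg f -> (Int f)%:E = (\int[mu]_(x in I01) (f x)%:E)%E.
Proof. by move=> i; rewrite /Int /Rintegral fineK// (integrable_fin_num mI01 i). Qed.

Lemma meas_itgM f (g : R -> R) (M : R) : itg f -> measurable_fun I01 g ->
  (forall x, I01 x -> `|g x| <= M) -> itg (fun x => g x * f x).
Proof.
move=> fi mg gM; apply: (@itg_le _ (fun x => M * `|f x|)).
- by apply: measurable_funM => //; exact: itg_meas.
- by move=> x Ix; rewrite normrM ler_wpM2r// gM.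
- by apply: itgZ; exact: itg_abs.
Qed.

Lemma cintE (h : R -> CC R) : cint h = (Int (fun x => cRe (h x)) +i* Int (fun x => cIm (h x)))%C.
Proof. by []. Qed.

Definition citg (h : R -> CC R) := itg (fun x => cRe (h x)) /\ itg (fun x => cIm (h x)).

Lemma cintB f g : citg f -> citg g -> cint (fun x => f x - g x) = cint f - cint g.
Proof.
move=> [f1 f2] [g1 g2]; rewrite !cintE; apply: CC_eq; rewrite !ccE /cRe /cIm /=.
  by rewrite -IntB//; apply: eq_Int => x _; rewrite -/(cRe _) -/(cRe _) !ccE.
by rewrite -IntB//; apply: eq_Int => x _; rewrite -/(cIm _) -/(cIm _) !ccE.
Qed.

Lemma cintZ c f : citg f -> cint (fun x => c * f x) = c * cint f.
Proof.
move=> [f1 f2]; rewrite !cintE; apply: CC_eq; rewrite !ccE {1}/cRe {1}/cIm /=.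
  rewrite -!IntZ// -IntB; [|exact: itgZ|exact: itgZ].
  by apply: eq_Int => x _; rewrite ccE.
rewrite -!IntZ// -IntD; [|exact: itgZ|exact: itgZ].
by apply: eq_Int => x _; rewrite ccE.
Qed.

Lemma citgB f g : citg f -> citg g -> citg (fun x => f x - g x).
Proof.
move=> [f1 f2] [g1 g2]; split.
  by apply: (eq_itg _ (itgB f1 g1)) => x _; rewrite !ccE.
by apply: (eq_itg _ (itgB f2 g2)) => x _; rewrite !ccE.
Qed.

Lemma citgZ c f : citg f -> citg (fun x => c * f x).
Proof.
move=> [f1 f2]; split.
  by apply: (eq_itg _ (itgB (itgZ (cRe c) f1) (itgZ (cIm c) f2))) => x _; rewrite !ccE.
by apply: (eq_itg _ (itgD (itgZ (cRe c) f2) (itgZ (cIm c) f1))) => x _; rewrite !ccE.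
Qed.

(** The factor 2 is the price of treating the two coordinates separately; the bound serves to
    differentiate [herg]. *)
Lemma cint_bound f (g : R -> R) : citg f -> itg g -> (forall x, I01 x -> rnorm (f x) <= g x) ->
  rnorm (cint f) <= 2 * Int g.
Proof.
move=> [f1 f2] ig fg; rewrite (le_trans (rnorm_le _))// mulr_natl mulr2n.
rewrite lerD// cintE /cRe /cIm /= (le_trans (Int_abs _))//; apply: Int_le => //; try exact: itg_abs.
  by move=> x Ix; rewrite (le_trans (cRe_le _))// fg.
by move=> x Ix; rewrite (le_trans (cIm_le _))// fg.
Qed.

Lemma citg_bndM (F : R -> CC R) (l : R -> R) (M : R) : cmeas F -> itg l ->
  (forall x, I01 x -> rnorm (F x) <= M) -> citg (fun x => F x * rC (l x)).
Proof.
move=> [F1 F2] il FM; split.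
  apply: (eq_itg _ (@meas_itgM l (fun x => cRe (F x)) M il _ _)) => [x _||x Ix].
  - by rewrite !ccE mulr0 subr0.
  - exact: measurable_funTS.
  - by rewrite (le_trans (cRe_le _))// FM.
apply: (eq_itg _ (@meas_itgM l (fun x => cIm (F x)) M il _ _)) => [x _||x Ix].
- by rewrite !ccE mulr0 add0r.
- exact: measurable_funTS.
- by rewrite (le_trans (cIm_le _))// FM.
Qed.

End integrals01.

Section herglotz.
Context {R : realType}.
Implicit Types (z w : CC R) (l : R -> R).

Definition hker w (x : R) : CC R := (zeta x + w) / (zeta x - w).
Definition herg l w : CC R := cint (fun x => hker w x * rC (l x)).
Definition poisson w (x : R) : R := (1 - rnorm w ^+ 2) / rnorm (zeta x - w) ^+ 2.

Lemma cRe_hker w x : rnorm w < 1 -> cRe (hker w x) = poisson w x.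
Proof.
move=> w1; rewrite /hker /poisson CCV !ccE cRe_cconj cIm_cconj mulr0 subr0 mulr0 add0r.
rewrite !mulrA -mulrBl; congr (_ / _).
have := rnorm_sqr (zeta x); rewrite rnorm_zeta expr1n rnorm_sqr !ccE => ->; ring.
Qed.

Lemma cmeas_hker w : @cmeas R _ (measurableTypeR R) (hker w).
Proof.
apply: cmeasM; first by apply: cmeasD; [exact: cmeas_zetaR|exact: cmeas_cst].
by apply: cmeasV; apply: cmeasB; [exact: cmeas_zetaR|exact: cmeas_cst].
Qed.

Lemma hker_bound w x : rnorm w < 1 -> rnorm (hker w x) <= 2 / (1 - rnorm w).
Proof.
move=> w1; rewrite /hker rnormM rnormV ler_pM ?rnorm_ge0 ?invr_ge0 ?rnorm_ge0//.
  by rewrite (le_trans (ler_rnormD _ _))// rnorm_zeta; lra.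
rewrite lef_pV2 ?posrE ?subr_gt0 ?zeta_sub_ge//.
by rewrite (lt_le_trans _ (zeta_sub_ge _ _))// subr_gt0.
Qed.

Lemma citg_herg l w : itg l -> rnorm w < 1 -> citg (fun x => hker w x * rC (l x)).
Proof.
move=> il w1; apply: (citg_bndM (cmeas_hker w) il) => x _; exact: hker_bound.
Qed.

Lemma has_cderiv_herg l w : itg l -> rnorm w < 1 -> exists d, has_cderiv (herg l) w d.
Proof.
move=> il w1.
(* The derivative of [hker] in [w]; the second-order remainder is the explicit fraction [2 * zeta x
   * h ^+ 2 / ((zeta x - (w + h)) * (zeta x - w) ^+ 2)]. *)
pose k' x : CC R := 2 * zeta x / (zeta x - w) ^+ 2.
pose d0 := 1 - rnorm w; have d00 : 0 < d0 by rewrite subr_gt0.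
have mk : @cmeas R _ (measurableTypeR R) k'.
  apply: cmeasM; first by apply: cmeasM; [exact: cmeas_cst|exact: cmeas_zetaR].
  apply: cmeasV; under [X in cmeas X]eq_fun do rewrite expr2.
  by apply: cmeasM; apply: cmeasB; (exact: cmeas_zetaR || exact: cmeas_cst).
have k'b x : rnorm (k' x) <= 2 / d0 ^+ 2.
  rewrite /k' !rnormM rnormV rnormX rnorm_zeta mulr1.
  have -> : rnorm (2 : CC R) = 2.
    by rewrite (_ : 2 = rC 2) ?rnorm_rC ?gtr0_norm// /rC rmorphMn.
  rewrite ler_pM2l// lef_pV2 ?posrE ?exprn_gt0//.
    by rewrite ler_pXn2r// ?nnegrE ?rnorm_ge0 ?(ltW d00) ?zeta_sub_ge.
  by rewrite (lt_le_trans _ (zeta_sub_ge _ _)).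
have ck' : citg (fun x => k' x * rC (l x)) by apply: (citg_bndM mk il) => x _; exact: k'b.
exists (cint (fun x => k' x * rC (l x))) => e e0.
pose L := Int (fun x => `|l x|).
have L0 : 0 <= L by apply: Int_ge0.
pose C := 8 * L / d0 ^+ 3 + 1.
have C0 : 0 < C by rewrite ltr_wpDl// mulr_ge0 ?invr_ge0 ?exprn_ge0 ?(ltW d00)// mulr_ge0.
exists (Num.min (d0 / 2) (e / C)); first by rewrite lt_min !divr_gt0.
move=> h; rewrite lt_min => /andP[h1 h2].
have wh1 : rnorm (w + h) < 1.
  by rewrite (le_lt_trans (ler_rnormD _ _))//; rewrite /d0 in h1; lra.
have -> : herg l (w + h) - herg l w - h *: cint (fun x => k' x * rC (l x)) =
   cint (fun x => hker (w + h) x * rC (l x) - hker w x * rC (l x) - h * (k' x * rC (l x))).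
  rewrite cintB; [|exact: (citgB (citg_herg il wh1) (citg_herg il w1))|exact: citgZ].
  by rewrite cintB; [|exact: citg_herg|exact: citg_herg]; rewrite cintZ.
have bd x : I01 x -> rnorm (hker (w + h) x * rC (l x) - hker w x * rC (l x) - h * (k' x * rC (l x)))
    <= (4 * rnorm h ^+ 2 / d0 ^+ 3) * `|l x|.
  move=> _.
  have z1 := zeta_sub_neq0 x w1; have z2 := zeta_sub_neq0 x wh1.
  have -> : hker (w + h) x * rC (l x) - hker w x * rC (l x) - h * (k' x * rC (l x)) =
    (2 * zeta x * h ^+ 2 / ((zeta x - (w + h)) * (zeta x - w) ^+ 2)) * rC (l x).
    by rewrite /hker /k'; field; rewrite z1.
  rewrite [leLHS]rnormM rnorm_rC ler_wpM2r//.
  rewrite rnormM (rnormM _ (h ^+ 2)) (rnormM 2) rnormV (rnormM (zeta x - (w + h))) !rnormX rnorm_zeta mulr1.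
  have -> : rnorm (2 : CC R) = 2.
    by rewrite (_ : 2 = rC 2) ?rnorm_rC ?gtr0_norm// /rC rmorphMn.
  have -> : 4 * rnorm h ^+ 2 / d0 ^+ 3 = 2 * rnorm h ^+ 2 / (d0 / 2 * d0 ^+ 2).
    by field; rewrite gt_eqF.
  rewrite ler_wpM2l ?mulr_ge0 ?exprn_ge0 ?rnorm_ge0//.
  have a1 : d0 / 2 <= rnorm (zeta x - (w + h)).
    rewrite (le_trans _ (zeta_sub_ge _ _))//.
    by have := ler_rnormD w h; rewrite /d0 in h1 *; lra.
  have a2 : d0 ^+ 2 <= rnorm (zeta x - w) ^+ 2.
    by rewrite ler_pXn2r// ?nnegrE ?rnorm_ge0 ?(ltW d00) ?zeta_sub_ge.
  have p1 : 0 < d0 / 2 * d0 ^+ 2 by rewrite mulr_gt0 ?divr_gt0 ?exprn_gt0.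
  have p2 : d0 / 2 * d0 ^+ 2 <= rnorm (zeta x - (w + h)) * rnorm (zeta x - w) ^+ 2.
    by rewrite ler_pM// ?exprn_ge0// ?divr_ge0// ltW.
  by rewrite lef_pV2 ?posrE// (lt_le_trans p1).
rewrite (le_trans (cint_bound _ _ bd)); last 1 first.
- rewrite IntZ; last exact: itg_abs.
  rewrite -/L; have -> : 2 * (4 * rnorm h ^+ 2 / d0 ^+ 3 * L) = (8 * L / d0 ^+ 3) * rnorm h * rnorm h.
    by field; rewrite gt_eqF.
  rewrite ler_wpM2r ?rnorm_ge0// (@le_trans _ _ (C * rnorm h))//.
    by rewrite ler_wpM2r ?rnorm_ge0// /C lerDl.
  by rewrite mulrC -ler_pdivlMr// ltW.
- by [].
- apply: citgB; last exact: citgZ.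
  exact: (citgB (citg_herg il wh1) (citg_herg il w1)).
- by apply: itgZ; exact: itg_abs.
Qed.

Lemma cRe_herg l w : rnorm w < 1 -> cRe (herg l w) = Int (fun x => poisson w x * l x).
Proof.
move=> w1; rewrite /herg cintE /cRe /=; apply: eq_Int => x _.
by rewrite -/(cRe _) ccE cRe_hker// mulr0 subr0.
Qed.

Lemma poisson_gt0 w x : rnorm w < 1 -> 0 < poisson w x.
Proof.
move=> w1; rewrite divr_gt0// ?exprn_gt0//.
  by rewrite subr_gt0 expr_lt1// rnorm_ge0.
by rewrite lt_neqAle rnorm_ge0 andbT eq_sym rnorm_eq0 zeta_sub_neq0.
Qed.

Lemma poisson_le w x : rnorm w < 1 -> poisson w x <= 2 / (1 - rnorm w).
Proof.
move=> w1; rewrite -cRe_hker// (le_trans (ler_norm _))// (le_trans (cRe_le _))//.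
exact: hker_bound.
Qed.

Lemma poisson_meas w : measurable_fun setT (poisson w : measurableTypeR R -> R).
Proof.
apply: measurable_funM => //; apply: (measurableT_comp measurable_invr).
apply: measurable_funX; apply: measurable_rnorm.
by apply: cmeasB; [exact: cmeas_zetaR|exact: cmeas_cst].
Qed.

Lemma itg_poisson l w : rnorm w < 1 -> itg l -> itg (fun x => poisson w x * l x).
Proof.
move=> w1 il; apply: (@meas_itgM _ l (poisson w) (2 / (1 - rnorm w)) il).
  exact: measurable_funTS (poisson_meas w).
by move=> x _; rewrite gtr0_norm ?poisson_gt0// poisson_le.
Qed.

(** Nontrivial characters of the circle have mean zero; this is what gives the Poisson kernel its
    total mass in [Int_poisson]. *)
Lemma Int_zetaX (n : nat) : Int (fun x : R => cRe (zeta x ^+ n.+1)) = 0 /\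
  Int (fun x : R => cIm (zeta x ^+ n.+1)) = 0.
Proof.
pose a : R := 2 * pi * n.+1%:R.
have a0 : a != 0 by rewrite !mulf_neq0// gt_eqF// pi_gt0.
have cz x : zeta x ^+ n.+1 = ((cos (a * x)) +i* (sin (a * x)))%C.
  by rewrite -zetaMn /zeta mulrA.
have sa : sin a = 0 /\ cos a = 1.
  have : zeta (1 : R) ^+ n.+1 = 1 by rewrite zeta1 expr1n.
  by rewrite cz mulr1 => /(congr1 (fun z => (cRe z, cIm z))) [].
have da (x : R) : is_derive x 1 (fun y : R => a * y) a.
  by have := is_deriveZ a (is_derive_id x 1); rewrite [_ *: _]mulr1.
have dS (x : R) : is_derive x 1 (fun x => sin (a * x) / a) (cos (a * x)).
  have -> : cos (a * x) = a^-1 * (cos (a * x) * a) by rewrite mulrCA mulVf ?mulr1.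
  have -> : (fun x => sin (a * x) / a) = (fun x => a^-1 * sin (a * x)).
    by apply/funext => y; rewrite mulrC.
  apply: (@is_deriveZ _ _ _ (fun x => sin (a * x)) a^-1 x 1 (cos (a * x) * a)).

have dC (x : R) : is_derive x 1 (fun x => - cos (a * x) / a) (sin (a * x)).
  have -> : sin (a * x) = (- a^-1) * (- sin (a * x) * a) by field.
  have -> : (fun x => - cos (a * x) / a) = (fun x => (- a^-1) * cos (a * x)).
    by apply/funext => y; rewrite mulrC mulrN mulNr.
  apply: (@is_deriveZ _ _ _ (fun x => cos (a * x)) (- a^-1) x 1 (- sin (a * x) * a)).

have cont (f : R -> R) : continuous f -> {within `[0, 1], continuous f}.
  by move=> cf; apply: continuous_subspaceT.
have cax : continuous (fun x : R => a * x) by move=> x; apply: mulrl_continuous.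
have ftc (F f : R -> R) : (forall x : R, is_derive x 1 F (f x)) -> continuous f ->
    Int f = F 1 - F 0.
  move=> dF cf; rewrite /Int /Rintegral /I01 (@continuous_FTC2 _ f F 0 1) ?ltr01//.
  - exact: cont.
  - split.
    + by move=> x _; have [] := dF x.
    + apply: cvg_at_right_filter; have [D _] := dF 0.
      by apply: differentiable_continuous; exact/derivable1_diffP.
    + apply: cvg_at_left_filter; have [D _] := dF 1.
      by apply: differentiable_continuous; exact/derivable1_diffP.
  - by move=> x _; rewrite derive1E; have [_ ->] := dF x.
split.
  rewrite (eq_Int (g := fun x => cos (a * x))); last by move=> x _; rewrite cz.
  rewrite (ftc _ _ dS); first by rewrite mulr1 mulr0 sa.1 sin0 mul0r subrr.
  by move=> x; apply: continuous_comp; [exact: cax|exact: continuous_cos].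
rewrite (eq_Int (g := fun x => sin (a * x))); last by move=> x _; rewrite cz.
rewrite (ftc _ _ dC); first by rewrite mulr1 mulr0 sa.2 cos0 subrr.
by move=> x; apply: continuous_comp; [exact: cax|exact: continuous_sin].
Qed.

End herglotz.

(** * Subharmonicity *)

Section poisson_mass.
Context {R : realType}.
Implicit Types (z w : CC R).

Lemma expr_small (r e : R) : 0 <= r < 1 -> 0 < e -> exists n, r ^+ n < e.
Proof.
move=> /andP[r0 r1] e0.
have : (r ^+ n @[n --> \oo] --> (0 : R)) by apply: cvg_expr; rewrite ger0_norm.
move=> /cvgrPdist_lt /(_ _ e0) [N _ HN]; exists N.
by have := HN N (leqnn _); rewrite /= sub0r normrN ger0_norm// exprn_ge0.
Qed.

(** The Herglotz kernel is [(1 + a) / (1 - a)] with [a = w * cconj (zeta x)]. In its geometric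
    expansion up to order [n] the nonconstant terms have mean zero by [Int_zetaX], and the remainder
    is of order [rnorm w ^+ n]. *)
Lemma Int_poisson w : rnorm w < 1 -> Int (poisson w) = 1.
Proof.
move=> w1.
pose a x : CC R := w * cconj (zeta x).
have ra x : rnorm (a x) = rnorm w by rewrite rnormM rnorm_cconj rnorm_zeta mulr1.
have a1 x : 1 - a x != 0.
  rewrite -rnorm_eq0 gt_eqF// (lt_le_trans _ (ler_rnormB _ _))//.
  by rewrite rnorm1 ra subr_gt0.
have zz (x : R) : zeta x * cconj (zeta x) = 1 by rewrite mul_cconj rnorm_zeta expr1n.
have cz0 (x : R) : cconj (zeta x) != 0 by rewrite -rnorm_eq0 rnorm_cconj rnorm_zeta oner_neq0.
have ha x : hker w x = (1 + a x) / (1 - a x).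
  have A1 := a1 x; rewrite /a in A1 *.
  have hz : zeta x = (cconj (zeta x))^-1 by apply: (mulIf (cz0 x)); rewrite zz mulVf.
  have C0 := cz0 x; have Z1 := zeta_sub_neq0 x w1; rewrite /hker; move: A1 C0 Z1 hz.
  by set c := cconj _ => A1 C0 Z1 hz; rewrite hz; field; rewrite C0 A1.
have ma : @cmeas R _ (measurableTypeR R) a.
  by apply: cmeasM; [exact: cmeas_cst|apply: cmeas_cconj; exact: cmeas_zetaR].
have maX n : @cmeas R _ (measurableTypeR R) (fun x => a x ^+ n).
  elim: n => [|n IH]; first by under [X in cmeas X]eq_fun do rewrite expr0; exact: cmeas_cst.
  by under [X in cmeas X]eq_fun do rewrite exprS; exact: cmeasM.
pose T n x : R := cRe (2 * a x ^+ n.+1 / (1 - a x)).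
have r2 : rnorm (2 : CC R) = 2.
  by rewrite (_ : 2 = rC 2) ?rnorm_rC ?gtr0_norm// /rC rmorphMn.
have Tb n x : `|T n x| <= 2 / (1 - rnorm w) * rnorm w ^+ n.+1.
  rewrite (le_trans (cRe_le _))// rnormM rnormV rnormM rnormX ra r2 mulrAC.
  rewrite ler_wpM2r ?exprn_ge0 ?rnorm_ge0// ler_pM2l// lef_pV2 ?posrE ?subr_gt0//.
    by rewrite (le_trans _ (ler_rnormB _ _))// rnorm1 ra.
  by rewrite lt_neqAle rnorm_ge0 andbT eq_sym rnorm_eq0.
have iT n : itg (T n).
  apply: (itg_bnd _ (fun x _ => Tb n x)); apply: measurable_funTS.
  suff [] : @cmeas R _ (measurableTypeR R) (fun x => 2 * a x ^+ n.+1 / (1 - a x)) by [].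
  apply: cmeasM; first by apply: cmeasM; [exact: cmeas_cst|exact: maX].
  by apply: cmeasV; apply: cmeasB => //; exact: cmeas_cst.
have IP n : Int (poisson w) = 1 + Int (T n).
  elim: n => [|n ->].
    rewrite -[X in X + _](@Int_cst R) -IntD//; last exact: itg_cst.
    apply: eq_Int => x _; rewrite -cRe_hker// ha /T expr1.
    rewrite (_ : 1 + _ = cRe (1 + 2 * a x / (1 - a x))); last by rewrite cReD cRe1.
    by congr cRe; field.
  congr (_ + _); have [I1 I2] := @Int_zetaX R n.
  pose w' : CC R := w ^+ n.+1.
  have i1 : itg (fun x => cRe (zeta x ^+ n.+1) : R).
    apply: (@itg_bnd _ _ 1) => [|x _].
      apply: measurable_funTS; under eq_fun do rewrite -zetaMn.
      by case: (@cmeas_zeta R _ (measurableTypeR R) (fun x => n.+1%:R * x)) => //; apply: measurable_funM => //; exact: measurable_RM.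
    by rewrite (le_trans (cRe_le _))// rnormX rnorm_zeta expr1n.
  have i2 : itg (fun x => cIm (zeta x ^+ n.+1) : R).
    apply: (@itg_bnd _ _ 1) => [|x _].
      apply: measurable_funTS; under eq_fun do rewrite -zetaMn.
      by case: (@cmeas_zeta R _ (measurableTypeR R) (fun x => n.+1%:R * x)) => //; apply: measurable_funM => //; exact: measurable_RM.
    by rewrite (le_trans (cIm_le _))// rnormX rnorm_zeta expr1n.
  rewrite (@eq_Int _ _ (fun x => T n.+1 x + (2 * cRe w' * cRe (zeta x ^+ n.+1) + 2 * cIm w' * cIm (zeta x ^+ n.+1)))).
    rewrite IntD//; last by apply: itgD; exact: itgZ.
    by rewrite IntD ?IntZ// ?I1 ?I2 ?mulr0 ?addr0//; exact: itgZ.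
  move=> x _; rewrite /T.
  have -> : 2 * a x ^+ n.+1 / (1 - a x) = 2 * a x ^+ n.+2 / (1 - a x) + 2 * a x ^+ n.+1.
    by rewrite (exprSr _ n.+1); field.
  rewrite cReD; congr (_ + _).
  have -> : a x ^+ n.+1 = w' * cconj (zeta x ^+ n.+1).
    by rewrite exprMn; congr (_ * _); rewrite -!zetaN -!zetaMn mulrN zetaN.
  have -> : (2 : CC R) = rC 2 by rewrite /rC rmorphMn.
  by rewrite !ccE cRe_cconj cIm_cconj; ring.
apply/eqP; rewrite eq_sym -subr_eq0 -normr_le0; apply/ler_addgt0Pr => e e0; rewrite add0r.
have d0 : 0 < 1 - rnorm w by rewrite subr_gt0.
have [n Hn] := @expr_small (rnorm w) (e * (1 - rnorm w) / 2) ltac:(by rewrite rnorm_ge0) ltac:(by rewrite divr_gt0 ?mulr_gt0).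
rewrite (IP n) opprD addrA subrr sub0r normrN (le_trans (Int_abs (iT n)))//.
rewrite (le_trans (Int_le (itg_abs (iT n)) (itg_cst _) (fun x _ => Tb n x)))// Int_cst.
rewrite (@le_trans _ _ (2 / (1 - rnorm w) * rnorm w ^+ n))//.
  by rewrite ler_wpM2l ?divr_ge0 ?(ltW d0)// exprS ler_piMl ?exprn_ge0 ?rnorm_ge0// ltW.
rewrite (le_trans (ler_wpM2l _ (ltW Hn))) ?divr_ge0 ?(ltW d0)//.
by rewrite le_eqVlt; apply/orP; left; apply/eqP; field; rewrite gt_eqF.
Qed.

Lemma itg_poisson1 w : rnorm w < 1 -> itg (poisson w).
Proof.
move=> w1; apply: (eq_itg _ (itg_poisson w1 (itg_cst 1))) => x _.
by rewrite mulr1.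
Qed.

(** The tangent of exp at the mean [m] lies below exp; integrating [expR m * (1 + (f x - m))]
    against [k] gives back [expR m]. *)
Lemma jensen_exp (k f : R -> R) : itg k -> (forall x, I01 x -> 0 <= k x) -> Int k = 1 ->
  itg (fun x => k x * f x) -> itg (fun x => k x * expR (f x)) ->
  expR (Int (fun x => k x * f x)) <= Int (fun x => k x * expR (f x)).
Proof.
move=> ik k0 k1 ikf ike; set m := Int (fun x => k x * f x).
have -> : expR m = Int (fun x => expR m * ((1 - m) * k x + k x * f x)).
  rewrite IntZ; last by apply: itgD => //; exact: itgZ.
  rewrite IntD//; last exact: itgZ.
  by rewrite IntZ// k1 -/m mulr1 subrK mulr1.
apply: Int_le => //.
  by apply: itgZ; apply: itgD => //; exact: itgZ.
move=> x Ix; rewrite (_ : (1 - m) * k x + k x * f x = k x * (1 + (f x - m))); last by ring.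
rewrite mulrCA ler_wpM2l ?k0//.
have -> : expR (f x) = expR m * expR (f x - m) by rewrite -expRD addrC subrK.
by rewrite ler_pM2l ?expR_gt0// expR_ge1Dx.
Qed.

End poisson_mass.

(** * Compactness of the closed disc *)

Section compactness.
Context {R : realType}.
Implicit Types (z w : CC R).

Let shift_half (a b h u v : R) : 0 <= h -> - h <= a -> a <= h -> u = a - b ->
  (0 <= a /\ b = h / 2) \/ (a <= 0 /\ b = - (h / 2)) -> v = h / 2 -> `|u| <= v.
Proof. by move=> h0 a1 a2 -> [[a0 ->]|[a0 ->]] ->; rewrite ler_norml; apply/andP; split; lra. Qed.

(** Compactness by bisection of squares. [G z d] persists when [d] shrinks, so the lemma covers
    uniform continuity ([d] a modulus) as well as boundedness ([d^-1] a bound). *)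
Lemma unit_disc_local (G : CC R -> R -> Prop) :
  (forall z d d', 0 < d' -> d' <= d -> G z d -> G z d') ->
  (forall z0, exists2 r, 0 < r & forall z, rnorm (z - z0) < r -> G z r) ->
  exists2 d, 0 < d & forall z, rnorm z <= 1 -> G z d.
Proof.
move=> Gm Gl.
pose inS (c : CC R) (h : R) z := `|cRe z - cRe c| <= h /\ `|cIm z - cIm c| <= h.
pose bad (c : CC R) (h : R) := forall d, 0 < d -> exists2 z, inS c h z & ~ G z d.
pose sg (b : bool) (h : R) : R := if b then h / 2 else - (h / 2).
pose sub (c : CC R) (h : R) (b1 b2 : bool) : CC R := ((cRe c + sg b1 h) +i* (cIm c + sg b2 h))%C.
have step c h : 0 < h -> bad c h -> exists c', bad c' (h / 2) /\ rnorm (c' - c) <= h.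
  move=> h0 B.
  have subd b1 b2 : rnorm (sub c h b1 b2 - c) <= h.
    rewrite (le_trans (rnorm_le _))// !ccE /sub {1}/cRe {2}/cIm /= (addrC (cRe c)) (addrC (cIm c)) !addrK.
    have sgn b : `|sg b h| = h / 2.
      by rewrite /sg; case: b; rewrite ?normrN gtr0_norm// divr_gt0.
    by rewrite !sgn -splitr.
  suff [b1 [b2 Hb]] : exists b1 b2, bad (sub c h b1 b2) (h / 2).
    by exists (sub c h b1 b2).
  apply: contrapT => /forallNP N.
  have N' b1 b2 : exists2 d, 0 < d & forall z, inS (sub c h b1 b2) (h / 2) z -> G z d.
    have /forallNP/(_ b2)/existsNP[d /not_implyP[d0 H]] := N b1.
    exists d => // z Hz; apply: contrapT => nG; apply: H; by exists z.
  have [d1 d10 H1] := N' true true; have [d2 d20 H2] := N' true false.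
  have [d3 d30 H3] := N' false true; have [d4 d40 H4] := N' false false.
  pose d := Num.min (Num.min d1 d2) (Num.min d3 d4).
  have d0 : 0 < d by rewrite !lt_min d10 d20 d30.
  have [z [z1 z2]] := B d d0; apply.
  have m1 : d <= d1 by rewrite !ge_min lexx.
  have m2 : d <= d2 by rewrite !ge_min lexx orbT.
  have m3 : d <= d3 by rewrite !ge_min lexx !orbT.
  have m4 : d <= d4 by rewrite !ge_min lexx !orbT.
  move: z1 z2; rewrite !ler_norml => /andP[a1 a2] /andP[a3 a4].
  have [r0|r0] := leP 0 (cRe z - cRe c); have [i0|i0] := leP 0 (cIm z - cIm c).
  - apply: (Gm _ _ _ d0 m1); apply: H1; split.
      by apply: (shift_half (ltW h0) a1 a2 _ _ erefl); [rewrite /= opprD addrA|left].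
    by apply: (shift_half (ltW h0) a3 a4 _ _ erefl); [rewrite /= opprD addrA|left].
  - apply: (Gm _ _ _ d0 m2); apply: H2; split.
      by apply: (shift_half (ltW h0) a1 a2 _ _ erefl); [rewrite /= opprD addrA|left].
    by apply: (shift_half (ltW h0) a3 a4 _ _ erefl); [rewrite /= opprD addrA|right; rewrite ltW].
  - apply: (Gm _ _ _ d0 m3); apply: H3; split.
      by apply: (shift_half (ltW h0) a1 a2 _ _ erefl); [rewrite /= opprD addrA|right; rewrite ltW].
    by apply: (shift_half (ltW h0) a3 a4 _ _ erefl); [rewrite /= opprD addrA|left].
  - apply: (Gm _ _ _ d0 m4); apply: H4; split.
      by apply: (shift_half (ltW h0) a1 a2 _ _ erefl); [rewrite /= opprD addrA|right; rewrite ltW].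
    by apply: (shift_half (ltW h0) a3 a4 _ _ erefl); [rewrite /= opprD addrA|right; rewrite ltW].
apply: contrapT => H.
have B0 : bad 0 (1 / 2 ^+ 0).
  move=> d d0; apply: contrapT => H'; apply: H; exists d => // z z1.
  apply: contrapT => nG; apply: H'; exists z => //.
  by rewrite /inS !ccE !subr0 expr0 divr1; split; apply: (le_trans _ z1); [exact: cRe_le|exact: cIm_le].
have p2 k : 0 < (2:R) ^+ k by rewrite exprn_gt0.
have st k c : bad c (1 / 2 ^+ k) -> {c' | bad c' (1 / 2 ^+ k.+1) /\ rnorm (c' - c) <= 1 / 2 ^+ k}.
  move=> B; apply: cid.
  have [|c' [Bc' dc']] := step c (1 / 2 ^+ k) _ B; first by rewrite divr_gt0.
  exists c'; split => //; rewrite (_ : 1 / 2 ^+ k.+1 = 1 / 2 ^+ k / 2)// exprSr.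
  by field; rewrite gt_eqF.
pose f := fix f k : {c | bad c (1 / 2 ^+ k)} := match k with
  | 0%N => exist (fun c => bad c (1 / 2 ^+ 0)) 0 B0
  | k'.+1 => exist (fun c => bad c (1 / 2 ^+ k'.+1)) (sval (st k' (sval (f k')) (svalP (f k'))))
     (svalP (st k' (sval (f k')) (svalP (f k')))).1
  end.
pose c k := sval (f k).
have cB k : bad (c k) (1 / 2 ^+ k) by exact: (svalP (f k)).
have cD k : rnorm (c k.+1 - c k) <= 1 / 2 ^+ k.
  exact: (svalP (st k (sval (f k)) (svalP (f k)))).2.
have [l Hl] := dyadic_cauchyC cD.
have [r r0 Hr] := Gl l.
(* A square of half-side [1 / 2 ^+ k] lies within [2 / 2 ^+ k] of its centre, and the centres are
   within [4 / 2 ^+ k] of their limit. *)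
have [k Hk] := pow2_big (6 / r).
have k6 : 6 / 2 ^+ k < r by rewrite ltr_pdivrMr// mulrC -ltr_pdivrMr.
have [z [z1 z2]] := cB k r r0; apply; apply: Hr.
have -> : z - l = (z - c k) - (l - c k) by rewrite opprB addrA subrK.
rewrite (le_lt_trans (ler_rnormD _ _))// rnormN.
apply: le_lt_trans k6; rewrite (@le_trans _ _ (2 * (1 / 2 ^+ k) + 4 * 1 / 2 ^+ k))//.
  rewrite lerD// (le_trans (rnorm_le _))// !ccE mulr_natl mulr2n lerD//.
by rewrite le_eqVlt; apply/orP; left; apply/eqP; field; rewrite gt_eqF.
Qed.

End compactness.

Section log_subharmonic.
Context {R : realType}.
Implicit Types (z w : CC R).

Lemma continuous_zeta_eps (x e : R) : 0 < e -> exists2 d : R, 0 < d &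
  forall y, `|x - y| < d -> rnorm (zeta x - zeta y) <= e.
Proof.
move=> e0; have e20 : 0 < e / 2 by rewrite divr_gt0.
have cc : continuous (fun x : R => cos (2 * pi * x)).
  by move=> t; apply: continuous_comp; [exact: mulrl_continuous|exact: continuous_cos].
have cs : continuous (fun x : R => sin (2 * pi * x)).
  by move=> t; apply: continuous_comp; [exact: mulrl_continuous|exact: continuous_sin].
have /cvgrPdist_le /(_ _ e20) /nbhs_normP[d1 /= d10 H1] := cc x.
have /cvgrPdist_le /(_ _ e20) /nbhs_normP[d2 /= d20 H2] := cs x.
exists (Num.min d1 d2); first by rewrite lt_min d10.
move=> y; rewrite lt_min => /andP[y1 y2].
rewrite (le_trans (rnorm_le _))// !ccE (splitr e) lerD//.
  exact: H1.
exact: H2.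
Qed.

Variables (X : normedModType (CC R)) (k : CC R -> X) (rho eps : R).
Hypothesis rho1 : 1 < rho.
Hypothesis kd : forall z, rnorm z < rho -> exists d, has_cderiv k z d.
Hypothesis eps0 : 0 < eps.

(** The floor [eps] keeps the logarithm finite at zeros of [k] and makes it uniformly continuous on
    the closed disc. *)
Let N w := Num.max (rnorm (k w)) eps.
Let Psi w := ln (N w).

Let N_ge w : eps <= N w. Proof. by rewrite le_max lexx orbT. Qed.
Let N_gt0 w : 0 < N w. Proof. exact: lt_le_trans (N_ge w). Qed.

Let Psi_lip w w' e : 0 <= e -> rnorm (k w - k w') <= e * eps -> `|Psi w - Psi w'| <= e.
Proof.
suff H a b : 0 <= e -> rnorm (k a - k b) <= e * eps -> Psi a - Psi b <= e.
  move=> e0 h; rewrite ler_norml; apply/andP; split; last exact: H.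
  by rewrite -lerN2 opprK opprB; apply: H => //; rewrite rnormB.
move=> e0 h; rewrite /Psi -ln_div ?posrE//.
have ab : N a / N b <= 1 + e.
  rewrite ler_pdivrMr// mulrDl mul1r.
  have h1 : rnorm (k a) <= rnorm (k b) + e * eps by have := ler_rnormB (k a) (k b); lra.
  have h2 : e * eps <= e * N b by rewrite ler_wpM2l.
  rewrite /N ge_max (le_trans h1) ?lerD ?le_max ?lexx//= (le_trans (N_ge b))//.
  by rewrite -/(N b) lerDl mulr_ge0// (ltW (N_gt0 b)).
have ab0 : 0 < N a / N b by rewrite divr_gt0.
have e1 : 0 < 1 + e by rewrite ltr_wpDr.
apply: (@le_trans _ _ (ln (1 + e))); first by rewrite ler_ln.
by apply: le_ln1Dx; rewrite (lt_le_trans _ e0)// ltrN10.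
Qed.

Let k_cont z0 e : rnorm z0 <= 1 -> 0 < e -> exists2 r, 0 < r & forall z, rnorm (z - z0) < r ->
  rnorm (k z - k z0) <= e.
Proof.
move=> z1 e0; have [d Hd] := kd (le_lt_trans z1 rho1).
have [r r0 Hr] := has_cderiv_cont Hd e0.
by exists r => // z /Hr; rewrite (addrC z0) subrK.
Qed.

Let Psi_unif e : 0 < e -> exists2 d, 0 < d & forall z w, rnorm z <= 1 -> rnorm w <= 1 ->
  rnorm (z - w) <= d -> `|Psi z - Psi w| <= e.
Proof.
move=> e0.
have [||d d0 H] := @unit_disc_local R (fun z d => rnorm z <= 1 -> forall w, rnorm w <= 1 ->
  rnorm (z - w) <= d -> `|Psi z - Psi w| <= e).
- by move=> z d d' _ dd' H z1 w w1 zw; apply: H => //; exact: le_trans dd'.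
- move=> z0; have [z01|z01] := leP (rnorm z0) 1; last first.
    exists (rnorm z0 - 1); first by rewrite subr_gt0.
    by move=> z hz z1; exfalso; have := ler_rnormB z0 z; rewrite rnormB; lra.
  have e20 : 0 < e * eps / 2 by rewrite !mulr_gt0.
  have [r r0 Hr] := k_cont z01 e20.
  exists (r / 2); first by rewrite divr_gt0.
  move=> z hz z1 w w1 zw; apply: Psi_lip; first exact: ltW.
  have -> : k z - k w = (k z - k z0) - (k w - k z0) by rewrite opprB addrA subrK.
  rewrite (le_trans (ler_rnormD _ _))// rnormN (splitr (e * eps)) lerD// Hr//; first by lra.
  have -> : w - z0 = (z - z0) - (z - w) by ring.
  by rewrite (le_lt_trans (ler_rnormD _ _))// rnormN; lra.
by exists d => // z w z1 w1 zw; apply: H.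
Qed.

Let Psi_bnd : exists2 B, 0 < B & forall z, rnorm z <= 1 -> `|Psi z| <= B.
Proof.
have [||d d0 H] := @unit_disc_local R (fun z d => rnorm z <= 1 -> `|Psi z| <= d^-1).
- move=> z d d' d'0 dd' H z1; rewrite (le_trans (H z1))// lef_pV2 ?posrE//.
  exact: lt_le_trans dd'.
- move=> z0; have [z01|z01] := leP (rnorm z0) 1; last first.
    exists (rnorm z0 - 1); first by rewrite subr_gt0.
    by move=> z hz z1; exfalso; have := ler_rnormB z0 z; rewrite rnormB; lra.
  have [r r0 Hr] := k_cont z01 eps0.
  have c0 : 0 < (1 + `|Psi z0|)^-1 by rewrite invr_gt0 ltr_pwDl.
  exists (Num.min r (1 + `|Psi z0|)^-1); first by rewrite lt_min r0.
  move=> z; rewrite lt_min => /andP[hz _] z1.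
  rewrite (@le_trans _ _ (1 + `|Psi z0|))//.
    have : `|Psi z - Psi z0| <= 1 by apply: Psi_lip => //; rewrite mul1r Hr.
    have := ler_normD (Psi z - Psi z0) (Psi z0); rewrite subrK; lra.
  rewrite -[leLHS]invrK lef_pV2 ?posrE ?lt_min ?r0//.
  by rewrite ge_min lexx orbT.
by exists d^-1; rewrite ?invr_gt0// => z z1; exact: H.
Qed.

Lemma log_circle_continuous : continuous (fun x : R => ln (Num.max (rnorm (k (zeta x))) eps)).
Proof.
move=> x; apply/cvgrPdist_le => e e0.
have [d d0 H] := Psi_unif e0.
have [d' d'0 H'] := continuous_zeta_eps x d0.
apply/nbhs_normP; exists d' => // y /= xy.
by apply: H; rewrite ?rnorm_zeta// H'.
Qed.

Lemma itg_log_circle : itg (fun x => ln (Num.max (rnorm (k (zeta x))) eps)).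
Proof.
have [B B0 HB] := Psi_bnd.
apply: (@itg_bnd _ _ B) => [|x _]; last by apply: HB; rewrite rnorm_zeta.
apply: measurable_funTS; apply: (@continuous_measurable_fun R).
exact: log_circle_continuous.
Qed.

(** Dividing [k] by the outer function with boundary modulus [Num.max (rnorm k) eps] leaves a
    function [F] whose limits superior at the circle are at most 1, and [max_disc] applies. *)
Lemma log_subharmonic z : rnorm z < 1 ->
  rnorm (k z) <= expR (Int (fun x => poisson z x * ln (Num.max (rnorm (k (zeta x))) eps))).
Proof.
pose l x := ln (Num.max (rnorm (k (zeta x))) eps).
have il : itg l by exact: itg_log_circle.
pose F w := cexp (- herg l w) *: k w.
have nF w : rnorm w < 1 -> rnorm (F w) = expR (- Int (fun x => poisson w x * l x)) * rnorm (k w).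
  by move=> w1; rewrite /F rnormZ rnorm_cexp cReN cRe_herg.
suff H w : rnorm w < 1 -> rnorm (F w) <= 1.
  move=> z1; have := H z z1; rewrite nF// expRN mulrC ler_pdivrMr ?expR_gt0//.
  by rewrite mul1r.
apply: max_disc => {z}.
  move=> z z1; have [d Hd] := has_cderiv_herg il z1.
  have [d' Hd'] := kd (lt_trans z1 rho1).
  have Hn : has_cderiv (fun w => - herg l w) z (0 *: herg l z + (-1) *: d).
    apply: (has_cderiv_unique_ext _ (has_cderivZ (has_cderiv_cst (-1 : CC R) z) Hd)) => u.
    by rewrite [LHS]mulN1r.
  by eexists; apply: has_cderivZ Hd'; exact: (has_cderiv_comp Hn (has_cderiv_cexp _)).
move=> e e0.
have [B B0 HB] := Psi_bnd.
pose e1 := ln (1 + e); have e10 : 0 < e1 by rewrite ln_gt0// ltrDl.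
have e20 : 0 < e1 / 2 by rewrite divr_gt0.
have [d d0 Hd] := Psi_unif e20.
(* At boundary points farther than [d] from [z] the Poisson kernel is at most
   [2 * (1 - rnorm z) / d ^+ 2] and the difference of logarithms at most [2 * B]. *)
pose K := 4 * B / d ^+ 2.
have K0 : 0 < K by rewrite divr_gt0 ?mulr_gt0 ?exprn_gt0.
exists (1 - e1 / (2 * K)); first by rewrite gtrBl divr_gt0// mulr_gt0.
move=> z /andP[z2 z1]; rewrite nF//.
have zK : K * (1 - rnorm z) <= e1 / 2.
  have : 1 - rnorm z < e1 / (2 * K) by lra.
  have K20 : 0 < 2 * K by rewrite mulr_gt0.
  by rewrite (ltr_pdivlMr _ _ K20) => h; lra.
have key x : I01 x -> poisson z x * Psi z - poisson z x * l x <= e1 / 2 * poisson z x + e1 / 2.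
  move=> _; rewrite -mulrBr.
  have p0 := ltW (poisson_gt0 x z1).
  have [zx|zx] := leP (rnorm (z - zeta x)) d.
    rewrite mulrC ler_wpDr ?(ltW e20)// ler_wpM2r// (le_trans (ler_norm _))//.
    by apply: Hd => //; rewrite ?rnorm_zeta// ltW.
  apply: (ler_wpDl (mulr_ge0 (ltW e20) p0)).
  have pd : poisson z x <= 2 * (1 - rnorm z) / d ^+ 2.
    rewrite /poisson; apply: ler_pM.
    - by rewrite subr_ge0 expr_le1 ?rnorm_ge0// ltW.
    - by rewrite invr_ge0 sqr_ge0.
    - have -> : 1 - rnorm z ^+ 2 = (1 + rnorm z) * (1 - rnorm z) by ring.
      by rewrite ler_wpM2r ?subr_ge0 ?(ltW z1)//; lra.
    - rewrite lef_pV2 ?posrE ?exprn_gt0 ?(lt_trans d0 zx)//.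
        by rewrite ler_pXn2r ?nnegrE ?(ltW d0) ?rnorm_ge0// rnormB ltW.
      by rewrite rnormB (lt_trans d0 zx).
  have b2 : Psi z - l x <= 2 * B.
    have := HB z (ltW z1); have := HB (zeta x) ltac:(by rewrite rnorm_zeta).
    have -> : l x = Psi (zeta x) by [].
    by rewrite !ler_norml => /andP[a1 a2] /andP[a3 a4]; lra.
  have b0 : 0 <= B by exact: ltW.
  apply: (@le_trans _ _ (poisson z x * (2 * B))); first by rewrite ler_wpM2l.
  apply: (@le_trans _ _ (2 * (1 - rnorm z) / d ^+ 2 * (2 * B))).
    by rewrite ler_wpM2r// mulr_ge0.
  apply: le_trans zK; rewrite /K le_eqVlt; apply/orP; left; apply/eqP.
  by field; rewrite gt_eqF.
have ip := itg_poisson1 z1; have ipl := itg_poisson z1 il.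
have ipz : itg (fun x => poisson z x * Psi z).
  by apply: (eq_itg _ (itgZ (Psi z) ip)) => x _; rewrite mulrC.
have ie : itg (fun x => e1 / 2 * poisson z x + e1 / 2).
  by apply: itgD; [exact: itgZ|exact: itg_cst].
have := Int_le (itgB ipz ipl) ie key.
rewrite (IntB ipz ipl) (IntD (itgZ _ ip) (itg_cst _)) (IntZ _ ip) Int_cst (Int_poisson z1).
have -> : Int (fun x => poisson z x * Psi z) = Psi z.
  rewrite (@eq_Int _ _ (fun x => Psi z * poisson z x)); last by move=> x _; rewrite mulrC.
  by rewrite IntZ// Int_poisson// mulr1.
move=> h.
have kz : rnorm (k z) <= expR (Psi z) by rewrite /Psi lnK ?posrE// le_max lexx.
apply: (@le_trans _ _ (expR (- Int (fun x => poisson z x * l x)) * expR (Psi z))).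
  by rewrite ler_wpM2l// expR_ge0.
rewrite -expRD -[1 + e]lnK ?posrE ?addr_gt0// ler_expR -/e1; lra.
Qed.

End log_subharmonic.

Section power_subharmonic.
Context {R : realType} (X : normedModType (CC R)).
Implicit Types (z w : CC R).
Variables (k : CC R -> X) (rho : R).
Hypothesis rho1 : 1 < rho.
Hypothesis kd : forall z, rnorm z < rho -> exists d, has_cderiv k z d.

Lemma rnorm_circle_measurable :
  measurable_fun setT (fun x : measurableTypeR R => rnorm (k (zeta x))).
Proof.
apply: (@continuous_measurable_fun R) => x; apply/cvgrPdist_le => e e0.
have [|d Hd] := @kd (zeta x); first by rewrite rnorm_zeta.
have [r r0 Hr] := has_cderiv_cont Hd e0.
have r20 : 0 < r / 2 by rewrite divr_gt0.
have [d' d'0 H'] := continuous_zeta_eps x r20.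
apply/nbhs_normP; exists d' => // y /= xy.
have h : rnorm (zeta y - zeta x) < r.
  by rewrite rnormB (le_lt_trans (H' _ xy))// ltr_pdivrMr// ltr_pMr// ltr1n.
have := Hr _ h; rewrite (addrC (zeta x)) subrK => h2.
rewrite ler_norml; have h3 := ler_rnormB (k (zeta x)) (k (zeta y)).
have h4 := ler_rnormB (k (zeta y)) (k (zeta x)).
by rewrite rnormB in h3; apply/andP; split; lra.
Qed.

Lemma rnorm_circle_bounded : exists2 B, 0 <= B & forall z, rnorm z <= 1 -> rnorm (k z) <= B.
Proof.
have [||d d0 H] := @unit_disc_local R (fun z d => rnorm z <= 1 -> rnorm (k z) <= d^-1).
- move=> z d d' d'0 dd' H z1; rewrite (le_trans (H z1))// lef_pV2 ?posrE//.
  exact: lt_le_trans dd'.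
- move=> z0; have [z01|z01] := leP (rnorm z0) 1; last first.
    exists (rnorm z0 - 1); first by rewrite subr_gt0.
    by move=> z hz z1; exfalso; have := ler_rnormB z0 z; rewrite rnormB; lra.
  have [d Hd] := kd (le_lt_trans z01 rho1).
  have [r r0 Hr] := has_cderiv_cont Hd ltr01.
  have c0 : 0 < (1 + rnorm (k z0))^-1 by rewrite invr_gt0 ltr_pwDl// rnorm_ge0.
  exists (Num.min r (1 + rnorm (k z0))^-1); first by rewrite lt_min r0.
  move=> z; rewrite lt_min => /andP[hz _] z1.
  rewrite (@le_trans _ _ (1 + rnorm (k z0)))//.
    have := Hr _ hz; rewrite (addrC z0) subrK => h.
    by have := ler_rnormB (k z) (k z0); lra.
  rewrite -[leLHS]invrK lef_pV2 ?posrE ?lt_min ?r0//.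
  by rewrite ge_min lexx orbT.
by exists d^-1; rewrite ?invr_ge0 ?(ltW d0)// => z z1; exact: H.
Qed.

Lemma itg_pow_circle (eta : R) : 0 < eta -> itg (fun x => powR (rnorm (k (zeta x))) eta).
Proof.
move=> eta0; have [B B0 HB] := rnorm_circle_bounded.
apply: (@itg_bnd _ _ (powR B eta)) => [|x _].
  apply: measurable_funTS; apply: (measurableT_comp (measurable_powR _)).
  exact: rnorm_circle_measurable.
rewrite ger0_norm ?powR_ge0// ge0_ler_powR ?nnegrE ?rnorm_ge0 ?(ltW eta0)//.
by rewrite HB// rnorm_zeta.
Qed.

(** [log_subharmonic] is multiplied by [eta] and exponentiated, Jensen moving the exponential under
    the Poisson integral; exponents below 1 are covered. The floor [eps] is chosen with
    [powR eps eta = e]. *)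
Lemma power_subharmonic (eta : R) z : 0 < eta -> rnorm z < 1 ->
  powR (rnorm (k z)) eta <= Int (fun x => poisson z x * powR (rnorm (k (zeta x))) eta).
Proof.
move=> eta0 z1; apply/ler_addgt0Pr => e e0.
pose eps := powR e eta^-1.
have eps0 : 0 < eps by rewrite powR_gt0.
have epse : powR eps eta = e by rewrite /eps -powRrM mulVf ?gt_eqF// powRr1// ltW.
pose N x := Num.max (rnorm (k (zeta x))) eps.
have N0 x : 0 < N x by rewrite lt_max eps0 orbT.
have il := itg_log_circle rho1 kd eps0.
have ip := itg_pow_circle eta0.
have Npow x : powR (N x) eta <= powR (rnorm (k (zeta x))) eta + e.
  rewrite /N maxEle; case: ifP => _; first by rewrite epse lerDr powR_ge0.
  by rewrite lerDl ltW.
have mN : measurable_fun setT (fun x : measurableTypeR R => powR (N x) eta).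
  apply: (measurableT_comp (measurable_powR _)); apply: measurable_maxr => //.
  exact: rnorm_circle_measurable.
have iN : itg (fun x => powR (N x) eta).
  apply: (itg_le (measurable_funTS mN) _ (itgD ip (itg_cst e))) => x _.
  by rewrite ger0_norm ?powR_ge0.
have expN x : expR (eta * ln (N x)) = powR (N x) eta by rewrite /powR gt_eqF.
apply: (@le_trans _ _ (Int (fun x => poisson z x * powR (N x) eta))).
  have h := log_subharmonic rho1 kd eps0 z1.
  apply: (@le_trans _ _ (powR (expR (Int (fun x => poisson z x * ln (N x)))) eta)).
    by apply: ge0_ler_powR; rewrite ?nnegrE ?rnorm_ge0 ?expR_ge0 ?(ltW eta0).
  rewrite -expRM mulrC -IntZ; last exact: itg_poisson.
  rewrite (@eq_Int _ _ (fun x => poisson z x * (eta * ln (N x)))); last by move=> x _; rewrite mulrCA.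
  rewrite (@eq_Int _ (fun x => poisson z x * powR (N x) eta) (fun x => poisson z x * expR (eta * ln (N x)))); last by move=> x _; rewrite expN.
  apply: jensen_exp.
  - exact: itg_poisson1.
  - by move=> x _; exact/ltW/poisson_gt0.
  - exact: Int_poisson.
  - by apply: itg_poisson => //; exact: itgZ.
  - apply: itg_poisson => //.
    by apply: (eq_itg _ iN) => x _; rewrite expN.
rewrite -[X in _ + X]mulr1 -(Int_poisson z1) -IntZ ?itg_poisson1// -IntD.
- apply: Int_le.
  + exact: itg_poisson.
  + by apply: itgD; [exact: itg_poisson|apply: itgZ; exact: itg_poisson1].
  move=> x _; rewrite (mulrC e) -mulrDr ler_wpM2l//.
  exact/ltW/poisson_gt0.
- exact: itg_poisson.
- by apply: itgZ; exact: itg_poisson1.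
Qed.

End power_subharmonic.

(** * Maximal functions *)

Section integral_toolkit.
Context {R : realType}.
Local Notation RM := (measurableTypeR R).
Local Notation mu := (@lebesgue_measure R).
Local Open Scope ereal_scope.

Lemma patch_measurable d (T : measurableType d) (D : set T) (f : T -> \bar R) :
  measurable D -> measurable_fun setT f -> measurable_fun setT (f \_ D).
Proof.
move=> mD mf; apply/(measurable_restrictT _ mD); exact: measurable_funTS.
Qed.

Lemma tonelli d1 d2 (T1 : measurableType d1) (T2 : measurableType d2)
  (m1 : {sigma_finite_measure set T1 -> \bar R}) (m2 : {sigma_finite_measure set T2 -> \bar R})
  (D1 : set T1) (D2 : set T2) (f : T1 -> T2 -> \bar R) :
  measurable D1 -> measurable D2 ->
  measurable_fun setT (fun p : T1 * T2 => f p.1 p.2) -> (forall x y, 0 <= f x y) ->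
  \int[m1]_(x in D1) \int[m2]_(y in D2) f x y = \int[m2]_(y in D2) \int[m1]_(x in D1) f x y.
Proof.
move=> mD1 mD2 mf f0.
pose g := (fun p : T1 * T2 => f p.1 p.2) \_ (D1 `*` D2).
have mg : measurable_fun setT g by apply: patch_measurable => //; exact: measurableX.
have g0 p : 0 <= g p by rewrite /g /patch; case: ifP.
have gE x y : g (x, y) = if (x \in D1) && (y \in D2) then f x y else 0.
  by rewrite /g /patch in_setX.
have := @fubini_tonelli _ _ T1 T2 R m1 m2 g mg g0.
have -> : (fun x => \int[m2]_y g (x, y)) = (fun x => \int[m2]_(y in D2) f x y) \_ D1.
  apply/funext => x; rewrite /patch; case: ifPn => xD1.
    rewrite [RHS]integral_mkcond; apply: eq_integral => y _.
    by rewrite gE xD1 /= /patch.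
  by rewrite -[RHS](@integral0 _ T2 R m2 setT); apply: eq_integral => y _; rewrite gE (negbTE xD1).
have -> : (fun y => \int[m1]_x g (x, y)) = (fun y => \int[m1]_(x in D1) f x y) \_ D2.
  apply/funext => y; rewrite /patch; case: ifPn => yD2.
    rewrite [RHS]integral_mkcond; apply: eq_integral => x _.
    by rewrite gE yD2 andbT /patch.
  by rewrite -[RHS](@integral0 _ T1 R m1 setT); apply: eq_integral => x _; rewrite gE (negbTE yD2) andbF.
by rewrite -!integral_mkcond.
Qed.

Lemma measurable_int_param d1 d2 (T1 : measurableType d1) (T2 : measurableType d2)
  (m2 : {sigma_finite_measure set T2 -> \bar R}) (D2 : set T2) (f : T1 -> T2 -> \bar R) :
  measurable D2 ->
  measurable_fun setT (fun p : T1 * T2 => f p.1 p.2) -> (forall x y, 0 <= f x y) ->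
  measurable_fun setT (fun x => \int[m2]_(y in D2) f x y).
Proof.
move=> mD2 mf f0.
pose g := (fun p : T1 * T2 => f p.1 p.2) \_ (setT `*` D2).
have mg : measurable_fun setT g by apply: patch_measurable => //; exact: measurableX.
have g0 p : 0 <= g p by rewrite /g /patch; case: ifP.
have := @measurable_fun_fubini_tonelli_F _ _ T1 T2 R m2 g mg g0.
rewrite /fubini_F; congr measurable_fun; apply/funext => x.
rewrite [RHS]integral_mkcond; apply: eq_integral => y _.
by rewrite /g /patch in_setX in_setT.
Qed.

Lemma integral_le d (T : measurableType d) (m : {measure set T -> \bar R}) (D : set T) (f g : T -> \bar R) :
  measurable D -> measurable_fun D f -> measurable_fun D g ->
  (forall x, D x -> 0 <= f x) -> (forall x, D x -> f x <= g x) ->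
  \int[m]_(x in D) f x <= \int[m]_(x in D) g x.
Proof. by move=> mD mf mg f0 fg; exact: ge0_le_integral. Qed.

Lemma lebesgue_measure_translate (c : R) (A : set RM) : measurable A ->
  pushforward mu (fun x : RM => (x + c)%R : RM) A = mu A.
Proof.
move=> mA; have mt : measurable_fun setT (fun x : RM => (x + c)%R : RM).
  by apply: measurable_funD; [exact: measurable_RM|exact: measurable_cst].
pose m' := pushforward mu (fun x : RM => (x + c)%R : RM).
apply/esym; apply: (lebesgue_measure_unique (mu := [the {measure set _ -> \bar _} of m'])) => //= _ [[a b]] _ <-.
rewrite /m' /pushforward /=.
have -> : (fun x : RM => (x + c)%R : RM) @^-1` `]a, b] = `](a - c)%R, (b - c)%R]%classic.
  apply/seteqP; split => x /=; rewrite !in_itv/= => /andP[h1 h2]; apply/andP; split; lra.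
rewrite !lebesgue_measure_itv/= !lte_fin ltrD2r; case: ifP => // _.
by rewrite -!EFinB; congr (_%:E); lra.
Qed.

Lemma integral_translate (c : R) (f : R -> \bar R) : measurable_fun setT (f : RM -> \bar R) ->
  (forall x, 0 <= f x) -> \int[mu]_x f (x + c)%R = \int[mu]_x f x.
Proof.
move=> mf f0; have mt : measurable_fun setT (fun x : RM => (x + c)%R : RM).
  by apply: measurable_funD; [exact: measurable_RM|exact: measurable_cst].
have := @ge0_integral_pushforward _ _ RM RM R _ mt mu setT f measurableT mf.
rewrite preimage_setT => <- //.
by apply: eq_measure_integral => A mA _; exact: lebesgue_measure_translate.
Qed.

End integral_toolkit.

Section maximal_function.
Context {R : realType}.
Local Notation RM := (measurableTypeR R).
Local Notation mu := (@lebesgue_measure R).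
Implicit Types (v : R -> R) (c : CC R).

Definition near_arc (n : nat) c : set RM := [set x : RM | rnorm (zeta x - c) * 2 ^+ n < 8].

(** A centred maximal function over chordal arcs of radius [8 / 2 ^+ n], with [2 ^+ n] standing for
    the reciprocal length; chords respect the identification of 0 and 1. The 8 leaves room: if a
    point of the disc is at distance [D] from the centre and [2 ^+ n * D < 2], all boundary points
    that see it are in the arc. *)
Definition Mc v c : \bar R :=
  ereal_sup (range (fun n : nat =>
    ((2 ^+ n)%:E * \int[mu]_(x in I01 `&` near_arc n c) (v x)%:E)%E)).

Lemma measurable_near_arc n c : measurable (near_arc n c).
Proof.
rewrite [X in measurable X](_ : _ = setT `&` ((fun x : RM => rnorm (zeta x - c) * 2 ^+ n) @^-1` `]-oo, 8[)); last first.
  by rewrite setTI; apply/seteqP; split => x; rewrite /near_arc /= in_itv.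
have mf : measurable_fun setT (fun x : RM => rnorm (zeta x - c) * 2 ^+ n).
  apply: measurable_funM => //; apply: measurable_rnorm; apply: cmeasB; [exact: cmeas_zetaR|exact: cmeas_cst].
by apply: mf => //; exact: measurable_itv.
Qed.

Lemma Mc_ge n v c :
  ((2 ^+ n)%:E * \int[mu]_(x in I01 `&` near_arc n c) (v x)%:E <= Mc v c)%E.
Proof. by apply: ereal_sup_ubound; exists n. Qed.

Lemma measurable_Mc v : measurable_fun setT (v : RM -> R) -> (forall x, 0 <= v x) ->
  measurable_fun setT (fun y : RM => Mc v (zeta y)).
Proof.
move=> mv v0.
have -> : (fun y : RM => Mc v (zeta y)) = (fun y => esups (fun n : nat =>
    ((2 ^+ n)%:E * \int[mu]_(x in I01 `&` near_arc n (zeta y)) (v x)%:E)%E) 0).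
  apply/funext => y; rewrite /Mc /esups /sdrop; congr ereal_sup.
  by apply/seteqP; split => [_ [n _ <-]|_ [n _ <-]]; exists n.
apply: measurable_fun_esups => n.
apply: emeasurable_funM; first exact: measurable_cst.
have -> : (fun x : RM => (\int[mu]_(x0 in I01 `&` near_arc n (zeta x)) (v x0)%:E)%E) =
  (fun y : RM => \int[mu]_(x in I01) ((v x)%:E * (\1_(near_arc n (zeta y)) x)%:E)%E)%E.
  apply/funext => y; rewrite [LHS]integral_mkcondr; apply: eq_integral => x _.
  by rewrite /patch indicE; case: ifP => _; rewrite ?mule1 ?mule0.
apply: (@measurable_int_param R _ _ RM RM) => //; first exact: measurable_itv; last first.
  by move=> x y; rewrite mule_ge0 ?lee_fin.
apply: emeasurable_funM.
  by apply/measurable_EFinP; apply: (measurableT_comp mv); exact: measurable_snd.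
apply/measurable_EFinP.
pose S : set (RM * RM) := [set p | rnorm (zeta p.2 - zeta p.1) * 2 ^+ n < 8].
have -> : (fun x : RM * RM => \1_(near_arc n (zeta x.1)) x.2) = (\1_S : RM * RM -> R).
  by apply/funext => -[a b]; rewrite !indicE; congr (_%:R); congr nat_of_bool; apply/idP/idP; rewrite !inE.
apply: measurable_indic.
rewrite [X in measurable X](_ : _ = setT `&` ((fun p : RM * RM => rnorm (zeta p.2 - zeta p.1) * 2 ^+ n) @^-1` `]-oo, 8[)); last first.
  by rewrite setTI; apply/seteqP; split => x; rewrite /S /= in_itv.
have mf : measurable_fun setT (fun p : RM * RM => rnorm (zeta p.2 - zeta p.1) * 2 ^+ n).
  apply: measurable_funM => //; apply: measurable_rnorm; apply: cmeasB.
    by apply: cmeas_zeta; apply: (measurableT_comp measurable_RM); exact: measurable_snd.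
  by apply: cmeas_zeta; apply: (measurableT_comp measurable_RM); exact: measurable_fst.
by apply: mf => //; exact: measurable_itv.
Qed.

End maximal_function.

Section chord.
Context {R : realType}.

(** Where the cosine is at least 1/2, by the mean value theorem and [pi >= 2]; elsewhere the sine
    itself is large. *)
Lemma sin_ge_id (s : R) : 0 <= s <= 1 / 2 -> s <= 2 * sin (pi * s).
Proof.
move=> /andP[s0 s1]; have p0 := @pi_gt0 R; have p2 := @pi_ge2 R.
have [->|sn0] := eqVneq s 0; first by rewrite mulr0 sin0 mulr0.
have {sn0}s0' : 0 < s by rewrite lt_neqAle eq_sym sn0.
have ps0 : 0 < pi * s by rewrite mulr_gt0.
have ps1 : pi * s <= pi / 2 by rewrite ler_pM2l//; lra.
have [c|c] := leP (1 / 2) (cos (pi * s)).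
  have csin : {within `[0, pi * s], continuous (@sin R)}.
    by apply: continuous_subspaceT; exact: continuous_sin.
  have [t] := @MVT R sin cos 0 (pi * s) ps0 (fun x _ => is_derive_sin x) csin.
  rewrite in_itv /= sin0 !subr0 => /andP[t0 t1] ->.
  have : cos (pi * s) <= cos t.
    by apply: ltW; rewrite ltr_cos// in_itv /=; apply/andP; split; lra.
  move=> h; have : 1 / 2 * (pi * s) <= cos t * (pi * s) by rewrite ler_wpM2r ?(ltW ps0)//; lra.
  have : 2 * s <= pi * s by rewrite ler_wpM2r.
  lra.
have c0 : 0 <= cos (pi * s) by apply: cos_ge0_pihalf; apply/andP; split; lra.
have sg : 0 <= sin (pi * s) by apply: sin_ge0_pi; apply/andP; split; lra.
have sq := cos2Dsin2 (pi * s).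
have c2 : cos (pi * s) ^+ 2 <= (1 / 2) ^+ 2 by rewrite ler_sqr ?nnegrE// ltW.
rewrite leNgt; apply/negP => h.
have : sin (pi * s) ^+ 2 < (1 / 4) ^+ 2 by rewrite ltr_sqr ?nnegrE//; lra.
lra.
Qed.

Lemma chord_eq (t : R) : rnorm (zeta t - 1) = 2 * `|sin (pi * t)|.
Proof.
have e : rnorm (zeta t - 1) ^+ 2 = (2 * `|sin (pi * t)|) ^+ 2.
  rewrite rnorm_sqr !ccE {1}/zeta {1}/zeta /cRe /cIm /= exprMn real_normK ?num_real//.
  have -> : 2 * pi * t = (pi * t) *+ 2 by rewrite mulr2n; ring.
  rewrite cos_mulr2n sin_mulr2n.
  have := cos2Dsin2 (pi * t); move: (cos _) (sin _) => c s h.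
  have e : c ^+ 2 = 1 - s ^+ 2 by rewrite -h addrK.
  have -> : ((c * s) *+ 2 - 0) ^+ 2 = 4 * (c ^+ 2 * s ^+ 2) by ring.
  by rewrite e; ring.
by apply/eqP; rewrite -(@eqrXn2 _ 2)// ?rnorm_ge0 ?mulr_ge0// e.
Qed.

Lemma zeta_sub (x y : R) : rnorm (zeta x - zeta y) = rnorm (zeta (x - y) - 1).
Proof.
have -> : zeta x - zeta y = zeta y * (zeta (x - y) - 1) by rewrite mulrBr mulr1 -zetaD (addrC y) subrK.
by rewrite rnormM rnorm_zeta mul1r.
Qed.

(** Chordal closeness means closeness of parameters only modulo 1. The three possible shifts are
    matched by the three translates in [periodize]. *)
Lemma chord_ge (x y : R) : I01 x -> I01 y ->
  exists2 m : R, m \in [:: -1; 0; 1] & `|x + m - y| <= rnorm (zeta x - zeta y).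
Proof.
rewrite /I01 /= !in_itv /= => /andP[x0 x1] /andP[y0 y1].
have half (t : R) : `|t| <= 1 / 2 -> `|t| <= rnorm (zeta t - 1).
  move=> ht; rewrite chord_eq.
  have := @sin_ge_id `|t|; rewrite normr_ge0 ht => /(_ isT) h.
  apply: (le_trans h); rewrite ler_pM2l//.
  have [t0|t0] := leP 0 t; first by rewrite ger0_norm// ler_norm.
  by rewrite ltr0_norm// mulrN sinN -normrN ler_norm.
have per (t : R) : zeta (t + 1) = zeta t by rewrite zetaD zeta1 mulr1.
rewrite zeta_sub.
have [h1|h1] := leP (x - y) (1 / 2); last first.
  exists (-1); first by rewrite !inE eqxx.
  have e : zeta (x - y) = zeta (x - y - 1) by rewrite -(per (x - y - 1)) subrK.
  by rewrite e addrAC; apply: half; rewrite ler_norml; apply/andP; split; lra.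
have [h2|h2] := leP (- (1 / 2)) (x - y).
  by exists 0; [rewrite !inE eqxx orbT|rewrite addr0; apply: half; rewrite ler_norml h2 h1].
exists 1; first by rewrite !inE eqxx !orbT.
rewrite addrAC -per; apply: half.
by rewrite ler_norml; apply/andP; split; lra.
Qed.

End chord.

(** * Weak-type and L^2 bounds for the maximal function *)

Section maximal_L2.
Context {R : realType}.
Local Notation RM := (measurableTypeR R).
Local Notation mu := (@lebesgue_measure R).

Section weak_type.
Variable w : R -> R.
Hypothesis mw : measurable_fun setT (w : RM -> R).
Hypothesis w0 : forall x, 0 <= w x.
Hypothesis iw : itg w.

(* Three consecutive translates of the restriction of [w] to [0, 1]: balls centred in [0, 1] see them as a periodic function. *)
Definition periodize (x : R) : R :=
  (w (x + 1) * \1_(@I01 R) (x + 1)) + (w x * \1_(@I01 R) x) + (w (x - 1) * \1_(@I01 R) (x - 1)).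

Let piece (m : R) (x : RM) : R := w (x + m) * \1_(@I01 R) (x + m).

Let mt (m : R) : measurable_fun setT (fun x : RM => (x + m) : RM).
Proof. by apply: measurable_funD; [exact: measurable_RM|exact: measurable_cst]. Qed.

Let m_piece m : measurable_fun setT (piece m).
Proof.
apply: measurable_funM; first exact: measurableT_comp mw (mt m).
by apply: measurableT_comp (mt m); apply: measurable_indic; exact: mI01.
Qed.

Let piece0 m x : 0 <= piece m x.
Proof. by rewrite mulr_ge0. Qed.

Let periodizeE x : periodize x = piece 1 x + piece 0 x + piece (-1) x.
Proof. by rewrite /periodize /piece addr0. Qed.

Lemma measurable_periodize : measurable_fun setT (periodize : RM -> R).
Proof.
have -> : periodize = (fun x => piece 1 x + piece 0 x + piece (-1) x) by apply/funext => x; rewrite periodizeE.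
by apply: measurable_funD; [apply: measurable_funD|].
Qed.

Lemma periodize_ge0 x : 0 <= periodize x. Proof. by rewrite periodizeE !addr_ge0. Qed.

Let int_piece m : (\int[mu]_x (piece m x)%:E = (Int w)%:E)%E.
Proof.
have := @integral_translate R m (fun x => (w x * \1_(@I01 R) x)%:E).
move=> ->.
- rewrite Int_EFin// [RHS]integral_mkcond; apply: eq_integral => x _.
  by rewrite /patch indicE; case: ifP => _; rewrite ?mulr1 ?mulr0.
- by apply/measurable_EFinP; apply: measurable_funM => //; apply: measurable_indic; exact: mI01.
- by move=> x; rewrite lee_fin mulr_ge0.
Qed.

Lemma integral_periodize : (\int[mu]_x (periodize x)%:E = (3 * Int w)%:E)%E.
Proof.
have -> : (fun x => (periodize x)%:E) = (fun x => ((piece 1 x)%:E + (piece 0 x)%:E) + (piece (-1) x)%:E)%E.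
  by apply/funext => x; rewrite periodizeE !EFinD.
have mp m : measurable_fun setT (fun x => (piece m x)%:E) by exact/measurable_EFinP.
rewrite ge0_integralD//=.
- rewrite ge0_integralD//=; first by rewrite !int_piece -!EFinD; congr (_%:E); ring.
  by move=> x _; rewrite lee_fin.
  by move=> x _; rewrite lee_fin.
- by move=> x _; rewrite adde_ge0// lee_fin.
- by apply: emeasurable_funD.
- by move=> x _; rewrite lee_fin.
Qed.

Lemma periodize_loc : locally_integrable setT periodize.
Proof.
split; [exact: measurable_periodize|exact: openT|].
move=> K _ cK; apply: (@le_lt_trans _ _ (3 * Int w)%:E); last exact: ltry.
rewrite -integral_periodize.
have -> : (fun x => `|periodize x|%:E) = (fun x => (periodize x)%:E).
  by apply/funext => x; rewrite ger0_norm ?periodize_ge0.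
apply: ge0_subset_integral => //.
- exact: compact_measurable.
- by apply/measurable_EFinP; exact: measurable_periodize.
- by move=> x _; rewrite lee_fin periodize_ge0.
Qed.

Let dom (a b c : \bar R) : (0 <= a -> 0 <= b -> 0 <= c ->
  a <= a + b + c /\ b <= a + b + c /\ c <= a + b + c)%E.
Proof.
move=> a0 b0 c0; split; first by rewrite -addeA leeDl// adde_ge0.
by split; [rewrite addeAC leeDr// adde_ge0|rewrite leeDr// adde_ge0].
Qed.

(** An arc becomes an interval of length [16 / 2 ^+ n], which is the constant 16; a point of the arc
    lies in that interval after one of the shifts of [chord_ge]. *)
Lemma Mc_le_HL y : I01 y -> (Mc w (zeta y) <= 16%:E * HL_maximal periodize y)%E.
Proof.
move=> Iy; apply: ge_ereal_sup => _ [n _ <-].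
have p2 : 0 < (2:R) ^+ n by rewrite exprn_gt0.
pose r : R := 8 / 2 ^+ n; have r0 : 0 < r by rewrite divr_gt0.
have H : (\int[mu]_(x in I01 `&` near_arc n (zeta y)) (w x)%:E <= \int[mu]_(x in ball y r) `|(periodize x)%:E|)%E.
  have -> : (fun x => `|(periodize x)%:E|)%E = (fun x => (periodize x)%:E).
    by apply/funext => x; rewrite /= ger0_norm ?periodize_ge0.
  rewrite integral_mkcond [leRHS]integral_mkcond.
  (* Unfolding [periodize] and undoing the translations turns the integral over the ball into three
     integrals of [w] over shifted balls. *)
  pose q (m : R) (x : R) : \bar R := (w x * \1_(@I01 R) x * \1_(ball y r) (x - m))%:E.
  have mq m : measurable_fun setT (q m : RM -> _).
    apply/measurable_EFinP; apply: measurable_funM.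
      by apply: measurable_funM => //; apply: measurable_indic; exact: mI01.
    have mi : measurable_fun setT (\1_(ball y r : set RM) : RM -> R).
      by apply: measurable_indic; exact: measurable_ball.
    exact: (measurableT_comp mi (mt (- m))).
  have q0 m x : (0 <= q m x)%E by rewrite lee_fin !mulr_ge0.
  have -> : (fun x => (periodize x)%:E) \_ (ball y r) = (fun x => q 1%R (x + 1)%R + q 0%R (x + 0)%R + q (-1)%R (x + (-1))%R)%E.
    apply/funext => x; rewrite /patch /q !addrK.
    rewrite -!EFinD /periodize addr0 (indicE _ (ball y r)); case: ifP => _ /=; first by rewrite !mulr1.
    by rewrite !mulr0 !addr0.
  have mqt m : measurable_fun setT (fun x : RM => q m (x + m)) by exact: (measurableT_comp (mq m) (mt m)).
  have qt m : (\int[mu]_x q m (x + m)%R = \int[mu]_x q m x)%E.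
    by apply: integral_translate; [exact: mq|exact: q0].
  rewrite [leRHS]ge0_integralD//=; [|by move=> x _; rewrite adde_ge0|exact: emeasurable_funD].
  rewrite [X in (_ <= X + _)%E]ge0_integralD//=.
  rewrite (qt 1) (qt 0) (qt (-1)).
  rewrite -[X in (_ <= X + _)%E]ge0_integralD// -ge0_integralD//=; [|by move=> x _; rewrite adde_ge0|exact: emeasurable_funD].
  apply: integral_le => //=.
  - apply: patch_measurable; last exact/measurable_EFinP.
    by apply: measurableI; [exact: mI01|exact: measurable_near_arc].
  - by apply: emeasurable_funD => //; exact: emeasurable_funD.
  - by move=> x _; rewrite /patch; case: ifP => _; rewrite ?lee_fin.
  - move=> x _; rewrite /patch; case: ifPn => [|_]; last by rewrite !adde_ge0.
    rewrite inE => -[Ix nx].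
    have [m hm hxm] := chord_ge Ix Iy.
    have hq m' : `|x + - m' - y| < r -> q m' x = (w x)%:E.
      move=> h; have hb : ball y r (x - m') by rewrite /ball /= distrC.
      by rewrite /q !indicE (mem_set Ix) (mem_set hb) !mulr1.
    have lt : `|x + m - y| < r by rewrite (le_lt_trans hxm)// /r ltr_pdivlMr.
    move: hm lt; rewrite !inE => /or3P[] /eqP -> lt.
    + by have [+ _] := dom (q0 1 x) (q0 0 x) (q0 (-1) x); rewrite {1}(hq 1).
    + have [_ [+ _]] := dom (q0 1 x) (q0 0 x) (q0 (-1) x); rewrite {1}(hq 0)//.
      by rewrite subr0; rewrite addr0 in lt.
    + have [_ [_ +]] := dom (q0 1 x) (q0 0 x) (q0 (-1) x); rewrite {1}(hq (-1))//.
      by rewrite opprK.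
have bE : mu (ball y r) = (r *+ 2)%:E by rewrite lebesgue_measure_ball// ltW.
have iavg_le : (iavg periodize (ball y r) <= HL_maximal periodize y)%E.
  by apply: ereal_sup_ubound; exists r => //=; rewrite in_itv /= r0.
apply: (@le_trans _ _ (16%:E * iavg periodize (ball y r))%E); last by rewrite lee_pmul2l.
rewrite /iavg bE inver mulrn_eq0 /= gt_eqF//.
rewrite muleA -EFinM (_ : 16 * (r *+ 2)^-1 = 2 ^+ n); last by rewrite /r; field; rewrite gt_eqF.
by rewrite lee_pmul2l.
Qed.

Lemma HL_periodize_bound b : (forall x, I01 x -> w x <= b) -> 0 <= b ->
  forall y, (HL_maximal periodize y <= (3 * b)%:E)%E.
Proof.
move=> wb b0 y; apply: ge_ereal_sup => _ [r /= r0 <-].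
rewrite in_itv /= andbT in r0.
rewrite /iavg lebesgue_measure_ball ?(ltW r0)// inver mulrn_eq0 /= gt_eqF//.
have wb3 x : periodize x <= 3 * b.
  have pb m : piece m x <= b.
    rewrite /piece indicE; case: (boolP (_ \in _)) => [/set_mem|_]; last by rewrite mulr0.
    by move=> ?; rewrite mulr1 wb.
  by rewrite periodizeE; have := pb 1; have := pb 0; have := pb (-1); lra.
have : (\int[mu]_(x in ball y r) `|(periodize x)%:E| <= (3 * b)%:E * mu (ball y r))%E.
  rewrite -integral_cst; last exact: measurable_ball.
  apply: integral_le => //; first exact: measurable_ball.
    by apply: measurableT_comp => //; apply/measurable_EFinP; apply: measurable_funTS; exact: measurable_periodize.
  by move=> x _ /=; rewrite lee_fin ger0_norm ?periodize_ge0.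
rewrite lebesgue_measure_ball ?(ltW r0)// => h.
have r20 : 0 < r *+ 2 by rewrite mulrn_wgt0.
by rewrite lee_pdivrMl// muleC.
Qed.

(** In [9 = 3 * 3] one factor is the constant of [maximal_inequality], the other the total mass of
    [periodize]. *)
Lemma weak_type (c : R) : 0 < c ->
  (mu [set x | (c%:E < HL_maximal periodize x)%E] <= (9 / c * Int w)%:E)%E.
Proof.
move=> c0; apply: (le_trans (maximal_inequality periodize_loc c0)).
have -> : (fun y => `|(periodize y)%:E|)%E = (fun x => (periodize x)%:E).
  by apply/funext => x; rewrite /= ger0_norm ?periodize_ge0.
by rewrite integral_periodize -EFinM lee_fin; lra.
Qed.

Lemma measurable_HL_periodize : measurable_fun setT (HL_maximal periodize : RM -> \bar R).
Proof. exact: measurable_HL_maximal periodize_loc. Qed.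

End weak_type.

End maximal_L2.

Section maximal_L2_bound.
Context {R : realType}.
Local Notation RM := (measurableTypeR R).
Local Notation mu := (@lebesgue_measure R).

Lemma itg_trunc (v : R -> R) (P : set RM) : measurable_fun setT (v : RM -> R) -> measurable P ->
  itg v -> measurable_fun setT (fun x : RM => v x * \1_P x) /\ itg (fun x => v x * \1_P x).
Proof.
move=> mv mP iv; have m : measurable_fun setT (fun x : RM => v x * \1_P x).
  by apply: measurable_funM => //; exact: measurable_indic.
split=> //; apply: (itg_le _ _ (itg_abs iv)); first exact: measurable_funTS m.
by move=> x _; rewrite normrM indicE; case: (_ \in _); rewrite ?normr1 ?mulr1// normr0 mulr0.
Qed.

Lemma Mc_leD (v v1 v2 : R -> R) c : measurable_fun setT (v1 : RM -> R) -> measurable_fun setT (v2 : RM -> R) ->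
  (forall x, 0 <= v1 x) -> (forall x, 0 <= v2 x) -> (forall x, v x = v1 x + v2 x) ->
  (Mc v c <= Mc v1 c + Mc v2 c)%E.
Proof.
move=> m1 m2 p1 p2 e; apply: ge_ereal_sup => _ [n _ <-].
have mI : measurable (I01 `&` near_arc n c : set RM) by apply: measurableI; [exact: mI01|exact: measurable_near_arc].
have -> : (fun x => (v x)%:E) = (fun x => (v1 x)%:E + (v2 x)%:E)%E by apply/funext => x; rewrite e EFinD.
rewrite ge0_integralD//=; first last.
- by apply/measurable_EFinP; exact: measurable_funTS.
- by move=> x _; rewrite lee_fin.
- by apply/measurable_EFinP; exact: measurable_funTS.
- by move=> x _; rewrite lee_fin.
by rewrite ge0_muleDr ?integral_ge0//; [apply: leeD; exact: Mc_ge|move=> x _; rewrite lee_fin..].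
Qed.

(** Split [v] at height [l / 96]. The low part has maximal function at most
    [16 * 3 * (l / 96) = l / 2], so that of the high part exceeds [l / 2], its [HL_maximal] exceeds
    [l / 32], and [9 * 32 = 288]. *)
Lemma Mc_weak (v : R -> R) (l : R) : measurable_fun setT (v : RM -> R) -> (forall x, 0 <= v x) ->
  itg v -> 0 < l ->
  (\int[mu]_(y in I01) (\1_[set y : RM | (l%:E < Mc v (zeta y))%E] y)%:E
   <= \int[mu]_(x in I01) (288 / l * (v x * \1_[set x : RM | (l < 96 * v x)%R] x))%:E)%E.
Proof.
move=> mv v0 iv l0.
pose P : set RM := [set x : RM | (l < 96 * v x)%R].
have m96 : measurable_fun setT (fun x : RM => 96 * v x).
  by apply: measurable_funM => //; exact: measurable_cst.
have mP : measurable P.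
  rewrite [X in measurable X](_ : _ = setT `&` ((fun x : RM => 96 * v x) @^-1` `]l, +oo[)).
    by apply: m96 => //; exact: measurable_itv.
  by rewrite setTI; apply/seteqP; split => x; rewrite /P /= in_itv /= andbT.
have mP' : measurable (~` P) by exact: measurableC.
have [m1 i1] := itg_trunc mv mP iv; have [m2 i2] := itg_trunc mv mP' iv.
pose v1 x := v x * \1_P x; pose v2 x := v x * \1_(~` P) x.
have v10 x : 0 <= v1 x by rewrite mulr_ge0.
have v20 x : 0 <= v2 x by rewrite mulr_ge0.
have ve x : v x = v1 x + v2 x.
  rewrite /v1 /v2 -mulrDr !indicE in_setC; case: (_ \in _) => /=; by rewrite ?addr0 ?add0r mulr1.
have v2b x : I01 x -> v2 x <= l / 96.
  move=> _; rewrite /v2 indicE; case: (boolP (_ \in _)) => [/set_mem|_]; rewrite ?mulr1 ?mulr0; last by lra.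
  by rewrite /P /= => /negP; rewrite -leNgt; lra.
set S := [set y : RM | (l%:E < Mc v (zeta y))%E].
have mS : measurable S.
  rewrite -[X in measurable X]setTI; apply: emeasurable_fun_o_infty => //; exact: measurable_Mc.
have l32 : 0 < l / 32 by lra.
have sub y : I01 y -> S y -> ((l / 32)%:E < HL_maximal (periodize v1) y)%E.
  move=> Iy Sy; rewrite ltNge; apply/negP => h.
  have h1 : (Mc v1 (zeta y) <= (l / 2)%:E)%E.
    have hh := Mc_le_HL m1 v10 Iy.
    apply: (le_trans hh).
    by apply: (@le_trans _ _ (16%:E * (l / 32)%:E)%E); [rewrite lee_pmul2l|rewrite -EFinM lee_fin; lra].
  have h2 : (Mc v2 (zeta y) <= (l / 2)%:E)%E.
    have hh := Mc_le_HL m2 v20 Iy.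
    apply: (le_trans hh).
    apply: (@le_trans _ _ (16%:E * (3 * (l / 96))%:E)%E); last by rewrite -EFinM lee_fin; lra.
    by rewrite lee_pmul2l//; apply: HL_periodize_bound => //; lra.
  have : (Mc v (zeta y) <= l%:E)%E.
    apply: (le_trans (Mc_leD _ m1 m2 v10 v20 ve)); apply: (le_trans (leeD h1 h2)).
    by rewrite -EFinD lee_fin; lra.
  by rewrite leNgt Sy.
have mH : measurable [set y : RM | ((l / 32)%:E < HL_maximal (periodize v1) y)%E].
  rewrite -[X in measurable X]setTI; apply: emeasurable_fun_o_infty => //; exact: measurable_HL_periodize.
rewrite integral_indic//; last exact: mI01.
apply: (@le_trans _ _ (9 / (l / 32) * Int v1)%:E).
  apply: le_trans (weak_type m1 v10 i1 l32); apply: le_measure; rewrite ?inE//.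
    by apply: measurableI => //; exact: mI01.
  by move=> y [Sy Iy]; exact: sub.
rewrite -Int_EFin; last exact: itgZ i1.
by rewrite IntZ// lee_fin (_ : 9 / (l / 32) = 288 / l)//; field; rewrite gt_eqF.
Qed.

(** The minimum is the induction invariant: its first entry bounds the earlier terms when a new one
    is added, its second entry is the bound that gets used. *)
Lemma geo_trunc_sum (a v : R) : 0 <= a -> 0 <= v -> forall n,
  \sum_(k < n) (2 ^+ k * a * (2 ^+ k * a < v)%R%:R) <= Num.min (2 ^+ n * a) (2 * v).
Proof.
move=> a0 v0; elim=> [|n ih]; first by rewrite big_ord0 le_min mul1r a0 mulr_ge0.
rewrite big_ord_recr /=; move: ih; rewrite !le_min => /andP[h1 h2].
have pa : 0 <= 2 ^+ n * a by rewrite mulr_ge0 ?exprn_ge0.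
rewrite exprS; case: (ltP (2 ^+ n * a) v) => h; rewrite ?mulr1 ?mulr0 ?addr0; apply/andP; split; lra.
Qed.

(** A discrete layer-cake formula: the last level [2 ^+ k * a] below [m] satisfies
    [m <= 2 ^+ k.+1 * a], so its term alone is at least [m ^+ 2]. *)
Lemma sqr_le_levels (a m : R) : 0 < a -> 0 <= m ->
  forall n, m <= 2 ^+ n * a -> m ^+ 2 <= a ^+ 2 + \sum_(k < n) (4 ^+ k.+1 * a ^+ 2 * (2 ^+ k * a < m)%R%:R).
Proof.
move=> a0 m0; elim=> [|n ih] hn.
  by rewrite big_ord0 addr0 ler_sqr ?nnegrE// ?(ltW a0)// (le_trans hn)// mul1r.
rewrite big_ord_recr /=; case: (ltP (2 ^+ n * a) m) => h; last first.
  by rewrite mulr0 addr0; exact: ih.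
rewrite mulr1.
have : m ^+ 2 <= (2 ^+ n.+1 * a) ^+ 2 by rewrite ler_sqr ?nnegrE// (le_trans m0).
rewrite exprMn -exprM mulnC exprM (_ : 2 ^+ 2 = 4 :> R); last by ring.
move=> /le_trans; apply; rewrite addrA lerDr addr_ge0 ?sqr_ge0// sumr_ge0// => i _.
have : 0 <= (4 : R) ^+ i.+1 by rewrite exprn_ge0.
have : 0 <= a ^+ 2 by rewrite sqr_ge0.
by move=> h1 h2; rewrite mulr_ge0// mulr_ge0.
Qed.

Lemma sqr_le_level_series (a : R) (M : \bar R) : 0 < a -> (0 <= M)%E ->
  (M * M <= (a ^+ 2)%:E + \sum_(0 <= k <oo) ((4 ^+ k.+1 * a ^+ 2)%:E * ((2 ^+ k * a)%:E < M)%E%:R%:E))%E.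
Proof.
move=> a0 M0.
have t0 k (b : bool) : (0 <= (4 ^+ k.+1 * a ^+ 2)%:E * (b%:R)%:E :> \bar R)%E.
  have : 0 <= (4 : R) ^+ k.+1 by rewrite exprn_ge0.
  have : 0 <= a ^+ 2 by rewrite sqr_ge0.
  by move=> h1 h2; rewrite mule_ge0 ?lee_fin// mulr_ge0.
have key (m : R) : 0 <= m -> (m%:E <= M)%E -> ((m ^+ 2)%:E <=
   (a ^+ 2)%:E + \sum_(0 <= k <oo) ((4 ^+ k.+1 * a ^+ 2)%:E * ((2 ^+ k * a)%:E < M)%E%:R%:E))%E.
  move=> m0 mM; have [n hn] := pow2_big (m / a).
  have hn' : m <= 2 ^+ n * a by rewrite -ler_pdivrMr// ltW.
  apply: (@le_trans _ _ ((a ^+ 2)%:E + \sum_(0 <= k < n) ((4 ^+ k.+1 * a ^+ 2)%:E * ((2 ^+ k * a)%:E < M)%E%:R%:E))%E); last first.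
    by apply: leeD => //; apply: nneseries_lim_ge => k _ _; exact: t0.
  apply: (@le_trans _ _ (a ^+ 2 + \sum_(k < n) (4 ^+ k.+1 * a ^+ 2 * (2 ^+ k * a < m)%R%:R))%:E).
    by rewrite lee_fin; exact: sqr_le_levels.
  rewrite EFinD leeD2l// -sumEFin big_mkord; apply: lee_sum => k _.
  rewrite EFinM lee_pmul2l ?fin_numE// ?lte_fin; last first.
    have h1 : 0 < (4 : R) ^+ k.+1 by rewrite exprn_gt0.
    have h2 : 0 < a ^+ 2 by rewrite exprn_gt0.
    by rewrite mulr_gt0.
  rewrite lee_fin; case: (ltP (2 ^+ k * a) m) => // h.
  by rewrite (lt_le_trans _ mM)// lte_fin.
case: M M0 key {t0} => [m| |]// M0 key.
  by rewrite -EFinM -expr2; apply: key => //; rewrite -lee_fin.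
rewrite mulyy leye_eq; apply/eqP; apply/eqyP => r r0.
have r1 : 0 <= r + 1 by rewrite addr_ge0 ?ltW.
apply: le_trans (key (r + 1) r1 (leey _)); rewrite lee_fin.
by have h : 0 <= r ^+ 2 by [rewrite sqr_ge0]; rewrite sqrrD1; lra.
Qed.

Lemma Mc_ge0 (v : R -> R) c : (forall x, 0 <= v x) -> (0 <= Mc v c)%E.
Proof.
move=> v0; apply: le_trans (Mc_ge 0 v c); rewrite mule_ge0 ?lee_fin// integral_ge0// => x _.
by rewrite lee_fin.
Qed.

(** Interpolation: the layers of [Mc v] are integrated with [Mc_weak], sum and integral are
    exchanged, and the layers below [96 * v x] form a geometric sum. *)
Lemma Mc_L2 : exists2 C : R, 0 < C & forall v : R -> R,
  measurable_fun setT (v : RM -> R) -> (forall x, 0 <= v x) -> itg v -> itg (fun x => v x ^+ 2) ->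
  (\int[mu]_(y in I01) (Mc v (zeta y) * Mc v (zeta y)) <= (C * Int (fun x => (v x ^+ 2)%R))%:E)%E.
Proof.
(* [1152 = 4 * 288] comes from the layer weights and [Mc_weak], [192 = 2 * 96] from
   [geo_trunc_sum]. *)
have [C eC] : exists C : R, C = 1152 * 192 by eexists.
exists C => [|v mv v0 iv iv2]; first by rewrite eC; lra.
apply/lee_addgt0Pr => e e0.
(* The bottom layer contributes [a ^+ 2], made equal to the allowed error [e]. *)
pose a := Num.sqrt e; have a0 : 0 < a by rewrite sqrtr_gt0.
have ae : a ^+ 2 = e by rewrite sqr_sqrtr ?ltW.
pose S k := [set y : RM | ((2 ^+ k * a)%:E < Mc v (zeta y))%E].
have mM := measurable_Mc mv v0.
have mS k : measurable (S k).
  by rewrite -[X in measurable X]setTI; apply: emeasurable_fun_o_infty.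
pose c k : R := 4 ^+ k.+1 * a ^+ 2.
have c0 k : 0 <= c k.
  have : 0 <= (4 : R) ^+ k.+1 by rewrite exprn_ge0.
  have : 0 <= a ^+ 2 by rewrite sqr_ge0.
  by move=> h1 h2; rewrite mulr_ge0.
have mterm k : measurable_fun I01 (fun y : RM => (c k)%:E * (\1_(S k) y)%:E)%E.
  apply: emeasurable_funM; first exact: measurable_cst.
  by apply/measurable_EFinP; apply: measurable_funTS; exact: measurable_indic.
have term0 k y : (0 <= (c k)%:E * (\1_(S k) y)%:E)%E by rewrite mule_ge0 ?lee_fin.
have mser : measurable_fun I01 (fun y => \sum_(0 <= k <oo) ((c k)%:E * (\1_(S k) y)%:E))%E.
  by apply: ge0_emeasurable_sum => k *.
apply: (@le_trans _ _ (\int[mu]_(y in I01) (e%:E + \sum_(0 <= k <oo) ((c k)%:E * (\1_(S k) y)%:E)))%E).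
  apply: integral_le; first exact: mI01.
  - by apply: measurable_funTS; exact: emeasurable_funM.
  - by apply: emeasurable_funD => //; exact: measurable_cst.
  - by move=> y _; rewrite mule_ge0 ?Mc_ge0.
  - move=> y _; have := sqr_le_level_series a0 (Mc_ge0 (zeta y) v0); rewrite ae => /le_trans; apply.
    rewrite leeD2l//; apply: lee_nneseries => k _; last by rewrite /c ae indicE /S mem_setE.
    by have := term0 k y; rewrite indicE /S mem_setE /c ae.
rewrite ge0_integralD//=; first last.
- by move=> y _; apply: nneseries_ge0 => k _ _; exact: term0.
- by move=> y _; rewrite lee_fin ltW.
- exact: mI01.
rewrite [X in (X + _)%E](_ : _ = e%:E); last first.
  have -> : (\int[mu]_(x in I01) e%:E = e%:E * mu I01)%E by exact: (integral_cst mu mI01).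
  by rewrite muI01 mule1.
rewrite addeC leeD2r//.
rewrite integral_nneseries//; last exact: mI01.
pose P k := [set x : RM | (2 ^+ k * a < 96 * v x)%R].
have mP k : measurable (P k).
  have m96 : measurable_fun setT (fun x : RM => 96 * v x).
    by apply: measurable_funM => //; exact: measurable_cst.
  rewrite [X in measurable X](_ : _ = setT `&` ((fun x : RM => 96 * v x) @^-1` `]2 ^+ k * a, +oo[)).
    by apply: m96 => //; exact: measurable_itv.
  by rewrite setTI; apply/seteqP; split => x; rewrite /P /= in_itv /= andbT.
have [d ed] : exists d : R, d = 1152 by eexists.
have d0 : 0 <= d by rewrite ed; lra.
pose t k x : R := d * v x * (2 ^+ k * a * \1_(P k) x).
have t0 k x : 0 <= t k x.
  by rewrite mulr_ge0 ?mulr_ge0 ?exprn_ge0 ?(ltW a0).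
have mt k : measurable_fun I01 (fun x : RM => (t k x)%:E).
  apply/measurable_EFinP; apply: measurable_funTS; apply: measurable_funM; apply: measurable_funM => //.
apply: (@le_trans _ _ (\sum_(0 <= k <oo) \int[mu]_(x in I01) (t k x)%:E)%E).
  apply: lee_nneseries => k _.
    by move=> _; apply: integral_ge0 => y _; exact: term0.
  rewrite ge0_integralZl_EFin//; first last.
  - by apply/measurable_EFinP; apply: measurable_funTS; exact: measurable_indic.
  - exact: mI01.
  have l0 : 0 < 2 ^+ k * a by rewrite mulr_gt0 ?exprn_gt0.
  apply: (le_trans (lee_wpmul2l _ (Mc_weak mv v0 iv l0))); first by rewrite lee_fin.
  have [m1 i1] := itg_trunc mv (mP k) iv.
  have i2 := itgZ (288 / (2 ^+ k * a)) i1.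
  rewrite -[X in (_ * X <= _)%E](Int_EFin i2) -EFinM -IntZ// (Int_EFin (itgZ (c k) i2)).
  rewrite le_eqVlt; apply/orP; left; apply/eqP; apply: eq_integral => x _; congr (_%:E).
  rewrite /t /c exprS (_ : 4 ^+ k = 2 ^+ k * 2 ^+ k :> R); last by rewrite -exprMn; congr (_ ^+ _); ring.
  by rewrite ed; field; rewrite !gt_eqF// exprn_gt0.
have <- : (\int[mu]_(x in I01) \sum_(0 <= k <oo) (t k x)%:E = \sum_(0 <= k <oo) \int[mu]_(x in I01) (t k x)%:E)%E.
  apply: integral_nneseries; [exact: mI01|by move=> k; exact: mt|].
  by move=> k x _; rewrite lee_fin.
have i3 := itgZ C iv2.
rewrite -IntZ// Int_EFin//; apply: integral_le; first exact: mI01.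
- by apply: ge0_emeasurable_sum => [k x _ _|k _]; [rewrite lee_fin|exact: mt].
- by apply/measurable_EFinP; exact: itg_meas i3.
- by move=> x _; apply: nneseries_ge0 => k _ _; rewrite lee_fin.
move=> x _; apply: lime_le.
  by apply: is_cvg_nneseries => k _ _; rewrite lee_fin.
near=> n; rewrite sumEFin lee_fin big_mkord -mulr_sumr.
have := @geo_trunc_sum a (96 * v x) (ltW a0) _ n; rewrite mulr_ge0// => /(_ isT); rewrite le_min => /andP[_ h].
have -> : \sum_(i < n) 2 ^+ i * a * \1_(P i) x = \sum_(i < n) 2 ^+ i * a * (2 ^+ i * a < 96 * v x)%R%:R.
  by apply: eq_bigr => i _; rewrite indicE /P mem_setE.
have v1 : 0 <= d * v x by rewrite mulr_ge0.
by apply: (le_trans (ler_wpM2l v1 h)); rewrite expr2 eC ed; lra.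
Unshelve. all: end_near.
Qed.

End maximal_L2_bound.

(** * Stolz angles *)

Section disc_measurability.
Context {R : realType}.
Local Notation RM := (measurableTypeR R).
Local Notation mu := (@lebesgue_measure R).

(** An open set of the plane is the countable union of the half-open dyadic squares that it
    contains. *)
Lemma open_measurable2 (U : set (RM * RM)) :
  (forall p, U p -> exists2 e : R, 0 < e & forall q : RM * RM, `|q.1 - p.1| < e -> `|q.2 - p.2| < e -> U q) ->
  measurable U.
Proof.
move=> oU.
pose I (n : nat) (k : int) : set RM := `[k%:~R / 2 ^+ n, (k%:~R + 1) / 2 ^+ n[%classic.
pose cell (t : nat * (int * int)) : set (RM * RM) := I t.1 t.2.1 `*` I t.1 t.2.2.
have -> : U = \bigcup_(t in [set t | cell t `<=` U]) cell t.
  apply/seteqP; split=> [p Up|p [t /= h1 h2]]; last exact: h1.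
  have [e e0 he] := oU _ Up.
  have [n hn] := pow2_big (1 / e).
  have p2 : 0 < (2 : R) ^+ n by rewrite exprn_gt0.
  have en : 1 / 2 ^+ n < e by rewrite ltr_pdivrMr// mulrC -ltr_pdivrMr.
  have inI (a : R) : I n (Num.floor (a * 2 ^+ n)) a.
    have := floorD1_gt (a * 2 ^+ n); rewrite intrD => h.
    by rewrite /I /= in_itv /= ler_pdivrMr// ltr_pdivlMr// floor_le.
  have near (k : int) (a b : R) : I n k a -> I n k b -> `|a - b| < e.
    rewrite /I /= !in_itv /= => /andP[a1 a2] /andP[b1 b2].
    apply: le_lt_trans en; rewrite mulrDl in a2 b2.
    by rewrite ler_norml; apply/andP; split; lra.
  exists (n, (Num.floor (p.1 * 2 ^+ n), Num.floor (p.2 * 2 ^+ n))) => /=.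
    by move=> q [q1 q2]; apply: he; [apply: near q1 _|apply: near q2 _]; exact: inI.
  by split; exact: inI.
rewrite bigcup_mkcond; apply: countable_bigcupT_measurable; first exact: countableP.
move=> t; case: ifP => // _; apply: measurableX; exact: measurable_itv.
Qed.

Lemma toC_sub_le (p q : RM * RM) (e : R) : `|q.1 - p.1| < e / 2 -> `|q.2 - p.2| < e / 2 ->
  rnorm (toC q - toC p) < e.
Proof.
move=> h1 h2; apply: (@le_lt_trans _ _ (`|q.1 - p.1| + `|q.2 - p.2|)); last lra.
by apply: (le_trans (rnorm_le _)); rewrite !ccE /toC /cRe /cIm.
Qed.

(** Analyticity says nothing outside the disc; the value 0 there gives a function measurable on the
    whole plane. *)
Definition discnorm (X : normedModType (CC R)) (f : CC R -> X) (z : CC R) : R :=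
  if rnorm z < 1 then rnorm (f z) else 0.

Lemma discnorm_ge0 (X : normedModType (CC R)) (f : CC R -> X) z : 0 <= discnorm f z.
Proof. by rewrite /discnorm; case: ifP => // _; exact: rnorm_ge0. Qed.

Lemma discnormE (X : normedModType (CC R)) (f : CC R -> X) z : disc z -> discnorm f z = rnorm (f z).
Proof. by rewrite /disc /discnorm /= => ->. Qed.

Lemma measurable_discnorm (X : normedModType (CC R)) (f : CC R -> X) : analytic f ->
  measurable_fun setT (fun p : RM * RM => discnorm f (toC p)).
Proof.
move=> af mD; apply: (measurability _ (RGenOInfty.measurableE R)) => //.
move=> _ [_ [a ->] <-]; rewrite setTI.
have [a0|a0] := ltP a 0.
  rewrite (_ : _ @^-1` _ = setT) //; apply/seteqP; split=> // p _.
  by rewrite /= in_itv /= andbT (lt_le_trans a0)// discnorm_ge0.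
apply: open_measurable2 => p; rewrite /= in_itv /= andbT /discnorm.
case: ifP => [dp|_]; last by rewrite ltNge a0.
move=> fa; have hd := derivable_has_cderiv (af _ dp).
pose e := rnorm (f (toC p)) - a.
have e0 : 0 < e by rewrite subr_gt0.
have e20 : 0 < e / 2 by lra.
have [r r0 hr] := has_cderiv_cont hd e20.
pose m := Num.min r (1 - rnorm (toC p)).
have m0 : 0 < m by rewrite lt_min r0 subr_gt0.
exists (m / 2); first by lra.
move=> q q1 q2; rewrite /= in_itv /= andbT.
have := toC_sub_le q1 q2; rewrite lt_min => /andP[h1 h2].
have -> : rnorm (toC q) < 1.
  by have := ler_rnormD (toC q - toC p) (toC p); rewrite subrK; lra.
have := hr _ h1; rewrite (addrC (toC p)) subrK => h3.
have := ler_rnormD (f (toC p) - f (toC q)) (f (toC q)); rewrite subrK.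
by rewrite -rnormN opprB /e in h3; lra.
Qed.

End disc_measurability.

Section stolz_geometry.
Context {R : realType}.
Local Notation RM := (measurableTypeR R).
Local Notation mu := (@lebesgue_measure R).
Implicit Types (z w c : CC R).

Lemma rnorm_rC_ge0 (t : R) : 0 <= t -> rnorm (rC t) = t.
Proof. by move=> t0; rewrite rnorm_rC ger0_norm. Qed.

Definition rCE := (@rCM R, @rCD R, @rCN R, @rC1 R, @rC0 R).

Lemma rC_1B (t : R) : rC (1 - t) = 1 - rC t :> CC R.
Proof. by rewrite rCD rCN rC1. Qed.

(** The discs of centre [t * c] and radius [(1 - t) / 2] have a convex union containing the
    generators. Conversely each consists of convex combinations of [c] with points of the disc of
    radius 1/2, and these lie on diameters of the generating circle. *)
Lemma stolzP z c : rnorm c = 1 ->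
  stolz c z <-> exists2 t : R, 0 <= t <= 1 & rnorm (z - rC t * c) <= (1 - t) / 2.
Proof.
move=> c1; split=> [H|[t /andP[t0 t1] ht]].
  apply: (H [set z | exists2 t : R, 0 <= t <= 1 & rnorm (z - rC t * c) <= (1 - t) / 2]).
    move=> w [/= ->|/= w2].
      by exists 1; rewrite ?ler01 ?lexx// rC1 mul1r subrr rnorm0 subrr mul0r.
    by exists 0; rewrite ?ler01 ?lexx// rC0 mul0r !subr0 w2 mul1r.
  move=> a b t /andP[t0 t1] [u /andP[u0 u1] hu] [v /andP[v0 v1] hv].
  exists (t * u + (1 - t) * v).
    have : 0 <= t * u by rewrite mulr_ge0.
    have : 0 <= (1 - t) * v by rewrite mulr_ge0 ?subr_ge0.
    have : t * u <= t * 1 by rewrite ler_wpM2l.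
    have : (1 - t) * v <= (1 - t) * 1 by rewrite ler_wpM2l ?subr_ge0.
    by move=> *; apply/andP; split; lra.
  have -> : rC t * a + rC (1 - t) * b - rC (t * u + (1 - t) * v) * c =
      rC t * (a - rC u * c) + rC (1 - t) * (b - rC v * c) by rewrite !rCE; ring.
  apply: (le_trans (ler_rnormD _ _)); rewrite !rnormM !rnorm_rC_ge0 ?subr_ge0//.
  have : t * rnorm (a - rC u * c) <= t * ((1 - u) / 2) by rewrite ler_wpM2l.
  have : (1 - t) * rnorm (b - rC v * c) <= (1 - t) * ((1 - v) / 2) by rewrite ler_wpM2l ?subr_ge0.
  lra.
move=> K KH cK; have Kc : K c by apply: KH; left.
have Kh w : rnorm w <= 1 / 2 -> K w.
  move=> hw; have [->|w0] := eqVneq w 0.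
    have -> : 0 = rC (1 / 2) * rC (1 / 2) + rC (1 - 1 / 2) * rC (- (1 / 2)) :> CC R.
      by rewrite -!rCM -rCD -rC0; congr rC; lra.
    apply: cK; first by apply/andP; split; lra.
      by apply: KH; right => /=; rewrite rnorm_rC ger0_norm; lra.
    by apply: KH; right => /=; rewrite rnorm_rC normrN ger0_norm; lra.
  have nw0 : rnorm w != 0 by rewrite rnorm_eq0.
  have nw : 0 < rnorm w by rewrite lt_neqAle eq_sym nw0 rnorm_ge0.
  pose s := 1 / 2 + rnorm w.
  pose u := rC (1 / (2 * rnorm w)) * w.
  have nu : rnorm u = 1 / 2.
    by rewrite rnormM rnorm_rC_ge0 ?divr_ge0 ?mulr_ge0 ?(ltW nw)//; field.
  have -> : w = rC s * u + rC (1 - s) * (- u).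
    have -> : rC s * u + rC (1 - s) * (- u) = rC (2 * s - 1) * u.
      by rewrite (_ : 2 * s - 1 = s - (1 - s)); [rewrite !rCE; ring|ring].
    rewrite /u mulrA -rCM (_ : (2 * s - 1) * (1 / (2 * rnorm w)) = 1) ?rC1 ?mul1r//.
    by rewrite /s; field.
  by apply: cK; [apply/andP; split; rewrite /s; lra|apply: KH; right; rewrite /= nu; lra|
    apply: KH; right; rewrite /= rnormN nu; lra].
have [e|t11] := eqVneq t 1.
  move: ht; rewrite e subrr mul0r rC1 mul1r => h.
  have /eqP : rnorm (z - c) == 0 by rewrite eq_le h rnorm_ge0.
  by move/eqP; rewrite rnorm_eq0 subr_eq0 => /eqP ->.
have t1' : 0 < 1 - t by rewrite subr_gt0 lt_neqAle t11.
pose w := rC (1 - t)^-1 * (z - rC t * c).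
have -> : z = rC t * c + rC (1 - t) * w.
  rewrite /w mulrA -rCM divff ?gt_eqF// rC1 mul1r; ring.
apply: cK => //; first by rewrite t0 t1.
apply: Kh; rewrite rnormM rnorm_rC_ge0 ?invr_ge0 ?(ltW t1')//.
by rewrite mulrC ler_pdivrMr//; lra.
Qed.

Lemma cRe_cconjM_sqr z c (t : R) : rnorm c = 1 ->
  rnorm (z - rC t * c) ^+ 2 = rnorm z ^+ 2 - 2 * t * cRe (z * cconj c) + t ^+ 2.
Proof.
move=> c1; have : rnorm c ^+ 2 = 1 by rewrite c1 expr1n.
rewrite !rnorm_sqr !ccE cRe_cconj cIm_cconj /rC /cRe /cIm /=.
move: (complex.Re c) (complex.Im c) (complex.Re z) (complex.Im z) => a b x y h.
have -> : (x - (t * a - 0 * b)) ^+ 2 + (y - (t * b + 0 * a)) ^+ 2 =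
  x ^+ 2 + y ^+ 2 - 2 * t * (x * a - y * - b) + t ^+ 2 * (a ^+ 2 + b ^+ 2) by ring.
by rewrite h mulr1.
Qed.

Lemma stolz_criterion z c : rnorm c = 1 -> stolz c z <->
  rnorm z <= 1 / 2 \/ (1 / 4 <= cRe (z * cconj c) <= 1 /\
    3 / 4 * (rnorm z ^+ 2 - 1 / 4) <= (cRe (z * cconj c) - 1 / 4) ^+ 2).
Proof.
move=> c1; have z0 := rnorm_ge0 z.
have E (t : R) : 0 <= t <= 1 -> (rnorm (z - rC t * c) <= (1 - t) / 2) =
   (rnorm z ^+ 2 - 2 * t * cRe (z * cconj c) + t ^+ 2 <= ((1 - t) / 2) ^+ 2).
  move=> /andP[t0 t1]; rewrite -cRe_cconjM_sqr// ler_sqr ?nnegrE ?rnorm_ge0//; lra.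
set r := cRe (z * cconj c) in E *.
have rz : r <= rnorm z.
  by apply: (le_trans (ler_norm _)); apply: (le_trans (cRe_le _)); rewrite rnormM rnorm_cconj c1 mulr1.
rewrite stolzP//; split=> [[t t01]|].
  rewrite E// => h; have /andP[t0 t1] := t01.
  have [?|zh] := leP (rnorm z) (1 / 2); [by left|right].
  have zh2 : (1 / 2) ^+ 2 < rnorm z ^+ 2 by rewrite ltr_sqr ?nnegrE//; lra.
  have h' : 3 / 4 * (rnorm z ^+ 2 - 1 / 4) <= (r - 1 / 4) ^+ 2 - (3 / 4 * t - (r - 1 / 4)) ^+ 2 by lra.
  have tr : 0 < t * (2 * r - 1 / 2 - 3 / 4 * t) by lra.
  have t0' : 0 < t by rewrite lt_neqAle t0 andbT; apply/eqP => t00; move: tr; rewrite -t00 mul0r ltxx.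
  have r4 : 1 / 4 <= r by move: tr; rewrite pmulr_rgt0//; lra.
  have := E _ t01; rewrite h => /idP h2.
  have : rnorm z <= 1.
    have := ler_rnormD (z - rC t * c) (rC t * c); rewrite subrK rnormM c1 mulr1 rnorm_rC_ge0//; lra.
  split; first by apply/andP; split; lra.
  have := sqr_ge0 (3 / 4 * t - (r - 1 / 4)); lra.
case=> [h|[/andP[r0 r1] h]].
  by exists 0; [rewrite lexx ler01|rewrite rC0 mul0r !subr0].
have t01 : 0 <= (4 * r - 1) / 3 <= 1 by apply/andP; split; lra.
exists ((4 * r - 1) / 3) => //; rewrite E//; lra.
Qed.

Lemma stolz_norm z c : rnorm c = 1 -> stolz c z -> rnorm z <= 1.
Proof.
move=> c1 /(stolzP _ c1)[t /andP[t0 t1] h].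
have := ler_rnormD (z - rC t * c) (rC t * c); rewrite subrK rnormM c1 mulr1 rnorm_rC_ge0//; lra.
Qed.

(** With [t] from [stolzP], [1 - rnorm z >= (1 - t) / 2] while
    [rnorm (c - z) <= 3 * (1 - t) / 2]. *)
Lemma stolz_dist z c : rnorm c = 1 -> stolz c z -> rnorm (c - z) <= 3 * (1 - rnorm z).
Proof.
move=> c1 /(stolzP _ c1)[t /andP[t0 t1] h].
have h1 := ler_rnormD (z - rC t * c) (rC t * c); rewrite subrK rnormM c1 mulr1 rnorm_rC_ge0// in h1.
have := ler_rnormD (rC t * c - z) (c - rC t * c).
rewrite [X in rnorm X <= _ -> _](_ : _ = c - z); last by ring.
have -> : c - rC t * c = rC (1 - t) * c by rewrite rC_1B; ring.
rewrite (rnormM (rC (1 - t))) c1 mulr1 rnorm_rC_ge0 ?subr_ge0//.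
rewrite -(rnormN (z - _)) opprB in h h1; lra.
Qed.

Lemma stolz_near z (a x : R) : rnorm z <= 1 -> z = rC (rnorm z) * zeta a ->
  rnorm (zeta x - zeta a) <= (1 - rnorm z) / 2 -> stolz (zeta x) z.
Proof.
move=> z1 ez h; apply/(stolzP _ (rnorm_zeta x)); exists (rnorm z); first by rewrite rnorm_ge0.
rewrite {1}ez -mulrBr rnormM rnorm_rC_ge0 ?rnorm_ge0// -(rnormN (zeta a - _)) opprB.
apply: (le_trans _ h); rewrite -[leRHS]mul1r ler_wpM2r ?rnorm_ge0//.
Qed.

(** The same [t] serves: the distance from [z] to [t * c'] decreases as [cRe (z * cconj c')]
    grows. *)
Lemma stolz_closer z c c' : rnorm c = 1 -> rnorm c' = 1 ->
  cRe (z * cconj c) <= cRe (z * cconj c') -> stolz c z -> stolz c' z.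
Proof.
move=> c1 c1' h /(stolzP _ c1)[t /andP[t0 t1] ht]; apply/(stolzP _ c1'); exists t; first by rewrite t0 t1.
have h1 : 0 <= (1 - t) / 2 by lra.
rewrite -ler_sqr ?nnegrE ?rnorm_ge0// cRe_cconjM_sqr//.
rewrite -ler_sqr ?nnegrE ?rnorm_ge0// cRe_cconjM_sqr// in ht.
have : t * cRe (z * cconj c) <= t * cRe (z * cconj c') by rewrite ler_wpM2l.
lra.
Qed.

(** With the vertex moved to 0, the discs of [stolzP] have radius half the distance of their centres
    from the vertex, so they lie in a cone of half-angle [pi / 6]. *)
Lemma stolz_cone z c : rnorm c = 1 -> stolz c z ->
  3 * cIm (1 - z * cconj c) ^+ 2 <= cRe (1 - z * cconj c) ^+ 2.
Proof.
move=> c1 /(stolzP _ c1)[t /andP[t0 t1] ht].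
have e : (1 - rC t) - (1 - z * cconj c) = (z - rC t * c) * cconj c.
  rewrite mulrBl -mulrA mul_cconj c1 expr1n rC1 mulr1; ring.
have : rnorm ((1 - rC t) - (1 - z * cconj c)) <= (1 - t) / 2 by rewrite e rnormM rnorm_cconj c1 mulr1.
have h1 : 0 <= (1 - t) / 2 by lra.
rewrite -ler_sqr ?nnegrE ?rnorm_ge0// rnorm_sqr.
move: (1 - z * cconj c) => w; rewrite -rC_1B !ccE /rC /cRe /cIm /=.
move: (complex.Re w) (complex.Im w) => x y.
have := sqr_ge0 (x * 4 - 3 * (1 - t)); lra.
Qed.

End stolz_geometry.

Section nonmeasurable_comparison.

(* No measurability of the domains: tents are not known to be measurable a priori. *)
Lemma ge0_integral_le_patch (R : realType) d (T : measurableType d) (m : {measure set T -> \bar R}) (D D' : set T) (f g : T -> \bar R) :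
  (forall x, D x -> 0 <= f x)%E -> (forall x, D' x -> 0 <= g x)%E ->
  (forall x, D x -> D' x /\ f x <= g x)%E ->
  (\int[m]_(x in D) f x <= \int[m]_(x in D') g x)%E.
Proof.
move=> f0 g0 fg; rewrite !ge0_integralE//.
apply: ge_ereal_sup => _ [h hf <-]; apply: ereal_sup_ubound; exists h => // x.
apply: (le_trans (hf x)); rewrite /patch; case: ifPn => [/set_mem /fg[D'x fgx]|_].
  by rewrite mem_set.
by case: ifPn => // /set_mem /g0.
Qed.

Lemma measurable_le_set (R : realType) d (T : measurableType d) (f g : T -> R) :
  measurable_fun setT f -> measurable_fun setT g -> measurable [set x | f x <= g x].
Proof.
move=> mf mg; rewrite [X in measurable X](_ : _ = setT `&` ((fun x => g x - f x) @^-1` `[0, +oo[)).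
  by apply: (measurable_funB mg mf) => //; exact: measurable_itv.
by rewrite setTI; apply/seteqP; split => x; rewrite /= in_itv /= andbT subr_ge0.
Qed.

Lemma measurable_lt_set (R : realType) d (T : measurableType d) (f g : T -> R) :
  measurable_fun setT f -> measurable_fun setT g -> measurable [set x | f x < g x].
Proof.
move=> mf mg; rewrite [X in measurable X](_ : _ = ~` [set x | g x <= f x]).
  by apply: measurableC; exact: measurable_le_set.
by apply/seteqP; split => x /=; rewrite ltNge => /negP.
Qed.

End nonmeasurable_comparison.

Section shadow.
Context {R : realType}.
Local Notation RM := (measurableTypeR R).
Local Notation mu := (@lebesgue_measure R).
Implicit Types (z w c : CC R).

Lemma measurable_stolz2 : measurable [set q : RM * (RM * RM) | stolz (zeta q.1) (toC q.2)].
Proof.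
have mz : cmeas (fun q : RM * (RM * RM) => toC q.2).
  by apply: (cmeas_comp cmeas_toC); exact: measurable_snd.
have mc : cmeas (fun q : RM * (RM * RM) => zeta q.1).
  by apply: cmeas_zeta; apply: (measurableT_comp measurable_RM); exact: measurable_fst.
have [mr _] := cmeasM mz (cmeas_cconj mc).
have mn := measurable_rnorm mz.
have mcst (a : R) : measurable_fun setT (fun _ : RM * (RM * RM) => a) by exact: measurable_cst.
rewrite [X in measurable X](_ : _ = [set q | rnorm (toC q.2) <= 1 / 2] `|`
  ([set q | 1 / 4 <= cRe (toC q.2 * cconj (zeta q.1))] `&`
   [set q | cRe (toC q.2 * cconj (zeta q.1)) <= 1] `&`
   [set q | 3 / 4 * (rnorm (toC q.2) ^+ 2 - 1 / 4) <= (cRe (toC q.2 * cconj (zeta q.1)) - 1 / 4) ^+ 2])).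
  apply: measurableU; first exact: measurable_le_set.
  apply: measurableI; first by apply: measurableI; exact: measurable_le_set.
  apply: measurable_le_set.
    by apply: measurable_funM => //; apply: measurable_funB => //; exact: measurable_funX.
  by apply: measurable_funX; exact: measurable_funB.
apply/seteqP; split => q /=; rewrite (stolz_criterion _ (rnorm_zeta _)).
  by case=> [?|[/andP[? ?] ?]]; [left|right].
by case=> [?|[[h1 h2] h3]]; [left|right; split; rewrite ?h1].
Qed.

Definition shadow z : set RM := I01 `&` [set x : RM | stolz (zeta x) z].

Lemma toC_cRe_cIm z : toC (cRe z, cIm z) = z.
Proof. by case: z. Qed.

Lemma measurable_shadow z : measurable (shadow z).
Proof.
apply: measurableI; first exact: mI01.
rewrite [X in measurable X](_ : _ = setT `&` ((fun x : RM => (x, (cRe z, cIm z))) @^-1` [set q : RM * (RM * RM) | stolz (zeta q.1) (toC q.2)])).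
  have m : measurable_fun setT (fun x : RM => (x, (cRe z, cIm z)) : RM * (RM * RM)).
    by apply: measurable_fun_pair; [exact: measurable_id|exact: measurable_cst].
  by apply: m => //; exact: measurable_stolz2.
by rewrite setTI; apply/seteqP; split => x /=; rewrite toC_cRe_cIm.
Qed.

Lemma abs_sin_le (x : R) : `|sin x| <= `|x|.
Proof.
have pos (t : R) : 0 < t -> `|sin t| <= t.
  move=> t0; have csin : {within `[0, t], continuous (@sin R)}.
    by apply: continuous_subspaceT; exact: continuous_sin.
  have [u _ e] := @MVT R sin cos 0 t t0 (fun x _ => is_derive_sin x) csin.
  move: e; rewrite sin0 !subr0 => ->; rewrite normrM (gtr0_norm t0).
  by rewrite -[leRHS]mul1r ler_wpM2r ?(ltW t0)// cos_max.
have [x0|x0|->] := ltgtP x 0; last by rewrite sin0 normr0.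
  by rewrite -normrN -sinN -(normrN x) (@gtr0_norm _ (- x)) ?oppr_gt0// pos ?oppr_gt0.
by rewrite (gtr0_norm x0) pos.
Qed.

Lemma zeta_lip (x y : R) : rnorm (zeta x - zeta y) <= 8 * `|x - y|.
Proof.
rewrite zeta_sub chord_eq.
have := abs_sin_le (pi * (x - y)); rewrite normrM (gtr0_norm (@pi_gt0 R)) => h.
have p4 : @pi R <= 4 by have := @pihalf_lt2 R; lra.
have : pi * `|x - y| <= 4 * `|x - y| by rewrite ler_wpM2r.
lra.
Qed.

Lemma zeta_inj (x y : R) : 0 <= x < 1 -> 0 <= y < 1 -> zeta x = zeta y -> x = y.
Proof.
move=> /andP[x0 x1] /andP[y0 y1] e.
have [||m + h] := @chord_ge R x y; rewrite ?/I01 /= ?in_itv /= ?x0 ?y0 ?ltW//.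
rewrite e subrr rnorm0 normr_le0 subr_eq0 in h.
by move/eqP: h => h; rewrite !inE => /or3P[] /eqP mE; lra.
Qed.

Lemma polar z : exists2 a : R, I01 a & z = rC (rnorm z) * zeta a.
Proof.
have [->|z0] := eqVneq z 0.
  by exists 0; [rewrite /I01 /= in_itv /= lexx ler01|rewrite rnorm0 rC0 mul0r].
have nz0 : rnorm z != 0 by rewrite rnorm_eq0.
have nz : 0 < rnorm z by rewrite lt_neqAle eq_sym nz0 rnorm_ge0.
have [|a /andP[a0 a1] e] := @zeta_surj R (rC (rnorm z)^-1 * z).
  by rewrite rnormM rnorm_rC_ge0 ?invr_ge0 ?(ltW nz)// mulVf.
exists a; first by rewrite /I01 /= in_itv /= a0 ltW.
by rewrite -e mulrA -rCM divff// rC1 mul1r.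
Qed.

Lemma shadow_measure_ge z : rnorm z < 1 -> (((1 - rnorm z) / 16)%:E <= mu (shadow z))%E.
Proof.
move=> z1; have n0 := rnorm_ge0 z; have [a + e] := polar z; rewrite /I01 /= in_itv /= => /andP[a0 a1].
(* By [zeta_lip] a parameter shift of at most [rho] moves the point by at most [(1 - rnorm z) / 2],
   as [stolz_near] asks. *)
pose rho := (1 - rnorm z) / 16.
have sub (J : set R) : measurable (J : set RM) -> (forall x, J x -> 0 <= x <= 1 /\ `|x - a| <= rho) -> (mu J <= mu (shadow z))%E.
  move=> mJ h; apply: le_measure; rewrite ?inE//; first exact: measurable_shadow.
  move=> x /h[h1 h2]; split; first by rewrite /I01 /= in_itv.
  apply: (stolz_near (ltW z1) e); apply: (le_trans (zeta_lip _ _)); rewrite /rho in h2; lra.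
have r0 : 0 < rho by rewrite /rho; lra.
have r1 : rho <= 1 / 16 by rewrite /rho; lra.
(* Only one side of the parameter [a] is used, the one that does not leave [0, 1]. *)
have [h|h] := leP a (1 / 2).
  apply: le_trans (sub `[a, a + rho]%classic _ _) => //=.
    by rewrite lebesgue_measure_itv /= lte_fin ltrDl r0 -EFinB lee_fin -/rho; lra.
  by move=> x; rewrite in_itv /= => /andP[h1 h2]; split; rewrite ?ler_norml; apply/andP; split; lra.
apply: le_trans (sub `[a - rho, a]%classic _ _) => //=.
  by rewrite lebesgue_measure_itv /= lte_fin gtrBl r0 -EFinB lee_fin -/rho; lra.
by move=> x; rewrite in_itv /= => /andP[h1 h2]; split; rewrite ?ler_norml; apply/andP; split; lra.
Qed.

Lemma arc_measure_le (y : R) (rho : R) : I01 y -> 0 <= rho ->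
  (mu (I01 `&` [set x : RM | (rnorm (zeta x - zeta y) <= rho)%R]) <= (6 * rho)%:E)%E.
Proof.
move=> Iy r0.
pose J m : set RM := `[y + m - rho, y + m + rho]%classic.
have mJ m : mu (J m) = (2 * rho)%:E.
  rewrite lebesgue_measure_itv /= lte_fin; case: ltP => h; rewrite -?EFinB; congr (_%:E); lra.
apply: (@le_trans _ _ (mu (J (-1) `|` J 0 `|` J 1))).
  apply: le_measure; rewrite ?inE.
  - apply: measurableI; first exact: mI01.
    apply: measurable_le_set; last exact: measurable_cst.
    by apply: measurable_rnorm; apply: cmeasB; [exact: cmeas_zetaR|exact: cmeas_cst].
  - by apply: measurableU; [apply: measurableU|]; exact: measurable_itv.
  - move=> x [Ix /= hx]; have [m hm h] := chord_ge Ix Iy.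
    have hJ m' : m' = - m -> J m' x.
      move=> ->; have := le_trans h hx; rewrite /J /= in_itv /= ler_norml => /andP[h1 h2].
      by apply/andP; split; lra.
    by move: hm hJ; rewrite !inE => /or3P[] /eqP -> hJ; [right|left; right|left; left]; apply: hJ; rewrite ?opprK ?oppr0.
have mJ' m : measurable (J m) by exact: measurable_itv.
have u1 : (mu (J (-1)%R `|` J 0%R `|` J 1%R) <= mu (J (-1)%R `|` J 0%R) + mu (J 1%R))%E.
  by apply: measureU2 => //; exact: measurableU.
have u2 : (mu (J (-1)%R `|` J 0%R) <= mu (J (-1)%R) + mu (J 0%R))%E by exact: measureU2.
apply: (le_trans u1); apply: (@le_trans _ _ (((2 * rho) + (2 * rho))%:E + (2 * rho)%:E)%E).
  by rewrite !mJ in u2 *; rewrite leeD2r// EFinD.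
by rewrite -EFinD lee_fin; lra.
Qed.

End shadow.

(** * Outer functions *)

Section integrability.
Context {R : realType}.
Local Notation RM := (measurableTypeR R).
Local Notation mu := (@lebesgue_measure R).

Lemma itg_ge0_lty (f : R -> R) : measurable_fun I01 (f : RM -> R) -> (forall x, I01 x -> 0 <= f x) ->
  (\int[mu]_(x in I01) (f x)%:E < +oo)%E -> itg f.
Proof.
move=> mf f0 fi; apply/integrableP; split; first exact/measurable_EFinP.
have -> // : (\int[mu]_(x in I01) `|(EFin \o f) x| = \int[mu]_(x in I01) (f x)%:E)%E.
by apply: eq_integral => x /set_mem Ix; rewrite /= ger0_norm ?f0.
Qed.

Lemma itg_of_sqr (f : R -> R) : measurable_fun I01 (f : RM -> R) -> itg (fun x => f x ^+ 2) -> itg f.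
Proof.
move=> mf f2; apply: (itg_le mf _ (itgD (itg_cst 1) f2)) => x _ /=.
have [h|h] := leP `|f x| 1; first by rewrite (le_trans h)// lerDl sqr_ge0.
rewrite -(real_normK (num_real (f x))); move: (`|f x|) h => a a1; nra.
Qed.

(** Meant for comparisons with [Mc v], which may be infinite on a null set and is then falsified by
    [fine]. *)
Lemma Int_ae_le (B : set RM) f g : itg f -> itg g -> measurable B -> mu B = 0%E ->
  (forall x, I01 x -> ~ B x -> f x <= g x) -> Int f <= Int g.
Proof.
move=> i1 i2 mB B0 h; rewrite -lee_fin !Int_EFin//.
rewrite (negligible_integral mB _ i1 B0); last exact: mI01.
rewrite (negligible_integral mB _ i2 B0); last exact: mI01.
have mD : measurable (I01 `\` B) by apply: measurableD => //; exact: mI01.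
apply: le_integral => //.
- by apply: integrableS (@subDsetl _ _ _) i1 => //; exact: mI01.
- by apply: integrableS (@subDsetl _ _ _) i2 => //; exact: mI01.
- by move=> x /set_mem[Ix nB]; rewrite lee_fin; exact: h.
Qed.

End integrability.

Section outer_of_maximal_function.
Context {R : realType}.
Local Notation RM := (measurableTypeR R).
Local Notation mu := (@lebesgue_measure R).
Variables (v : R -> R) (tau eta : R).
Hypothesis mv : measurable_fun setT (v : RM -> R).
Hypothesis tau0 : 0 < tau.
Hypothesis vtau : forall x, tau <= v x.
Hypothesis iv2 : itg (fun x => v x ^+ 2).
Hypothesis eta0 : 0 < eta.

Let v0 x : 0 <= v x. Proof. exact: le_trans (ltW tau0) (vtau x). Qed.

Let iv : itg v. Proof. by apply: itg_of_sqr iv2; exact: measurable_funTS. Qed.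

(** [fine] sends +oo to 0, and the maximum with [tau] restores a positive lower bound; the points
    where [Mc v] is infinite form the null set [Bad]. *)
Definition trunc_Mc (c : CC R) : R := Num.max (fine (Mc v c)) tau.
Local Notation m := (fun x => trunc_Mc (zeta x)).

Lemma trunc_Mc_ge c : tau <= trunc_Mc c.
Proof. by rewrite le_max lexx orbT. Qed.

Let m0 c : 0 < trunc_Mc c. Proof. exact: lt_le_trans tau0 (trunc_Mc_ge c). Qed.

Lemma measurable_trunc_Mc : measurable_fun setT (m : RM -> R).
Proof.
apply: measurable_maxr; last exact: measurable_cst.
by apply: measurableT_comp; [exact: fine_measurable|exact: measurable_Mc].
Qed.

Lemma trunc_Mc_sqr c : ((trunc_Mc c ^+ 2)%:E <= Mc v c * Mc v c + (tau ^+ 2)%:E)%E.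
Proof.
rewrite /trunc_Mc; have := Mc_ge0 c v0; case: (Mc v c) => [r| |]//= r0.
  rewrite -EFinM -EFinD lee_fin -expr2; rewrite lee_fin in r0.
  by case: (leP r tau) => _; [rewrite lerDr|rewrite lerDl]; rewrite sqr_ge0.
by rewrite mulyy addye// leey.
Qed.

Let int_sqr : exists2 C : R, 0 < C & forall w : R -> R,
  measurable_fun setT (w : RM -> R) -> (forall x, 0 <= w x) -> itg w -> itg (fun x => w x ^+ 2) ->
  (\int[mu]_(y in I01) (Mc w (zeta y) * Mc w (zeta y)) <= (C * Int (fun x => (w x ^+ 2)%R))%:E)%E.
Proof. exact: Mc_L2. Qed.

Lemma trunc_Mc_L2 (C : R) :
  (\int[mu]_(y in I01) (Mc v (zeta y) * Mc v (zeta y)) <= (C * Int (fun x => (v x ^+ 2)%R))%:E)%E ->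
  (\int[mu]_(x in I01) (trunc_Mc (zeta x) ^+ 2)%:E <= (C * Int (fun x => (v x ^+ 2)%R) + tau ^+ 2)%:E)%E.
Proof.
move=> HC; have mM : measurable_fun I01 (fun y : RM => Mc v (zeta y) * Mc v (zeta y))%E.
  by apply: measurable_funTS; apply: emeasurable_funM; exact: measurable_Mc.
have mt2 : measurable_fun I01 (cst (tau ^+ 2)%:E : RM -> \bar R) by exact: measurable_cst.
apply: (@le_trans _ _ (\int[mu]_(x in I01) (Mc v (zeta x) * Mc v (zeta x) + (tau ^+ 2)%:E))%E).
  apply: integral_le; first exact: mI01.
  - apply/measurable_EFinP; apply: measurable_funTS; apply: measurable_funX; exact: measurable_trunc_Mc.
  - exact: emeasurable_funD.
  - by move=> x _; rewrite lee_fin sqr_ge0.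
  - by move=> x _; exact: trunc_Mc_sqr.
rewrite ge0_integralD//=; first last.
- by move=> x _; rewrite lee_fin sqr_ge0.
- by move=> x _; rewrite mule_ge0 ?Mc_ge0.
- exact: mI01.
rewrite EFinD leeD//.
have -> : (\int[mu]_(x in I01) (tau ^+ 2)%:E = (tau ^+ 2)%:E * mu I01)%E by exact: (integral_cst mu mI01).
by rewrite muI01 mule1.
Qed.

Lemma itg_trunc_Mc_sqr : itg (fun x => trunc_Mc (zeta x) ^+ 2).
Proof.
have [C C0 /(_ _ mv v0 iv iv2) H] := int_sqr.
apply: itg_ge0_lty.
- by apply: measurable_funTS; apply: measurable_funX; exact: measurable_trunc_Mc.
- by move=> x _; rewrite sqr_ge0.
- exact: le_lt_trans (trunc_Mc_L2 H) (ltry _).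
Qed.

Let Bad : set RM := I01 `&` [set x : RM | Mc v (zeta x) = +oo%E].

Let mBad : measurable Bad.
Proof.
apply: measurableI; first exact: mI01.
rewrite [X in measurable X](_ : _ = setT `&` ((fun x : RM => Mc v (zeta x)) @^-1` [set +oo%E])); last by rewrite setTI.
exact: (measurable_Mc mv v0).
Qed.

Let Bad0 : mu Bad = 0%E.
Proof.
have [C C0 /(_ _ mv v0 iv iv2) H] := int_sqr.
have mM : measurable_fun I01 (fun y : RM => Mc v (zeta y) * Mc v (zeta y))%E.
  by apply: measurable_funTS; apply: emeasurable_funM; exact: measurable_Mc.
have iM : mu.-integrable I01 (fun y : RM => Mc v (zeta y) * Mc v (zeta y))%E.
  apply/integrableP; split=> //; apply: le_lt_trans (ltry _); apply: le_trans H.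
  rewrite le_eqVlt; apply/orP; left; apply/eqP; apply: eq_integral => x _.
  by rewrite gee0_abs// mule_ge0 ?Mc_ge0.
have [N [mN N0 hN]] := integrable_ae mI01 iM.
apply/eqP; rewrite eq_le measure_ge0 andbT -N0.
apply: le_measure; rewrite ?inE// => x [Ix /= e]; apply: hN => /= h.
by have := h Ix; rewrite e mulyy.
Qed.

Lemma Mc_le_trunc x : I01 x -> ~ Bad x -> (Mc v (zeta x) <= (trunc_Mc (zeta x))%:E)%E.
Proof.
move=> Ix nB; have : Mc v (zeta x) != +oo%E by apply/eqP => h; apply: nB.
rewrite /trunc_Mc; have := Mc_ge0 (zeta x) v0; case: (Mc v (zeta x)) => [r| |]//= r0 _.
by rewrite lee_fin le_max lexx.
Qed.

Definition out_weight (c : CC R) : R := powR (trunc_Mc c) eta^-1.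
Definition out_fun (w : CC R) : CC R := cexp (herg (fun x => ln (out_weight (zeta x))) w).

Let l x := ln (out_weight (zeta x)).

Let lE x : l x = eta^-1 * ln (trunc_Mc (zeta x)).
Proof. by rewrite /l /out_weight ln_powR. Qed.

Lemma itg_ln_trunc : itg (fun x => ln (trunc_Mc (zeta x))).
Proof.
have im : itg (fun x => trunc_Mc (zeta x)).
  by apply: itg_of_sqr itg_trunc_Mc_sqr; apply: measurable_funTS; exact: measurable_trunc_Mc.
apply: (itg_le _ _ (itgD (itg_cst `|ln tau|) im)).
  by apply: measurable_funTS; apply: measurableT_comp; [exact: measurable_ln|exact: measurable_trunc_Mc].
move=> x _; have h1 : ln (trunc_Mc (zeta x)) < trunc_Mc (zeta x) by exact: ln_sublinear.
have h2 : ln tau <= ln (trunc_Mc (zeta x)) by rewrite ler_ln ?posrE// trunc_Mc_ge.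
have h3 := ler_norm (- ln tau); rewrite normrN in h3; have h4 := m0 (zeta x); have h5 := normr_ge0 (ln tau).
by rewrite ler_norml; apply/andP; split; lra.
Qed.

Let il : itg l.
Proof. by apply: eq_itg (itgZ eta^-1 itg_ln_trunc) => x _; rewrite lE. Qed.

Lemma outer_out_fun : outer out_fun.
Proof.
exists 1, out_weight; split; first by rewrite rnorm1.
split; first by move=> x; exact: powR_ge0.
split.
  exists set0; split=> // x [_ /=]; have := powR_gt0 eta^-1 (m0 (zeta x)); rewrite -/(out_weight _) => h e.
  by move: h; rewrite e ltxx.
by split=> // w _; rewrite mul1r.
Qed.

Lemma rnorm_out_fun w : rnorm w < 1 -> rnorm (out_fun w) = expR (Int (fun x => poisson w x * l x)).
Proof. by move=> w1; rewrite /out_fun rnorm_cexp cRe_herg. Qed.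

Lemma has_cderiv_out_fun w : rnorm w < 1 -> exists d, has_cderiv out_fun w d.
Proof.
move=> w1; have [d hd] := has_cderiv_herg il w1.
by eexists; apply: has_cderiv_comp hd (has_cderiv_cexp _).
Qed.

Lemma poisson_sym (r x y : R) : poisson (rC r * zeta x) y = poisson (rC r * zeta y) x.
Proof.
rewrite /poisson !rnormM !rnorm_zeta; congr (_ / _).
rewrite !cRe_cconjM_sqr ?rnorm_zeta//; congr (_ - _ * _ + _).
by rewrite !ccE !cRe_cconj !cIm_cconj; ring.
Qed.

Let measurable_poisson2 (r : R) : measurable_fun setT (fun q : RM * RM => poisson (rC r * zeta q.1) q.2).
Proof.
have mw : cmeas (fun q : RM * RM => rC r * zeta q.1).
  by apply: cmeasM; [exact: cmeas_cst|apply: (cmeas_comp cmeas_zetaR); exact: measurable_fst].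
have mz : cmeas (fun q : RM * RM => zeta q.2).
  by apply: (cmeas_comp cmeas_zetaR); exact: measurable_snd.
rewrite (_ : (fun q => _) = fun q : RM * RM =>
    (1 - rnorm (rC r * zeta q.1) ^+ 2) * powR (rnorm (zeta q.2 - rC r * zeta q.1) ^+ 2) (-1)); last first.
  by apply/funext => q; rewrite powR_inv1 ?sqr_ge0.
apply: measurable_funM.
  by apply: measurable_funB; [exact: measurable_cst|apply: measurable_funX; exact: measurable_rnorm].
apply: (measurableT_comp (measurable_powR _)); apply: measurable_funX.
by apply: measurable_rnorm; exact: cmeasB.
Qed.

(** By Jensen the p-th power of the modulus is at most the Poisson integral of the square of
    [trunc_Mc], because [p = 2 * eta]. In the mean over the circle of radius [r], Tonelli and the
    symmetry [poisson_sym] integrate the kernel to 1. *)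
Lemma Hp_out_fun (p r : R) : p = 2 * eta -> 0 < r < 1 ->
  (arc_int (fun x => (powR (rnorm (out_fun (rC r * zeta x))) p)%:E) <=
   \int[mu]_(x in I01) (trunc_Mc (zeta x) ^+ 2)%:E)%E.
Proof.
move=> pe /andP[r0 r1].
have w1 x : rnorm (rC r * zeta x) < 1 by rewrite rnormM rnorm_zeta mulr1 rnorm_rC_ge0 ?(ltW r0).
have pw x y : 0 <= poisson (rC r * zeta x) y by rewrite ltW// poisson_gt0.
have e2 y : expR (p * l y) = trunc_Mc (zeta y) ^+ 2.
  rewrite lE pe (_ : 2 * eta * (eta^-1 * ln (trunc_Mc (zeta y))) = ln (trunc_Mc (zeta y)) *+ 2).
    by rewrite mulr2n expRD lnK ?posrE.
  by rewrite mulr2n; field; rewrite gt_eqF.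
have key x : ((powR (rnorm (out_fun (rC r * zeta x))) p)%:E <=
    \int[mu]_(y in I01) (poisson (rC r * zeta x) y * trunc_Mc (zeta y) ^+ 2)%:E)%E.
  rewrite rnorm_out_fun// -expRM mulrC -IntZ; last exact: itg_poisson.
  have := @jensen_exp R (poisson (rC r * zeta x)) (fun y => p * l y) (itg_poisson1 (w1 x)) (fun y _ => pw x y) (Int_poisson (w1 x)).
  have i1 := itg_poisson (w1 x) (itgZ p il).
  have i2 : itg (fun y => poisson (rC r * zeta x) y * expR (p * l y)).
    apply: itg_poisson => //; apply: eq_itg itg_trunc_Mc_sqr => y _; by rewrite e2.
  move=> /(_ i1 i2).
  rewrite (_ : (fun y => poisson (rC r * zeta x) y * (p * l y)) = (fun y => p * (poisson (rC r * zeta x) y * l y))); last first.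
    by apply/funext => y; ring.
  rewrite -lee_fin (Int_EFin i2) => /le_trans; apply.
  by rewrite le_eqVlt; apply/orP; left; apply/eqP; apply: eq_integral => y _; rewrite e2.
have mk : measurable_fun setT (fun q : RM * RM => (poisson (rC r * zeta q.1) q.2 * trunc_Mc (zeta q.2) ^+ 2)%:E).
  apply/measurable_EFinP; apply: measurable_funM => //; apply: measurable_funX.
  by apply: (measurableT_comp measurable_trunc_Mc); exact: measurable_snd.
have k0 x y : (0 <= (poisson (rC r * zeta x) y * trunc_Mc (zeta y) ^+ 2)%:E)%E.
  by rewrite lee_fin mulr_ge0// sqr_ge0.
apply: (@le_trans _ _ (\int[mu]_(x in I01) \int[mu]_(y in I01) (poisson (rC r * zeta x) y * trunc_Mc (zeta y) ^+ 2)%:E)%E).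
  by apply: ge0_integral_le_patch => // x _; [rewrite lee_fin powR_ge0|exact: integral_ge0].
rewrite (@tonelli R _ _ RM RM mu mu I01 I01 (fun x y => (poisson (rC r * zeta x) y * trunc_Mc (zeta y) ^+ 2)%:E) mI01 mI01 mk k0).
rewrite le_eqVlt; apply/orP; left; apply/eqP; apply: eq_integral => y _.
have -> : (fun x => (poisson (rC r * zeta x) y * trunc_Mc (zeta y) ^+ 2)%:E) = (fun x => (trunc_Mc (zeta y) ^+ 2 * poisson (rC r * zeta y) x)%:E).
  by apply/funext => x; rewrite poisson_sym mulrC.
by rewrite -(Int_EFin (itgZ _ (itg_poisson1 (w1 y)))) IntZ ?Int_poisson ?mulr1//; exact: itg_poisson1.
Qed.

Let Lam z := Int (fun x => v x * \1_(shadow z) x).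

Let iLam z : itg (fun x => v x * \1_(shadow z) x).
Proof. by have [] := itg_trunc mv (measurable_shadow z) iv. Qed.

Let Lam_gt0 z : rnorm z < 1 -> 0 < Lam z.
Proof.
move=> z1; have h : 0 < tau * ((1 - rnorm z) / 16) by rewrite mulr_gt0// divr_gt0// subr_gt0.
apply: (lt_le_trans h); rewrite -lee_fin Int_EFin//.
apply: (@le_trans _ _ (tau%:E * mu (shadow z))%E).
  by rewrite EFinM lee_wpmul2l// ?lee_fin ?(ltW tau0)// shadow_measure_ge.
rewrite -integral_cst; last exact: measurable_shadow.
apply: ge0_integral_le_patch => x /=.
- by move=> _; rewrite lee_fin ltW.
- by move=> _; rewrite lee_fin mulr_ge0.
- by move=> sx; split; [case: sx|rewrite indicE mem_set// mulr1 lee_fin].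
Qed.

(** All boundary points that see [z] lie within [3 * (1 - rnorm z) <= 3 * D] of it, hence within
    [4 * D] of [zeta y]; for [2 ^+ n * D] in [1, 2) they lie in [near_arc n]. *)
Let Lam_le_Mc z y : rnorm z < 1 -> ((Lam z / rnorm (zeta y - z))%:E <= Mc v (zeta y))%E.
Proof.
move=> z1; set D := rnorm (zeta y - z).
have D0 : 0 < D by rewrite lt_neqAle rnorm_ge0 andbT eq_sym rnorm_eq0 zeta_sub_neq0.
have D2 : D < 2.
  by apply: (le_lt_trans (ler_rnormD _ _)); rewrite rnormN rnorm_zeta; lra.
have D1 : 1 - rnorm z <= D by have := ler_rnormD (zeta y - z) z; rewrite subrK rnorm_zeta /D; lra.
have [n n1 n2] : exists2 n : nat, 1 <= 2 ^+ n * D & 2 ^+ n * D < 2.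
  have ex : exists n : nat, 1 <= 2 ^+ n * D.
    by have [n hn] := pow2_big (1 / D); exists n; rewrite -ler_pdivrMr// ltW.
  case: (ex_minnP ex) => -[|n] h1 hmin; first by exists 0%N => //; rewrite mul1r.
  exists n.+1 => //; rewrite exprS -mulrA.
  have : ~ (1 <= 2 ^+ n * D) by move=> /hmin; rewrite ltnn.
  by move/negP; rewrite -ltNge; lra.
have hL : ((Lam z)%:E <= \int[mu]_(x in I01 `&` near_arc n (zeta y)) (v x)%:E)%E.
  rewrite Int_EFin// integral_mkcondr; apply: ge0_integral_le_patch => x Ix.
  - by rewrite lee_fin mulr_ge0.
  - by rewrite /patch; case: ifP; rewrite // lee_fin.
  split=> //; rewrite /patch indicE; case: (boolP (x \in shadow z)) => [/set_mem[_ /= sx]|_]; last first.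
    by rewrite mulr0; case: ifP; rewrite ?lee_fin.
  rewrite mulr1 mem_set//= /near_arc /=.
  have := stolz_dist (rnorm_zeta _) sx.
  have := ler_rnormD (zeta x - z) (z - zeta y); rewrite addrA subrK -(rnormN (z - _)) opprB -/D => h1 h2.
  apply: (@le_lt_trans _ _ (4 * D * 2 ^+ n)); last by lra.
  by rewrite ler_wpM2r ?exprn_ge0//; lra.
apply: le_trans (Mc_ge n v (zeta y)).
apply: (@le_trans _ _ ((2 ^+ n)%:E * (Lam z)%:E)%E); last by rewrite lee_wpmul2l// lee_fin exprn_ge0.
by rewrite -EFinM lee_fin ler_pdivrMr//; have := Lam_gt0 z1; nra.
Qed.

(** [Lam_le_Mc] bounds the logarithm of [trunc_Mc] below by [ln (Lam z) - ln (D y)]. The Poisson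
    integral of [- ln (D y)] is estimated by [log_subharmonic] for [k w = (1 - cconj z * w)^-1],
    which has modulus [(D y)^-1] on the circle and the value [(1 - rnorm z ^+ 2)^-1] at [z]. *)
Lemma out_fun_lower z : rnorm z < 1 ->
  Int (fun x => v x * \1_(shadow z) x) / (2 * (1 - rnorm z)) <= powR (rnorm (out_fun z)) eta.
Proof.
move=> z1; rewrite -/(Lam z); have n0 := rnorm_ge0 z.
pose D y := rnorm (zeta y - z).
have D0 y : 0 < D y by rewrite lt_neqAle rnorm_ge0 andbT eq_sym rnorm_eq0 zeta_sub_neq0.
have D2 y : D y < 2.
  by apply: (le_lt_trans (ler_rnormD _ _)); rewrite rnormN rnorm_zeta; lra.
pose k w : CC R := (1 - cconj z * w)^-1.
have rho1 : 1 < 2 / (1 + rnorm z) by rewrite ltr_pdivlMr; lra.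
have kd w : rnorm w < 2 / (1 + rnorm z) -> exists d, has_cderiv k w d.
  move=> hw; have nz : 1 - cconj z * w != 0.
    apply/eqP => /subr0_eq e; have : rnorm (cconj z * w) = 1 by rewrite -e rnorm1.
    rewrite rnormM rnorm_cconj; rewrite ltr_pdivlMr in hw; last lra.
    have := rnorm_ge0 w; nra.
  have h1 : has_cderiv (fun t : CC R => - (cconj z * t)) w (0 *: w + - cconj z *: 1).
    apply: (has_cderiv_unique_ext (f := fun t : CC R => - cconj z *: (t : CC R))).
      by move=> t; rewrite -mulNr.
    exact: (has_cderivZ (has_cderiv_cst _ _) (has_cderiv_id _)).
  have h2 := has_cderivD (has_cderiv_cst (1 : CC R) w) h1.
  by eexists; exact: (has_cderiv_comp h2 (has_cderivV nz)).
(* The floor 1/4 is inactive: on the circle the modulus of [k] is [(D y)^-1 > 1 / 2]. *)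
have e4 : 0 < (1 / 4 : R) by lra.
have kz y : Num.max (rnorm (k (zeta y))) (1 / 4) = (D y)^-1.
  have -> : rnorm (k (zeta y)) = (D y)^-1.
    rewrite /k rnormV; congr (_^-1).
    rewrite /D -[RHS](rnorm_cconj) -[RHS]mulr1 -(rnorm_zeta y) -rnormM.
    congr rnorm; apply: CC_eq; rewrite !ccE !cRe_cconj !cIm_cconj !ccE;
      have := rnorm_sqr (zeta y); rewrite rnorm_zeta expr1n; move: (cRe (zeta y)) (cIm (zeta y)) (cRe z) (cIm z) => a b c d h.
    - have -> : (a - c) * a - - (b - d) * b = (a ^+ 2 + b ^+ 2) - (c * a - - d * b) by ring.
      by rewrite -h.
    - by ring.
  by apply/max_idPl; rewrite -[1 / 4]invrK lef_pV2 ?posrE//; last (have := D2 y; lra); rewrite invr_gt0.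
have := log_subharmonic rho1 kd e4 z1.
have ik := itg_log_circle rho1 kd e4.
pose J := Int (fun x => poisson z x * ln (Num.max (rnorm (k (zeta x))) (1 / 4))).
rewrite -/J => hJ.
have z2 : 0 < 1 - rnorm z ^+ 2 by nra.
have hJ' : (1 - rnorm z ^+ 2)^-1 <= expR J.
  apply: le_trans hJ; rewrite /k rnormV mulrC mul_cconj -rC1 -rCN -rCD rnorm_rC_ge0; [exact: lexx|exact: ltW].
have L0 := Lam_gt0 z1.
have hI : ln (Lam z) + J <= Int (fun x => poisson z x * ln (trunc_Mc (zeta x))).
  have i1 := itg_poisson z1 (itg_cst (ln (Lam z))).
  have i2 := itg_poisson z1 ik.
  have -> : ln (Lam z) + J = Int (fun x => poisson z x * ln (Lam z) + poisson z x * ln (Num.max (rnorm (k (zeta x))) (1 / 4))).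
    rewrite IntD//; congr (_ + _).
    rewrite -[LHS]mulr1 -(Int_poisson z1) -IntZ; last exact: itg_poisson1.
    by apply: eq_Int => x _; rewrite mulrC.
  apply: (Int_ae_le (itgD i1 i2) (itg_poisson z1 itg_ln_trunc) mBad Bad0) => x Ix nB.
  rewrite -mulrDr ler_pM2l ?poisson_gt0// kz lnV ?posrE// -ln_div ?posrE//.
  rewrite ler_ln ?posrE ?divr_gt0//.
  by rewrite -lee_fin; apply: le_trans (Mc_le_trunc Ix nB); exact: Lam_le_Mc.
rewrite rnorm_out_fun// -expRM.
have -> : Int (fun x => poisson z x * l x) * eta = Int (fun x => poisson z x * ln (trunc_Mc (zeta x))).
  rewrite mulrC -IntZ; last exact: itg_poisson.
  by apply: eq_Int => x _; rewrite lE; field; rewrite gt_eqF.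
apply: (@le_trans _ _ (expR (ln (Lam z) + J))); last by rewrite ler_expR.
rewrite expRD lnK ?posrE// ler_pM2l//; apply: le_trans hJ'.
rewrite lef_pV2 ?posrE//; nra.
Qed.

End outer_of_maximal_function.

(** * Area integrals and tents *)

Section area_toolkit.
Context {R : realType}.
Local Notation RM := (measurableTypeR R).
Local Notation mu := (@lebesgue_measure R).

(** A separate name for planar Lebesgue measure, to which sigma-finiteness is attached so that it
    can be a factor in [tonelli]. *)
Definition area : set (RM * RM)%type -> \bar R := (mu \x mu)%E.

HB.instance Definition _ := Measure.on area.

Lemma area_rect (A B : set RM) : measurable A -> measurable B -> area (A `*` B) = (mu A * mu B)%E.
Proof. by move=> mA mB; rewrite /area product_measure1E. Qed.

Let area_sigma_finite : sigma_finite setT area.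
Proof.
have /sigma_finiteP[F [TF ndF Foo]] := @sigma_finiteT _ _ R mu.
exists (fun n => F n `*` F n).
  rewrite -setXTT TF predeqE => -[x y]; split.
    move=> [/= [n _ Fnx] [k _ Gky]]; exists (maxn n k) => //; split.
    - by move: x Fnx; exact/subsetPset/ndF/leq_maxl.
    - by move: y Gky; exact/subsetPset/ndF/leq_maxr.
  by move=> [n _ []/= ? ?]; split; exists n.
move=> k; have [? ?] := Foo k.
split; first exact: measurableX.
by rewrite area_rect// lte_mul_pinfty// ge0_fin_numE.
Qed.

HB.instance Definition _ := Measure_isSigmaFinite.Build _ _ _ area area_sigma_finite.

Lemma area_intE (S : set (CC R)) (G : CC R -> \bar R) :
  area_int S G = (\int[area]_(p in toC @^-1` S) G (toC p))%E.
Proof. by []. Qed.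

Variable X : normedModType (CC R).
Implicit Types (f h : CC R -> X) (z : CC R) (b s q : R).

(** One density for both norms: [b = -2] is the integrand of the area function, [b = -1] that of the
    tents. For [q != 0] it vanishes off the disc. *)
Definition weight b s q f z : R :=
  powR (powR (1 - rnorm z) (- s) * discnorm f z) q * powR (1 - rnorm z) b.

Lemma weight_ge0 b s q f z : 0 <= weight b s q f z.
Proof. by rewrite mulr_ge0 ?powR_ge0. Qed.

Lemma weight_out b s q f z : q != 0 -> ~ disc z -> weight b s q f z = 0.
Proof.
by move=> q0; rewrite /disc /weight /discnorm /= => /negP/negbTE ->; rewrite mulr0 powR0// mul0r.
Qed.

Lemma weightE b s q f z : disc z -> weight b s q f z = powR (TLweight s f z) q * powR (1 - rnorm z) b.
Proof. by move=> dz; rewrite /weight /TLweight discnormE. Qed.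

Lemma measurable_weight b s q f : analytic f -> measurable_fun setT (fun p : RM * RM => weight b s q f (toC p)).
Proof.
move=> af.
have m1 (c : R) : measurable_fun setT (fun p : RM * RM => powR (1 - rnorm (toC p)) c).
  apply: (measurableT_comp (measurable_powR _)); apply: measurable_funB; first exact: measurable_cst.
  by apply: measurable_rnorm; exact: cmeas_toC.
apply: measurable_funM => //; apply: (measurableT_comp (measurable_powR _)).
by apply: measurable_funM => //; exact: measurable_discnorm.
Qed.

Definition cone_kernel s q f (x : R) (p : RM * RM) : R :=
  weight (-2) s q f (toC p) * \1_[set t : RM * (RM * RM) | stolz (zeta t.1) (toC t.2)] (x, p).

Lemma cone_kernel_ge0 s q f x p : 0 <= cone_kernel s q f x p.
Proof. by rewrite mulr_ge0 ?weight_ge0. Qed.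

Lemma measurable_cone_kernel s q f : analytic f ->
  measurable_fun setT (fun t : RM * (RM * RM) => cone_kernel s q f t.1 t.2).
Proof.
move=> af; apply: measurable_funM.
  apply: (@measurableT_comp _ _ _ _ _ _ (fun p : RM * RM => weight (-2) s q f (toC p))); last exact: measurable_snd.
  exact: measurable_weight.
rewrite (_ : (fun _ => _) = \1_[set t : RM * (RM * RM) | stolz (zeta t.1) (toC t.2)]); last by apply/funext => -[].
apply: measurable_indic; exact: measurable_stolz2.
Qed.

Definition cone_int s q f (x : R) : \bar R := (\int[area]_p (cone_kernel s q f x p)%:E)%E.

Lemma cone_int_ge0 s q f x : (0 <= cone_int s q f x)%E.
Proof. by apply: integral_ge0 => p _; rewrite lee_fin cone_kernel_ge0. Qed.

Lemma measurable_cone_int s q f : analytic f -> measurable_fun setT (cone_int s q f : RM -> \bar R).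
Proof.
move=> af; apply: (@measurable_int_param R _ _ RM (RM * RM)%type area setT (fun x p => (cone_kernel s q f x p)%:E)) => //.
- by apply/measurable_EFinP; exact: measurable_cone_kernel.
- by move=> x p; rewrite lee_fin cone_kernel_ge0.
Qed.

Lemma AqE s q f x : 0 < q -> Aq q (TLweight s f) (zeta x) = (cone_int s q f x `^ q^-1)%E.
Proof.
move=> q0; rewrite /Aq area_intE; congr (_ `^ _)%E.
rewrite integral_mkcond; apply: eq_integral => p _.
rewrite /patch /cone_kernel indicE; case: ifPn => [/set_mem|] hp.
  rewrite mem_set// mulr1; case: (ltP (rnorm (toC p)) 1) => h; first by rewrite weightE.
  (* A closed Stolz angle reaches the circle, where both integrands are 0 thanks to the convention
     [powR 0 (-2) = 0]. *)
  rewrite weight_out ?gt_eqF//; last by rewrite /disc /= ltNge h.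
  have -> : rnorm (toC p) = 1 by apply/eqP; rewrite eq_le h (stolz_norm (rnorm_zeta x) hp).
  by rewrite subrr (powR0 (x := -2)) ?mulr0// oppr_eq0.
rewrite memNset ?mulr0//= => h; move: hp; rewrite notin_setE; exact.
Qed.

End area_toolkit.

Section area_submean.
Context {R : realType}.
Local Notation RM := (measurableTypeR R).
Local Notation mu := (@lebesgue_measure R).
Variable X : normedModType (CC R).

Lemma area_translate (c : RM * RM) (F : RM * RM -> \bar R) : measurable_fun setT F ->
  (forall p, (0 <= F p)%E) ->
  (\int[area]_p F (p.1 + c.1, p.2 + c.2)%R = \int[area]_p F p)%E.
Proof.
move=> mF F0.
have mT : measurable_fun setT (fun p : RM * RM => (p.1 + c.1, p.2 + c.2)%R : RM * RM).
  apply: measurable_fun_pair; apply: measurable_funD; try exact: measurable_cst.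
    exact: (measurableT_comp measurable_RM measurable_fst).
  exact: (measurableT_comp measurable_RM measurable_snd).
have := @fubini_tonelli1 _ _ RM RM R mu mu F mF F0.
rewrite -/(@area R) => ->.
have := @fubini_tonelli1 _ _ RM RM R mu mu (fun p => F (p.1 + c.1, p.2 + c.2)%R) (measurableT_comp mF mT) (fun p => F0 _).
rewrite -/(@area R) => ->.
rewrite /fubini_F /=.
have my (x : RM) : measurable_fun setT (fun y : RM => F (x, y)).
  have mp : measurable_fun setT (fun y : RM => (x, y) : RM * RM).
    by apply: measurable_fun_pair; [exact: measurable_cst|exact: measurable_id].
  exact: (measurableT_comp mF mp).
have -> : (fun x => \int[mu]_y F ((x + c.1)%R, (y + c.2)%R))%E = (fun x => (fun x' => \int[mu]_y F (x', y)) (x + c.1)%R)%E.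
  by apply/funext => x; rewrite (@integral_translate R c.2 (fun y => F ((x + c.1)%R, y))).
apply: (@integral_translate R c.1 (fun x' => \int[mu]_y F (x', y))%E).
  apply: (@measurable_int_param R _ _ RM RM mu setT (fun x y => F (x, y))) => //.
  by rewrite (_ : (fun _ => _) = F)//; apply/funext => -[].
by move=> x; apply: integral_ge0.
Qed.

Lemma poisson_le4 (w : CC R) x : rnorm w <= 1 / 2 -> poisson w x <= 4.
Proof.
move=> h; apply: (le_trans (poisson_le _ _)); first by lra.
by rewrite ler_pdivrMr; lra.
Qed.

(* Average [power_subharmonic] over the discs of radius [rho] centred in a small square around [z]. *)
Lemma area_submean (h : CC R -> X) (q rho : R) z : analytic h -> 0 < q -> 0 < rho ->
  2 * rho <= 1 - rnorm z ->
  ((rho ^+ 2 / 16 * powR (rnorm (h z)) q)%:E <=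
   \int[area]_p (powR (discnorm h (toC p)) q * \1_[set p : RM * RM | rnorm (toC p - z) <= 2 * rho] p)%:E)%E.
Proof.
move=> ah q0 rho0 hz.
pose Phi (p : RM * RM) : R := powR (discnorm h (toC p)) q * \1_[set p : RM * RM | rnorm (toC p - z) <= 2 * rho] p.
have Phi0 p : 0 <= Phi p by rewrite mulr_ge0 ?powR_ge0.
have mPhi : measurable_fun setT Phi.
  apply: measurable_funM.
    exact: measurableT_comp (measurable_powR _) (measurable_discnorm ah).
  apply: measurable_indic; apply: measurable_le_set; last exact: measurable_cst.
  by apply: measurable_rnorm; apply: cmeasB; [exact: cmeas_toC|exact: cmeas_cst].
(* For a shift [t] with [rnorm t <= rho / 2], the point [z] is at relative distance at most 1/2 from
   the centre of the circle of radius [rho] around [z + t], where the Poisson kernel is at most 4.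
   Integrating over [t] in [Q] turns circle means into an area mean. *)
pose Q : set (RM * RM) := `[(- (rho / 4))%R, (rho / 4)%R]%classic `*` `[(- (rho / 4))%R, (rho / 4)%R]%classic.
have mQ : measurable Q by apply: measurableX; exact: measurable_itv.
have Qn t : Q t -> rnorm (toC t) <= rho / 2.
  move=> [/=]; rewrite !in_itv /= => /andP[a1 a2] /andP[b1 b2].
  apply: (le_trans (rnorm_le _)); rewrite /toC /cRe /cIm /=.
  by have : `|t.1| <= rho / 4 by [rewrite ler_norml a1]; have : `|t.2| <= rho / 4 by [rewrite ler_norml b1]; lra.
have aQ : area Q = (rho ^+ 2 / 4)%:E.
  rewrite /Q area_rect; try exact: measurable_itv.
  rewrite !lebesgue_measure_itv /= lte_fin ifT; last by lra.
  by rewrite -EFinB -EFinM; congr (_%:E); field.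
pose sh (x : R) : RM * RM := (cRe z + rho * cRe (zeta x), cIm z + rho * cIm (zeta x)).
have shE t x : toC (t.1 + (sh x).1, t.2 + (sh x).2) = z + toC t + rC rho * zeta x.
  by apply: CC_eq; rewrite /toC !ccE /cRe /cIm /=; ring.
have sub t : Q t -> ((powR (rnorm (h z)) q)%:E <= \int[mu]_(x in I01) (4 * Phi (t.1 + (sh x).1, t.2 + (sh x).2))%:E)%E.
  move=> Qt; have tn := Qn _ Qt.
  pose k (w : CC R) := h (z + toC t + rC rho * w).
  have dk w : rnorm w < 5 / 4 -> rnorm (z + toC t + rC rho * w) < 1.
    move=> hw; have := ler_rnormD (z + toC t) (rC rho * w); have := ler_rnormD z (toC t).
    rewrite (rnormM (rC rho)) rnorm_rC_ge0 ?(ltW rho0)//.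
    have : rho * rnorm w <= rho * (5 / 4) by rewrite ler_pM2l// ltW.
    lra.
  have kd w : rnorm w < 5 / 4 -> exists d, has_cderiv k w d.
    move=> hw; have h1 : has_cderiv (fun w : CC R => rC rho * w) w (0 *: w + rC rho *: 1).
      exact: (has_cderivZ (has_cderiv_cst _ _) (has_cderiv_id _)).
    have h2 := has_cderivD (has_cderiv_cst (z + toC t) w) h1.
    by eexists; exact: (has_cderiv_comp h2 (derivable_has_cderiv (ah _ (dk _ hw)))).
  pose w0 : CC R := - (rC rho^-1 * toC t).
  have w0n : rnorm w0 <= 1 / 2.
    rewrite /w0 rnormN rnormM rnorm_rC_ge0 ?invr_ge0 ?(ltW rho0)// mulrC ler_pdivrMr//; lra.
  have kw0 : k w0 = h z.
    by rewrite /k /w0 mulrN mulrA -rCM divff ?gt_eqF// rC1 mul1r addrK.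
  have r1 : 1 < 5 / 4 :> R by lra.
  have w01 : rnorm w0 < 1 by lra.
  have := power_subharmonic r1 kd q0 w01; rewrite kw0.
  have ik := itg_pow_circle r1 kd q0.
  move=> hs; have : powR (rnorm (h z)) q <= Int (fun x => 4 * powR (rnorm (k (zeta x))) q).
    apply: (le_trans hs); apply: Int_le; [exact: itg_poisson|exact: itgZ|].
    by move=> x _; rewrite ler_wpM2r ?powR_ge0// poisson_le4.
  rewrite -lee_fin Int_EFin; last exact: itgZ.
  move=> /le_trans; apply; rewrite le_eqVlt; apply/orP; left; apply/eqP; apply: eq_integral => x _.
  congr (_%:E); congr (_ * _); rewrite /Phi shE discnormE; last first.
    by apply: dk; rewrite rnorm_zeta.
  rewrite indicE mem_set ?mulr1//= shE.
  rewrite (_ : z + toC t + rC rho * zeta x - z = toC t + rC rho * zeta x); last by ring.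
  have := ler_rnormD (toC t) (rC rho * zeta x).
  by rewrite rnormM rnorm_zeta mulr1 rnorm_rC_ge0 ?(ltW rho0)//; lra.
have msh : measurable_fun setT (fun u : (RM * RM) * RM => (u.1.1 + (sh u.2).1, u.1.2 + (sh u.2).2) : RM * RM).
  have [z1 z2] : cmeas (fun u : (RM * RM) * RM => zeta u.2).
    by apply: cmeas_zeta; apply: (measurableT_comp measurable_RM); exact: measurable_snd.
  have m11 : measurable_fun setT (fun u : (RM * RM) * RM => u.1.1).
    exact: (measurableT_comp measurable_fst measurable_fst).
  have m12 : measurable_fun setT (fun u : (RM * RM) * RM => u.1.2).
    exact: (measurableT_comp measurable_snd measurable_fst).
  apply: measurable_fun_pair; apply: measurable_funD.
  - exact: (measurableT_comp measurable_RM m11).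
  - by apply: measurable_funD; [exact: measurable_cst|apply: measurable_funM].
  - exact: (measurableT_comp measurable_RM m12).
  - by apply: measurable_funD; [exact: measurable_cst|apply: measurable_funM].
have mP4 : measurable_fun setT (fun u : (RM * RM) * RM => (4 * Phi (u.1.1 + (sh u.2).1, u.1.2 + (sh u.2).2))%:E).
  by apply/measurable_EFinP; apply: measurable_funM => //; exact: (measurableT_comp mPhi msh).
have P40 t x : (0 <= (4 * Phi (t.1 + (sh x).1, t.2 + (sh x).2))%:E)%E by rewrite lee_fin mulr_ge0.
have key : ((rho ^+ 2 / 4 * powR (rnorm (h z)) q)%:E <= 4%:E * \int[area]_p (Phi p)%:E)%E.
  rewrite mulrC EFinM -aQ -integral_cst//.
  apply: (@le_trans _ _ (\int[area]_(t in Q) \int[mu]_(x in I01) (4 * Phi (t.1 + (sh x).1, t.2 + (sh x).2))%:E)%E).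
    apply: ge0_integral_le_patch => t Qt; first by rewrite lee_fin powR_ge0.
      exact: integral_ge0.
    by split=> //; exact: sub.
  rewrite (@tonelli R _ _ (RM * RM)%type RM area mu Q I01 (fun t x => (4 * Phi (t.1 + (sh x).1, t.2 + (sh x).2))%:E) mQ mI01 mP4 P40).
  apply: (@le_trans _ _ (\int[mu]_(x in I01) (4%:E * \int[area]_p (Phi p)%:E))%E); last first.
    have : (0 <= \int[area]_p (Phi p)%:E)%E by apply: integral_ge0 => p _; rewrite lee_fin.
    case: (\int[area]_p (Phi p)%:E)%E => [c| |] c0 //.
      have -> : (\int[mu]_(x in I01) (4%:E * c%:E) = (4 * c)%:E * mu I01)%E by exact: (integral_cst mu mI01).
      by rewrite muI01 mule1.
    by rewrite mulry gtr0_sg// mul1e leey.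
  apply: ge0_integral_le_patch => x Ix.
  - exact: integral_ge0.
  - by rewrite mule_ge0// integral_ge0// => p _; rewrite lee_fin.
  split=> //.
  have mP : measurable_fun setT (fun p : RM * RM => (4 * Phi p)%:E).
    by apply/measurable_EFinP; apply: measurable_funM.
  rewrite -ge0_integralZl_EFin//; [|by move=> p _; rewrite lee_fin|exact/measurable_EFinP].
  have -> : (fun p => 4%:E * (Phi p)%:E)%E = (fun p => (4 * Phi p)%:E) by apply/funext => p; rewrite EFinM.
  rewrite -(@area_translate (sh x) (fun p => (4 * Phi p)%:E) mP); last by move=> p; rewrite lee_fin mulr_ge0.
  by apply: ge0_integral_le_patch => // p _; rewrite lee_fin mulr_ge0.
have h4 : ((1 / 4)%:E * (rho ^+ 2 / 4 * powR (rnorm (h z)) q)%:E <= (1 / 4)%:E * (4%:E * \int[area]_p (Phi p)%:E))%E.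
  by rewrite lee_wpmul2l// lee_fin; lra.
rewrite muleA -!EFinM (_ : 1 / 4 * 4 = 1) ?mul1e in h4; last by field.
by apply: le_trans h4; rewrite lee_fin; lra.
Qed.

End area_submean.

(** * Dyadic points of the circle *)

Section dyadic_points.
Context {R : realType}.
Implicit Types (z w c xi : CC R).

Lemma half_chord (t : R) : `|t| <= 1 / 2 -> `|t| <= rnorm (zeta t - 1).
Proof.
move=> ht; rewrite chord_eq.
have := @sin_ge_id R `|t|; rewrite normr_ge0 ht => /(_ isT) h.
apply: (le_trans h); rewrite ler_pM2l//.
have [t0|t0] := leP 0 t; first by rewrite ger0_norm// ler_norm.
by rewrite ltr0_norm// mulrN sinN -normrN ler_norm.
Qed.

Lemma cIm_zeta_le0 (y : R) : - (1 / 2) <= y <= 0 -> cIm (zeta y) <= 0.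
Proof.
move=> /andP[y1 y0]; rewrite /zeta /cIm /= -oppr_ge0 -sinN; apply: sin_ge0_pi.
have := @pi_gt0 R => p0; rewrite -mulrN.
have h : 2 * - y <= 1 by lra.
apply/andP; split; first by rewrite !mulr_ge0 ?(ltW p0)//; lra.
by rewrite mulrAC mulrC ler_piMr// ltW.
Qed.

Lemma circle_param (b : R) c : rnorm c = 1 -> exists y : R,
  [/\ c = zeta (b + y), `|y| <= rnorm (c - zeta b),
      0 < cIm (c * cconj (zeta b)) -> 0 < y & cIm (c * cconj (zeta b)) < 0 -> y < 0].
Proof.
move=> c1; have zb : zeta b * cconj (zeta b) = 1 by rewrite mul_cconj rnorm_zeta expr1n rC1.
have [|y0 /andP[y00 y01] e0] := @zeta_surj R (c * cconj (zeta b)).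
  by rewrite rnormM c1 rnorm_cconj rnorm_zeta mulr1.
have [y hy e] : exists2 y : R, - (1 / 2) <= y <= 1 / 2 & c * cconj (zeta b) = zeta y.
  have [h|h] := leP y0 (1 / 2); first by exists y0 => //; apply/andP; split; lra.
  exists (y0 - 1); first by apply/andP; split; lra.
  by rewrite zetaD zetaN zeta1 e0; apply: CC_eq; rewrite !ccE cRe_cconj cIm_cconj !ccE; ring.
have /andP[hy1 hy2] := hy.
have ec : c = zeta (b + y) by rewrite zetaD -e mulrCA zb mulr1.
exists y; split=> //.
- have -> : c - zeta b = zeta b * (zeta y - 1) by rewrite ec zetaD; ring.
  by rewrite rnormM rnorm_zeta mul1r half_chord// ler_norml.
- rewrite e => h; rewrite ltNge; apply/negP => y0'; move: h; rewrite ltNge => /negP; apply.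
  by apply: cIm_zeta_le0; rewrite hy1.
- rewrite e => h; rewrite ltNge; apply/negP => y0'; move: h; rewrite ltNge => /negP; apply.
  rewrite -[y]opprK zetaN cIm_cconj oppr_ge0; apply: cIm_zeta_le0.
  by apply/andP; split; lra.
Qed.

Lemma upper_arc (j k m : nat) : (k <= 2 ^ j)%N -> (j <= m)%N -> exists2 k' : nat, (k' < 2 ^ m)%N &
  forall y : R, 0 <= y -> y < (2 ^+ m)^-1 -> dyadic_arc m k' (zeta (k%:R / 2 ^+ j + y)).
Proof.
move=> kj jm; have p2 n : 0 < (2 : R) ^+ n by rewrite exprn_gt0.
have e2 : (2 : R) ^+ m = 2 ^+ (m - j) * 2 ^+ j by rewrite -exprD subnK.
rewrite leq_eqVlt in kj; case/orP: kj => [/eqP ->|kj].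
  (* The dyadic point 1 is the same point of the circle as 0, so the arc that starts there has index
     0. *)
  exists 0%N; first by rewrite expn_gt0.
  move=> y y0 y1; exists y; first by rewrite /= in_itv /= mul0r y0 mul1r.
  by rewrite natrX divff ?gt_eqF// zetaD zeta1 mul1r.
exists (k * 2 ^ (m - j))%N; first by rewrite -{2}(subnKC jm) expnD ltn_pmul2r// expn_gt0.
move=> y y0 y1; exists (k%:R / 2 ^+ j + y) => //.
have e3 : (k * 2 ^ (m - j))%:R / 2 ^+ m = k%:R / 2 ^+ j :> R.
  by rewrite e2 natrM natrX; field; rewrite !gt_eqF.
by rewrite /= in_itv /= -(natr1 (k * 2 ^ (m - j))) mulrDl e3 mul1r lerDl y0 ltrD2l.
Qed.

Lemma lower_arc (j k m : nat) : (0 < k)%N -> (k <= 2 ^ j)%N -> (j <= m)%N -> exists2 k' : nat, (k' < 2 ^ m)%N &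
  forall y : R, - (2 ^+ m)^-1 <= y -> y < 0 -> dyadic_arc m k' (zeta (k%:R / 2 ^+ j + y)).
Proof.
move=> k0 kj jm; have p2 n : 0 < (2 : R) ^+ n by rewrite exprn_gt0.
have e2 : (2 : R) ^+ m = 2 ^+ (m - j) * 2 ^+ j by rewrite -exprD subnK.
have kk : (0 < k * 2 ^ (m - j))%N by rewrite muln_gt0 k0 expn_gt0.
exists (k * 2 ^ (m - j)).-1%N.
  by rewrite prednK// -{2}(subnKC jm) expnD leq_pmul2r// expn_gt0.
move=> y y0 y1; exists (k%:R / 2 ^+ j + y) => //.
have e3 : (k * 2 ^ (m - j))%:R / 2 ^+ m = k%:R / 2 ^+ j :> R.
  by rewrite e2 natrM natrX; field; rewrite !gt_eqF.
rewrite /= in_itv /= prednK// e3 -[X in X%:R / _ <= _]subn1 natrB// mulrBl e3 mul1r.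
by apply/andP; split; lra.
Qed.

(** For odd [k] the dyadic point is the midpoint of an arc one generation up, which therefore
    contains both of its sides. *)
Lemma parent_arc (j k : nat) : odd k -> (k <= 2 ^ j.+1)%N -> exists2 k' : nat, (k' < 2 ^ j)%N &
  forall y : R, `|y| < (2 ^+ j.+1)^-1 -> dyadic_arc j k' (zeta (k%:R / 2 ^+ j.+1 + y)).
Proof.
move=> ok kj; have p2 n : 0 < (2 : R) ^+ n by rewrite exprn_gt0.
have ek : k = (k./2).*2.+1 by rewrite -{1}[k]odd_double_half ok.
exists k./2; first by move: kj ek; rewrite expnS; lia.
move=> y; rewrite ltr_norml => /andP[y0 y1]; exists (k%:R / 2 ^+ j.+1 + y) => //.
have e : k%:R / 2 ^+ j.+1 = (k./2)%:R / 2 ^+ j + (2 ^+ j.+1)^-1 :> R.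
  by rewrite {1}ek -(natr1 (k./2).*2) -muln2 natrM exprS; field; rewrite gt_eqF.
have e' : (2 ^+ j)^-1 = 2 * (2 ^+ j.+1)^-1 :> R by rewrite exprS; field; rewrite gt_eqF.
by rewrite /= in_itv /= e -(natr1 k./2) mulrDl mul1r e'; apply/andP; split; lra.
Qed.

Lemma dyadic_arc_full c : rnorm c = 1 -> @dyadic_arc R 0 0 c.
Proof.
move=> /zeta_surj[x hx ->]; exists x => //.
by rewrite /= in_itv /= expr0 !divr1.
Qed.

Lemma tent_intro (E : set (CC R)) z : disc z -> (forall c, rnorm c = 1 -> stolz c z -> E c) -> tent E z.
Proof. by move=> dz h; split=> // -[c [c1 nE] sc]; apply: nE; exact: h. Qed.

(** Were [c] and [z] on different sides of [xi], the product [cRe (z * cconj xi)] would be at least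
    [cRe (z * cconj c)], [stolz_closer] would put [z] in the Stolz angle of [xi], and [stolz_cone]
    excludes this. *)
Lemma one_sided xi z c : rnorm xi = 1 -> rnorm c = 1 -> stolz c z -> rnorm (1 - z * cconj xi) < 1 ->
  cRe (1 - z * cconj xi) ^+ 2 < 3 * cIm (1 - z * cconj xi) ^+ 2 ->
  0 < cIm (z * cconj xi) * cIm (c * cconj xi).
Proof.
move=> x1 c1 sc w1 hw; rewrite ltNge; apply/negP => h.
have := @stolz_closer R z c xi c1 x1 _ sc; apply: contraPP => _.
have rb : 0 <= cRe (z * cconj xi).
  have := cRe_le (1 - z * cconj xi); rewrite [cRe _]ccE !ccE => /(le_trans (ler_norm _)).
  by rewrite ?ccE in w1 *; lra.
have ra : cRe (c * cconj xi) <= 1.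
  by apply: (le_trans (ler_norm _)); apply: (le_trans (cRe_le _)); rewrite rnormM rnorm_cconj c1 x1 mulr1.
have e : z * cconj c = (z * cconj xi) * cconj (c * cconj xi).
  have : xi * cconj xi = 1 by rewrite mul_cconj x1 expr1n rC1.
  move=> e1; have -> : cconj (c * cconj xi) = cconj c * xi.
    by apply: CC_eq; rewrite !ccE !cRe_cconj !cIm_cconj !ccE !cRe_cconj !cIm_cconj; ring.
  by rewrite mulrACA (mulrC (cconj xi)) e1 mulr1.
move=> /(_ _) hcl; have /hcl /(stolz_cone x1) : cRe (z * cconj c) <= cRe (z * cconj xi).
  rewrite e [leLHS]ccE cRe_cconj cIm_cconj mulrN opprK.
  have : cRe (z * cconj xi) * cRe (c * cconj xi) <= cRe (z * cconj xi) * 1 by rewrite ler_wpM2l.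
  lra.
by rewrite leNgt hw.
Qed.

(** The cone [5 * cIm w ^+ 2 <= 3 * cRe w ^+ 2] is wider than that of [stolz_cone]. Outside it the
    imaginary part is at least 0.61 and the real part at most 0.80 times [rnorm w]; a move by
    [rnorm w / 16] leaves 0.54 and 0.87, still outside the Stolz cone and on the same side. *)
Lemma noncone_stable w w' : 3 * cRe w ^+ 2 < 5 * cIm w ^+ 2 -> rnorm (w' - w) <= rnorm w / 16 ->
  cRe w' ^+ 2 < 3 * cIm w' ^+ 2 /\ 0 < cIm w * cIm w'.
Proof.
move=> h hd.
have hr := le_trans (cRe_le (w' - w)) hd; have hi := le_trans (cIm_le (w' - w)) hd.
rewrite !ccE in hr hi.
have n2 := rnorm_sqr w; have n0 := rnorm_ge0 w.
move: (rnorm w) (cRe w) (cIm w) (cRe w') (cIm w') h hr hi n2 n0 {hd} => n a b a' b' h.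
rewrite !ler_norml => /andP[r1 r2] /andP[i1 i2] n2 n0.
have np : 0 < n.
  rewrite lt_neqAle n0 andbT eq_sym; apply/eqP => e; move: n2; rewrite e expr0n /= => e2.
  have := sqr_ge0 a; have := sqr_ge0 b; lra.
have hb : (61 / 100 * n) ^+ 2 <= b ^+ 2 by rewrite exprMn n2; have := sqr_ge0 b; have := sqr_ge0 a; lra.
have ha : a ^+ 2 <= (80 / 100 * n) ^+ 2 by rewrite exprMn n2; have := sqr_ge0 b; have := sqr_ge0 a; lra.
have ha' : `|a| <= 80 / 100 * n.
  by rewrite -ler_sqr ?nnegrE ?normr_ge0 ?mulr_ge0// real_normK ?num_real.
have hb' : 61 / 100 * n <= `|b|.
  by rewrite -ler_sqr ?nnegrE ?normr_ge0 ?mulr_ge0// real_normK ?num_real.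
move: ha'; rewrite ler_norml => /andP[a1 a2].
have A : a' ^+ 2 <= (87 / 100 * n) ^+ 2.
  rewrite -(real_normK (num_real a')) ler_sqr ?nnegrE ?normr_ge0 ?mulr_ge0//.
  by rewrite ler_norml; apply/andP; split; lra.
have sq (y : R) : 0 <= y -> 54 / 100 * n <= y -> a' ^+ 2 < 3 * y ^+ 2.
  move=> y0 B; have B2 : (54 / 100 * n) ^+ 2 <= y ^+ 2 by rewrite ler_sqr ?nnegrE ?mulr_ge0.
  have n2' : 0 < n ^+ 2 by rewrite exprn_gt0.
  by move: A B2; rewrite !exprMn; lra.
have [b0|b0] := leP 0 b; [rewrite (ger0_norm b0) in hb'|rewrite (ltr0_norm b0) in hb'].
  have B : 54 / 100 * n <= b' by lra.
  have b'0 : 0 < b' by apply: lt_le_trans B; rewrite mulr_gt0// divr_gt0.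
  have bp : 0 < b by apply: lt_le_trans hb'; rewrite mulr_gt0// divr_gt0.
  by split; [apply: (sq b' _ B); exact: ltW|exact: mulr_gt0].
have B : 54 / 100 * n <= - b' by lra.
have b'0 : 0 < - b' by apply: lt_le_trans B; rewrite mulr_gt0// divr_gt0.
have bp : 0 < - b by apply: lt_le_trans hb'; rewrite mulr_gt0// divr_gt0.
split; first by rewrite -[b']opprK sqrrN; apply: (sq (- b') _ B); exact: ltW.
by rewrite -mulrNN; exact: mulr_gt0.
Qed.

(** The 5 is rounded up from [4 * 17 / 16]: [c] is within three depths of [z'], and the depth is at
    most the distance [rnorm w'] from [z'] to [zeta b]. *)
Lemma seen_near (b : R) z z' c : disc z -> rnorm (z' - z) <= (1 - rnorm z) / 16 -> rnorm c = 1 -> stolz c z' ->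
  let w := 1 - z * cconj (zeta b) in let w' := 1 - z' * cconj (zeta b) in
  [/\ disc z', rnorm (w' - w) <= rnorm w / 16 & rnorm (c - zeta b) <= 5 * rnorm w].
Proof.
move=> dz hz c1 sc w w'; rewrite /disc /= in dz.
have E t : rnorm (1 - t * cconj (zeta b)) = rnorm (zeta b - t).
  have -> : 1 - t * cconj (zeta b) = (zeta b - t) * cconj (zeta b).
    by rewrite mulrBl mul_cconj rnorm_zeta expr1n rC1.
  by rewrite rnormM rnorm_cconj rnorm_zeta mulr1.
have dw (t : CC R) : 1 - rnorm t <= rnorm (1 - t * cconj (zeta b)).
  by rewrite E; have := ler_rnormD (zeta b - t) t; rewrite subrK rnorm_zeta; lra.
have h1 : rnorm (w' - w) <= rnorm w / 16.
  have -> : w' - w = (z - z') * cconj (zeta b) by rewrite /w /w'; ring.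
  rewrite rnormM rnorm_cconj rnorm_zeta mulr1 -rnormN opprB; apply: (le_trans hz).
  by have := dw z; rewrite -/w; lra.
split=> //.
  by rewrite /disc /=; have := ler_rnormD (z' - z) z; rewrite subrK; lra.
have := ler_rnormD (w' - w) w; rewrite subrK.
have := stolz_dist c1 sc; have := dw z'; rewrite -/w'.
have := ler_rnormD (c - z') (z' - zeta b); rewrite addrA subrK -(rnormN (z' - _)) opprB -E -/w'.
have := rnorm_ge0 w; lra.
Qed.

End dyadic_points.

(** * Jensen's inequality over shadows and quotients by the outer function *)

Section power_inequalities.
Context {R : realType}.

Lemma ge0_powRN_le (x y a : R) : 0 <= a -> 0 < x -> x <= y -> powR y (- a) <= powR x (- a).
Proof.
move=> a0 x0 xy; have y0 := lt_le_trans x0 xy.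
rewrite !powRN lef_pV2 ?posrE ?powR_gt0//.
by apply: ge0_ler_powR; rewrite ?nnegrE// ltW.
Qed.

(* Tangent line to the convex function [t |-> t^(-a)]. *)
Lemma powRN_tangent (a lam v : R) : 0 <= a -> 0 < lam -> 0 < v ->
  powR lam (- a) * (1 + a - a * (v / lam)) <= powR v (- a).
Proof.
move=> a0 l0 v0; have vl0 : 0 < v / lam by rewrite divr_gt0.
have -> : powR v (- a) = powR lam (- a) * powR (v / lam) (- a).
  by rewrite -powRM ?ltW// mulrC divfK ?gt_eqF.
rewrite ler_pM2l ?powR_gt0// /powR gt_eqF//.
have := expR_ge1Dx (- a * ln (v / lam)); apply: le_trans.
have : ln (v / lam) <= v / lam - 1.
  have := @le_ln1Dx R (v / lam - 1); rewrite (addrC 1) subrK; apply; lra.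
move=> h; have : a * ln (v / lam) <= a * (v / lam - 1) by rewrite ler_wpM2l.
lra.
Qed.

End power_inequalities.

Section factorization.
Context {R : realType}.
Local Notation RM := (measurableTypeR R).
Local Notation mu := (@lebesgue_measure R).
Variable X : normedModType (CC R).

(** Jensen for the convex function [t ^ (- a)] on the shadow, with [lam] the mean of [v] there. Both
    [powR 32 a] and 16 pay for exchanging the measure of the shadow with the depth, by
    [shadow_measure_ge]. *)
Lemma shadow_jensen (v : R -> R) (tau a : R) z : measurable_fun setT (v : RM -> R) ->
  0 < tau -> (forall x, tau <= v x) -> 0 < a -> itg v -> rnorm z < 1 ->
  let L := Int (fun x => v x * \1_(shadow z) x) in
  0 < L ->
  powR (L / (2 * (1 - rnorm z))) (- a) * (1 - rnorm z) <=
    powR 32 a * 16 * Int (fun x => powR (v x) (- a) * \1_(shadow z) x).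
Proof.
move=> mv tau0 vtau a0 iv z1 L L0.
have d0 : 0 < 1 - rnorm z by rewrite subr_gt0.
have v0 x : 0 < v x by exact: lt_le_trans tau0 (vtau x).
have mS := measurable_shadow z.
have SI : shadow z `<=` I01 by move=> x [].
have i1 : itg (\1_(shadow z) : R -> R).
  apply: (@itg_bnd _ _ 1); first by apply: measurable_funTS; exact: measurable_indic.
  by move=> x _; rewrite indicE; case: (_ \in _); rewrite ?normr1 ?normr0.
pose sg := Int (\1_(shadow z) : R -> R).
have sE : mu (shadow z) = sg%:E.
  rewrite /sg Int_EFin// integral_indic//; last exact: mI01.
  by rewrite setIidl.
have sge : (1 - rnorm z) / 16 <= sg.
  by rewrite -lee_fin -sE; exact: shadow_measure_ge.
have s0 : 0 < sg by apply: lt_le_trans sge; rewrite divr_gt0.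
have iL : itg (fun x => v x * \1_(shadow z) x) by have [] := itg_trunc mv mS iv.
have mw : measurable_fun setT (fun x : RM => powR (v x) (- a)).
  exact: measurableT_comp (measurable_powR _) mv.
have iw : itg (fun x => powR (v x) (- a)).
  apply: (@itg_bnd _ _ (powR tau (- a))); first exact: measurable_funTS.
  by move=> x _; rewrite ger0_norm ?powR_ge0// ge0_powRN_le// ltW.
have iW : itg (fun x => powR (v x) (- a) * \1_(shadow z) x) by have [] := itg_trunc mw mS iw.
pose lam := L / sg; have l0 : 0 < lam by rewrite divr_gt0.
have key : powR lam (- a) * sg <= Int (fun x => powR (v x) (- a) * \1_(shadow z) x).
  pose A := powR lam (- a).
  have i2 := itgB (itgZ (A * (1 + a)) i1) (itgZ (A * (a / lam)) iL).
  have : Int (fun x => A * (1 + a) * \1_(shadow z) x - A * (a / lam) * (v x * \1_(shadow z) x)) <=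
     Int (fun x => powR (v x) (- a) * \1_(shadow z) x).
    apply: Int_le => // x _.
    rewrite (_ : _ - _ = A * (1 + a - a * (v x / lam)) * \1_(shadow z) x); last by ring.
    by rewrite ler_wpM2r// powRN_tangent// ltW.
  apply: le_trans; rewrite IntB ?IntZ//; [|exact: itgZ..].
  rewrite -/sg -/L (_ : A * (a / lam) * L = A * a * sg); last first.
    by rewrite /lam; field; rewrite !gt_eqF.
  by rewrite /A; lra.
have h1 : lam / 32 <= L / (2 * (1 - rnorm z)).
  rewrite /lam -!mulrA ler_pM2l// -invfM lef_pV2 ?posrE ?mulr_gt0//; lra.
have l32 : 0 < lam / 32 by rewrite divr_gt0.
have h2 : powR (L / (2 * (1 - rnorm z))) (- a) <= powR 32 a * powR lam (- a).
  apply: (le_trans (ge0_powRN_le (ltW a0) l32 h1)).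
  rewrite powRM ?(ltW l0)// ?invr_ge0// mulrC ler_wpM2r ?powR_ge0//.
  by rewrite -powR_inv1// -powRrM mulN1r opprK.
have P0 : 0 <= powR lam (- a) by exact: powR_ge0.
apply: (@le_trans _ _ (powR 32 a * powR lam (- a) * (16 * sg))).
  apply: ler_pM => //; [exact: powR_ge0|exact: ltW|lra].
rewrite (_ : _ * (16 * sg) = powR 32 a * 16 * (powR lam (- a) * sg)); last by ring.
by rewrite ler_wpM2l// mulr_ge0 ?powR_ge0.
Qed.

Section tent_bound.
Variables (v : R -> R) (tau eta s q : R) (f : CC R -> X).
Hypothesis mv : measurable_fun setT (v : RM -> R).
Hypothesis tau0 : 0 < tau.
Hypothesis vtau : forall x, tau <= v x.
Hypothesis iv2 : itg (fun x => v x ^+ 2).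
Hypothesis eta0 : 0 < eta.
Hypothesis q0 : 0 < q.
Hypothesis af : analytic f.

Local Notation g := (out_fun v tau eta).
Let iv : itg v. Proof. by apply: itg_of_sqr iv2; exact: measurable_funTS. Qed.
Let a := q / eta.
Let a0 : 0 < a. Proof. exact: divr_gt0. Qed.
Let v0 x : 0 < v x. Proof. exact: lt_le_trans tau0 (vtau x). Qed.

Lemma out_fun_neq0 z : g z != 0. Proof. exact: cexp_neq0. Qed.

Lemma shadow_int_gt0 z : rnorm z < 1 -> 0 < Int (fun x => v x * \1_(shadow z) x).
Proof.
move=> z1; have mS := measurable_shadow z.
have [_ iL] := itg_trunc mv mS iv.
have h : 0 < tau * ((1 - rnorm z) / 16) by rewrite mulr_gt0// divr_gt0// subr_gt0.
apply: (lt_le_trans h); rewrite -lee_fin Int_EFin//.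
apply: (@le_trans _ _ (tau%:E * mu (shadow z))%E).
  by rewrite EFinM lee_wpmul2l// ?lee_fin ?(ltW tau0)// shadow_measure_ge.
rewrite -integral_cst//.
apply: ge0_integral_le_patch => x /=.
- by move=> _; rewrite lee_fin ltW.
- by move=> _; rewrite lee_fin mulr_ge0// ltW.
- by move=> sx; split; [case: sx|rewrite indicE mem_set// mulr1 lee_fin].
Qed.

(** [out_fun_lower] bounds [powR (rnorm (g z)) (- q)] by a negative power of a mean of [v];
    [shadow_jensen] spends one factor [1 - rnorm z] on it, which turns the tent exponent -1 into the
    area exponent -2. *)
Lemma quotient_weight_le z : rnorm z < 1 ->
  powR (TLweight s (fun w => (g w)^-1 *: f w) z) q * powR (1 - rnorm z) (-1) <=
  weight (-2) s q f z * (powR 32 a * 16 * Int (fun x => powR (v x) (- a) * \1_(shadow z) x)).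
Proof.
move=> z1; have d0 : 0 < 1 - rnorm z by rewrite subr_gt0.
have L0 := shadow_int_gt0 z1.
have gn0 : 0 < rnorm (g z) by rewrite lt_neqAle rnorm_ge0 andbT eq_sym rnorm_eq0 out_fun_neq0.
have := shadow_jensen mv tau0 vtau a0 iv z1 L0.
have := out_fun_lower mv tau0 vtau iv2 eta0 z1.
set L := Int (fun x => v x * _); set W := Int (fun x => powR _ _ * _) => h1 h2.
have L2 : 0 < L / (2 * (1 - rnorm z)) by rewrite divr_gt0// mulr_gt0.
have h3 : powR (rnorm (g z)) (- q) <= powR (L / (2 * (1 - rnorm z))) (- a).
  have -> : powR (rnorm (g z)) (- q) = powR (powR (rnorm (g z)) eta) (- a).
    by rewrite -powRrM /a mulrN mulrC divfK ?gt_eqF.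
  exact: ge0_powRN_le (ltW a0) L2 h1.
rewrite weightE// /TLweight rnormZ rnormV.
have -> : powR (powR (1 - rnorm z) (- s) * ((rnorm (g z))^-1 * rnorm (f z))) q =
   powR (powR (1 - rnorm z) (- s) * rnorm (f z)) q * powR (rnorm (g z)) (- q).
  rewrite [X in powR X q](_ : _ = powR (1 - rnorm z) (- s) * rnorm (f z) * (rnorm (g z))^-1); last by ring.
  rewrite powRM ?invr_ge0 ?rnorm_ge0// ?mulr_ge0 ?powR_ge0 ?rnorm_ge0//.
  by rewrite -powR_inv1 ?rnorm_ge0// -powRrM mulN1r.
rewrite -!mulrA ler_wpM2l ?powR_ge0//.
have -> : powR (1 - rnorm z) (-1) = powR (1 - rnorm z) (-2) * (1 - rnorm z).
  rewrite -[X in _ * X]powRr1 ?(ltW d0)// -powRD; last by apply/implyP => _; rewrite gt_eqF.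
  by congr (_ `^ _); ring.
rewrite mulrCA ler_wpM2l ?powR_ge0//; apply: le_trans (le_trans _ h2) _; last by rewrite mulrA.
by rewrite ler_wpM2r// ltW.
Qed.

(** A point of the tent over [E] is seen only from [E], so its shadow lies in [E']; Tonelli then
    trades the tent integral for an integral over [E']. *)
Lemma tent_quotient_le (E : set (CC R)) (E' : set RM) : measurable E' ->
  (forall x, I01 x -> E (zeta x) -> E' x) ->
  (area_int (tent E) (fun z => (powR (TLweight s (fun w => (g w)^-1 *: f w) z) q * powR (1 - rnorm z) (-1))%:E)
   <= (powR 32 a * 16)%:E * \int[mu]_(x in E') ((powR (v x) (- a))%:E * cone_int s q f x))%E.
Proof.
move=> mE' hE; rewrite area_intE.
pose phi (x : RM) (p : RM * RM) : \bar R := (powR (v x) (- a) * cone_kernel s q f x p)%:E.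
have phi0 x p : (0 <= phi x p)%E by rewrite lee_fin mulr_ge0 ?powR_ge0 ?cone_kernel_ge0.
have mva : measurable_fun setT (fun x : RM => powR (v x) (- a)) by exact: measurableT_comp (measurable_powR _) mv.
have mphi : measurable_fun setT (fun t : RM * (RM * RM) => phi t.1 t.2).
  apply/measurable_EFinP; apply: measurable_funM; last exact: measurable_cone_kernel.
  by apply: (measurableT_comp mva); exact: measurable_fst.
have c0 : 0 <= powR 32 a * 16 by rewrite mulr_ge0 ?powR_ge0.
have -> : (\int[mu]_(x in E') ((powR (v x) (- a))%:E * cone_int s q f x) =
    \int[mu]_(x in E') \int[area]_(p in setT) phi x p)%E.
  apply: eq_integral => x _; rewrite /cone_int -ge0_integralZl//=.
  - have mp : measurable_fun setT (fun p : RM * RM => (x, p) : RM * (RM * RM)).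
      by apply: measurable_fun_pair; [exact: measurable_cst|exact: measurable_id].
    apply/measurable_EFinP; exact: (measurableT_comp (measurable_cone_kernel s q af) mp).
  - by move=> p _; rewrite lee_fin cone_kernel_ge0.
  - by rewrite lee_fin powR_ge0.
rewrite (@tonelli R _ _ RM (RM * RM)%type mu area E' setT phi)//.
rewrite -ge0_integralZl//=; first last.
- by move=> p _; apply: integral_ge0.
- apply: (@measurable_int_param R _ _ (RM * RM)%type RM mu E' (fun p x => phi x p)) => //.
  have mp : measurable_fun setT (fun u : (RM * RM) * RM => (u.2, u.1) : RM * (RM * RM)).
    by apply: measurable_fun_pair; [exact: measurable_snd|exact: measurable_fst].
  exact: (measurableT_comp mphi mp).
apply: ge0_integral_le_patch => p.
- by move=> _; rewrite lee_fin mulr_ge0 ?powR_ge0.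
- by move=> _; rewrite mule_ge0// integral_ge0.
move=> [/= dp hp]; split=> //.
apply: (@le_trans _ _ ((weight (-2) s q f (toC p) * (powR 32 a * 16 * Int (fun x => powR (v x) (- a) * \1_(shadow (toC p)) x)))%:E)).
  by rewrite lee_fin; exact: quotient_weight_le.
rewrite (_ : weight _ _ _ _ _ * _ = powR 32 a * 16 * (weight (-2) s q f (toC p) * Int (fun x => powR (v x) (- a) * \1_(shadow (toC p)) x))); last by ring.
rewrite EFinM lee_wpmul2l// ?lee_fin//.
have iw : itg (fun x => powR (v x) (- a)).
  apply: (@itg_bnd _ _ (powR tau (- a))); first exact: measurable_funTS.
  by move=> x _; rewrite ger0_norm ?powR_ge0// ge0_powRN_le// ltW.
have [_ iW] := itg_trunc mva (measurable_shadow (toC p)) iw.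
rewrite -IntZ// Int_EFin; last exact: itgZ.
rewrite integral_mkcond [leRHS]integral_mkcond; apply: ge0_integral_le_patch => // x.
- by move=> _; rewrite /patch; case: ifP => // _; rewrite lee_fin !mulr_ge0 ?weight_ge0 ?powR_ge0.
- by move=> _; rewrite /patch; case: ifP.
move=> _; split=> //; rewrite /patch; case: ifPn => [/set_mem Ix|_]; last by case: ifP.
rewrite indicE; case: (boolP (x \in shadow (toC p))) => [/set_mem[_ /= sx]|_]; last first.
  by rewrite !mulr0; case: ifP.
have Ex : E (zeta x).
  apply: contrapT => nE; apply: hp; exists (zeta x) => //; split=> //.
  exact: rnorm_zeta.
rewrite mem_set; last exact: hE.
by rewrite /phi /cone_kernel lee_fin indicE mem_set//= !mulr1 mulrC.
Qed.

End tent_bound.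

End factorization.

(** * The second inclusion *)

Section outer_factorization.
Context {R : realType}.
Local Notation RM := (measurableTypeR R).
Local Notation mu := (@lebesgue_measure R).
Variable X : normedModType (CC R).

Lemma ler_poweR (x y : \bar R) (r : R) : 0 <= r -> (0 <= x -> x <= y -> x `^ r <= y `^ r)%E.
Proof.
by move=> r0 x0 xy; apply: gt0_ler_poweR => //; rewrite in_itv /= leey andbT// (le_trans x0).
Qed.

(* The arc seen in [0, 1]; the endpoint [1] is identified with [0]. *)
Definition arc_param (j k : nat) : set RM := `[(k%:R / 2 ^+ j)%R, (k.+1%:R / 2 ^+ j)%R[ `|` [set 1%R].

Lemma measurable_arc_param j k : measurable (arc_param j k).
Proof. by apply: measurableU; [exact: measurable_itv|exact: measurable_set1]. Qed.

Lemma dyadic_bounds (j k : nat) : (k < 2 ^ j)%N -> 0 <= (k%:R / 2 ^+ j : R) /\ (k.+1%:R / 2 ^+ j : R) <= 1.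
Proof.
move=> kj; split; first by rewrite divr_ge0 ?exprn_ge0.
by rewrite ler_pdivrMr ?exprn_gt0// mul1r -natrX ler_nat.
Qed.

Lemma arc_param_sub j k : (k < 2 ^ j)%N -> arc_param j k `<=` I01.
Proof.
move=> /dyadic_bounds[h1 h2] x [|->]; last by rewrite /I01 /= in_itv /= ler01 lexx.
by rewrite /I01 /= !in_itv /= => /andP[a b]; apply/andP; split; [exact: le_trans a|exact: ltW (lt_le_trans b h2)].
Qed.

Lemma dyadic_arc_param j k x : (k < 2 ^ j)%N -> I01 x -> dyadic_arc j k (zeta x) -> arc_param j k x.
Proof.
move=> /dyadic_bounds[h1 h2]; rewrite /I01 /= in_itv /= => /andP[x0 x1] [y + e].
rewrite /= in_itv /= => /andP[y1 y2].
have [->|xn1] := eqVneq x 1; [by right|left].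
have -> : x = y.
  apply: zeta_inj => //; first by rewrite x0 lt_neqAle xn1.
  by rewrite (le_trans h1 y1) (lt_le_trans y2 h2).
by rewrite /= in_itv /= y1.
Qed.

Lemma arc_param_measure j k : (mu (arc_param j k) <= ((2 ^+ j)^-1)%:E)%E.
Proof.
have u : (mu (arc_param j k) <= mu `[(k%:R / 2 ^+ j)%R, (k.+1%:R / 2 ^+ j)%R[%classic + mu [set 1%R])%E.
  by apply: measureU2; [exact: measurable_itv|exact: measurable_set1].
apply: (le_trans u); rewrite lebesgue_measure_set1 adde0 lebesgue_measure_itv /= lte_fin.
case: ifP => _; last by rewrite lee_fin invr_ge0 exprn_ge0.
by rewrite -EFinB lee_fin -mulrBl -natr1 addrAC subrr add0r mul1r.
Qed.

Lemma outer_factorization (s p q : R) : 0 < p -> 1 <= q ->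
  exists C : R, forall f : CC R -> X, inTL s p q f ->
     exists (g : CC R -> CC R) (h : CC R -> X),
       outer g /\ inHp p g /\ inTL_inf s q h /\
       (forall z : CC R, disc z -> f z = g z *: h z) /\
       (Hp_norm p g * TL_norm_inf s q h <= C%:E * TL_norm s p q f)%E.
Proof.
move=> p0 q1; have q0 : 0 < q by exact: lt_le_trans q1.
pose eta := p / 2; have eta0 : 0 < eta by rewrite divr_gt0.
pose a := q / eta; have a0 : 0 < a by rewrite divr_gt0.
have [C1 C10 HMc] := @Mc_L2 R.
pose C2 := C1 * 4 + 1; have C20 : 0 < C2 by rewrite addr_gt0// mulr_gt0.
pose C0 : R := powR 32 a * 16.
have C00 : 0 < C0 by rewrite mulr_gt0// powR_gt0.
exists (powR C2 p^-1 * powR C0 q^-1) => f [af fN].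
pose A := cone_int s q f.
have A0 x : (0 <= A x)%E by exact: cone_int_ge0.
have mA : measurable_fun setT (A : RM -> \bar R) by exact: measurable_cone_int.
have pq0 : 0 < p / q by rewrite divr_gt0.
pose Ap x := (A x `^ (p / q))%E.
have mAp : measurable_fun setT (Ap : RM -> \bar R).
  exact: (measurableT_comp (measurable_poweR _) mA).
have Ap0 x : (0 <= Ap x)%E by exact: poweR_ge0.
pose J := (\int[mu]_(x in I01) Ap x)%E.
have TLE : TL_norm s p q f = (J `^ p^-1)%E.
  rewrite /TL_norm /tent_norm /arc_int; congr (_ `^ _)%E; apply: eq_integral => x _.
  by rewrite AqE// -poweRrM mulrC.
have J0 : (0 <= J)%E by exact: integral_ge0.
have Jlt : (J < +oo)%E.
  by move: fN; rewrite TLE; apply: lty_poweRy; rewrite invr_eq0 gt_eqF.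
have Jfin : J \is a fin_num by rewrite ge0_fin_numE.
pose Jr := fine J; have Jr0 : 0 <= Jr by exact: fine_ge0.
have JE : J = Jr%:E by rewrite fineK.
have iAp : mu.-integrable I01 Ap.
  apply/integrableP; split; first exact: measurable_funTS.
  by rewrite (_ : (\int[mu]_(x in I01) `|Ap x|)%E = J)//; apply: eq_integral => x _; rewrite gee0_abs.
(* [tau ^+ 2] equals the integral of [Ap], so both summands of [v] have comparable L^2 norms. If
   that integral is 0, any positive value does. *)
pose tau : R := if Jr == 0 then 1 else Num.sqrt Jr.
have tau0 : 0 < tau.
  by rewrite /tau; case: eqVneq => // h; rewrite sqrtr_gt0 lt_neqAle eq_sym h.
have Jtau : Jr <= tau ^+ 2.
  by rewrite /tau; case: eqVneq => [->|_]; rewrite ?expr1n// sqr_sqrtr.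
pose v x : R := powR (fine (A x)) (eta / q) + tau.
have vtau x : tau <= v x by rewrite lerDr powR_ge0.
have mv : measurable_fun setT (v : RM -> R).
  apply: measurable_funD; last exact: measurable_cst.
  apply: (measurableT_comp (measurable_powR _)).
  by apply: measurableT_comp; [exact: fine_measurable|exact: mA].
pose w x : R := powR (fine (A x)) (p / q).
have w0 x : 0 <= w x by exact: powR_ge0.
have mw : measurable_fun setT (w : RM -> R).
  apply: (measurableT_comp (measurable_powR _)).
  by apply: measurableT_comp; [exact: fine_measurable|exact: mA].
have wAp x : ((w x)%:E <= Ap x)%E.
  rewrite /w /Ap; have := A0 x; case: (A x) => [r| |]//= r0.
  by rewrite gt_eqF// leey.
have wJ : (\int[mu]_(x in I01) (w x)%:E <= Jr%:E)%E.
  by rewrite -JE; apply: ge0_integral_le_patch => // x _; rewrite lee_fin.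
have iw : itg w.
  by apply: itg_ge0_lty => //; [exact: measurable_funTS|exact: le_lt_trans wJ (ltry _)].
have v2 x : v x ^+ 2 <= 2 * w x + 2 * tau ^+ 2.
  have -> : w x = powR (fine (A x)) (eta / q) ^+ 2.
    rewrite -powR_mulrn ?powR_ge0// -powRrM /w; congr (_ `^ _).
    by rewrite /eta; field; rewrite gt_eqF.
  by rewrite /v; have := sqr_ge0 (powR (fine (A x)) (eta / q) - tau); nra.
have ib : itg (fun x => 2 * w x + 2 * tau ^+ 2) by exact: itgD (itgZ _ iw) (itg_cst _).
have iv2 : itg (fun x => v x ^+ 2).
  apply: (itg_le _ _ ib); first by apply: measurable_funTS; exact: measurable_funX.
  by move=> x _; rewrite ger0_norm ?sqr_ge0.
have iv : itg v by apply: itg_of_sqr iv2; exact: measurable_funTS.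
have Iv2 : Int (fun x => v x ^+ 2) <= 4 * tau ^+ 2.
  apply: (le_trans (Int_le iv2 ib (fun x _ => v2 x))).
  rewrite IntD; [|exact: itgZ|exact: itg_cst].
  rewrite IntZ// Int_cst; have : Int w <= Jr by rewrite -lee_fin Int_EFin.
  lra.
have v0 x : 0 <= v x by exact: le_trans (ltW tau0) (vtau x).
pose g := out_fun v tau eta; pose h z := (g z)^-1 *: f z.
have gd z : rnorm z < 1 -> exists d, has_cderiv g z d.
  exact: (has_cderiv_out_fun eta mv tau0 vtau iv2).
have ag : analytic g by move=> z dz; have [d hd] := gd z dz; exact: has_cderiv_derivable hd.
have gn0 z : g z != 0 by exact: out_fun_neq0.
have ah : analytic h.
  move=> z dz; have [d hd] := gd z dz.
  have h1 := has_cderiv_comp hd (has_cderivV (gn0 z)).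
  exact: has_cderiv_derivable (has_cderivZ h1 (derivable_has_cderiv (af z dz))).
have HpB : (Hp_norm p g <= (powR (C2 * tau ^+ 2) p^-1)%:E)%E.
  apply: ge_ereal_sup => _ [r [r01 ->]].
  rewrite -poweR_EFin; apply: ler_poweR; first by rewrite invr_ge0 ltW.
    by apply: integral_ge0 => x _; rewrite lee_fin powR_ge0.
  have pe : p = 2 * eta by rewrite /eta; lra.
  apply: (le_trans (Hp_out_fun mv tau0 vtau iv2 eta0 pe r01)).
  apply: (le_trans (trunc_Mc_L2 mv tau0 vtau (HMc v mv v0 iv iv2))).
  rewrite lee_fin /C2.
  have : C1 * Int (fun x => v x ^+ 2) <= C1 * (4 * tau ^+ 2) by rewrite ler_pM2l.
  lra.
(* If [Jr = 0] the area function vanishes almost everywhere, and so do the tent masses of [h]; the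
   bound 0 matches the norm inequality, whose right side is then 0. *)
pose B := if Jr == 0 then 0 else C0.
have B0 : 0 <= B by rewrite /B; case: ifP => // _; exact: ltW.
(* Where [A] is finite, [v] dominates [A] to the power [eta / q], and [(eta / q) * a = 1]. *)
have vA x : (A x < +oo)%E -> ((powR (v x) (- a))%:E * A x <= 1)%E.
  have := A0 x; rewrite /v; case: (A x) => [r| |]//= r0 _.
  rewrite lee_fin in r0; rewrite -EFinM lee_fin.
  have [->|rn0] := eqVneq r 0; first by rewrite mulr0.
  have rp : 0 < r by rewrite lt_neqAle eq_sym rn0.
  apply: (@le_trans _ _ (powR (powR r (eta / q)) (- a) * r)).
    by rewrite ler_pM2r// ge0_powRN_le ?(ltW a0) ?powR_gt0// lerDl ltW.
  rewrite -powRrM (_ : eta / q * - a = -1); last by rewrite /a; field; rewrite !gt_eqF.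
  by rewrite powR_inv1// mulVf.
have TB : (TL_norm_inf s q h <= (powR B q^-1)%:E)%E.
  rewrite -poweR_EFin; apply: ler_poweR; first by rewrite invr_ge0 ltW.
    apply: (@le_trans _ _ ((2 ^+ 0 : R)%:E * area_int (tent (dyadic_arc 0 0)) (fun z => (powR (TLweight s h z) q * powR (1 - rnorm z) (-1))%:E))%E).
      rewrite mule_ge0 ?lee_fin// area_intE; apply: integral_ge0 => x _.
      by rewrite lee_fin mulr_ge0 ?powR_ge0.
    by apply: ereal_sup_ubound; exists 0%N, 0%N.
  apply: ge_ereal_sup => _ [j [k [kj ->]]].
  have p2 : 0 < (2 : R) ^+ j by rewrite exprn_gt0.
  have T := tent_quotient_le s mv tau0 vtau iv2 eta0 q0 af (measurable_arc_param j k) (fun x Ix => @dyadic_arc_param j k x kj Ix).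
  have mI : measurable_fun (arc_param j k) (fun x => (powR (v x) (- a))%:E * A x)%E.
    apply: measurable_funTS; apply: emeasurable_funM => //; apply/measurable_EFinP.
    exact: measurableT_comp (measurable_powR _) mv.
  have I0 x : (0 <= (powR (v x) (- a))%:E * A x)%E by rewrite mule_ge0// lee_fin powR_ge0.
  have sub := arc_param_sub kj.
  have I : (\int[mu]_(x in arc_param j k) ((powR (v x) (- a))%:E * A x) <= (B / C0 / 2 ^+ j)%:E)%E.
    rewrite /B; case: ifPn => [/eqP Jr00|Jrn].
      have /(ae_eq_integral_abs mu mI01 (measurable_funTS mAp)) ae0 : (\int[mu]_(x in I01) `|Ap x| = 0)%E.
        have -> : (\int[mu]_(x in I01) `|Ap x|)%E = J.
          by apply: eq_integral => x _; rewrite gee0_abs.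
        by rewrite JE Jr00.
      rewrite (@ge0_ae_eq_integral _ _ _ mu _ _ (cst 0%E))//.
      + by rewrite integral_cst ?mul0e ?mul0r//; exact: measurable_arc_param.
      + exact: measurable_arc_param.
      + apply: filterS ae0 => x /= e Ex; have /= := e (sub _ Ex).
        by move=> /(poweR_eq0_eq0 (A0 x)) ->; rewrite mule0.
    rewrite divff ?gt_eqF// mul1r; apply: le_trans (arc_param_measure j k).
    rewrite -[leRHS]mul1e -integral_cst; last exact: measurable_arc_param.
    apply: ae_ge0_le_integral => //; first exact: measurable_arc_param.
    have ae1 := integrable_ae mI01 iAp.
    apply: filterS ae1 => x /= e Ex; apply: vA.
    have := e (sub _ Ex); rewrite ge0_fin_numE// /Ap => hlt.
    by apply: (lty_poweRy _ hlt); rewrite gt_eqF.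
  apply: (@le_trans _ _ ((2 ^+ j)%:E * (C0%:E * (B / C0 / 2 ^+ j)%:E))%E).
    apply: lee_wpmul2l; first by rewrite lee_fin ltW.
    by apply: (le_trans T); apply: lee_wpmul2l => //; rewrite lee_fin ltW.
  by rewrite -!EFinM lee_fin le_eqVlt; apply/orP; left; apply/eqP; field; rewrite !gt_eqF.
exists g, h; split; first exact: (outer_out_fun eta mv tau0 vtau iv2).
split; first by split=> //; exact: le_lt_trans HpB (ltry _).
split; first by split=> //; exact: le_lt_trans TB (ltry _).
split; first by move=> z _; rewrite /h scalerA divff ?scale1r.
have Hp0 : (0 <= Hp_norm p g)%E.
  apply: (@le_trans _ _ (arc_int (fun x => (powR (rnorm (g (rC (1 / 2) * zeta x))) p)%:E) `^ p^-1)%E); first exact: poweR_ge0.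
  by apply: ereal_sup_ubound; exists (1 / 2); split=> //; rewrite divr_gt0//= ltr_pdivrMr// mul1r ltr1n.
apply: (@le_trans _ _ ((powR (C2 * tau ^+ 2) p^-1)%:E * (powR B q^-1)%:E)%E).
  by apply: lee_pmul => //; exact: poweR_ge0.
rewrite TLE JE poweR_EFin -!EFinM lee_fin.
rewrite /B /tau; case: eqVneq => [_|h0].
  by rewrite powR0 ?mulr0 ?invr_eq0 ?gt_eqF// !mulr_ge0// powR_ge0.
rewrite sqr_sqrtr// powRM ?(ltW C20)// le_eqVlt; apply/orP; left; apply/eqP; ring.
Qed.
End outer_factorization.

(** * Sums along the branches of a dyadic tree *)

Section binary_tree.
Context {R : realType}.
Implicit Types (a b c phi psi : nat -> nat -> R).

(** Nodes are pairs of a generation and an index, with children [k.*2] and [k.*2.+1]. [tavg] is the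
    expectation after a random descent of [n] steps, [tsum] the expected sum of [b] met on the
    way. *)
Fixpoint tavg n phi j k : R :=
  if n is n'.+1 then (tavg n' phi j.+1 k.*2 + tavg n' phi j.+1 k.*2.+1) / 2 else phi j k.

Fixpoint tsum n b j k : R :=
  b j k + (if n is n'.+1 then (tsum n' b j.+1 k.*2 + tsum n' b j.+1 k.*2.+1) / 2 else 0).

Fixpoint bpath c j k : R :=
  if j is j'.+1 then bpath c j' k./2 + c j k else c 0 k.

Lemma tavg_le n phi psi j k : (forall l, phi (j + n)%N l <= psi (j + n)%N l) -> tavg n phi j k <= tavg n psi j k.
Proof.
elim: n j k => [|n ih] j k h /=; first by have := h k; rewrite addn0.
have h' l : phi (j.+1 + n)%N l <= psi (j.+1 + n)%N l by rewrite addSnnS.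
by have := ih j.+1 k.*2 h'; have := ih j.+1 k.*2.+1 h'; lra.
Qed.

Lemma tavgD n phi psi j k : tavg n (fun j k => phi j k + psi j k) j k = tavg n phi j k + tavg n psi j k.
Proof. by elim: n j k => //= n ih j k; rewrite !ih; lra. Qed.

Lemma tavgZ n (x : R) phi j k : tavg n (fun j k => x * phi j k) j k = x * tavg n phi j k.
Proof. by elim: n j k => //= n ih j k; rewrite !ih; lra. Qed.

Lemma half_child (k : nat) : (k.*2.+1)./2 = k.
Proof. exact: (half_bit_double k true). Qed.

Lemma pathS c j k : bpath c j.+1 k = bpath c j k./2 + c j.+1 k. Proof. by []. Qed.

Lemma tavg_path n c j k : tavg n (bpath c) j k = bpath c j k - c j k + tsum n c j k.
Proof.
elim: n j k => [|n ih] j k; first by rewrite /= addr0 subrK.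
rewrite [LHS]/= !ih !pathS doubleK half_child.
rewrite [tsum n.+1 c j k]/=; lra.
Qed.

Definition tmono a := forall j k, a j k <= a j.+1 k.*2 /\ a j k <= a j.+1 k.*2.+1.

Lemma tmono_half a : tmono a -> forall j k, a j k./2 <= a j.+1 k.
Proof.
by move=> ma j k; have [h1 h2] := ma j k./2; rewrite -{2}[k]odd_double_half; case: (odd k).
Qed.

(* Carleson embedding: write a as the sum of its increments along the branches. *)
Lemma tree_embedding a b (C : R) n j k : tmono a -> (forall j k, 0 <= b j k) ->
  (forall i l m, (j <= i)%N -> (m + i = j + n)%N -> tsum m b i l <= C) ->
  tsum n (fun j k => a j k * b j k) j k <= C * (tavg n a j k - a j k) + a j k * tsum n b j k.
Proof.
move=> ma b0; elim: n j k => [|n ih] j k hC /=; first by rewrite !addr0 subrr mulr0 add0r.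
have hC' i l m : (j.+1 <= i)%N -> (m + i = j.+1 + n)%N -> tsum m b i l <= C.
  by move=> ji e; apply: hC; [exact: ltnW|rewrite e addSnnS].
have [m1 m2] := ma j k.
have c1 : tsum n b j.+1 k.*2 <= C by apply: hC; lia.
have c2 : tsum n b j.+1 k.*2.+1 <= C by apply: hC; lia.
have := ih j.+1 k.*2 hC'; have := ih j.+1 k.*2.+1 hC'.
have : (a j.+1 k.*2 - a j k) * (C - tsum n b j.+1 k.*2) >= 0 by rewrite mulr_ge0 ?subr_ge0.
have : (a j.+1 k.*2.+1 - a j k) * (C - tsum n b j.+1 k.*2.+1) >= 0 by rewrite mulr_ge0 ?subr_ge0.
lra.
Qed.

Section power.
Variables (a b : nat -> nat -> R) (C r : R) (n : nat).
Hypothesis ma : tmono a.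
Hypothesis a0 : forall j k, 0 < a j k.
Hypothesis b0 : forall j k, 0 <= b j k.
Hypothesis C0 : 0 < C.
Hypothesis r0 : 0 < r.
Hypothesis pack : forall i l m, (m + i = n)%N -> tsum m b i l <= C.

Local Notation B := (bpath (fun j k => a j k * b j k)).

(** [tree_embedding] at the root, where the packing bound makes the two root terms cancel. *)
Let embed a' : tmono a' -> (forall j k, 0 <= a' j k) ->
  tsum n (fun j k => a' j k * b j k) 0 0 <= C * tavg n a' 0 0.
Proof.
move=> ma' a'0.
have h : forall i l m, (0 <= i)%N -> (m + i = 0 + n)%N -> tsum m b i l <= C.
  by move=> i l m _; rewrite add0n; exact: pack.
have := tree_embedding 0 ma' b0 h.
have : a' 0 0 * tsum n b 0 0 <= a' 0 0 * C.
  by rewrite ler_wpM2l//; apply: pack; rewrite addn0.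
lra.
Qed.

Let B0 j k : 0 <= B j k.
Proof.
have ab j' k' : 0 <= a j' k' * b j' k' by rewrite mulr_ge0// ltW.
by elim: j k => [|j ih] k //=; rewrite addr_ge0.
Qed.

Let Bmono j k : B j k./2 <= B j.+1 k.
Proof. by rewrite /= lerDl mulr_ge0// ltW. Qed.

Lemma bernoulli_nat (t : R) (N : nat) : 0 <= t <= 1 -> 1 - t ^+ N <= N%:R * (1 - t).
Proof.
move=> /andP[t0 t1]; elim: N => [|N ih]; first by rewrite expr0 subrr mul0r.
rewrite exprS -natr1; have : t ^+ N <= 1 by rewrite exprn_ile1.
have : 0 <= t ^+ N by rewrite exprn_ge0.
by move=> *; nra.
Qed.

(** The mean value inequality, with an integer [N >= r] in place of [r] so that it reduces to
    Bernoulli for natural powers of [y / x]. *)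
Lemma powR_sub_le (x y : R) (N : nat) : r <= N%:R -> 0 <= y -> y <= x ->
  powR x r - powR y r <= N%:R * (x - y) * powR x (r - 1).
Proof.
move=> rN y0 yx; have [x0|x0] := leP x 0.
  have -> : x = 0 by lra.
  have -> : y = 0 by lra.
  by rewrite !subrr mulr0 mul0r.
have [->|yn0] := eqVneq y 0.
  have N1 : 1 <= N%:R :> R by rewrite ler1n -(ltr0n R); exact: lt_le_trans r0 rN.
  by rewrite powR0 ?gt_eqF// !subr0 -mulrA mulr_powRB1 ?(ltW x0)// ler_peMl ?powR_ge0.
have yp : 0 < y by rewrite lt_neqAle eq_sym yn0.
have t01 : 0 < y / x <= 1 by rewrite divr_gt0//= ler_pdivrMr// mul1r.
have -> : powR y r = powR (y / x) r * powR x r by rewrite -powRM ?divfK ?gt_eqF ?divr_ge0 ?ltW.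
rewrite -[X in X - _]mul1r -mulrBl.
have -> : N%:R * (x - y) * powR x (r - 1) = N%:R * (1 - y / x) * powR x r.
  by rewrite -(mulr_powRB1 (ltW x0) r0); field; rewrite gt_eqF.
rewrite ler_wpM2r ?powR_ge0//; apply: le_trans (bernoulli_nat N _); last by case/andP: t01 => /ltW -> ->.
rewrite lerD2l lerN2 -powR_mulrn; last by case/andP: t01 => /ltW.
exact: ger_powR.
Qed.

(** By [powR_sub_le] the power of a branch sum is at most the branch sum of [a' * b] with
    [a' = N * a * powR B (r - 1)], again monotone, so the embedding applies to [a']. Young's
    inequality gives back half of the left side, which is finite and absorbed. *)
Lemma tree_power_ge1 (N : nat) : 1 <= r -> r <= N%:R ->
  tavg n (fun j k => powR (B j k) r) 0 0 <= 2 * powR (2 * N%:R) r * powR C r * tavg n (fun j k => powR (a j k) r) 0 0.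
Proof.
move=> r1 rN; have N0 : 0 < N%:R :> R by lra.
pose a' j k := N%:R * (a j k * powR (B j k) (r - 1)).
have Pm j k : powR (B j k./2) (r - 1) <= powR (B j.+1 k) (r - 1).
  by apply: ge0_ler_powR; rewrite ?nnegrE ?subr_ge0// Bmono.
have ma' : tmono a'.
  have h j k : a' j k./2 <= a' j.+1 k.
    rewrite /a' ler_pM2l//; apply: ler_pM; rewrite ?powR_ge0 ?(ltW (a0 _ _))//.
    exact: tmono_half.
  by move=> j k; have := h j k.*2; have := h j k.*2.+1; rewrite doubleK half_child; split.
have a'0 j k : 0 <= a' j k by rewrite !mulr_ge0 ?powR_ge0 ?(ltW (a0 _ _))// ltW.
have step j k : powR (B j k) r <= bpath (fun j k => a' j k * b j k) j k.
  elim: j k => [|j ih] k.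
    have := @powR_sub_le (B 0 k) 0 N rN (lexx 0) (B0 0 k).
    by rewrite powR0 ?gt_eqF// !subr0 /a' /=; lra.
  have := @powR_sub_le (B j.+1 k) (B j k./2) N rN (B0 _ _) (Bmono _ _).
  have -> : B j.+1 k - B j k./2 = a j.+1 k * b j.+1 k by rewrite /= addrC addrA addNr add0r.
  by have := ih k./2; rewrite [bpath (fun j k => a' j k * b j k) j.+1 k]/= /a'; lra.
have h1 : tavg n (fun j k => powR (B j k) r) 0 0 <= C * tavg n a' 0 0.
  apply: le_trans (embed ma' a'0).
  apply: (@le_trans _ _ (tavg n (bpath (fun j k => a' j k * b j k)) 0 0)); first by apply: tavg_le => l.
  by rewrite tavg_path /= subrr add0r.
(* Either [B] exceeds [2 * N * C * a] and [C * a'] is at most half of [powR B r], or the factor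
   [powR B (r - 1)] is controlled by a power of [a]. *)
have young j k : C * a' j k <= 2^-1 * powR (B j k) r + powR (2 * N%:R) r * powR C r * powR (a j k) r.
  have ap := a0 j k.
  have -> : powR (2 * N%:R) r * powR C r * powR (a j k) r = powR (2 * N%:R * C * a j k) r.
    by rewrite -!powRM// ?mulr_ge0// ltW.
  have T0 : 0 < 2 * N%:R * C * a j k by rewrite !mulr_gt0.
  have [h|h] := leP (2 * N%:R * C * a j k) (B j k).
    rewrite -(mulr_powRB1 (B0 j k) r0) /a'.
    have := powR_ge0 (2 * N%:R * C * a j k) r.
    have : 2 * N%:R * C * a j k * powR (B j k) (r - 1) <= B j k * powR (B j k) (r - 1) by rewrite ler_wpM2r ?powR_ge0.
    lra.
  rewrite -(mulr_powRB1 (ltW T0) r0) /a'.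
  have : powR (B j k) (r - 1) <= powR (2 * N%:R * C * a j k) (r - 1).
    by apply: ge0_ler_powR; rewrite ?nnegrE ?subr_ge0// ltW.
  have := powR_ge0 (B j k) r; have := powR_ge0 (B j k) (r - 1).
  move: (powR (B j k) (r - 1)) (powR (2 * N%:R * C * a j k) (r - 1)) => u w u0 h3 uw.
  have : N%:R * C * a j k * u <= N%:R * C * a j k * w by rewrite ler_pM2l// !mulr_gt0.
  have : 0 <= N%:R * C * a j k * w.
    by apply: mulr_ge0; [rewrite ltW// !mulr_gt0|exact: le_trans uw].
  lra.
have h2 : C * tavg n a' 0 0 <= 2^-1 * tavg n (fun j k => powR (B j k) r) 0 0 +
    powR (2 * N%:R) r * powR C r * tavg n (fun j k => powR (a j k) r) 0 0.
  by rewrite -!tavgZ -tavgD; apply: tavg_le => l; exact: young.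
lra.
Qed.

(** As [a] increases along branches and [r < 1], [B * powR a (r - 1)] is at most the branch sum of
    [powR a r * b], to which the embedding applies. Then [powR B r] is the product of
    [powR (B * powR a (r - 1)) r] and [powR (powR a r) (1 - r)], split by Young's inequality. *)
Lemma tree_power_lt1 : r < 1 ->
  tavg n (fun j k => powR (B j k) r) 0 0 <= 2 * powR C r * tavg n (fun j k => powR (a j k) r) 0 0.
Proof.
move=> r1.
have low j k : B j k * powR (a j k) (r - 1) <= bpath (fun j k => powR (a j k) r * b j k) j k.
  have E j' k' : a j' k' * b j' k' * powR (a j' k') (r - 1) = powR (a j' k') r * b j' k'.
    by rewrite -(mulr_powRB1 (ltW (a0 j' k')) r0); ring.
  elim: j k => [|j ih] k; first by rewrite /= E.
  rewrite [bpath (fun j k => powR (a j k) r * b j k) j.+1 k]/= [B j.+1 k]/= mulrDl E lerD2r.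
  apply: le_trans (ih k./2); rewrite ler_wpM2l// -(opprB 1 r) !powRN lef_pV2 ?posrE ?powR_gt0//.
  by apply: ge0_ler_powR; [lra|rewrite nnegrE ltW..|exact: tmono_half].
have mar : tmono (fun j k => powR (a j k) r).
  by move=> j k; have [h1 h2] := ma j k; split; apply: ge0_ler_powR; rewrite ?nnegrE ?(ltW (a0 _ _))// ltW.
have h1 := embed mar (fun j k => powR_ge0 (a j k) r).
have young j k : powR (B j k) r <= powR C r * (C^-1 * (B j k * powR (a j k) (r - 1)) + powR (a j k) r).
  pose x := C^-1 * (B j k * powR (a j k) (r - 1)); pose y := powR (a j k) r.
  have ap := a0 j k; have y0 : 0 < y by exact: powR_gt0.
  have x0 : 0 <= x by rewrite mulr_ge0 ?mulr_ge0 ?powR_ge0 ?invr_ge0 ?(ltW C0).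
  have -> : powR (B j k) r = powR C r * (powR x r * powR y (1 - r)).
    rewrite mulrA -powRM ?(ltW C0)// /x mulVKf ?gt_eqF// powRM ?powR_ge0//.
    rewrite -mulrA /y -!powRrM -powRD; last by apply/implyP => _; rewrite gt_eqF.
    by rewrite (_ : (r - 1) * r + r * (1 - r) = 0) ?powRr0 ?mulr1//; ring.
  rewrite ler_pM2l ?powR_gt0//.
  have M0 : 0 < x + y by rewrite ltr_wpDl.
  have hx : powR x r <= powR (x + y) r by apply: ge0_ler_powR; rewrite ?nnegrE ?(ltW r0) ?(ltW M0)// lerDl ltW.
  have hy : powR y (1 - r) <= powR (x + y) (1 - r).
    by apply: ge0_ler_powR; rewrite ?nnegrE ?(ltW y0) ?(ltW M0) ?subr_ge0 ?(ltW r1)// lerDr.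
  apply: (le_trans (ler_pM (powR_ge0 _ _) (powR_ge0 _ _) hx hy)).
  rewrite -powRD; last by apply/implyP => _; rewrite gt_eqF.
  by rewrite (addrC r) subrK powRr1// ltW.
apply: (@le_trans _ _ (tavg n (fun j k => powR C r * (C^-1 * bpath (fun j k => powR (a j k) r * b j k) j k + powR (a j k) r)) 0 0)).
  apply: tavg_le => l; apply: (le_trans (young _ _)); rewrite ler_pM2l ?powR_gt0// lerD2r ler_pM2l ?invr_gt0//.
rewrite tavgZ tavgD tavgZ tavg_path /= subrr add0r.
have : C^-1 * tsum n (fun j k => powR (a j k) r * b j k) 0 0 <= tavg n (fun j k => powR (a j k) r) 0 0.
  by rewrite mulrC ler_pdivrMr// mulrC.
have Cr : 0 < powR C r by exact: powR_gt0.
by move=> h; have : powR C r * (C^-1 * tsum n (fun j k => powR (a j k) r * b j k) 0 0) <= powR C r * tavg n (fun j k => powR (a j k) r) 0 0 by [rewrite ler_pM2l]; lra.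
Qed.

End power.

Lemma tree_power (r : R) : 0 < r -> exists2 K : R, 0 < K & forall a b (C : R) (n : nat),
  tmono a -> (forall j k, 0 < a j k) -> (forall j k, 0 <= b j k) -> 0 < C ->
  (forall i l m, (m + i = n)%N -> tsum m b i l <= C) ->
  tavg n (fun j k => powR (bpath (fun j k => a j k * b j k) j k) r) 0 0 <=
    K * powR C r * tavg n (fun j k => powR (a j k) r) 0 0.
Proof.
move=> r0; have [r1|r1] := leP 1 r; last first.
  by exists 2 => // *; exact: tree_power_lt1.
have N := archi_boundP (ltW r0).
exists (2 * powR (2 * (Num.bound r)%:R) r).
  by rewrite mulr_gt0// powR_gt0// mulr_gt0//; lra.
by move=> *; apply: tree_power_ge1 => //; exact: ltW.
Qed.

End binary_tree.

(** * Bounds for h from its tent masses *)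

Section pointwise_bounds.
Context {R : realType}.
Local Notation RM := (measurableTypeR R).
Local Notation mu := (@lebesgue_measure R).
Variable X : normedModType (CC R).

Lemma powR_comparable (x y e : R) : 0 < x -> x / 2 <= y <= 2 * x -> powR y e <= powR 2 `|e| * powR x e.
Proof.
move=> x0 /andP[h1 h2]; have y0 : 0 < y by lra.
have [e0|e0] := leP 0 e.
  rewrite (ger0_norm e0) -powRM ?(ltW x0)//.
  by apply: ge0_ler_powR; rewrite ?nnegrE ?(ltW y0)// mulr_ge0 ?(ltW x0).
rewrite (ltr0_norm e0); have -> : powR 2 (- e) * powR x e = powR (x / 2) e.
  by rewrite powRM ?(ltW x0) ?invr_ge0// mulrC -powR_inv1// -powRrM mulN1r.
have ne0 : 0 <= - e by rewrite oppr_ge0 ltW.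
by have := @ge0_powRN_le R (x / 2) y (- e) ne0; rewrite opprK; apply; rewrite ?divr_gt0.
Qed.

Variables (s q : R).
Hypothesis q1 : 1 <= q.
Let q0 : 0 < q. Proof. exact: lt_le_trans q1. Qed.

Definition tent_mass (h : CC R -> X) (E : set (CC R)) : \bar R :=
  area_int (tent E) (fun z => (powR (TLweight s h z) q * powR (1 - rnorm z) (-1))%:E).

(** [4 ^+ 7 = 16 * 32 ^+ 2] comes from [area_submean] with a radius of 1/32 of the depth, the power
    of 2 from the variation of the depth over that disc. *)
Definition pw_const : R := 4 ^+ 7 * powR 2 `|s * q + 1|.

Lemma pw_const_gt0 : 0 < pw_const.
Proof. by apply: mulr_gt0; [exact: exprn_gt0|exact: powR_gt0]. Qed.

Lemma weight_unit (h : CC R -> X) z : disc z ->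
  powR (discnorm h z) q = powR (1 - rnorm z) (s * q + 1) * weight (-1) s q h z.
Proof.
rewrite /disc /= => dz; have d0 : 0 < 1 - rnorm z by rewrite subr_gt0.
have dn0 (a : R) : (a == 0) ==> (1 - rnorm z != 0) by apply/implyP => _; rewrite gt_eqF.
rewrite /weight powRM ?powR_ge0 ?discnorm_ge0// -powRrM.
have e : powR (1 - rnorm z) (s * q + 1) * (powR (1 - rnorm z) (- s * q) * powR (1 - rnorm z) (-1)) = 1.
  by rewrite -!powRD// (_ : s * q + 1 + (- s * q + -1) = 0) ?powRr0//; ring.
transitivity (powR (1 - rnorm z) (s * q + 1) * (powR (1 - rnorm z) (- s * q) * powR (1 - rnorm z) (-1)) * powR (discnorm h z) q).
  by rewrite e mul1r.
by ring.
Qed.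

Lemma integral_mul_indic (B : set (RM * RM)) (f : RM * RM -> R) :
  (\int[area]_p (f p * \1_B p)%:E = \int[area]_(p in B) (f p)%:E)%E.
Proof.
rewrite [RHS]integral_mkcond; apply: eq_integral => p _.
by rewrite /patch indicE; case: ifP => _; rewrite ?mulr1 ?mulr0.
Qed.

(** A submean value over a disc of radius comparable to the depth; there the depth varies by at most
    a factor 2, so the weight can be taken in and out of the integral. *)
Lemma pointwise_of_tent (h : CC R -> X) (E : set (CC R)) (M : R) z : analytic h -> disc z ->
  (forall z', rnorm (z' - z) <= (1 - rnorm z) / 16 -> tent E z') -> (tent_mass h E <= M%:E)%E ->
  powR (rnorm (h z)) q <= pw_const * powR (1 - rnorm z) (s * q - 1) * M.
Proof.
move=> ah; rewrite /disc /= => dz hE hM; set d := 1 - rnorm z.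
have d0 : 0 < d by rewrite subr_gt0.
have rho0 : 0 < d / 32 by rewrite divr_gt0.
have hz : 2 * (d / 32) <= 1 - rnorm z by rewrite -/d; lra.
have := area_submean ah q0 rho0 hz.
have Cp0 : 0 <= powR 2 `|s * q + 1| * powR d (s * q + 1) by rewrite mulr_ge0 ?powR_ge0.
set B := [set p : RM * RM | rnorm (toC p - z) <= 2 * (d / 32)].
have Bt p : B p -> tent E (toC p).
  by rewrite /B /= => h1; apply: hE; rewrite -/d; lra.
have le : (\int[area]_p (powR (discnorm h (toC p)) q * \1_B p)%:E
   <= (powR 2 `|s * q + 1| * powR d (s * q + 1) * M)%:E)%E.
  apply: (@le_trans _ _ (\int[area]_p ((powR 2 `|s * q + 1| * powR d (s * q + 1))%:E * (weight (-1) s q h (toC p) * \1_B p)%:E))%E).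
    apply: ge0_integral_le_patch => p _.
    - by rewrite lee_fin mulr_ge0 ?powR_ge0.
    - by rewrite mule_ge0// lee_fin mulr_ge0 ?weight_ge0.
    split=> //; rewrite -EFinM lee_fin mulrA indicE.
    case: (boolP (p \in B)) => [/set_mem Bp|_]; last by rewrite !mulr0.
    have [dp _] := Bt _ Bp; rewrite !mulr1 weight_unit//.
    rewrite ler_wpM2r ?weight_ge0// powR_comparable// -/d.
    have := ler_rnormD (toC p - z) z; have := ler_rnormD (z - toC p) (toC p).
    rewrite !subrK -(rnormN (z - _)) opprB.
    by rewrite /B /= in Bp => h1 h2; apply/andP; split; rewrite /d in Bp *; lra.
  have mB : measurable B.
    apply: measurable_le_set; last exact: measurable_cst.
    by apply: measurable_rnorm; apply: cmeasB; [exact: cmeas_toC|exact: cmeas_cst].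
  rewrite ge0_integralZl_EFin//; first last.
  - apply/measurable_EFinP; apply: measurable_funM; last exact: measurable_indic.
    exact: measurable_weight.
  - by move=> p _; rewrite lee_fin mulr_ge0 ?weight_ge0.
  rewrite (EFinM _ M); apply: lee_wpmul2l; first by rewrite lee_fin.
  apply: le_trans hM; rewrite integral_mul_indic /tent_mass area_intE.
  apply: ge0_integral_le_patch => p.
  - by move=> _; rewrite lee_fin weight_ge0.
  - by move=> _; rewrite lee_fin mulr_ge0 ?powR_ge0.
  - by move=> Bp; have tp := Bt _ Bp; split=> //; rewrite weightE//; case: tp.
move=> /le_trans /(_ le); rewrite lee_fin => H.
have -> : powR d (s * q - 1) = powR d (s * q + 1) * d ^- 2.
  rewrite -(powR_invn 2 (ltW d0)) -powRD; last by apply/implyP => _; rewrite gt_eqF.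
  by congr (_ `^ _); ring.
have d2 : 0 < d ^+ 2 by rewrite exprn_gt0.
rewrite /pw_const -(ler_pM2l (_ : 0 < (d / 32) ^+ 2 / 16)); last by rewrite divr_gt0// exprn_gt0.
apply: (le_trans H); rewrite le_eqVlt; apply/orP; left; apply/eqP.
by field; rewrite gt_eqF.
Qed.

Variables (h : CC R -> X) (K : R).
Hypothesis ah : analytic h.
Hypothesis K0 : 0 <= K.
Hypothesis hK : forall j k, (k < 2 ^ j)%N -> (tent_mass h (dyadic_arc j k) <= (K / 2 ^+ j)%:E)%E.

Definition root_const : R := powR pw_const q^-1.
Local Notation kap := (powR K q^-1).

Lemma root_const_gt0 : 0 < root_const.
Proof. exact: powR_gt0 pw_const_gt0. Qed.

Lemma root_pointwise m k z : disc z -> (k < 2 ^ m)%N ->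
  (forall z', rnorm (z' - z) <= (1 - rnorm z) / 16 -> tent (dyadic_arc m k) z') ->
  rnorm (h z) <= root_const * kap * powR (1 - rnorm z) (s - q^-1) * powR (2 ^+ m)^-1 q^-1.
Proof.
move=> dz km hE; have d0 : 0 < 1 - rnorm z by rewrite subr_gt0.
have Kd : 0 <= K / 2 ^+ m by rewrite divr_ge0// exprn_ge0.
have := pointwise_of_tent ah dz hE (hK km).
have p0 := ltW pw_const_gt0.
move=> H; have := @ge0_ler_powR R q^-1 _ _ _ _ _ H.
rewrite !nnegrE invr_ge0 (ltW q0) powR_ge0 !mulr_ge0 ?powR_ge0// => /(_ isT isT isT).
rewrite -powRrM divff ?gt_eqF// powRr1 ?rnorm_ge0// => /le_trans; apply.
rewrite powRM ?mulr_ge0 ?powR_ge0// powRM ?powR_ge0//.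
rewrite powRM ?invr_ge0 ?exprn_ge0// -powRrM /root_const.
rewrite mulrBl mulfK ?gt_eqF// mul1r le_eqVlt; apply/orP; left; apply/eqP; ring.
Qed.

Local Notation ww z b := (1 - z * cconj (zeta b)).

Lemma ww_dist (z : CC R) (b : R) : rnorm (ww z b) = rnorm (zeta b - z).
Proof.
have -> : ww z b = (zeta b - z) * cconj (zeta b).
  by rewrite mulrBl mul_cconj rnorm_zeta expr1n rC1.
by rewrite rnormM rnorm_cconj rnorm_zeta mulr1.
Qed.

Lemma ww_gt0 (z : CC R) (b : R) : disc z -> 0 < rnorm (ww z b).
Proof.
by move=> dz; rewrite ww_dist lt_neqAle rnorm_ge0 andbT eq_sym rnorm_eq0 zeta_sub_neq0.
Qed.

(** Off the cone all points near [z] are seen only from one side of [zeta b], so they lie in the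
    tent over an arc that starts or ends at [zeta b] and has length comparable to [rnorm w]. *)
Lemma noncone_bound j k z : (0 < k)%N -> (k <= 2 ^ j)%N -> disc z ->
  let b := k%:R / 2 ^+ j in let w := ww z b in
  16 * rnorm w * 2 ^+ j <= 1 -> 3 * cRe w ^+ 2 < 5 * cIm w ^+ 2 ->
  rnorm (h z) <= root_const * kap * powR (1 - rnorm z) (s - q^-1) * powR (16 * rnorm w) q^-1.
Proof.
move=> k0 kj dz b w wj nc; have w0 : 0 < rnorm w by exact: ww_gt0.
have p2 n : 0 < (2 : R) ^+ n by rewrite exprn_gt0.
(* Arcs of generation [m] have length between [8 * rnorm w] and [16 * rnorm w]: the first exceeds
   the distance [5 * rnorm w] of [seen_near], the second enters the bound. *)
have [m jm [m1 m2]] : exists2 m, (j <= m)%N & 8 * rnorm w * 2 ^+ m <= 1 /\ 1 < 16 * rnorm w * 2 ^+ m.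
  have ex : exists m, (j <= m)%N && (1 < 16 * rnorm w * 2 ^+ m).
    have [m hm] := pow2_big (1 / (16 * rnorm w)); exists (maxn j m); rewrite leq_maxl/=.
    have w16 : 0 < 16 * rnorm w by rewrite mulr_gt0.
    rewrite mulrC -ltr_pdivrMr//; apply: (lt_le_trans hm); rewrite ler_eXn2l ?leq_maxr//; lra.
  case: (ex_minnP ex) => m /andP[jm h1] hmin; exists m => //; split=> //.
  move: jm; rewrite leq_eqVlt => /orP[/eqP <-|jm]; first by have := mulr_ge0 (ltW w0) (ltW (p2 j)); lra.
  case: m jm h1 hmin => // m jm h1 hmin.
  rewrite leNgt; apply/negP => h2; suff : (m < m)%N by rewrite ltnn.
  by apply: hmin; rewrite -ltnS jm /=; rewrite exprS in h2; lra.
have [k' k'm hE] : exists2 k' : nat, (k' < 2 ^ m)%N &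
   forall z', rnorm (z' - z) <= (1 - rnorm z) / 16 -> tent (dyadic_arc m k') z'.
  have near z' c : rnorm (z' - z) <= (1 - rnorm z) / 16 -> rnorm c = 1 -> stolz c z' ->
      exists y, [/\ disc z', c = zeta (b + y), `|y| < (2 ^+ m)^-1, cIm w < 0 -> 0 < y & 0 < cIm w -> y < 0].
    move=> hz c1 sc; have [dz' hw' hc] := seen_near b dz hz c1 sc.
    have [n1 n2] := noncone_stable nc hw'.
    have [y [ec hy yp yn]] := circle_param b c1.
    have zle : rnorm (ww z' b) < 1.
      have := ler_rnormD (ww z' b - w) w; rewrite subrK.
      have : 16 * rnorm w * 1 <= 16 * rnorm w * 2 ^+ j.
        by rewrite ler_wpM2l ?mulr_ge0 ?(ltW w0)// exprn_ege1//; lra.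
      rewrite /w in hw' *; lra.
    have := one_sided (rnorm_zeta b) c1 sc zle n1.
    have eI : cIm (z' * cconj (zeta b)) = - cIm (ww z' b) by rewrite [in RHS]cImD cImN cIm1 add0r opprK.
    rewrite eI mulNr oppr_gt0 => sg.
    exists y; split=> //.
    - have : 5 * rnorm w < (2 ^+ m)^-1 by rewrite -[(2 ^+ m)^-1]mul1r ltr_pdivlMr//; have := mulr_gt0 w0 (p2 m); lra.
      by move=> h5; apply: le_lt_trans hy (le_lt_trans hc h5).
    - move=> iw; apply: yp; rewrite -/w in n2; nra.
    - move=> iw; apply: yn; rewrite -/w in n2; nra.
  have dz' z' : rnorm (z' - z) <= (1 - rnorm z) / 16 -> disc z'.
    rewrite /disc /= in dz *; have := ler_rnormD (z' - z) z; rewrite subrK; lra.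
  have [iw|iw] := ltP (cIm w) 0.
    have [k' k'm hk'] := @upper_arc R j k m kj jm; exists k' => // z' hz'.
    apply: tent_intro => [|c c1 sc]; first exact: dz'.
    have [y [_ -> hy /(_ iw) y0 _]] := near z' c hz' c1 sc.
    by apply: hk'; [exact: ltW|exact: le_lt_trans (ler_norm _) hy].
  have iw' : 0 < cIm w.
    rewrite lt_neqAle iw andbT eq_sym; apply/eqP => e; move: nc; rewrite e expr0n /= mulr0.
    by rewrite ltNge mulr_ge0 ?sqr_ge0.
  have [k' k'm hk'] := @lower_arc R j k m k0 kj jm; exists k' => // z' hz'.
  apply: tent_intro => [|c c1 sc]; first exact: dz'.
  have [y [_ -> hy _ /(_ iw') y0]] := near z' c hz' c1 sc.
  by apply: hk' => //; move: hy; rewrite ltr_norml => /andP[/ltW].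
apply: (le_trans (root_pointwise dz k'm hE)).
apply: ler_wpM2l.
  by rewrite !mulr_ge0 ?powR_ge0// ltW// root_const_gt0.
apply: ge0_ler_powR; rewrite ?nnegrE ?invr_ge0 ?(ltW q0) ?(ltW (p2 m))//.
  by rewrite mulr_ge0// ltW.
by rewrite -[(2 ^+ m)^-1]mul1r ler_pdivrMr// ltW.
Qed.

(** The crude bound valid inside the cone too: it uses the arc of [parent_arc], or the full circle
    for [j = 0], whose length does not shrink with [rnorm w]. *)
Lemma base_bound j k z : (k <= 2 ^ j)%N -> odd k || (j == 0%N) -> disc z ->
  let b := k%:R / 2 ^+ j in let w := ww z b in
  16 * rnorm w * 2 ^+ j <= 1 ->
  rnorm (h z) <= root_const * kap * powR (1 - rnorm z) (s - q^-1) * powR (2 / 2 ^+ j) q^-1.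
Proof.
move=> kj par dz; have p2 n : 0 < (2 : R) ^+ n by rewrite exprn_gt0.
have dz' z' : rnorm (z' - z) <= (1 - rnorm z) / 16 -> disc z'.
  rewrite /disc /= in dz *; have := ler_rnormD (z' - z) z; rewrite subrK; lra.
have c0 : 0 <= root_const * kap * powR (1 - rnorm z) (s - q^-1).
  by rewrite !mulr_ge0 ?powR_ge0// ltW// root_const_gt0.
case: j kj par => [|j] kj par b w wj; have w0 : 0 < rnorm w by [exact: ww_gt0].
  have hE z' : rnorm (z' - z) <= (1 - rnorm z) / 16 -> tent (dyadic_arc 0 0) z'.
    by move=> hz'; apply: tent_intro => [|c c1 _]; [exact: dz'|exact: dyadic_arc_full].
  apply: (le_trans (root_pointwise dz (isT : (0 < 2 ^ 0)%N) hE)).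
  apply: ler_wpM2l => //; apply: ge0_ler_powR; rewrite ?nnegrE ?invr_ge0 ?(ltW q0)//.
  by rewrite expr0 invr1 mulr1; lra.
have [k' k'm hk'] := @parent_arc R j k ltac:(by move: par; rewrite orbF) kj.
have hE z' : rnorm (z' - z) <= (1 - rnorm z) / 16 -> tent (dyadic_arc j k') z'.
  move=> hz'; apply: tent_intro => [|c c1 sc]; first exact: dz'.
  have [_ _ hc] := seen_near b dz hz' c1 sc.
  have [y [ec hy _ _]] := circle_param b c1; rewrite ec.
  apply: hk'; apply: le_lt_trans hy (le_lt_trans hc _).
  by rewrite -/w -[(2 ^+ j.+1)^-1]mul1r ltr_pdivlMr//; have := mulr_gt0 w0 (p2 j.+1); lra.
apply: (le_trans (root_pointwise dz k'm hE)).
apply: ler_wpM2l => //; apply: ge0_ler_powR; rewrite ?nnegrE ?invr_ge0 ?(ltW q0) ?(ltW (p2 _))//.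
by rewrite exprS invfM mulrA divff ?mul1r.
Qed.

End pointwise_bounds.

(** * A Phragmen-Lindelof argument at a boundary point *)

Section phragmen_lindelof.
Context {R : realType}.
Variable X : normedModType (CC R).
Implicit Types (w u : CC R).

Lemma has_cderivX (f : CC R -> CC R) w d (n : nat) : has_cderiv f w d -> exists d', has_cderiv (fun t : CC R => f t ^+ n : CC R) w d'.
Proof.
move=> hf; elim: n => [|n [d' ih]]; first by exists 0; exact: has_cderiv_cst.
exists (d *: (f w ^+ n) + f w *: d').
by apply: (has_cderiv_unique_ext _ (has_cderivZ hf ih)) => t; rewrite exprS.
Qed.

Lemma disc_shift_norm w : rnorm (1 - w) ^+ 2 = 1 - 2 * cRe w + rnorm w ^+ 2.
Proof. by rewrite !rnorm_sqr !ccE; ring. Qed.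

Lemma depth_ge w (a : R) : rnorm (1 - w) < 1 -> a <= 2 * cRe w - rnorm w ^+ 2 -> a / 2 <= 1 - rnorm (1 - w).
Proof.
move=> w1; have := disc_shift_norm w; have := rnorm_ge0 (1 - w).
by move: (rnorm (1 - w)) w1 => x x1 x0 e h; nra.
Qed.

Lemma cone_cRe w : rnorm (1 - w) < 1 -> 5 * cIm w ^+ 2 <= 3 * cRe w ^+ 2 -> 79 / 100 * rnorm w <= cRe w.
Proof.
move=> w1 cw; have e := disc_shift_norm w; have n2 := rnorm_sqr w.
have n0 := rnorm_ge0 w; have x0 := rnorm_ge0 (1 - w).
have r0 : 0 <= cRe w.
  have : rnorm (1 - w) ^+ 2 <= 1 by rewrite expr_le1// ltW.
  have := sqr_ge0 (rnorm w); lra.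
rewrite -ler_sqr ?nnegrE ?mulr_ge0// exprMn n2; have := sqr_ge0 (cIm w); have := sqr_ge0 (cRe w); lra.
Qed.

Variables (H : CC R -> X) (s q T C : R).
Hypothesis s0 : s < 0.
Hypothesis q1 : 1 <= q.
Let sg := s - q^-1.
Hypothesis T0 : 0 < T.
Hypothesis T1 : T <= 1 / 32.
Hypothesis C0 : 0 <= C.
Hypothesis Hd : forall w, rnorm (1 - w) < 1 -> exists d, has_cderiv H w d.
Hypothesis Hnc : forall w, rnorm (1 - w) < 1 -> rnorm w <= 2 * T -> 3 * cRe w ^+ 2 < 5 * cIm w ^+ 2 ->
  rnorm (H w) <= C * powR (1 - rnorm (1 - w)) sg * powR (16 * rnorm w) q^-1.
Hypothesis Hb : forall w, rnorm (1 - w) < 1 -> rnorm w <= 2 * T ->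
  rnorm (H w) <= C * powR (1 - rnorm (1 - w)) sg * powR (64 * T) q^-1.

Let q0 : 0 < q. Proof. exact: lt_le_trans q1. Qed.
Let iq0 : 0 < q^-1. Proof. by rewrite invr_gt0. Qed.
Let sg0 : 0 <= - sg. Proof. by rewrite /sg opprB subr_ge0 (le_trans (ltW s0))// ltW. Qed.

(** At least [1 - 2 * sg]: in the auxiliary function the factor [(1 + u) ^+ N] beats
    [powR (rnorm (1 + u)) (2 * sg)] with one power to spare. *)
Definition pl_order : nat := Num.bound (1 + 2 * q^-1 - 2 * s).
Local Notation N := pl_order.
Let N1 : 1 + 2 * q^-1 - 2 * s <= N%:R.
Proof.
apply: ltW; apply: archi_boundP.
by have := iq0; have := s0; lra.
Qed.

(** On the far part of the cone [cRe u >= 1 / 8], so the exponential is at most [expR (- N%:R)]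
    there. *)
Definition pl_rate : R := 8 * N%:R.
Local Notation c := pl_rate.
(** The first entry serves the top scale, the second the points off the cone. It depends on neither
    the scale nor [T], so the induction over scales does not lose. *)
Definition pl_const : R := Num.max (powR (3 / 4) sg * powR 96 q^-1)
  (expR c * powR 4 (- sg) * powR 16 q^-1 * 2 ^+ N).
Local Notation A := pl_const.

Let c0 : 0 <= c. Proof. by rewrite mulr_ge0. Qed.

Let powR_nonincr (x y : R) : 0 < x -> x <= y -> powR y sg <= powR x sg.
Proof. by move=> x0 xy; have := ge0_powRN_le sg0 x0 xy; rewrite opprK. Qed.

Let w_neq0 w : rnorm (1 - w) < 1 -> 0 < rnorm w.
Proof.
move=> w1; rewrite lt_neqAle rnorm_ge0 andbT eq_sym rnorm_eq0; apply/eqP => e.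
by move: w1; rewrite e subr0 rnorm1 ltxx.
Qed.

(** At the top scale [T] is comparable with [rnorm w], and in the cone the depth is as well, so the
    crude bound [Hb] already has the right size. *)
Lemma pl_base w : rnorm (1 - w) < 1 -> 2 / 3 * T <= rnorm w -> rnorm w <= 2 * T ->
  5 * cIm w ^+ 2 <= 3 * cRe w ^+ 2 -> rnorm (H w) <= C * A * powR (rnorm w) s.
Proof.
move=> w1 wT wT2 cw; have w0 := w_neq0 w1.
have d1 : 3 / 4 * rnorm w <= 1 - rnorm (1 - w).
  have := @depth_ge w (3 / 2 * rnorm w) w1; rewrite (_ : 3 / 2 * rnorm w / 2 = 3 / 4 * rnorm w); last by field.
  have h1 := cone_cRe w1 cw.
  have h2 : rnorm w * rnorm w <= 1 / 16 * rnorm w by rewrite ler_wpM2r ?rnorm_ge0//; have := T1; lra.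
  by apply; rewrite expr2; lra.
apply: (le_trans (Hb w1 wT2)); rewrite -!mulrA; apply: ler_wpM2l => //.
have w34 : 0 < 3 / 4 * rnorm w by rewrite mulr_gt0// divr_gt0.
have h1 := powR_nonincr w34 d1.
have h2 : powR (64 * T) q^-1 <= powR (96 * rnorm w) q^-1.
  by apply: ge0_ler_powR; rewrite ?nnegrE ?(ltW iq0) ?mulr_ge0 ?(ltW w0) ?(ltW T0)//; lra.
apply: (le_trans (ler_pM (powR_ge0 _ _) (powR_ge0 _ _) h1 h2)).
rewrite powRM ?(ltW w0)// ?divr_ge0// powRM ?(ltW w0)//.
have -> : powR (rnorm w) s = powR (rnorm w) sg * powR (rnorm w) q^-1.
  by rewrite -powRD /sg ?subrK//; apply/implyP => _; rewrite gt_eqF.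
rewrite mulrACA ler_wpM2r ?mulr_ge0 ?powR_ge0//.
by rewrite /pl_const le_max lexx.
Qed.

Section step.
Variable t : R.
Hypothesis t0 : 0 < t.
Hypothesis tT : t <= T.
Hypothesis ih : forall w, rnorm (1 - w) < 1 -> 3 / 2 * t <= rnorm w -> rnorm w <= 2 * T ->
  5 * cIm w ^+ 2 <= 3 * cRe w ^+ 2 -> rnorm (H w) <= C * A * powR (rnorm w) s.

Let W u : CC R := rC t * (1 + u).
(* [(1 + u) ^+ N] absorbs the blow-up of [H] at the boundary point 0, and the decay of [cexp (- c u)] beats
   the factor [(1 + u) ^+ N] on the far side [3 / 2 * t <= rnorm (W u)], where the induction hypothesis applies. *)
Let F u : X := ((1 + u) ^+ N * cexp (rC (- c) * u)) *: H (W u).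

Let WD u : rnorm u < 1 -> rnorm (1 - W u) < 1.
Proof.
move=> u1; have -> : 1 - W u = rC (1 - t) - rC t * u by rewrite /W rC_1B; ring.
have := ler_rnormD (rC (1 - t)) (- (rC t * u)); rewrite rnormN rnormM !rnorm_rC_ge0 ?(ltW t0)//; last by have := T1; have := tT; lra.
have : t * rnorm u < t * 1 by rewrite ltr_pM2l.
lra.
Qed.

Let Wn u : rnorm (W u) = t * rnorm (1 + u).
Proof. by rewrite /W rnormM rnorm_rC_ge0 ?(ltW t0). Qed.

Let Wre u : cRe (W u) = t * (1 + cRe u).
Proof. by rewrite /W !ccE mul0r subr0. Qed.

Let dn u : rnorm u < 1 -> 0 < rnorm (1 + u) /\ rnorm (1 + u) < 2.
Proof.
move=> u1; split; last by have := ler_rnormD (1 : CC R) u; rewrite rnorm1; lra.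
have := ler_rnormD (1 + u) (- u); rewrite addrK rnormN rnorm1; lra.
Qed.

(** [W] maps the unit disc onto a disc of radius [t] internally tangent to the circle at 0, so
    towards the tangency the depth may be quadratic in [rnorm (1 + u)]. *)
Let Wdepth u : rnorm u < 1 -> t * rnorm (1 + u) ^+ 2 / 4 <= 1 - rnorm (1 - W u).
Proof.
move=> u1; have u2 : rnorm u ^+ 2 <= 1 by rewrite expr_le1 ?rnorm_ge0// ltW.
have := @depth_ge (W u) (t * rnorm (1 + u) ^+ 2 / 2) (WD u1).
rewrite (_ : _ / 2 / 2 = t * rnorm (1 + u) ^+ 2 / 4); last by field.
apply; rewrite Wn Wre exprMn.
have : rnorm (1 + u) ^+ 2 = 1 + 2 * cRe u + rnorm u ^+ 2 by rewrite !rnorm_sqr !ccE; ring.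
move: (rnorm (1 + u) ^+ 2) (rnorm u ^+ 2) u2 (sqr_ge0 (rnorm (1 + u))) => D U u2 D0 e.
have h1 : D <= 2 * (1 + cRe u) by lra.
have : t * D <= t * (2 * (1 + cRe u)) by rewrite ler_pM2l.
have : t * (t * D) <= 1 / 2 * (t * D) by rewrite ler_wpM2r ?mulr_ge0 ?(ltW t0)//; have := T1; have := tT; lra.
by rewrite expr2; lra.
Qed.

Let Fd u : rnorm u < 1 -> exists d, has_cderiv F u d.
Proof.
move=> u1.
have h1 := has_cderivD (has_cderiv_cst (1 : CC R) u) (has_cderiv_id u).
have [d2 h2] := has_cderivX N h1.
have h3 : has_cderiv (fun v : CC R => rC (- c) * v) u (0 *: u + rC (- c) *: 1).
  exact: (has_cderivZ (has_cderiv_cst _ _) (has_cderiv_id _)).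
have h4 := has_cderiv_comp h3 (has_cderiv_cexp _).
have h5 := has_cderivZ h2 h4.
have h6 : has_cderiv W u (0 *: (1 + u) + rC t *: (0 + 1)).
  exact: (has_cderivZ (has_cderiv_cst _ _) h1).
have [d7 h7] := Hd (WD u1).
by eexists; exact: (has_cderivZ h5 (has_cderiv_comp h6 h7)).
Qed.

Let Fn u : rnorm (F u) = rnorm (1 + u) ^+ N * expR (- c * cRe u) * rnorm (H (W u)).
Proof. by rewrite /F rnormZ rnormM rnormX rnorm_cexp !ccE mul0r subr0. Qed.

Let ce u : rnorm u < 1 -> expR (- c * cRe u) <= expR c.
Proof.
move=> u1; rewrite ler_expR mulNr.
have := cRe_le u; rewrite ler_norml => /andP[h1 h2].
have : c * (- cRe u) <= c * 1 by rewrite ler_wpM2l//; lra.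
lra.
Qed.

Let powsg u : rnorm u < 1 -> powR (1 - rnorm (1 - W u)) sg <=
  powR 4 (- sg) * powR t sg * powR (rnorm (1 + u)) (2 * sg).
Proof.
move=> u1; have [d0 d2] := dn u1.
have p0 : 0 < t * rnorm (1 + u) ^+ 2 / 4 by rewrite divr_gt0// mulr_gt0// exprn_gt0.
apply: (le_trans (powR_nonincr p0 (Wdepth u1))).
have t2 : 0 <= t * rnorm (1 + u) ^+ 2 by rewrite ltW// mulr_gt0// exprn_gt0.
have i4 : 0 <= (4^-1 : R) by rewrite invr_ge0.
rewrite (powRM _ t2 i4) (powRM _ (ltW t0) (sqr_ge0 _)).
rewrite -(powR_mulrn 2 (ltW d0)) -powRrM -(powR_inv1 (_ : 0 <= 4 :> R))// -powRrM mulN1r.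
by rewrite le_eqVlt; apply/orP; left; apply/eqP; ring.
Qed.

Let M := C * A * powR t s.

Let A0 : 0 <= A.
Proof. by rewrite /pl_const le_max mulr_ge0 ?powR_ge0. Qed.

Let tsE : powR t s = powR t sg * powR t q^-1.
Proof. by rewrite -powRD /sg ?subrK//; apply/implyP => _; rewrite gt_eqF. Qed.

Let pl_noncone u : rnorm u < 1 -> 3 * cRe (W u) ^+ 2 < 5 * cIm (W u) ^+ 2 -> rnorm (F u) <= M.
Proof.
move=> u1 nc; have [d0 d2] := dn u1; set d := rnorm (1 + u) in d0 d2.
have WT : rnorm (W u) <= 2 * T.
  have h0 : t * d <= t * 2 by rewrite ler_pM2l// ltW.
  by rewrite Wn -/d; have := tT; lra.
have h1 := Hnc (WD u1) WT nc.
have h2 : powR (16 * rnorm (W u)) q^-1 = powR 16 q^-1 * powR t q^-1 * powR d q^-1.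
  by rewrite Wn mulrA powRM ?mulr_ge0 ?(ltW t0) ?(ltW d0)// powRM ?(ltW t0).
rewrite h2 in h1; have h3 := powsg u1; rewrite -/d in h3.
have h4 : rnorm (H (W u)) <= C * (powR 4 (- sg) * powR t sg * powR d (2 * sg)) * (powR 16 q^-1 * powR t q^-1 * powR d q^-1).
  by apply: (le_trans h1); rewrite ler_wpM2r ?mulr_ge0 ?powR_ge0// ler_wpM2l.
have e1 : powR d (2 * sg) * powR d q^-1 * d ^+ N = powR d (N%:R + 2 * sg + q^-1).
  rewrite -(powR_mulrn N (ltW d0)) -!powRD; try by apply/implyP => _; rewrite gt_eqF.
  by congr (_ `^ _); ring.
have e2 : powR d (N%:R + 2 * sg + q^-1) <= 2 ^+ N.
  apply: (@le_trans _ _ (powR 2 (N%:R + 2 * sg + q^-1))).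
    by apply: ge0_ler_powR; rewrite ?nnegrE ?(ltW d0) ?(ltW d2)//; have := N1; have := iq0; rewrite /sg; lra.
  rewrite -powR_mulrn//; apply: ler_powR; first by lra.
  by have := iq0; have := s0; rewrite /sg; lra.
rewrite Fn -/d; apply: (@le_trans _ _ (d ^+ N * expR c * (C * (powR 4 (- sg) * powR t sg * powR d (2 * sg)) * (powR 16 q^-1 * powR t q^-1 * powR d q^-1)))).
  apply: ler_pM => //; rewrite ?rnorm_ge0 ?mulr_ge0 ?expR_ge0 ?exprn_ge0 ?(ltW d0)//.
  by rewrite ler_wpM2l ?exprn_ge0 ?(ltW d0)// ce.
rewrite (_ : _ * _ = C * (expR c * powR 4 (- sg) * powR 16 q^-1 * (powR d (2 * sg) * powR d q^-1 * d ^+ N)) * (powR t sg * powR t q^-1)); last by ring.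
rewrite e1 -tsE /M; apply: ler_wpM2r; first exact: powR_ge0.
apply: ler_wpM2l => //; apply: (@le_trans _ _ (expR c * powR 4 (- sg) * powR 16 q^-1 * 2 ^+ N)).
  by apply: ler_wpM2l => //; rewrite !mulr_ge0 ?powR_ge0 ?expR_ge0.
by rewrite /pl_const le_max lexx orbT.
Qed.

Let pl_top u : rnorm u < 1 -> 5 * cIm (W u) ^+ 2 <= 3 * cRe (W u) ^+ 2 -> 3 / 2 <= rnorm (1 + u) -> rnorm (F u) <= M.
Proof.
move=> u1 cn d32; have [d0 d2] := dn u1; set d := rnorm (1 + u) in d0 d2 d32.
have WT : rnorm (W u) <= 2 * T.
  have h0 : t * d <= t * 2 by rewrite ler_pM2l// ltW.
  by rewrite Wn -/d; have := tT; lra.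
have Wt : 3 / 2 * t <= rnorm (W u) by rewrite Wn -/d mulrC ler_pM2l.
have h1 := ih (WD u1) Wt WT cn.
(* In the cone [1 + cRe u] is at least 0.79 times [d >= 3 / 2]; the decay of the exponential then
   outweighs [d ^+ N]. *)
have re : 1 / 8 <= cRe u.
  have := cone_cRe (WD u1) cn; rewrite Wn Wre -/d mulrCA ler_pM2l//; lra.
have h2 : powR (rnorm (W u)) s <= powR t s.
  have ns0 : 0 <= - s by rewrite oppr_ge0 ltW.
  have := @ge0_powRN_le R t (rnorm (W u)) (- s) ns0 t0; rewrite opprK; apply.
  by have := ltW t0; lra.
have h3 : d ^+ N * expR (- c * cRe u) <= 1.
  have e1 : expR (- c * cRe u) <= expR (- N%:R).
    by rewrite ler_expR /pl_rate; have : (0 : R) <= N%:R by []; nra.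
  have e2 : d ^+ N <= expR N%:R.
    rewrite -[X in expR X]mulr1 expRM_natl; apply: lerXn2r; rewrite ?nnegrE ?(ltW d0) ?expR_ge0//.
    by have := expR_ge1Dx (1 : R); lra.
  apply: (@le_trans _ _ (expR N%:R * expR (- N%:R))).
    by apply: ler_pM => //; rewrite ?exprn_ge0 ?expR_ge0 ?(ltW d0).
  by rewrite -expRD subrr expR0.
rewrite Fn -/d -[leRHS]mul1r; apply: ler_pM => //; rewrite ?rnorm_ge0 ?mulr_ge0 ?exprn_ge0 ?expR_ge0 ?(ltW d0)//.
by apply: (le_trans h1); rewrite /M ler_wpM2l// mulr_ge0.
Qed.

Let pl_bottom e : 0 < e -> exists2 k : R, k < 1 & forall u, k < rnorm u < 1 ->
  5 * cIm (W u) ^+ 2 <= 3 * cRe (W u) ^+ 2 -> rnorm (1 + u) < 3 / 2 -> rnorm (F u) <= e.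
Proof.
move=> e0.
pose Q := expR c * (C * (powR 4 (- sg) * powR t sg) * powR (64 * T) q^-1).
have Q0 : 0 <= Q by rewrite !mulr_ge0 ?expR_ge0 ?powR_ge0.
pose m := Num.min 1 (e / (Q + 1)).
have m0 : 0 < m by rewrite lt_min ltr01 divr_gt0//; lra.
have m1 : m <= 1 by rewrite ge_min lexx.
exists (1 - m / 25); first by lra.
move=> u /andP[ku u1] cn; have [d0 d2] := dn u1; set d := rnorm (1 + u) in d0 d2 *; move=> d32.
(* For [rnorm u = 1] the cone would give [d ^+ 2 >= 1.58 * d], that is [d = 0] or [d >= 1.58]; with
   [d < 3 / 2] and [rnorm u] close to 1 only small [d] remain. *)
have dm : d < m.
  have h1 := cone_cRe (WD u1) cn; rewrite Wn Wre -/d mulrCA ler_pM2l// in h1.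
  have : d ^+ 2 = 1 + 2 * cRe u + rnorm u ^+ 2 by rewrite /d !rnorm_sqr !ccE; ring.
  have : (1 - m / 25) ^+ 2 < rnorm u ^+ 2 by rewrite ltr_sqr ?nnegrE ?rnorm_ge0//; lra.
  by move: (rnorm u ^+ 2) => U; nra.
have WT : rnorm (W u) <= 2 * T.
  have h0 : t * d <= t * 2 by rewrite ler_pM2l// ltW.
  by rewrite Wn -/d; have := tT; lra.
have h4 : rnorm (H (W u)) <= C * (powR 4 (- sg) * powR t sg * powR d (2 * sg)) * powR (64 * T) q^-1.
  apply: (le_trans (Hb (WD u1) WT)); rewrite ler_wpM2r ?powR_ge0// ler_wpM2l//.
  exact: powsg.
have e1 : powR d (2 * sg) * d ^+ N = powR d (N%:R + 2 * sg).
  rewrite -(powR_mulrn N (ltW d0)) -!powRD; try by apply/implyP => _; rewrite gt_eqF.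
  by congr (_ `^ _); ring.
have e2 : powR d (N%:R + 2 * sg) <= d.
  rewrite -[leRHS]powRr1 ?(ltW d0)//; apply: ger_powR; first by rewrite d0/=; lra.
  by have := N1; rewrite /sg; lra.
rewrite Fn -/d; apply: (@le_trans _ _ (d ^+ N * expR c * (C * (powR 4 (- sg) * powR t sg * powR d (2 * sg)) * powR (64 * T) q^-1))).
  apply: ler_pM => //; rewrite ?rnorm_ge0 ?mulr_ge0 ?expR_ge0 ?exprn_ge0 ?(ltW d0)//.
  by rewrite ler_wpM2l ?exprn_ge0 ?(ltW d0)// ce.
rewrite (_ : _ * _ = Q * (powR d (2 * sg) * d ^+ N)); last by rewrite /Q; ring.
rewrite e1; apply: (@le_trans _ _ (Q * d)); first by rewrite ler_wpM2l.
have : d <= e / (Q + 1) by apply: ltW; apply: (lt_le_trans dm); rewrite ge_min lexx orbT.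
rewrite ler_pdivlMr; last by lra.
by nra.
Qed.

(** The maximum principle for [F], with three zones near the boundary: outside the cone
    ([pl_noncone]), the far part of the cone ([pl_top], from the larger scales), and the vertex
    ([pl_bottom]), where [F] tends to 0. *)
Lemma pl_step w : rnorm (1 - w) < 1 -> rnorm w = t -> 5 * cIm w ^+ 2 <= 3 * cRe w ^+ 2 ->
  rnorm (H w) <= C * A * powR (rnorm w) s.
Proof.
move=> w1 wt cw.
have Fle u : rnorm u < 1 -> rnorm (F u) <= M.
  apply: (max_disc Fd) => e e0; have [k k1 hk] := pl_bottom e0.
  have M0 : 0 <= M by rewrite !mulr_ge0 ?powR_ge0.
  exists k => // v /andP[kv v1].
  have [nc|cn] := ltP (3 * cRe (W v) ^+ 2) (5 * cIm (W v) ^+ 2).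
    by apply: (le_trans (pl_noncone v1 nc)); rewrite lerDl ltW.
  have [h|h] := leP (3 / 2) (rnorm (1 + v)).
    by apply: (le_trans (pl_top v1 cn h)); rewrite lerDl ltW.
  by apply: (@le_trans _ _ e); [apply: hk => //; rewrite kv|rewrite lerDr].
pose u : CC R := rC t^-1 * w - 1.
have Wu : W u = w by rewrite /W /u addrC subrK mulrA -rCM divff ?gt_eqF// rC1 mul1r.
have d1 : rnorm (1 + u) = 1.
  by apply: (mulfI (lt0r_neq0 t0)); rewrite -Wn Wu wt mulr1.
have re := cone_cRe w1 cw; rewrite -Wu Wre Wn d1 mulr1 mulrC ler_pM2l// in re.
have d2 : 1 = 1 + 2 * cRe u + rnorm u ^+ 2.
  by have : rnorm (1 + u) ^+ 2 = 1 by [rewrite d1 expr1n]; rewrite !rnorm_sqr !ccE; lra.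
have u1 : rnorm u < 1.
  by rewrite -(@ltr_pXn2r _ 2) ?nnegrE ?rnorm_ge0// expr1n; lra.
have := Fle _ u1; rewrite Fn d1 expr1n mul1r Wu /M wt; apply: le_trans.
(* [rnorm (1 + u) = 1] forces [cRe u <= 0], so the exponential factor does not shrink the value at
   the point of interest. *)
have E1 : 1 <= expR (- c * cRe u).
  rewrite -expR0 ler_expR; have := sqr_ge0 (rnorm u); have := c0; nra.
by rewrite -[leLHS]mul1r ler_wpM2r ?rnorm_ge0.
Qed.

End step.

Theorem phragmen_lindelof_cone w : rnorm (1 - w) < 1 -> rnorm w <= 2 * T -> 5 * cIm w ^+ 2 <= 3 * cRe w ^+ 2 ->
  rnorm (H w) <= C * A * powR (rnorm w) s.
Proof.
(* The step at scale [t] calls on points with [rnorm w >= 3 / 2 * t], so each round lowers the scale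
   by the factor 2/3 with the same constant. *)
have main (n : nat) : forall w, rnorm (1 - w) < 1 -> (2 / 3) ^+ n.+1 * T <= rnorm w -> rnorm w <= 2 * T ->
    5 * cIm w ^+ 2 <= 3 * cRe w ^+ 2 -> rnorm (H w) <= C * A * powR (rnorm w) s.
  elim: n => [|n ihn] v v1 hv1 hv2 cv; first by apply: pl_base; rewrite // expr1 in hv1.
  have [h|h] := leP ((2 / 3) ^+ n.+1 * T) (rnorm v); first exact: ihn.
  have e23 : (2 / 3 : R) ^+ n.+1 <= 1 by rewrite exprn_ile1//; lra.
  have vT : rnorm v <= T.
    by apply: (le_trans (ltW h)); rewrite -[leRHS]mul1r ler_wpM2r// ltW.
  apply: (@pl_step (rnorm v)) => //; first exact: w_neq0.
  move=> w' w'1 hw1 hw2 cw'; apply: ihn => //; apply: le_trans hw1.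
  by rewrite exprS in hv1; lra.
move=> w1 wT cw; have w0 := w_neq0 w1.
have [n hn] : exists n : nat, (2 / 3) ^+ n.+1 * T <= rnorm w.
  have r01 : 0 <= (2 / 3 : R) < 1 by apply/andP; split; lra.
  have [n hn] := expr_small r01 (divr_gt0 w0 T0).
  exists n; rewrite -ler_pdivlMr//; apply: le_trans (ltW hn).
  by rewrite exprS ler_piMl ?exprn_ge0//; lra.
exact: (main n).
Qed.

End phragmen_lindelof.

(** * Masses of discs centred on the circle *)

Section shells.
Context {R : realType}.
Local Notation RM := (measurableTypeR R).
Local Notation mu := (@lebesgue_measure R).

Definition disc_at (z0 : CC R) (r : R) : set (RM * RM) := [set p | rnorm (toC p - z0) <= r].

Lemma measurable_disc_at z0 r : measurable (disc_at z0 r).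
Proof.
apply: measurable_le_set; last exact: measurable_cst.
by apply: measurable_rnorm; apply: cmeasB; [exact: cmeas_toC|exact: cmeas_cst].
Qed.

Lemma area_disc_at z0 r : 0 <= r -> (area (disc_at z0 r) <= (4 * r ^+ 2)%:E)%E.
Proof.
move=> r0; pose J (a : R) : set RM := `[a - r, a + r]%classic.
have mJ a : mu (J a) = (2 * r)%:E.
  rewrite lebesgue_measure_itv /= lte_fin; case: ltP => h; rewrite -?EFinB; congr (_%:E); lra.
apply: (@le_trans _ _ (area (J (cRe z0) `*` J (cIm z0)))); last first.
  by rewrite area_rect ?mJ -?EFinM ?lee_fin; try exact: measurable_itv; lra.
apply: le_measure; rewrite ?inE; first exact: measurable_disc_at.
  by apply: measurableX; exact: measurable_itv.
move=> [a b]; rewrite /disc_at /= => h.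
have := le_trans (cRe_le (toC (a, b) - z0)) h; have := le_trans (cIm_le (toC (a, b) - z0)) h.
rewrite !ccE /toC /= /J /= !in_itv /= !ler_norml.
rewrite -/(cRe z0) -/(cIm z0) => /andP[h1 h2] /andP[h3 h4].
by rewrite /cRe /cIm /= in h1 h2 h3 h4 *; split; apply/andP; split; lra.
Qed.

Lemma inv_le_shells (rho r : R) : 0 < r -> 0 <= rho <= r ->
  ((rho^-1)%:E <= \sum_(0 <= n <oo) ((2 ^+ n.+1 / r)%:E * ((rho <= 2 ^- n * r)%R%:R)%:E))%E.
Proof.
move=> r0 /andP[rho0 rhor]; have p2 n : 0 < (2 : R) ^+ n by rewrite exprn_gt0.
have t0 n : (0 <= (2 ^+ n.+1 / r)%:E * ((rho <= 2 ^- n * r)%R%:R)%:E :> \bar R)%E.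
  by rewrite mule_ge0// lee_fin// divr_ge0 ?ltW.
have [e|rn0] := eqVneq rho 0; first by rewrite {1}e invr0; apply: nneseries_ge0.
have rp : 0 < rho by rewrite lt_neqAle eq_sym rn0.
have [n n1 n2] : exists2 n : nat, rho <= 2 ^- n * r & r < 2 ^+ n.+1 * rho.
  have ex : exists n : nat, r < 2 ^+ n.+1 * rho.
    have [n hn] := pow2_big (r / rho); exists n; rewrite -ltr_pdivrMr//.
    by apply: (lt_le_trans hn); rewrite exprS ler_peMl ?(ltW (p2 n))//; lra.
  case: (ex_minnP ex) => -[|n] h1 hmin; first by exists 0%N; rewrite // expr0 invr1 mul1r.
  exists n.+1 => //; rewrite mulrC ler_pdivlMr// mulrC leNgt; apply/negP => h2.
  by have := hmin _ h2; rewrite ltnn.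
apply: (@le_trans _ _ (\sum_(0 <= i < n.+1) ((2 ^+ i.+1 / r)%:E * ((rho <= 2 ^- i * r)%R%:R)%:E))%E); last first.
  by apply: nneseries_lim_ge => k _ _; exact: t0.
rewrite big_nat_recr//=; apply: (@le_trans _ _ ((2 ^+ n.+1 / r)%:E * ((rho <= 2 ^- n * r)%R%:R)%:E)%E); last first.
  by rewrite leeDr// sume_ge0.
by rewrite n1 mule1 lee_fin -[rho^-1]mul1r ler_pdivrMr// mulrAC ler_pdivlMr// mul1r ltW.
Qed.

(** The [n]-th disc contributes area [4 * (2 ^- n * r) ^+ 2] times [2 ^+ n.+1 / r], a geometric
    series. *)
Lemma integral_inv_disc z0 r : 0 < r ->
  (\int[area]_(p in disc_at z0 r) ((rnorm (toC p - z0))^-1)%:E <= (16 * r)%:E)%E.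
Proof.
move=> r0; have p2 n : 0 < (2 : R) ^+ n by rewrite exprn_gt0.
pose f n (p : RM * RM) : \bar R := ((2 ^+ n.+1 / r)%:E * (\1_(disc_at z0 (2 ^- n * r)) p)%:E)%E.
have f0 n p : (0 <= f n p)%E by rewrite mule_ge0// lee_fin// divr_ge0 ?ltW.
have mf n : measurable_fun setT (f n).
  apply: emeasurable_funM; first exact: measurable_cst.
  by apply/measurable_EFinP; apply: measurable_indic; exact: measurable_disc_at.
apply: (@le_trans _ _ (\int[area]_p \sum_(0 <= n <oo) f n p)%E).
  apply: ge0_integral_le_patch => p.
  - by move=> _; rewrite lee_fin invr_ge0 rnorm_ge0.
  - by move=> _; apply: nneseries_ge0.
  move=> hp; split=> //; have hp' : 0 <= rnorm (toC p - z0) <= r by rewrite rnorm_ge0.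
  apply: (le_trans (inv_le_shells r0 hp')); apply: lee_nneseries => n _.
    by move=> _; rewrite mule_ge0// lee_fin// divr_ge0 ?ltW.
  by rewrite /f indicE /disc_at mem_setE.
rewrite integral_nneseries//.
have an n : (\int[area]_p f n p <= (8 * r * 2 ^- n)%:E)%E.
  rewrite ge0_integralZl_EFin//; first last.
  - by rewrite divr_ge0 ?ltW.
  - by apply/measurable_EFinP; apply: measurable_indic; exact: measurable_disc_at.
  rewrite integral_indic ?setIT//; last exact: measurable_disc_at.
  have pn : 0 <= 2 ^- n * r by rewrite mulr_ge0 ?(ltW r0)// invr_ge0 ltW.
  apply: (@le_trans _ _ ((2 ^+ n.+1 / r)%:E * (4 * (2 ^- n * r) ^+ 2)%:E)%E).
    by apply: lee_wpmul2l; [rewrite lee_fin divr_ge0 ?ltW|exact: area_disc_at].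
  rewrite -EFinM lee_fin le_eqVlt; apply/orP; left; apply/eqP; rewrite exprS.
  by field; rewrite !gt_eqF.
have geo (m : nat) : \sum_(i < m) 8 * r * 2 ^- i = 16 * r * (1 - 2 ^- m).
  elim: m => [|m ihm]; first by rewrite big_ord0 expr0 invr1 subrr mulr0.
  by rewrite big_ord_recr /= ihm exprS; field; rewrite gt_eqF.
apply: lime_le.
  by apply: is_cvg_nneseries => n _ _; exact: integral_ge0.
near=> m; apply: (@le_trans _ _ (\sum_(0 <= n < m) (8 * r * 2 ^- n)%:E)%E); first exact: lee_sum.
rewrite sumEFin lee_fin big_mkord geo.
have : 0 <= (2 : R) ^- m by rewrite invr_ge0 ltW.
by have := r0; nra.
Unshelve. all: end_near.
Qed.

End shells.

Section carleson_measure.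
Context {R : realType}.
Local Notation RM := (measurableTypeR R).
Local Notation mu := (@lebesgue_measure R).
Variable X : normedModType (CC R).
Variables (s q : R).
Hypothesis s0 : s < 0.
Hypothesis q1 : 1 <= q.
Let q0 : 0 < q. Proof. exact: lt_le_trans q1. Qed.
Variables (h : CC R -> X) (K : R).
Hypothesis ah : analytic h.
Hypothesis K0 : 0 <= K.
Hypothesis hK : forall j k, (k < 2 ^ j)%N -> (tent_mass s q h (dyadic_arc j k) <= (K / 2 ^+ j)%:E)%E.
Local Notation kap := (powR K q^-1).
Local Notation ww z b := (1 - z * cconj (zeta b)).
Let p2 n : 0 < (2 : R) ^+ n. Proof. by rewrite exprn_gt0. Qed.

Let rc0 : 0 <= root_const s q * kap.
Proof. by rewrite mulr_ge0 ?powR_ge0// ltW// root_const_gt0. Qed.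

Let cone_bound_reduced j k z : (0 < k)%N -> (k <= 2 ^ j)%N -> odd k || (j == 0%N) -> disc z ->
  let b := k%:R / 2 ^+ j in let w := ww z b in
  16 * rnorm w * 2 ^+ j <= 1 -> 5 * cIm w ^+ 2 <= 3 * cRe w ^+ 2 ->
  rnorm (h z) <= root_const s q * kap * pl_const s q * powR (rnorm w) s.
Proof.
move=> k0 kj par dz b w wj cw.
have zz : zeta b * cconj (zeta b) = 1 by rewrite mul_cconj rnorm_zeta expr1n rC1.
(* The dyadic point is moved to 0. With this [T], the condition [rnorm w <= 2 * T] is
   [16 * rnorm w * 2 ^+ j <= 1], and [64 * T] is the [2 / 2 ^+ j] of [base_bound]. *)
pose H t := h (zeta b * (1 - t)); pose T : R := (32 * 2 ^+ j)^-1.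
have T0 : 0 < T by rewrite invr_gt0 mulr_gt0.
have T1 : T <= 1 / 32.
  have j1 : 1 <= (2 : R) ^+ j by rewrite exprn_ege1//; lra.
  rewrite div1r lef_pV2 ?posrE ?mulr_gt0//; lra.
have TE : T * (32 * 2 ^+ j) = 1 by rewrite mulVf// gt_eqF// mulr_gt0.
have zn t : rnorm (zeta b * (1 - t)) = rnorm (1 - t) by rewrite rnormM rnorm_zeta mul1r.
have wz t : ww (zeta b * (1 - t)) b = t.
  by rewrite mulrAC zz mul1r subKr.
have wT (t : CC R) : rnorm t <= 2 * T -> 16 * rnorm t * 2 ^+ j <= 1.
  move=> ht; have : rnorm t * (16 * 2 ^+ j) <= 2 * T * (16 * 2 ^+ j) by rewrite ler_wpM2r// mulr_ge0// ltW.
  lra.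
have Hd (t : CC R) : rnorm (1 - t) < 1 -> exists d, has_cderiv H t d.
  move=> t1; have h1 : has_cderiv (fun v : CC R => - v) t (0 *: t + (-1) *: 1).
    apply: (has_cderiv_unique_ext (f := fun v : CC R => (-1 : CC R) *: (v : CC R))); first by move=> v; rewrite scaleN1r.
    exact: (has_cderivZ (has_cderiv_cst _ _) (has_cderiv_id _)).
  have h2 := has_cderivD (has_cderiv_cst (1 : CC R) t) h1.
  have h3 := has_cderivZ (has_cderiv_cst (zeta b) t) h2.
  have dt : disc (zeta b * (1 - t)) by rewrite /disc /= zn.
  by eexists; exact: (has_cderiv_comp h3 (derivable_has_cderiv (ah dt))).
have Hnc (t : CC R) : rnorm (1 - t) < 1 -> rnorm t <= 2 * T -> 3 * cRe t ^+ 2 < 5 * cIm t ^+ 2 ->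
    rnorm (H t) <= root_const s q * kap * powR (1 - rnorm (1 - t)) (s - q^-1) * powR (16 * rnorm t) q^-1.
  move=> t1 tT nc; have dt : disc (zeta b * (1 - t)) by rewrite /disc /= zn.
  have := noncone_bound q1 ah K0 hK k0 kj dt.
  rewrite [X in X -> _]/=.
  by rewrite wz zn; apply=> //; exact: wT.
have Hb (t : CC R) : rnorm (1 - t) < 1 -> rnorm t <= 2 * T ->
    rnorm (H t) <= root_const s q * kap * powR (1 - rnorm (1 - t)) (s - q^-1) * powR (64 * T) q^-1.
  move=> t1 tT; have dt : disc (zeta b * (1 - t)) by rewrite /disc /= zn.
  have -> : 64 * T = 2 / 2 ^+ j by rewrite /T; field; rewrite gt_eqF.
  have := base_bound q1 ah K0 hK kj par dt.
  by cbv zeta; rewrite wz zn; apply; exact: wT.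
have w1 : rnorm (1 - w) < 1 by rewrite /w subKr rnormM rnorm_cconj rnorm_zeta mulr1.
have hw2 : rnorm w <= 2 * T.
  rewrite -(@ler_pM2r _ (16 * 2 ^+ j)) ?mulr_gt0//; rewrite -/w in wj; lra.
have := @phragmen_lindelof_cone R X H s q T _ s0 q1 T0 T1 rc0 Hd Hnc Hb w w1 hw2 cw.
by rewrite /H /w subKr mulrCA zz mulr1.
Qed.

(** The fraction [k / 2 ^+ j] is reduced until its numerator is odd; a lower generation only weakens
    the smallness condition on [rnorm w]. *)
Lemma cone_bound j k z : (0 < k)%N -> (k <= 2 ^ j)%N -> disc z ->
  let b := k%:R / 2 ^+ j in let w := ww z b in
  16 * rnorm w * 2 ^+ j <= 1 -> 5 * cIm w ^+ 2 <= 3 * cRe w ^+ 2 ->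
  rnorm (h z) <= root_const s q * kap * pl_const s q * powR (rnorm w) s.
Proof.
elim: j k => [|j ih] k k0 kj dz b w wj cw.
  by apply: (cone_bound_reduced k0 kj) => //; rewrite eqxx orbT.
case: (boolP (odd k)) => [ok|ek].
  by apply: (cone_bound_reduced k0 kj) => //; rewrite ok.
have e2 : k = (k./2).*2 by rewrite -{1}[k]odd_double_half (negbTE ek).
have k0' : (0 < k./2)%N by lia.
have kj' : (k./2 <= 2 ^ j)%N by move: kj; rewrite expnS; lia.
have eb : b = (k./2)%:R / 2 ^+ j.
  by rewrite /b {1}e2 -muln2 natrM exprS; field; rewrite gt_eqF.
have := ih k./2 k0' kj' dz; rewrite -eb; apply=> //.
have := mulr_ge0 (rnorm_ge0 w) (ltW (p2 j)); rewrite /w in wj *.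
by rewrite exprS in wj; lra.
Qed.

Definition cone_mass_const : R := powR (root_const s q * pl_const s q) q * (4 / 3).

Lemma cone_weight j k z : (0 < k)%N -> (k <= 2 ^ j)%N -> disc z ->
  let b := k%:R / 2 ^+ j in let w := ww z b in
  16 * rnorm w * 2 ^+ j <= 1 -> 5 * cIm w ^+ 2 <= 3 * cRe w ^+ 2 ->
  weight (-1) s q h z <= cone_mass_const * K * (rnorm (z - zeta b))^-1.
Proof.
move=> k0 kj dz b w wj cw; have hz := cone_bound k0 kj dz wj cw.
have w0 : 0 < rnorm w by exact: ww_gt0.
have wd : rnorm w = rnorm (z - zeta b) by rewrite ww_dist -rnormN opprB.
have d0 : 0 < 1 - rnorm z by rewrite subr_gt0.
have zw : rnorm (1 - w) = rnorm z by rewrite /w subKr rnormM rnorm_cconj rnorm_zeta mulr1.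
have w16 : 16 * rnorm w <= 1.
  have : 16 * rnorm w * 1 <= 16 * rnorm w * 2 ^+ j.
    by rewrite ler_wpM2l ?mulr_ge0 ?(ltW w0)// exprn_ege1//; lra.
  rewrite -/w in wj; lra.
have w1 : rnorm (1 - w) < 1 by rewrite zw.
have dw : 3 / 4 * rnorm w <= 1 - rnorm z.
  have := @depth_ge R w (3 / 2 * rnorm w) w1; rewrite zw (_ : 3 / 2 * rnorm w / 2 = 3 / 4 * rnorm w); last by field.
  have h1 := cone_cRe w1 cw.
  have h2 : rnorm w * rnorm w <= 1 / 16 * rnorm w by rewrite ler_wpM2r ?rnorm_ge0//; lra.
  by apply; rewrite expr2; lra.
have dle : 1 - rnorm z <= rnorm w.
  by rewrite ww_dist; have := ler_rnormD (zeta b - z) z; rewrite subrK rnorm_zeta; lra.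
have pl0 : 0 <= pl_const s q by rewrite /pl_const le_max mulr_ge0 ?powR_ge0.
have rp0 : 0 <= root_const s q * pl_const s q by rewrite mulr_ge0// ltW// root_const_gt0.
rewrite weightE// /TLweight.
have h1 : powR (1 - rnorm z) (- s) * rnorm (h z) <= root_const s q * pl_const s q * kap.
  apply: (le_trans (ler_wpM2l (powR_ge0 _ _) hz)).
  rewrite [X in X <= _](_ : _ = root_const s q * pl_const s q * kap * (powR (1 - rnorm z) (- s) * powR (rnorm w) s)); last by rewrite /w; ring.
  rewrite -[leRHS]mulr1; apply: ler_wpM2l; first by rewrite mulr_ge0 ?powR_ge0.
  have e1 : powR (rnorm w) (- s) * powR (rnorm w) s = 1.
    by rewrite -powRD ?addNr ?powRr0//; apply/implyP => _; rewrite gt_eqF.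
  rewrite -[leRHS]e1 ler_wpM2r ?powR_ge0//; apply: ge0_ler_powR; rewrite ?nnegrE ?oppr_ge0 ?(ltW s0) ?(ltW d0) ?rnorm_ge0//.
have h2 : powR (powR (1 - rnorm z) (- s) * rnorm (h z)) q <= powR (root_const s q * pl_const s q) q * K.
  apply: (@le_trans _ _ (powR (root_const s q * pl_const s q * kap) q)).
    apply: ge0_ler_powR; rewrite ?nnegrE ?(ltW q0)//.
      by rewrite mulr_ge0 ?powR_ge0 ?rnorm_ge0.
    by rewrite mulr_ge0 ?powR_ge0.
  by rewrite powRM ?powR_ge0// -powRrM mulVf ?gt_eqF// powRr1.
rewrite /cone_mass_const -/b -wd powR_inv1 ?(ltW d0)//.
rewrite [leRHS](_ : _ = powR (root_const s q * pl_const s q) q * K * (4 / 3 * (rnorm w)^-1)); last by ring.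
apply: ler_pM => //; rewrite ?powR_ge0 ?invr_ge0 ?(ltW d0)//.
rewrite (_ : 4 / 3 * (rnorm w)^-1 = (3 / 4 * rnorm w)^-1); last by field; rewrite gt_eqF.
by rewrite lef_pV2 ?posrE// mulr_gt0// divr_gt0.
Qed.

Definition wmass (S : set (RM * RM)) : \bar R := (\int[area]_(p in S) (weight (-1) s q h (toC p))%:E)%E.

Lemma wmass_le (S S' : set (RM * RM)) : S `<=` S' -> (wmass S <= wmass S')%E.
Proof.
move=> h1; apply: ge0_integral_le_patch => p; try by move=> _; rewrite lee_fin weight_ge0.
by move=> /h1.
Qed.

Lemma wmass_tent E : (wmass (toC @^-1` (tent E)) <= tent_mass s q h E)%E.
Proof.
apply: ge0_integral_le_patch => p.
- by move=> _; rewrite lee_fin weight_ge0.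
- by move=> _; rewrite lee_fin mulr_ge0 ?powR_ge0.
- by move=> tp; split=> //; rewrite weightE//; case: tp.
Qed.

Lemma wmass_all : (wmass setT <= K%:E)%E.
Proof.
have := hK (isT : (0 < 2 ^ 0)%N); rewrite expr0 divr1; apply: le_trans.
apply: le_trans (wmass_tent _); rewrite /wmass integral_mkcond [leRHS]integral_mkcond.
apply: ge0_integral_le_patch => p.
- by move=> _; rewrite patch_setT lee_fin weight_ge0.
- by move=> _; rewrite /patch; case: ifP => // _; rewrite lee_fin weight_ge0.
move=> _; split=> //; rewrite patch_setT.
have [dp|dp] := pselect (disc (toC p)); last by rewrite weight_out ?gt_eqF// /patch; case: ifP => //; rewrite lee_fin weight_ge0.
rewrite /patch mem_set//=; apply: tent_intro => // c c1 _; exact: dyadic_arc_full.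
Qed.

End carleson_measure.

Section carleson_discs.
Context {R : realType}.
Local Notation RM := (measurableTypeR R).
Variable X : normedModType (CC R).
Variables (s q : R).
Hypothesis s0 : s < 0.
Hypothesis q1 : 1 <= q.
Let q0 : 0 < q. Proof. exact: lt_le_trans q1. Qed.
Variables (h : CC R -> X) (K : R).
Hypothesis ah : analytic h.
Hypothesis K0 : 0 <= K.
Hypothesis hK : forall j k, (k < 2 ^ j)%N -> (tent_mass s q h (dyadic_arc j k) <= (K / 2 ^+ j)%:E)%E.
Local Notation ww z b := (1 - z * cconj (zeta b)).
Let p2 n : 0 < (2 : R) ^+ n. Proof. by rewrite exprn_gt0. Qed.

Let j3 j : (3 <= j)%N -> (2 ^+ j)^-1 <= 1 / 8 :> R.
Proof.
move=> hj; rewrite div1r lef_pV2 ?posrE//; rewrite -(subnK hj) exprD.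
have : 1 <= (2 : R) ^+ (j - 3) by rewrite exprn_ege1//; lra.
by rewrite (_ : (2 : R) ^+ 3 = 8); [lra|ring].
Qed.

Let near_w (x b d : R) z : d <= 1 / 8 -> `|x - b| <= d / 2 -> rnorm (z - zeta x) <= d / 64 -> rnorm (ww z b) <= 51 / 100.
Proof.
move=> d8 xb zx; rewrite ww_dist.
have := ler_rnormD (zeta b - zeta x) (zeta x - z); rewrite addrA subrK => hh.
have := zeta_lip b x; rewrite distrC => h2.
by rewrite -rnormN opprB in zx; lra.
Qed.

Let cone_depth (w : CC R) : rnorm (1 - w) < 1 -> 5 * cIm w ^+ 2 <= 3 * cRe w ^+ 2 -> rnorm w <= 51 / 100 ->
  107 / 200 * rnorm w <= 1 - rnorm (1 - w).
Proof.
move=> w1 cw w51; have hc := cone_cRe w1 cw.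
have h2 : rnorm w ^+ 2 <= 51 / 100 * rnorm w by rewrite expr2 ler_wpM2r ?rnorm_ge0.
have := @depth_ge R w (107 / 100 * rnorm w) w1; rewrite (_ : _ / 2 = 107 / 200 * rnorm w); last by field.
by apply; lra.
Qed.

Let radius_le (d n m : R) : 0 <= d -> 107 / 200 * n <= 1 - m -> 1 - d / 64 <= m -> n <= d / 16.
Proof. by lra. Qed.

(* Outside the cone at [zeta b] a point is seen only from its own side of [zeta b], hence lies in one dyadic tent. *)
Let noncone_side (x : R) j k z c : (3 <= j)%N -> let b := k%:R / 2 ^+ j in
  `|x - b| <= (2 ^+ j)^-1 / 2 -> disc z -> rnorm (z - zeta x) <= (2 ^+ j)^-1 / 64 ->
  3 * cRe (ww z b) ^+ 2 < 5 * cIm (ww z b) ^+ 2 -> rnorm c = 1 -> stolz c z ->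
  exists y : R, [/\ c = zeta (b + y), `|y| < (2 ^+ j)^-1, cIm (ww z b) < 0 -> 0 < y & 0 < cIm (ww z b) -> y < 0].
Proof.
move=> hj b xb dz zx nc c1 sc.
have d8 := j3 hj; have d0 : 0 < (2 ^+ j)^-1 :> R by rewrite invr_gt0.
move: ((2 ^+ j)^-1 : R) d8 d0 xb zx => d d8 d0 xb zx.
have dep : 1 - rnorm z <= d / 64.
  have := ler_rnormD (zeta x - z) z; rewrite subrK rnorm_zeta.
  by rewrite -rnormN opprB in zx; lra.
have cx : rnorm (c - zeta x) <= d / 16.
  have := ler_rnormD (c - z) (z - zeta x); rewrite addrA subrK.
  by have := stolz_dist c1 sc; lra.
have [y0 [ec hy0 _ _]] := circle_param x c1.
pose y := x - b + y0; have ec' : c = zeta (b + y) by rewrite ec; congr zeta; rewrite /y; ring.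
have hy : `|y| < d by have := ler_normD (x - b) y0; rewrite -/y; lra.
have ey : c * cconj (zeta b) = zeta y.
  by rewrite ec' zetaD mulrAC mul_cconj rnorm_zeta expr1n rC1 mul1r.
have zb1 := rnorm_zeta b.
have w51 := near_w d8 xb zx.
have w1 : rnorm (ww z b) < 1 by lra.
have nc' : cRe (ww z b) ^+ 2 < 3 * cIm (ww z b) ^+ 2.
  by have := sqr_ge0 (cIm (ww z b)); have := sqr_ge0 (cRe (ww z b)); lra.
have os := one_sided zb1 c1 sc w1 nc'; rewrite ey in os.
have iw : cIm (ww z b) = - cIm (z * cconj (zeta b)) by rewrite !ccE sub0r.
exists y; split=> //.
  move=> hw; rewrite ltNge; apply/negP => y0'.
  have yr : - (1 / 2) <= y <= 0 by move: hy; rewrite ltr_norml => /andP[]; lra.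
  by have := cIm_zeta_le0 yr; rewrite iw in hw; nra.
move=> hw; rewrite ltNge; apply/negP => y0'.
have yr : - (1 / 2) <= - y <= 0 by move: hy; rewrite ltr_norml => /andP[]; lra.
have := cIm_zeta_le0 yr; rewrite zetaN cIm_cconj => yi; rewrite iw in hw; nra.
Qed.

Lemma wmassU (A B : set (RM * RM)) : measurable A -> measurable B ->
  (wmass s q h (A `|` B) <= wmass s q h A + wmass s q h B)%E.
Proof.
move=> mA mB.
have -> : A `|` B = A `|` (B `\` A).
  by apply/seteqP; split=> p; [case: (pselect (A p)) => ? [?|?]; [left|left|left|right]|case=> [?|[]]; [left|right]].
rewrite /wmass ge0_integral_setU//=.
- by rewrite leeD2l// wmass_le// => p [].
- exact: measurableD.
- apply/measurable_EFinP; apply: measurable_funTS; exact: measurable_weight.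
- by move=> p _; rewrite lee_fin weight_ge0.
- by apply/disj_setPS => p [Ap []].
Qed.

Let meas_ww b : cmeas (fun p : RM * RM => ww (toC p) b).
Proof. by apply: cmeasB; [exact: cmeas_cst|apply: cmeasM; [exact: cmeas_toC|exact: cmeas_cst]]. Qed.

Let cmc := @cone_mass_const R s q.

(** Off the cone the two sides lie in the tents over the two adjacent arcs, of mass at most
    [K / 2 ^+ j] each; in the cone [cone_weight] leaves the integral of a reciprocal distance; off
    the unit disc the weight is 0. *)
Let wmass_near_dyadic (x : R) j k : (3 <= j)%N -> (0 < k)%N -> (k <= 2 ^ j)%N ->
  `|x - k%:R / 2 ^+ j| <= (2 ^+ j)^-1 / 2 ->
  (wmass s q h (disc_at (zeta x) ((2 ^+ j)^-1 / 64)) <= ((2 + cmc) * K / 2 ^+ j)%:E)%E.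
Proof.
move=> hj k0 kj; set b := k%:R / 2 ^+ j => xb.
have d8 := j3 hj; have d0 : 0 < (2 ^+ j)^-1 :> R by rewrite invr_gt0.
pose S := disc_at (zeta x) ((2 ^+ j)^-1 / 64 : R).
pose N := [set p : RM * RM | 3 * cRe (ww (toC p) b) ^+ 2 < 5 * cIm (ww (toC p) b) ^+ 2].
pose D := [set p : RM * RM | disc (toC p)].
pose U := (S `&` N) `&` (D `&` [set p | cIm (ww (toC p) b) < 0]).
pose L := (S `&` N) `&` (D `&` [set p | 0 < cIm (ww (toC p) b)]).
pose V := (S `&` D) `\` N.
have [mre mim] := meas_ww b.
have mS : measurable S by exact: measurable_disc_at.
have mN : measurable N.
  by apply: measurable_lt_set; apply: measurable_funM => //; exact: measurable_funX.
have mD : measurable D.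
  apply: measurable_lt_set; last exact: measurable_cst.
  by apply: measurable_rnorm; exact: cmeas_toC.
have mU : measurable U.
  by apply: measurableI; [exact: measurableI|apply: measurableI => //; apply: measurable_lt_set => //; exact: measurable_cst].
have mL : measurable L.
  by apply: measurableI; [exact: measurableI|apply: measurableI => //; apply: measurable_lt_set => //; exact: measurable_cst].
have mV : measurable V by apply: measurableD => //; exact: measurableI.
pose O := S `\` D.
have mO : measurable O by exact: measurableD.
have cover : S `<=` U `|` L `|` V `|` O.
  move=> p Sp; case: (pselect (D p)) => Dp; last by right.
  left; case: (pselect (N p)) => Np; last by right.
  left; have [i0|i0|i0] := ltgtP (cIm (ww (toC p) b)) 0; [by left|by right|].
  exfalso; have {}i0 : cIm (ww (toC p) b) ^+ 2 = 0 by rewrite i0 expr0n.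
  have Np' : 3 * cRe (ww (toC p) b) ^+ 2 < 5 * cIm (ww (toC p) b) ^+ 2 by exact: Np.
  by rewrite i0 in Np'; have := sqr_ge0 (cRe (ww (toC p) b)); lra.
apply: (le_trans (wmass_le s q h cover)).
have mUL : measurable (U `|` L) by exact: measurableU.
have mULV : measurable (U `|` L `|` V) by exact: measurableU.
have hO : wmass s q h O = 0%E.
  by apply: integral0_eq => p [_ nD]; rewrite weight_out ?gt_eqF.
apply: (le_trans (wmassU mULV mO)); rewrite hO adde0.
apply: (le_trans (wmassU mUL mV)).
have side := @noncone_side x j k _ _ hj xb.
have hU : (wmass s q h U <= (K / 2 ^+ j)%:E)%E.
  have [k' kj' hk'] := @upper_arc R j k j kj (leqnn j).
  apply: le_trans (hK kj'); apply: le_trans (wmass_tent s q h _); apply: wmass_le => p [[Sp Np] [Dp ip]].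
  apply: tent_intro => // c c1 sc.
  have [y [-> hy h1 _]] := side (toC p) c Dp Sp Np c1 sc.
  by apply: hk'; [exact: ltW (h1 ip)|exact: le_lt_trans (ler_norm _) hy].
have hL : (wmass s q h L <= (K / 2 ^+ j)%:E)%E.
  have [k' kj' hk'] := @lower_arc R j k j k0 kj (leqnn j).
  apply: le_trans (hK kj'); apply: le_trans (wmass_tent s q h _); apply: wmass_le => p [[Sp Np] [Dp ip]].
  apply: tent_intro => // c c1 sc.
  have [y [-> hy _ h1]] := side (toC p) c Dp Sp Np c1 sc.
  by apply: hk'; [move: hy; rewrite ltr_norml => /andP[/ltW]|exact: h1].
have cm0 : 0 <= cmc by rewrite mulr_ge0 ?powR_ge0//; lra.
have hV : (wmass s q h V <= (cmc * K / 2 ^+ j)%:E)%E.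
  (* Points of the cone at depth at most [(2 ^+ j)^-1 / 64] lie within [r] of [zeta b], and the
     [16 * r] of [integral_inv_disc] is [(2 ^+ j)^-1]. *)
  pose r : R := (2 ^+ j)^-1 / 16; have r0 : 0 < r by rewrite divr_gt0.
  apply: (@le_trans _ _ (\int[area]_(p in disc_at (zeta b) r) ((cmc * K)%:E * ((rnorm (toC p - zeta b))^-1)%:E))%E).
    apply: ge0_integral_le_patch => p.
    - by move=> _; rewrite lee_fin weight_ge0.
    - by move=> _; rewrite mule_ge0 ?lee_fin ?invr_ge0 ?rnorm_ge0// mulr_ge0.
    move=> [[Sp Dp] nN].
    have cw : 5 * cIm (ww (toC p) b) ^+ 2 <= 3 * cRe (ww (toC p) b) ^+ 2 by rewrite leNgt; apply/negP.
    have w51 := near_w d8 xb Sp.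
    have w1 : rnorm (ww (toC p) b) < 1 by lra.
    have zw : rnorm (1 - ww (toC p) b) = rnorm (toC p) by rewrite subKr rnormM rnorm_cconj rnorm_zeta mulr1.
    have wd : rnorm (ww (toC p) b) = rnorm (toC p - zeta b) by rewrite ww_dist -rnormN opprB.
    have w1' : rnorm (1 - ww (toC p) b) < 1 by rewrite zw.
    have dep := cone_depth w1' cw w51; rewrite zw in dep.
    have zs : rnorm (toC p) >= 1 - (2 ^+ j)^-1 / 64.
      have := ler_rnormD (zeta x - toC p) (toC p); rewrite subrK rnorm_zeta.
      have : rnorm (zeta x - toC p) <= (2 ^+ j)^-1 / 64 by rewrite -rnormN opprB.
      lra.
    have wr : rnorm (ww (toC p) b) <= r by exact: (radius_le (ltW d0) dep zs).
    split; first by rewrite /disc_at /= -wd.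
    rewrite -EFinM lee_fin; apply: (cone_weight s0 q1 ah K0 hK k0 kj Dp _ cw).
    have : rnorm (ww (toC p) b) * 2 ^+ j <= r * 2 ^+ j by rewrite ler_wpM2r// ltW.
    rewrite /r mulrAC mulVf ?gt_eqF// -/b; lra.
  rewrite ge0_integralZl_EFin//.
  - apply: (@le_trans _ _ ((cmc * K)%:E * (16 * r)%:E)%E).
      by apply: lee_wpmul2l; [rewrite lee_fin mulr_ge0|exact: integral_inv_disc].
    by rewrite -EFinM lee_fin /r; lra.
  - exact: measurable_disc_at.
  - by move=> p _; rewrite lee_fin invr_ge0 rnorm_ge0.
  - apply/measurable_EFinP; apply: measurable_funTS.
    rewrite [X in measurable_fun _ X](_ : _ = (fun p => powR (rnorm (toC p - zeta b)) (-1))); last first.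
      by apply/funext => p; rewrite powR_inv1 ?rnorm_ge0.
    apply: (measurableT_comp (measurable_powR _)); apply: measurable_rnorm.
    by apply: cmeasB; [exact: cmeas_toC|exact: cmeas_cst].
  - by rewrite mulr_ge0.
apply: (le_trans (leeD (le_trans (wmassU mU mL) (leeD hU hL)) hV)); rewrite -!EFinD lee_fin; lra.
Qed.

(** [8192 = 2 ^+ 13] covers the generations [j <= 13], where the total mass [K] serves as bound. *)
Definition carleson_const : R := 8192 * (2 + cmc).

Lemma carleson_const_gt0 : 0 < carleson_const.
Proof.
have : 0 <= cmc by rewrite mulr_ge0 ?powR_ge0//; lra.
by rewrite /carleson_const => h'; lra.
Qed.

Lemma wmass_disc_at (x : R) j : (@I01 R) x ->
  (wmass s q h (disc_at (zeta x) (32 / 2 ^+ j)) <= (carleson_const * K / 2 ^+ j)%:E)%E.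
Proof.
move=> Ix; have cm0 : 0 <= cmc by rewrite mulr_ge0 ?powR_ge0//; lra.
have [j3'|j3'] := leqP 3 (j - 11)%N; last first.
  apply: (le_trans (wmass_le s q h (@subsetT _ _))); apply: (le_trans (wmass_all q1 hK)).
  have jj : (j <= 13)%N by lia.
  have h1 : (2 : R) ^+ j <= 8192.
    by rewrite (_ : 8192 = (2 : R) ^+ 13); [rewrite ler_eXn2l//; lra|ring].
  rewrite lee_fin ler_pdivlMr// /carleson_const.
  have h2 : K * 2 ^+ j <= K * 8192 by rewrite ler_wpM2l.
  have h3 : 0 <= cmc * K by rewrite mulr_ge0.
  by have := K0; lra.
(* As [2 ^+ 11 = 32 * 64], the radius [32 / 2 ^+ j] is the [(2 ^+ i)^-1 / 64] of
   [wmass_near_dyadic]. *)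
pose i := (j - 11)%N.
have ei : (2 : R) ^+ j = 2 ^+ i * 2048.
  by rewrite -(subnK (_ : (11 <= j)%N)) ?exprD -/i; [rewrite (_ : (2 : R) ^+ 11 = 2048)//; ring|lia].
have [k [x' [k0 kj hx ex]]] : exists k : nat, exists x' : R, [/\ (0 < k)%N, (k <= 2 ^ i)%N,
    `|x' - k%:R / 2 ^+ i| <= (2 ^+ i)^-1 / 2 & zeta x = zeta x'].
  move: Ix; rewrite /I01 /= in_itv /= => /andP[x0 x1].
  pose t := x * 2 ^+ i + 1 / 2; have t0 : 0 <= t by rewrite addr_ge0 ?mulr_ge0 ?(ltW (p2 _))//; lra.
  have ht := truncn_itv t0; pose k := Num.truncn t.
  rewrite -/k -natr1 in ht; case/andP: ht => ht1 ht2.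
  have kx (k' : R) (x' : R) : `|x' * 2 ^+ i - k'| <= 1 / 2 -> `|x' - k' / 2 ^+ i| <= (2 ^+ i)^-1 / 2.
    have e : `|x' - k' / 2 ^+ i| * 2 ^+ i = `|x' * 2 ^+ i - k'|.
      by rewrite -[X in _ * X](gtr0_norm (p2 i)) -normrM mulrBl divfK// gt_eqF.
    by move=> hh; rewrite -(ler_pM2r (p2 i)) e mulrAC mulVf ?gt_eqF.
  (* If the nearest dyadic point is 0, it is written as 1 and [x] as [x + 1], to have an arc on its
     lower side. *)
  have [k0|k0] := posnP k.
    exists (2 ^ i)%N, (x + 1); split=> //; first by rewrite expn_gt0.
      apply: kx; rewrite natrX mulrDl mul1r addrK ger0_norm ?mulr_ge0 ?(ltW (p2 _))//.
      by rewrite k0 in ht2; rewrite /t in ht2; lra.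
    by rewrite zetaD zeta1 mulr1.
  exists k, x; split=> //.
    have : k%:R < (2 ^ i).+1%:R :> R.
      rewrite -natr1 natrX; apply: (le_lt_trans ht1); rewrite /t.
      have : x * 2 ^+ i <= 1 * 2 ^+ i by rewrite ler_wpM2r// ltW.
      lra.
    by rewrite ltr_nat.
  by apply: kx; rewrite ler_norml; apply/andP; split; rewrite /t in ht1 ht2; lra.
rewrite ex; have := wmass_near_dyadic j3' k0 kj hx; rewrite -/i.
have -> : 32 / 2 ^+ j = (2 ^+ i)^-1 / 64 :> R by rewrite ei; field; rewrite gt_eqF.
move/le_trans; apply; rewrite lee_fin ei /carleson_const.
have -> : 8192 * (2 + cmc) * K / (2 ^+ i * 2048) = 4 * ((2 + cmc) * K / 2 ^+ i) by field; rewrite gt_eqF.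
have : 0 <= (2 + cmc) * K / 2 ^+ i by rewrite !mulr_ge0 ?invr_ge0 ?(ltW (p2 _))//; lra.
lra.
Qed.

End carleson_discs.

(** * Poisson integrals bounded by the maximal function *)

Section poisson_maximal.
Context {R : realType}.
Local Notation RM := (measurableTypeR R).
Local Notation mu := (@lebesgue_measure R).
Local Notation I01 := (@I01 R).
Implicit Types (c z : CC R).
Let p2 n : 0 < (2 : R) ^+ n. Proof. by rewrite exprn_gt0. Qed.

(** At chordal distance about [8 / 2 ^+ n] from [c] the kernel is of order [4 ^+ n] times the depth,
    and the depth is about [2 ^- N]. *)
Lemma poisson_le_shells c z (N : nat) (x : R) : rnorm c = 1 -> rnorm z < 1 ->
  (2 ^+ N.+1)^-1 < 1 - rnorm z -> 1 - rnorm z <= (2 ^+ N)^-1 -> rnorm (z - c) <= 38 * (1 - rnorm z) ->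
  poisson z x <= \sum_(n < N.+1) 200 * 2 ^+ n * (2 ^+ n / 2 ^+ N) * \1_(near_arc n c) x.
Proof.
move=> c1 z1 d1 d2 zc.
have d0 : 0 < 1 - rnorm z by rewrite subr_gt0.
have e0 := zeta_sub_ge x z.
pose D := rnorm (zeta x - c).
have D39 : D <= 39 * rnorm (zeta x - z).
  by have := ler_rnormD (zeta x - z) (z - c); rewrite addrA subrK -/D; lra.
have sq0 : 0 < rnorm (zeta x - z) ^+ 2 by rewrite exprn_gt0//; lra.
have Pn : poisson z x * rnorm (zeta x - z) ^+ 2 <= 2 * (1 - rnorm z).
  rewrite /poisson divfK ?gt_eqF//.
  have -> : 1 - rnorm z ^+ 2 = (1 + rnorm z) * (1 - rnorm z) by ring.
  by rewrite ler_wpM2r ?(ltW d0)//; lra.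
have P0 : 0 <= poisson z x by rewrite divr_ge0 ?sqr_ge0// subr_ge0 expr_le1// ?rnorm_ge0// ltW.
have [n nN hn] : exists2 n : nat, (n <= N)%N &
    (D * 2 ^+ n < 8) /\ poisson z x <= 200 * 2 ^+ n * (2 ^+ n / 2 ^+ N).
  have [hN|hN] := ltP (D * 2 ^+ N) 8.
    exists N => //; split=> //; rewrite divff ?gt_eqF// mulr1.
    have s1 : (1 - rnorm z) ^+ 2 <= rnorm (zeta x - z) ^+ 2 by rewrite ler_pXn2r ?nnegrE ?(ltW d0) ?rnorm_ge0.
    have s2 : poisson z x * (1 - rnorm z) * (1 - rnorm z) <= 2 * (1 - rnorm z).
      by rewrite -mulrA -expr2; apply: le_trans Pn; rewrite ler_wpM2l.
    rewrite ler_pM2r// in s2.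
    have : poisson z x * (2 ^+ N.+1)^-1 <= 2 by apply: le_trans s2; rewrite ler_wpM2l// ltW.
    by rewrite ler_pdivrMr// exprS; have := p2 N; lra.
  have ex : exists n : nat, 8 <= D * 2 ^+ n by exists N.
  case: (ex_minnP ex) => -[|n] h1 hmin.
    exfalso; have := ler_rnormB (zeta x) c; rewrite expr0 mulr1 /D in h1.
    have := ler_rnormD (zeta x) (- c); rewrite rnormN rnorm_zeta c1; lra.
  have nN : (n < N)%N by exact: hmin.
  exists n; first exact: ltnW.
  have h2 : D * 2 ^+ n < 8 by rewrite ltNge; apply/negP => /hmin; rewrite ltnn.
  split=> //.
  have h3 : 4 <= D * 2 ^+ n by move: h1; rewrite exprS; lra.
  have h4 : 16 <= (D * 2 ^+ n) ^+ 2 by rewrite expr2; nra.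
  (* [39 = 38 + 1] is the constant of [D39]; [2 * 39 ^+ 2 / 16] is rounded up to 200. *)
  have [e ee] : exists e : R, e = 39 by eexists.
  rewrite -ee in D39; have e0' : 0 <= e by rewrite ee ler0n.
  have h5 : (D * 2 ^+ n) ^+ 2 <= (e * rnorm (zeta x - z) * 2 ^+ n) ^+ 2.
    rewrite ler_pXn2r ?nnegrE ?mulr_ge0 ?(ltW (p2 _)) ?rnorm_ge0//; try lra.
    by rewrite ler_wpM2r// ltW.
  have h6 : 16 * poisson z x <= e ^+ 2 * (2 * (1 - rnorm z)) * (2 ^+ n * 2 ^+ n).
    apply: (@le_trans _ _ (e ^+ 2 * (poisson z x * rnorm (zeta x - z) ^+ 2) * (2 ^+ n * 2 ^+ n))).
      rewrite (_ : e ^+ 2 * _ * _ = (e * rnorm (zeta x - z) * 2 ^+ n) ^+ 2 * poisson z x); last by ring.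
      by rewrite ler_wpM2r// (le_trans h4).
    apply: ler_wpM2r; first by rewrite mulr_ge0 ?(ltW (p2 _)).
    by apply: ler_wpM2l => //; rewrite sqr_ge0.
  rewrite mulrA ler_pdivlMr//.
  have h7 : (1 - rnorm z) * 2 ^+ N <= 1 by rewrite -ler_pdivlMr// div1r.
  have := ler_wpM2r (ltW (p2 N)) h6.
  have h8 : (1 - rnorm z) * 2 ^+ N * (2 ^+ n * 2 ^+ n) <= 1 * (2 ^+ n * 2 ^+ n).
    by rewrite ler_wpM2r ?mulr_ge0 ?(ltW (p2 _)).
  have := mulr_ge0 (ltW (p2 n)) (ltW (p2 n)); rewrite ee; lra.
have nN' : (n < N.+1)%N by [].
rewrite (bigD1 (Ordinal nN')) //=; case: hn => hn1 hn2.
rewrite indicE mem_set// mulr1; apply: (le_trans hn2); rewrite lerDl; apply: sumr_ge0 => i _.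
by rewrite !mulr_ge0 ?invr_ge0 ?(ltW (p2 _)) ?indic_ge0.
Qed.

(** Summed over the shells, the ratios [2 ^+ n / 2 ^+ N] form a geometric series below 2, whence
    [400 = 2 * 200]. *)
Lemma Int_poisson_le_Mc (v : R -> R) c z (N : nat) (M : R) :
  measurable_fun setT (v : RM -> R) -> (forall x, 0 <= v x) -> rnorm c = 1 -> rnorm z < 1 ->
  (2 ^+ N.+1)^-1 < 1 - rnorm z -> 1 - rnorm z <= (2 ^+ N)^-1 -> rnorm (z - c) <= 38 * (1 - rnorm z) ->
  (Mc v c <= M%:E)%E -> Int (fun x => poisson z x * v x) <= 400 * M.
Proof.
move=> mv v0 c1 z1 d1 d2 zc hM.
pose a (n : nat) : R := 200 * 2 ^+ n * (2 ^+ n / 2 ^+ N).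
have a0 n : 0 <= a n by rewrite !mulr_ge0 ?invr_ge0 ?(ltW (p2 _)) ?ler0n.
have P0 x : 0 <= poisson z x by rewrite divr_ge0 ?sqr_ge0// subr_ge0 expr_le1// ?rnorm_ge0// ltW.
have mi n : measurable_fun setT (fun x : RM => v x * \1_(near_arc n c) x).
  by apply: measurable_funM => //; apply: measurable_indic; exact: measurable_near_arc.
have i0 n x : 0 <= v x * \1_(near_arc n c) x by rewrite mulr_ge0 ?indic_ge0.
have M0 : 0 <= M by have := le_trans (Mc_ge0 c v0) hM; rewrite lee_fin.
have geo (m : nat) : \sum_(n < m.+1) (2 : R) ^+ n = 2 ^+ m.+1 - 1.
  elim: m => [|m ih]; first by rewrite big_ord_recr big_ord0 /= add0r expr0 expr1; ring.
  by rewrite big_ord_recr /= ih !exprS; ring.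
have main : (\int[mu]_(x in I01) (poisson z x * v x)%:E <= (400 * M)%:E)%E.
  apply: (@le_trans _ _ (\int[mu]_(x in I01) \sum_(n < N.+1) ((a n)%:E * (v x * \1_(near_arc n c) x)%:E))%E).
    apply: ge0_integral_le_patch => x.
    - by move=> _; rewrite lee_fin mulr_ge0.
    - by move=> _; apply: sume_ge0 => n _; rewrite -EFinM lee_fin mulr_ge0.
    move=> Ix; split=> //.
    under eq_bigr do rewrite -EFinM.
    rewrite sumEFin lee_fin; apply: (le_trans (ler_wpM2r (v0 x) (poisson_le_shells x c1 z1 d1 d2 zc))).
    by rewrite mulr_suml ler_sum// => n _; rewrite /a -!mulrA [v x * _]mulrC.
  rewrite ge0_integral_sum//; last first.
  - by move=> n x _; rewrite -EFinM lee_fin mulr_ge0.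
  - by move=> n; apply: measurable_funeM; apply/measurable_EFinP; exact: measurable_funTS.
  - exact: mI01.
  apply: (@le_trans _ _ (\sum_(n < N.+1) (a n / 2 ^+ n * M)%:E)%E).
    apply: lee_sum => n _; rewrite ge0_integralZl_EFin//; last 3 first.
    - exact: mI01.
    - by move=> x _; rewrite lee_fin.
    - by apply/measurable_EFinP; exact: measurable_funTS.
    have -> : (\int[mu]_(x in I01) (v x * \1_(near_arc n c) x)%:E = \int[mu]_(x in I01 `&` near_arc n c) (v x)%:E)%E.
      rewrite integral_mkcondr; apply: eq_integral => x _; rewrite /patch indicE.
      by case: ifP; rewrite ?mulr1 ?mulr0.
    have := le_trans (Mc_ge n v c) hM.
    have -> : (a n)%:E = ((a n / 2 ^+ n)%:E * (2 ^+ n)%:E)%E by rewrite -EFinM divfK ?gt_eqF.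
    by rewrite -muleA => hh; rewrite (EFinM (a n / 2 ^+ n) M); apply: lee_wpmul2l; rewrite ?lee_fin ?divr_ge0 ?(ltW (p2 _)).
  rewrite sumEFin lee_fin -mulr_suml ler_wpM2r//.
  have -> : \sum_(n < N.+1) a n / 2 ^+ n = 200 / 2 ^+ N * \sum_(n < N.+1) (2 : R) ^+ n.
    by rewrite mulr_sumr; apply: eq_bigr => n _; rewrite /a; field; rewrite !gt_eqF.
  rewrite geo exprS mulrAC ler_pdivrMr//; have := p2 N; lra.
rewrite /Int /Rintegral -lee_fin fineK// ge0_fin_numE ?(le_lt_trans main) ?ltry//.
by apply: integral_ge0 => x _; rewrite lee_fin mulr_ge0.
Qed.

End poisson_maximal.

(** * Dyadic discretization *)

Section dyadic_averages.
Context {R : realType}.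
Local Notation RM := (measurableTypeR R).
Local Notation mu := (@lebesgue_measure R).
Local Notation I01 := (@I01 R).
Let p2 n : 0 < (2 : R) ^+ n. Proof. by rewrite exprn_gt0. Qed.

Definition dyad (j k : nat) : set RM := `[k%:R / 2 ^+ j, k.+1%:R / 2 ^+ j[%classic.

Lemma measurable_dyad j k : measurable (dyad j k).
Proof. exact: measurable_itv. Qed.

Lemma dyad_measure j k : mu (dyad j k) = ((2 ^+ j)^-1)%:E.
Proof.
rewrite lebesgue_measure_itv /= lte_fin ltr_pM2r ?invr_gt0// ltr_nat ltnSn -EFinB.
by rewrite -natr1; congr (_%:E); ring.
Qed.

Lemma dyad_sub_I01 j k : (k < 2 ^ j)%N -> dyad j k `<=` I01.
Proof.
move=> kj x; rewrite /dyad /I01 /= !in_itv /= => /andP[h1 h2]; apply/andP; split.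
  by apply: le_trans h1; rewrite divr_ge0 ?ler0n ?ltW.
apply: (le_trans (ltW h2)); rewrite ler_pdivrMr// mul1r -natrX ler_nat; exact: kj.
Qed.

Lemma dyad_split j k : dyad j k = dyad j.+1 k.*2 `|` dyad j.+1 k.*2.+1.
Proof.
have e0 : k%:R / 2 ^+ j = k.*2%:R / 2 ^+ j.+1 :> R by rewrite -muln2 natrM exprS; field; rewrite gt_eqF.
have e1 : k.+1%:R / 2 ^+ j = k.*2.+2%:R / 2 ^+ j.+1 :> R.
  by rewrite -doubleS -muln2 natrM exprS; field; rewrite gt_eqF.
have h (a b : nat) : (a <= b)%N -> a%:R / 2 ^+ j.+1 <= b%:R / 2 ^+ j.+1 :> R.
  by move=> ab; rewrite ler_pM2r ?invr_gt0// ler_nat.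
rewrite /dyad e0 e1; have h1 := h k.*2 k.*2.+1 (leqnSn _); have h2 := h k.*2.+1 k.*2.+2 (leqnSn _).
apply/seteqP; split => x /=; rewrite !in_itv /=; last first.
  by case=> /andP[x0 x1]; rewrite ?x0 ?x1 ?andbT ?(lt_le_trans x1)// (le_trans h1).
case/andP => x0 x1; have [x2|x2] := ltP x (k.*2.+1%:R / 2 ^+ j.+1).
  by left; rewrite x0.
by right; rewrite x1.
Qed.

Lemma dyad_disj j k : [disjoint dyad j.+1 k.*2 & dyad j.+1 k.*2.+1].
Proof.
by apply/disj_setPS => x; rewrite /dyad /= !in_itv /= => -[/andP[_ x1] /andP[x2 _]]; move: (le_lt_trans x2 x1); rewrite ltxx.
Qed.

Lemma integral_dyad_split j k (F : RM -> \bar R) : measurable_fun setT F -> (forall x, (0 <= F x)%E) ->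
  (\int[mu]_(x in dyad j k) F x = \int[mu]_(x in dyad j.+1 k.*2) F x + \int[mu]_(x in dyad j.+1 k.*2.+1) F x)%E.
Proof.
move=> mF F0; rewrite dyad_split ge0_integral_setU//=.
- exact: measurable_dyad.
- exact: measurable_dyad.
- exact: measurable_funTS.
- exact: dyad_disj.
Qed.

Lemma integral_cst_dyad j k (c : R) : (\int[mu]_(x in dyad j k) c%:E = (c / 2 ^+ j)%:E)%E.
Proof.
rewrite (@integral_cst _ _ _ mu _ (measurable_dyad j k)).
transitivity (c%:E * ((2 ^+ j)^-1)%:E)%E; last by [].
by congr (_ * _)%E; exact: dyad_measure.
Qed.

Let halves (a b c : R) : (a + b) / 2 / c = a / (2 * c) + b / (2 * c).
Proof. by rewrite invfM; ring. Qed.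

Let kid j k : (k < 2 ^ j)%N -> (k.*2 < 2 ^ j.+1)%N && (k.*2.+1 < 2 ^ j.+1)%N.
Proof. by rewrite expnS; lia. Qed.

Lemma integral_le_tavg n phi (F : RM -> \bar R) j k : measurable_fun setT F -> (forall x, (0 <= F x)%E) ->
  (k < 2 ^ j)%N ->
  (forall l x, (l < 2 ^ (j + n))%N -> dyad (j + n) l x -> (F x <= (phi (j + n)%N l)%:E)%E) ->
  (\int[mu]_(x in dyad j k) F x <= (tavg n phi j k / 2 ^+ j)%:E)%E.
Proof.
move=> mF F0; elim: n j k => [|n ih] j k kj hF /=.
  rewrite -(integral_cst_dyad j k); apply: ge0_integral_le_patch => x; [by []| |].
    by move=> xj; have := hF k x; rewrite addn0 => /(_ kj xj); exact: le_trans.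
  by move=> xj; split=> //; have := hF k x; rewrite addn0; apply.
have hF' l x : (l < 2 ^ (j.+1 + n))%N -> dyad (j.+1 + n) l x -> (F x <= (phi (j.+1 + n)%N l)%:E)%E.
  by have := hF l x; rewrite addSnnS.
have /andP[k1 k2] := kid kj.
by rewrite integral_dyad_split// halves -exprS EFinD leeD//; exact: ih.
Qed.

Lemma tavg_le_integral n phi (F : RM -> \bar R) j k : measurable_fun setT F -> (forall x, (0 <= F x)%E) ->
  (forall l, 0 <= phi (j + n)%N l) -> (k < 2 ^ j)%N ->
  (forall l x, (l < 2 ^ (j + n))%N -> dyad (j + n) l x -> ((phi (j + n)%N l)%:E <= F x)%E) ->
  ((tavg n phi j k / 2 ^+ j)%:E <= \int[mu]_(x in dyad j k) F x)%E.
Proof.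
move=> mF F0; elim: n j k => [|n ih] j k p0 kj hF /=.
  rewrite -(integral_cst_dyad j k); apply: ge0_integral_le_patch => x.
  - by move=> _; rewrite lee_fin; have := p0 k; rewrite addn0.
  - by [].
  by move=> xj; split=> //; have := hF k x; rewrite addn0; apply.
have hF' l x : (l < 2 ^ (j.+1 + n))%N -> dyad (j.+1 + n) l x -> ((phi (j.+1 + n)%N l)%:E <= F x)%E.
  by have := hF l x; rewrite addSnnS.
have p0' l : 0 <= phi (j.+1 + n)%N l by have := p0 l; rewrite addSnnS.
have /andP[k1 k2] := kid kj.
by rewrite integral_dyad_split// halves -exprS EFinD leeD//; exact: ih.
Qed.

Lemma integral_dyad00 (F : RM -> \bar R) : measurable_fun setT F ->
  (\int[mu]_(x in dyad 0 0) F x = \int[mu]_(x in I01) F x)%E.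
Proof.
move=> mF; rewrite /dyad /I01 expr0 !divr1.
by apply: integral_itv_bndo_bndc; exact: measurable_funTS.
Qed.

End dyadic_averages.

Section packing.
Context {R : realType}.
Local Notation RM := (measurableTypeR R).
Local Notation mu := (@lebesgue_measure R).
Variable X : normedModType (CC R).
Variables (s q : R).
Hypothesis s0 : s < 0.
Hypothesis q1 : 1 <= q.
Let q0 : 0 < q. Proof. exact: lt_le_trans q1. Qed.
Variables (h : CC R -> X) (K : R).
Hypothesis ah : analytic h.
Hypothesis K0 : 0 <= K.
Hypothesis hK : forall j k, (k < 2 ^ j)%N -> (tent_mass s q h (dyadic_arc j k) <= (K / 2 ^+ j)%:E)%E.
Let p2 n : 0 < (2 : R) ^+ n. Proof. by rewrite exprn_gt0. Qed.
Local Notation wt b p := (weight b s q h (toC p)).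
Local Notation dep p := (1 - rnorm (toC p)).

Lemma weight_depth z : disc z -> weight (-1) s q h z = weight (-2) s q h z * (1 - rnorm z).
Proof.
rewrite /disc /= => dz; have d0 : 0 < 1 - rnorm z by rewrite subr_gt0.
rewrite /weight -mulrA; congr (_ * _); rewrite -{3}[1 - rnorm z]powRr1 ?(ltW d0)// -powRD; last first.
  by apply/implyP => _; rewrite gt_eqF.
by congr powR; ring.
Qed.

(** [11 = 3 + 8]: a point of layer [j] seen from the arc is within [3 / 2 ^+ j] of the seeing point,
    which is within [8 / 2 ^+ j] of the left end. Cells of neighbouring arcs overlap. *)
Definition cell (j k : nat) : set (RM * RM) :=
  [set p | (2 ^+ j.+1)^-1 < dep p] `&` [set p | dep p <= (2 ^+ j)^-1] `&` disc_at (zeta (k%:R / 2 ^+ j)) (11 / 2 ^+ j).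

(** In the layer [2 ^+ j.+1] exceeds the reciprocal depth, which converts the tent weight into the
    area weight; indices from [2 ^ j] on are not arcs and get 0. *)
Definition bmass (j k : nat) : R := if (k < 2 ^ j)%N then 2 ^+ j.+1 * fine (wmass s q h (cell j k)) else 0.

Let near_set i : set (RM * (RM * RM)) :=
  [set t | dep t.2 <= (2 ^+ i)^-1] `&` [set t | rnorm (toC t.2 - zeta t.1) <= 38 * dep t.2].

(* Integrating over [x] first, the factor [1 / (1 - |z|)] in [weight (-2)] is cancelled by the measure of the near points;
   integrating over [p] first, the levels of the tree telescope ([near_int_step]). *)
Definition near_kernel i (x : R) (p : RM * RM) : R := 2 * wt (-2) p * \1_(near_set i) (x, p).
Definition near_int i (x : R) : \bar R := (\int[area]_p (near_kernel i x p)%:E)%E.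

Let mdep : measurable_fun setT (fun p : RM * RM => dep p).
Proof. by apply: measurable_funB; [exact: measurable_cst|apply: measurable_rnorm; exact: cmeas_toC]. Qed.

Let measurable_near_set i : measurable (near_set i).
Proof.
have md2 : measurable_fun setT (fun t : RM * (RM * RM) => dep t.2).
  exact: (measurableT_comp mdep (@measurable_snd _ _ RM (RM * RM)%type)).
apply: measurableI.
  by apply: measurable_le_set => //; exact: measurable_cst.
apply: measurable_le_set; last by apply: measurable_funM => //; exact: measurable_cst.
apply: measurable_rnorm; apply: cmeasB.
  by apply: (cmeas_comp cmeas_toC); exact: measurable_snd.
by apply: (cmeas_comp cmeas_zetaR); exact: measurable_fst.
Qed.

Let near_kernel_ge0 i x p : 0 <= near_kernel i x p.
Proof. by rewrite /near_kernel indicE mulr_ge0 ?ler0n// mulr_ge0 ?weight_ge0. Qed.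

Let measurable_near_kernel i : measurable_fun setT (fun t : RM * (RM * RM) => near_kernel i t.1 t.2).
Proof.
apply: measurable_funM.
  apply: measurable_funM; first exact: measurable_cst.
  apply: (@measurableT_comp _ _ _ _ _ _ (fun p : RM * RM => wt (-2) p)); last exact: measurable_snd.
  exact: measurable_weight.
rewrite (_ : (fun _ => _) = \1_(near_set i)); last by apply/funext => -[].
by apply: measurable_indic; exact: measurable_near_set.
Qed.

Let measurable_near_int i : measurable_fun setT (near_int i : RM -> \bar R).
Proof.
apply: (@measurable_int_param R _ _ RM (RM * RM)%type area setT (fun x p => (near_kernel i x p)%:E)) => //.
- by apply/measurable_EFinP; exact: measurable_near_kernel.
- by move=> x p; rewrite lee_fin near_kernel_ge0.
Qed.

Let near_int_ge0 i x : (0 <= near_int i x)%E.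
Proof. by apply: integral_ge0 => p _; rewrite lee_fin near_kernel_ge0. Qed.

Let measurable_cell j k : measurable (cell j k).
Proof.
apply: measurableI; last exact: measurable_disc_at.
by apply: measurableI; [apply: measurable_lt_set|apply: measurable_le_set] => //; exact: measurable_cst.
Qed.

Lemma wmass_cell_fin j k : (fine (wmass s q h (cell j k)))%:E = wmass s q h (cell j k).
Proof.
rewrite fineK// ge0_fin_numE; last by apply: integral_ge0 => p _; rewrite lee_fin weight_ge0.
by apply: (le_lt_trans (wmass_le s q h (@subsetT _ _))); apply: (le_lt_trans (wmass_all q1 hK)); rewrite ltry.
Qed.

Lemma bmass_ge0 j k : 0 <= bmass j k.
Proof.
rewrite /bmass; case: ifP => // _; rewrite mulr_ge0 ?(ltW (p2 _))//.
by rewrite fine_ge0//; apply: integral_ge0 => p _; rewrite lee_fin weight_ge0.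
Qed.

Lemma dyad_zeta j k x : dyad j k x -> rnorm (zeta x - zeta (k%:R / 2 ^+ j)) <= 8 / 2 ^+ j :> R.
Proof.
rewrite /dyad /= in_itv /= -natr1 mulrDl mul1r => /andP[x0 x1].
by have := zeta_lip x (k%:R / 2 ^+ j); rewrite ger0_norm; lra.
Qed.

(** The cell lies in the near set of level [j] but not in that of [j.+1], and on it [2 ^+ j.+1]
    times the depth is at most 2. The 38 is [2 * (11 + 8)], the depth being more than half of
    [2 ^- j]. *)
Let near_int_step j k x : (k < 2 ^ j)%N -> dyad j k x ->
  ((bmass j k)%:E + near_int j.+1 x <= near_int j x)%E.
Proof.
move=> kj xd.
have c0 : (0 <= (2 ^+ j.+1)%:E :> \bar R)%E by rewrite lee_fin ltW.
have pw0 p : (0 <= ((fun p : RM * RM => (wt (-1) p)%:E) \_ (cell j k)) p)%E.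
  by rewrite /patch; case: ifP => // _; rewrite lee_fin weight_ge0.
rewrite /bmass kj EFinM wmass_cell_fin /wmass integral_mkcond -ge0_integralZl_EFin//; first last.
- apply: patch_measurable; first exact: measurable_cell.
  by apply/measurable_EFinP; exact: measurable_weight.
rewrite -ge0_integralD//; first last.
- have mp : measurable_fun setT (fun p : RM * RM => (x, p) : RM * (RM * RM)) by exact: measurable_pair1.
  by apply/measurable_EFinP; exact: (measurableT_comp (measurable_near_kernel j.+1) mp).
- by move=> p _; rewrite lee_fin near_kernel_ge0.
- apply: emeasurable_funM; first exact: measurable_cst.
  apply: patch_measurable; first exact: measurable_cell.
  by apply/measurable_EFinP; exact: measurable_weight.
- by move=> p _; apply: mule_ge0 => //; exact: pw0.
apply: ge0_integral_le_patch => p.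
- move=> _; apply: adde_ge0; last by rewrite lee_fin near_kernel_ge0.
  by apply: mule_ge0 => //; exact: pw0.
- by move=> _; rewrite lee_fin near_kernel_ge0.
move=> _; split=> //; rewrite /patch /near_kernel !indicE; case: ifPn => [/set_mem|_].
  move=> [[d1 d2] dc]; rewrite /= in d1 d2 dc.
  rewrite (@memNset _ (near_set j.+1)) ?mulr0 ?adde0; last first.
    by move=> [/= h1 _]; move: (lt_le_trans d1 h1); rewrite ltxx.
  have e2 : (2 ^+ j.+1)^-1 = (2 ^+ j)^-1 / 2 :> R by rewrite exprS invfM mulrC.
  have d0 : 0 < (2 ^+ j)^-1 :> R by rewrite invr_gt0.
  have dp : disc (toC p) by rewrite /disc /=; rewrite e2 in d1; lra.
  rewrite mem_set; last first.
    split=> //=; have := ler_rnormD (toC p - zeta (k%:R / 2 ^+ j)) (zeta (k%:R / 2 ^+ j) - zeta x).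
    rewrite addrA subrK; have := dyad_zeta xd; rewrite -[rnorm (zeta x - _)]rnormN opprB.
    rewrite /disc_at /= in dc; rewrite e2 in d1; lra.
  rewrite mulr1 -EFinM lee_fin weight_depth//.
  have w0 : 0 <= wt (-2) p by exact: weight_ge0.
  have : 2 ^+ j.+1 * dep p <= 2.
    by rewrite -[leRHS](_ : 2 ^+ j.+1 * (2 ^+ j)^-1 = 2) ?ler_wpM2l ?(ltW (p2 _))// exprS mulfK// gt_eqF.
  move=> /(ler_wpM2l w0); lra.
rewrite mule0 add0e lee_fin; apply: ler_wpM2l; first by rewrite mulr_ge0 ?weight_ge0.
rewrite ler_nat; case: (boolP (_ \in near_set j.+1)) => // /set_mem[/= h1 h2].
rewrite mem_set//; split=> //=; apply: (le_trans h1).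
by rewrite lef_pV2 ?posrE// exprS ler_peMl ?(ltW (p2 _))//; lra.
Qed.

Let tsum_out m i l : (2 ^ i <= l)%N -> tsum m bmass i l = 0.
Proof.
elim: m i l => [|m ih] i l hl /=; rewrite /bmass ltnNge hl /= ?addr0//.
by rewrite !ih ?expnS; [lra|lia|lia].
Qed.

Let tsum_le_near m i l : (l < 2 ^ i)%N ->
  ((tsum m bmass i l / 2 ^+ i)%:E <= \int[mu]_(x in dyad i l) near_int i x)%E.
Proof.
have step i' l' : (l' < 2 ^ i')%N -> ((bmass i' l' / 2 ^+ i')%:E +
    \int[mu]_(x in dyad i' l') near_int i'.+1 x <= \int[mu]_(x in dyad i' l') near_int i' x)%E.
  move=> li; rewrite -(integral_cst_dyad i' l') -ge0_integralD//; first last.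
  - exact: measurable_funTS.
  - by move=> x _; rewrite lee_fin bmass_ge0.
  - exact: measurable_dyad.
  apply: ge0_integral_le_patch => x.
  - by move=> _; rewrite adde_ge0// lee_fin bmass_ge0.
  - by [].
  by move=> xd; split=> //; exact: near_int_step.
elim: m i l => [|m ih] i l li /=.
  apply: le_trans (step i l li); rewrite addr0 leeDl//; exact: integral_ge0.
apply: le_trans (step i l li); rewrite integral_dyad_split//.
have -> : (bmass i l + (tsum m bmass i.+1 l.*2 + tsum m bmass i.+1 l.*2.+1) / 2) / 2 ^+ i =
  bmass i l / 2 ^+ i + (tsum m bmass i.+1 l.*2 / 2 ^+ i.+1 + tsum m bmass i.+1 l.*2.+1 / 2 ^+ i.+1).
  by rewrite exprS; field; rewrite gt_eqF.
by rewrite !EFinD; apply: leeD2l; apply: leeD; apply: ih; rewrite expnS; lia.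
Qed.

(** 912 is the constant of [near_fiber]; the 2 comes from viewing a disc of radius [64 / 2 ^+ i] in
    generation [i - 1], and the 1 covers generation 0. *)
Definition packing_const : R := 912 * (2 * @carleson_const R s q + 1).

Lemma packing_const_gt0 : 0 < packing_const.
Proof. by rewrite mulr_gt0 ?ltr0n//; have := carleson_const_gt0 s q; lra. Qed.

(** Boundary points near the same [p] are within 76 depths of each other and so fill a set of
    measure at most [6 * 76] depths; one depth turns [weight (-2)] into [weight (-1)], and
    [912 = 2 * 6 * 76]. *)
Let near_fiber i l (p : RM * RM) : (l < 2 ^ i)%N ->
  (\int[mu]_(x in dyad i l) (near_kernel i x p)%:E <=
   (912 * (wt (-1) p * \1_(disc_at (zeta (l%:R / 2 ^+ i)) (64 / 2 ^+ i)) p))%:E)%E.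
Proof.
move=> li; have [c ec] : exists c : R, c = 912 by eexists.
rewrite -ec; have c0 : 0 <= c by rewrite ec ler0n.
have r0 : 0 <= c * (wt (-1) p * \1_(disc_at (zeta (l%:R / 2 ^+ i)) (64 / 2 ^+ i)) p).
  by rewrite indicE mulr_ge0// mulr_ge0 ?weight_ge0 ?ler0n.
have [[y [yd yp dp]]|no] := pselect (exists y, [/\ dyad i l y, near_set i (y, p) & disc (toC p)]); last first.
  rewrite integral0_eq ?lee_fin// => x xd; rewrite /near_kernel.
  have [dp|dp] := pselect (disc (toC p)); last by rewrite weight_out ?gt_eqF// mulr0 mul0r.
  by rewrite indicE memNset ?mulr0// => xp; apply: no; exists x.
have d0 : 0 < dep p by rewrite subr_gt0.
case: yp => /= y1 y2.
rewrite indicE mem_set ?mulr1; last first.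
  rewrite /disc_at /=; have := ler_rnormD (toC p - zeta y) (zeta y - zeta (l%:R / 2 ^+ i)).
  by rewrite addrA subrK; have := dyad_zeta yd; lra.
have Iy := dyad_sub_I01 li yd.
pose A := @I01 R `&` [set x : RM | rnorm (zeta x - zeta y) <= 76 * dep p].
have w0 : 0 <= 2 * wt (-2) p by rewrite mulr_ge0 ?weight_ge0.
apply: (@le_trans _ _ (\int[mu]_(x in A) (2 * wt (-2) p)%:E)%E).
  rewrite (_ : (\int[mu]_(x in dyad i l) _)%E =
      (\int[mu]_(x in dyad i l `&` [set x | near_set i (x, p)]) (near_kernel i x p)%:E)%E); last first.
    rewrite [RHS]integral_mkcondr; apply: eq_integral => x _; rewrite /patch; case: ifPn => // /negP xn.
    by rewrite /near_kernel indicE; case: (boolP (_ \in _)) => [/set_mem h'|]; rewrite ?mulr0//; exfalso; apply: xn; rewrite mem_set.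
  apply: ge0_integral_le_patch => x.
  - by move=> _; rewrite lee_fin near_kernel_ge0.
  - by move=> _; rewrite lee_fin.
  move=> [xd [/= _ xp]]; split.
    split; first exact: dyad_sub_I01 xd.
    have := ler_rnormD (zeta x - toC p) (toC p - zeta y); rewrite addrA subrK /=.
    by rewrite -[rnorm (zeta x - toC p)]rnormN opprB; lra.
  by rewrite /near_kernel indicE lee_fin ler_piMr// lern1 leq_b1.
have mA : measurable A.
  apply: measurableI; first exact: mI01.
  apply: measurable_le_set; last exact: measurable_cst.
  by apply: measurable_rnorm; apply: cmeasB; [exact: cmeas_zetaR|exact: cmeas_cst].
rewrite (@integral_cst _ _ _ mu _ mA).
apply: (@le_trans _ _ ((2 * wt (-2) p)%:E * (6 * (76 * dep p))%:E)%E).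
  by apply: lee_wpmul2l; rewrite ?lee_fin//; apply: arc_measure_le => //; rewrite mulr_ge0 ?ler0n ?(ltW d0).
rewrite -EFinM lee_fin weight_depth// ec; lra.
Qed.

(** The packing condition of [tree_power]: the mass counted below a node sits in a disc of radius
    comparable to its arc, which is controlled by [wmass_disc_at]. *)
Lemma tsum_packing m i l : tsum m bmass i l <= packing_const * K.
Proof.
have [li|li] := leqP (2 ^ i) l.
  by rewrite tsum_out// mulr_ge0// ltW// packing_const_gt0.
have [c ec] : exists c : R, c = 912 by eexists.
have c0 : 0 <= c by rewrite ec ler0n.
have cc0 := carleson_const_gt0 s q.
pose D := disc_at (zeta (l%:R / 2 ^+ i)) (64 / 2 ^+ i : R).
have mD : measurable D by exact: measurable_disc_at.
have hD : (wmass s q h D <= ((2 * @carleson_const R s q + 1) * K / 2 ^+ i)%:E)%E.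
  rewrite /D; case: i li {D mD} => [|i] li.
    apply: (le_trans (wmass_le s q h (@subsetT _ _))); apply: (le_trans (wmass_all q1 hK)).
    rewrite lee_fin expr0 divr1 -[leLHS]mul1r ler_wpM2r//; lra.
  have Il : (@I01 R) (l%:R / 2 ^+ i.+1).
    apply: (dyad_sub_I01 li); rewrite /dyad /= in_itv /= lexx /= ltr_pM2r ?invr_gt0//.
    by rewrite ltr_nat.
  have := wmass_disc_at s0 q1 ah K0 hK i Il.
  rewrite (_ : 32 / 2 ^+ i = 64 / 2 ^+ i.+1); last by rewrite exprS; field; rewrite gt_eqF.
  move/le_trans; apply; rewrite lee_fin exprS.
  have -> : (2 * carleson_const s q + 1) * K / (2 * 2 ^+ i) =
    carleson_const s q * K / 2 ^+ i + K / (2 * 2 ^+ i) by field; rewrite gt_eqF.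
  by rewrite lerDl divr_ge0// mulr_ge0 ?ltW.
have main : (\int[mu]_(x in dyad i l) near_int i x <= (packing_const * K / 2 ^+ i)%:E)%E.
  rewrite (@tonelli R _ _ RM (RM * RM)%type mu area (dyad i l) setT (fun x p => (near_kernel i x p)%:E)); last 4 first.
  - exact: measurable_dyad.
  - by [].
  - by apply/measurable_EFinP; exact: measurable_near_kernel.
  - by move=> x p; rewrite lee_fin near_kernel_ge0.
  apply: (@le_trans _ _ (\int[area]_p (c%:E * ((wt (-1) p) * \1_D p)%:E))%E).
    apply: ge0_integral_le_patch => p.
    - by move=> _; apply: integral_ge0 => x _; rewrite lee_fin near_kernel_ge0.
    - by move=> _; rewrite mule_ge0 ?lee_fin// indicE mulr_ge0 ?weight_ge0 ?ler0n.
    by move=> _; split=> //; rewrite -EFinM ec; exact: near_fiber.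
  rewrite ge0_integralZl_EFin//; last 2 first.
  - by move=> p _; rewrite lee_fin indicE mulr_ge0 ?weight_ge0 ?ler0n.
  - apply/measurable_EFinP; apply: measurable_funM; first exact: measurable_weight.
    by apply: measurable_indic.
  have -> : (\int[area]_p ((wt (-1) p) * \1_D p)%:E = wmass s q h D)%E by exact: integral_mul_indic.
  apply: (le_trans (lee_wpmul2l _ hD)); first by rewrite lee_fin.
  by rewrite -EFinM lee_fin /packing_const -ec; lra.
have := le_trans (tsum_le_near m li) main.
by rewrite lee_fin ler_pM2r ?invr_gt0.
Qed.

End packing.

Lemma analyticZ (R : realType) (X : normedModType (CC R)) (g : CC R -> CC R) (h : CC R -> X) :
  analytic g -> analytic h -> analytic (fun z => g z *: h z).
Proof.
move=> ag ah z dz.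
exact: has_cderiv_derivable (has_cderivZ (derivable_has_cderiv (ag z dz)) (derivable_has_cderiv (ah z dz))).
Qed.

(** * Domination of the truncated area function by branch sums *)

Section embedding.
Context {R : realType}.
Local Notation RM := (measurableTypeR R).
Local Notation mu := (@lebesgue_measure R).
Variable X : normedModType (CC R).
Variables (s q : R).
Hypothesis s0 : s < 0.
Hypothesis q1 : 1 <= q.
Let q0 : 0 < q. Proof. exact: lt_le_trans q1. Qed.
Variables (h : CC R -> X) (K : R).
Hypothesis ah : analytic h.
Hypothesis K0 : 0 <= K.
Hypothesis hK : forall j k, (k < 2 ^ j)%N -> (tent_mass s q h (dyadic_arc j k) <= (K / 2 ^+ j)%:E)%E.
Variable g : CC R -> CC R.
Hypothesis ag : analytic g.
Variables (phi : R -> R) (tau : R).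
Hypothesis tau0 : 0 < tau.
Hypothesis phi_ge : forall y, tau <= phi y.
Hypothesis phi_dom : forall y z, (@I01 R) y -> disc z -> rnorm (z - zeta y) <= 38 * (1 - rnorm z) ->
  powR (rnorm (g z)) q <= phi y.
Let p2 n : 0 < (2 : R) ^+ n. Proof. by rewrite exprn_gt0. Qed.
Local Notation dep p := (1 - rnorm (toC p)).

(** An infimum over shrinking arcs increases down the tree. It still dominates [g] on the layer,
    because [phi_dom] holds at every point [y] of the arc. *)
Definition amin (j k : nat) : R := inf [set phi y | y in (dyad j k : set R)].

Let dyad_nonempty j k : dyad j k (k%:R / 2 ^+ j : R).
Proof. by rewrite /dyad /= in_itv /= lexx /= ltr_pM2r ?invr_gt0// ltr_nat. Qed.

Let amin_ge c j k : (forall y, dyad j k y -> c <= phi y) -> c <= amin j k.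
Proof.
move=> hc; apply: lb_le_inf; first by exists (phi (k%:R / 2 ^+ j)), (k%:R / 2 ^+ j).
by move=> _ [y /hc hy <-].
Qed.

Let amin_le j k y : dyad j k y -> amin j k <= phi y.
Proof. by move=> yd; apply: ge_inf; [exists tau => _ [z _ <-]|exists y]. Qed.

Let amin_gt0 j k : 0 < amin j k.
Proof. by apply: (lt_le_trans tau0); apply: amin_ge. Qed.

Let amin_mono : tmono amin.
Proof. by move=> j k; split; apply: amin_ge => y yd; apply: amin_le; rewrite dyad_split; [left|right]. Qed.

Let f z := g z *: h z.

Lemma weight_prod b z : disc z -> weight b s q f z = powR (rnorm (g z)) q * weight b s q h z.
Proof.
move=> dz; rewrite !weightE// /TLweight /f rnormZ mulrCA [in LHS]powRM ?rnorm_ge0 ?mulr_ge0 ?powR_ge0 ?rnorm_ge0//.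
by rewrite mulrA.
Qed.

Let af : analytic f.
Proof. exact: analyticZ. Qed.

(** The cut at depth [(2 ^+ n.+1)^-1] leaves the layers 0 to [n], hence a finite tree. *)
Definition trunc_kernel n (x : R) (p : RM * RM) : R :=
  cone_kernel s q f x p * \1_[set p : RM * RM | (2 ^+ n.+1)^-1 < dep p] p.
Definition trunc_int n (x : R) : \bar R := (\int[area]_p (trunc_kernel n x p)%:E)%E.

Let lev n : set (RM * RM) := [set p | (2 ^+ n.+1)^-1 < dep p] `&` [set p | dep p <= (2 ^+ n)^-1].
Let lev_int n (x : R) : \bar R := (\int[area]_p (cone_kernel s q f x p * \1_(lev n) p)%:E)%E.

Let mdep : measurable_fun setT (fun p : RM * RM => dep p).
Proof. by apply: measurable_funB; [exact: measurable_cst|apply: measurable_rnorm; exact: cmeas_toC]. Qed.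

Let mdepth n : measurable [set p : RM * RM | (2 ^+ n.+1)^-1 < dep p].
Proof. by apply: measurable_lt_set => //; exact: measurable_cst. Qed.

Let mlev n : measurable (lev n).
Proof. by apply: measurableI => //; apply: measurable_le_set => //; exact: measurable_cst. Qed.

Let mcone x : measurable_fun setT (fun p : RM * RM => cone_kernel s q f x p).
Proof.
have mp : measurable_fun setT (fun p : RM * RM => (x, p) : RM * (RM * RM)) by exact: measurable_pair1.
exact: (measurableT_comp (measurable_cone_kernel s q af) mp).
Qed.

Lemma trunc_kernel_ge0 n x p : 0 <= trunc_kernel n x p.
Proof. by rewrite mulr_ge0 ?cone_kernel_ge0. Qed.

Lemma measurable_trunc_kernel n x : measurable_fun setT (trunc_kernel n x).
Proof. by apply: measurable_funM => //; exact: measurable_indic. Qed.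

Let lev_kernel_ge0 n x p : 0 <= cone_kernel s q f x p * \1_(lev n) p.
Proof. by rewrite mulr_ge0 ?cone_kernel_ge0. Qed.

Let measurable_lev_kernel n x : measurable_fun setT (fun p : RM * RM => cone_kernel s q f x p * \1_(lev n) p).
Proof. by apply: measurable_funM => //; exact: measurable_indic. Qed.

Lemma trunc_int_ge0 n x : (0 <= trunc_int n x)%E.
Proof. by apply: integral_ge0 => p _; rewrite lee_fin trunc_kernel_ge0. Qed.

Lemma measurable_trunc_int n : measurable_fun setT (trunc_int n : RM -> \bar R).
Proof.
apply: (@measurable_int_param R _ _ RM (RM * RM)%type area setT (fun x p => (trunc_kernel n x p)%:E)) => //.
  apply/measurable_EFinP; apply: measurable_funM; first exact: measurable_cone_kernel.
  have mi : measurable_fun setT (\1_[set p : RM * RM | (2 ^+ n.+1)^-1 < dep p] : RM * RM -> R).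
    exact: measurable_indic.
  exact: (measurableT_comp mi (@measurable_snd _ _ RM (RM * RM)%type)).
by move=> x p; rewrite lee_fin trunc_kernel_ge0.
Qed.

Let wmass_indic (D : set (RM * RM)) :
  (\int[area]_p (weight (-1) s q h (toC p) * \1_D p)%:E = wmass s q h D)%E.
Proof. exact: integral_mul_indic. Qed.

Let lev_le j k x : (k < 2 ^ j)%N -> dyad j k x -> (lev_int j x <= (amin j k * bmass s q h j k)%:E)%E.
Proof.
move=> kj xd; have a0 : 0 <= amin j k * 2 ^+ j.+1 by rewrite mulr_ge0 ?ltW ?amin_gt0.
have mc : measurable (cell j k : set (RM * RM)).
  by apply: measurableI; [exact: mlev|exact: measurable_disc_at].
rewrite /bmass kj mulrA EFinM (wmass_cell_fin _ hK)// -wmass_indic -ge0_integralZl_EFin//; last 2 first.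
- by move=> p _; rewrite lee_fin mulr_ge0 ?weight_ge0.
- by apply/measurable_EFinP; apply: measurable_funM; [exact: measurable_weight|exact: measurable_indic].
apply: ge0_integral_le_patch => p.
- by move=> _; rewrite lee_fin.
- by move=> _; rewrite mule_ge0 ?lee_fin// mulr_ge0 ?weight_ge0.
move=> _; split=> //; rewrite -EFinM lee_fin.
have r0 : 0 <= amin j k * 2 ^+ j.+1 * (weight (-1) s q h (toC p) * \1_(cell j k) p).
  by rewrite mulr_ge0// mulr_ge0 ?weight_ge0.
rewrite /cone_kernel 2!indicE.
case: (boolP (_ \in [set t : RM * (RM * RM) | _])) => [/set_mem/= sp|]; last by rewrite mulr0 mul0r.
case: (boolP (p \in lev j)) => [/set_mem lp|]; last by rewrite mulr0.
case: (lp) => /= l1 l2; rewrite !mulr1.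
have e2 : (2 ^+ j.+1)^-1 = (2 ^+ j)^-1 / 2 :> R by rewrite exprS invfM mulrC.
have d0 : 0 < (2 ^+ j)^-1 :> R by rewrite invr_gt0.
have dp : disc (toC p) by rewrite /disc /=; rewrite e2 in l1; lra.
have xz := stolz_dist (rnorm_zeta x) sp.
rewrite indicE mem_set ?mulr1; last first.
  split=> //; rewrite /disc_at /=; have := dyad_zeta xd.
  have := ler_rnormD (toC p - zeta x) (zeta x - zeta (k%:R / 2 ^+ j)); rewrite addrA subrK.
  by rewrite -[rnorm (toC p - zeta x)]rnormN opprB; lra.
rewrite weight_prod// weight_depth//.
have w0 : 0 <= weight (-2) s q h (toC p) by exact: weight_ge0.
(* The point is within 3 depths of [zeta x], and [zeta x] within [16 / 2 ^+ j], less than 32 depths,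
   of [zeta y]: 35 in all, inside the 38 of [phi_dom]. *)
have h1 : powR (rnorm (g (toC p))) q <= amin j k.
  apply: amin_ge => y yd; apply: phi_dom => //; first exact: dyad_sub_I01 yd.
  have := dyad_zeta yd; have := dyad_zeta xd.
  have := ler_rnormD (zeta x - zeta (k%:R / 2 ^+ j)) (zeta (k%:R / 2 ^+ j) - zeta y); rewrite addrA subrK.
  have := ler_rnormD (toC p - zeta x) (zeta x - zeta y); rewrite addrA subrK.
  rewrite -[rnorm (toC p - zeta x)]rnormN opprB -[rnorm (_ - zeta y)]rnormN opprB.
  rewrite -[rnorm (zeta (k%:R / 2 ^+ j) - zeta y)]rnormN opprB.
  by rewrite e2 in l1; lra.
have h2 : 1 <= 2 ^+ j.+1 * dep p.
  by rewrite mulrC -ler_pdivrMr// div1r ltW.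
apply: (le_trans (ler_wpM2r w0 h1)).
rewrite (_ : amin j k * 2 ^+ j.+1 * _ = amin j k * weight (-2) s q h (toC p) * (2 ^+ j.+1 * dep p)); last by ring.
by rewrite ler_peMr// mulr_ge0// ltW.
Qed.

(** Each layer met by the Stolz angle at [zeta x] is charged to the arc of that generation
    containing [x], and these arcs form one branch. *)
Lemma trunc_int_le_path n k x : (k < 2 ^ n)%N -> dyad n k x ->
  (trunc_int n x <= (bpath (fun j k => amin j k * bmass s q h j k) n k)%:E)%E.
Proof.
elim: n k => [|n ih] k kn xd /=.
  apply: le_trans (lev_le kn xd); apply: ge0_integral_le_patch => p.
  - by move=> _; rewrite lee_fin trunc_kernel_ge0.
  - by move=> _; rewrite lee_fin.
  move=> _; split=> //; rewrite lee_fin; apply: ler_wpM2l; first exact: cone_kernel_ge0.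
  rewrite !indicE ler_nat; case: (boolP (p \in [set p | _])) => // /set_mem /= h1.
  by rewrite mem_set//; split=> //=; rewrite expr0 invr1; have := rnorm_ge0 (toC p); lra.
have kn' : (k./2 < 2 ^ n)%N by move: kn; rewrite expnS; lia.
have xd' : dyad n k./2 x.
  rewrite dyad_split; move: xd; rewrite -{1}[k]odd_double_half; case: (odd k) => /=; rewrite ?add0n ?add1n => xd.
    by right.
  by left.
rewrite EFinD; apply: le_trans (leeD (ih _ kn' xd') (lev_le kn xd)).
rewrite /trunc_int /lev_int -ge0_integralD//; last 4 first.
- by move=> p _; rewrite lee_fin trunc_kernel_ge0.
- by apply/measurable_EFinP; exact: measurable_trunc_kernel.
- by move=> p _; rewrite lee_fin.
- by apply/measurable_EFinP.
apply: ge0_integral_le_patch => p.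
- by move=> _; rewrite lee_fin trunc_kernel_ge0.
- by move=> _; rewrite adde_ge0// lee_fin ?trunc_kernel_ge0.
move=> _; split=> //; rewrite -EFinD lee_fin /trunc_kernel -mulrDr; apply: ler_wpM2l; first exact: cone_kernel_ge0.
rewrite !indicE -natrD ler_nat; case: (boolP (p \in [set p | (2 ^+ n.+2)^-1 < _])) => // /set_mem /= h1.
have [h2|h2] := ltP (2 ^+ n.+1)^-1 (dep p); first by rewrite mem_set.
by rewrite (_ : p \in lev n.+1) ?addn1// mem_set.
Qed.

Lemma integral_trunc_le (r Kt : R) n : 0 < r -> 0 < K -> measurable_fun setT (phi : RM -> R) ->
  (forall a b (C : R) (n : nat),
    tmono a -> (forall j k, 0 < a j k) -> (forall j k, 0 <= b j k) -> 0 < C ->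
    (forall i l m, (m + i = n)%N -> tsum m b i l <= C) ->
    tavg n (fun j k => powR (bpath (fun j k => a j k * b j k) j k) r) 0 0 <=
      Kt * powR C r * tavg n (fun j k => powR (a j k) r) 0 0) -> 0 < Kt ->
  (\int[mu]_(x in @I01 R) (trunc_int n x `^ r) <=
    (Kt * powR (packing_const s q * K) r)%:E * \int[mu]_(x in @I01 R) (powR (phi x) r)%:E)%E.
Proof.
move=> r0 K0' mphi tree Kt0.
have mF : measurable_fun setT (fun x : RM => (trunc_int n x `^ r)%E).
  exact: (measurableT_comp (measurable_poweR r) (measurable_trunc_int n)).
have mP : measurable_fun setT (fun x : RM => (powR (phi x) r)%:E).
  by apply/measurable_EFinP; exact: (measurableT_comp (measurable_powR r) mphi).
have C0 : 0 < packing_const s q * K by rewrite mulr_gt0 ?packing_const_gt0.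
have tr := tree amin (bmass s q h) _ n amin_mono amin_gt0 (bmass_ge0 s q h) C0
  (fun i l m _ => tsum_packing s0 q1 ah K0 hK m i l).
have L0 : (0 < 2 ^ 0)%N by [].
rewrite -(integral_dyad00 mF) -(integral_dyad00 mP).
have h1 := @integral_le_tavg R n (fun j k => powR (bpath (fun j k => amin j k * bmass s q h j k) j k) r) _ 0 0 mF.
have h2 := @tavg_le_integral R n (fun j k => powR (amin j k) r) _ 0 0 mP.
apply: (le_trans (h1 _ _ _)) => //.
  by move=> x; exact: poweR_ge0.
  move=> l x ll xl; rewrite -poweR_EFin; apply: ler_poweR; [exact: ltW|exact: trunc_int_ge0|].
  exact: trunc_int_le_path.
apply: (@le_trans _ _ ((Kt * powR (packing_const s q * K) r)%:E * (tavg n (fun j k => powR (amin j k) r) 0 0 / 2 ^+ 0)%:E)%E).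
  by rewrite -EFinM lee_fin expr0 !divr1.
apply: lee_wpmul2l; first by rewrite lee_fin mulr_ge0 ?powR_ge0// ltW.
apply: h2 => //.
- by move=> x; rewrite lee_fin powR_ge0.
- by move=> l; exact: powR_ge0.
- by move=> l x ll xl; rewrite lee_fin; apply: ge0_ler_powR; rewrite ?nnegrE ?(ltW r0) ?(ltW (amin_gt0 _ _)) ?amin_le// (le_trans _ (phi_ge x))// ltW.
Qed.

End embedding.

Section circle_bound.
Context {R : realType}.
Local Notation RM := (measurableTypeR R).
Local Notation mu := (@lebesgue_measure R).
Local Notation I01 := (@I01 R).
Let p2 n : 0 < (2 : R) ^+ n. Proof. by rewrite exprn_gt0. Qed.

Definition dilate (r : R) (g : CC R -> CC R) : CC R -> CC R := fun z => g (rC r * z).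

Lemma dilate_cderiv (g : CC R -> CC R) (r : R) : analytic g -> 0 < r ->
  forall z, rnorm z < r^-1 -> exists d, has_cderiv (dilate r g) z d.
Proof.
move=> ag r0 z hz; have dz : disc (rC r * z).
  by rewrite /disc /= rnormM rnorm_rC_ge0 ?(ltW r0)// mulrC -ltr_pdivlMr// div1r.
have h1 := has_cderivZ (has_cderiv_cst (rC r : CC R) z) (has_cderiv_id z).
by eexists; exact: (has_cderiv_comp h1 (derivable_has_cderiv (ag _ dz))).
Qed.

(** For a dilated function [v] is bounded on the circle, so [Mc v] is finite everywhere and [fine]
    loses nothing; [48 = 6 * 8] by [arc_measure_le]. *)
Lemma Mc_bounded (v : R -> R) (B : R) y : 0 <= B -> (forall x, 0 <= v x <= B) -> I01 y ->
  (Mc v (zeta y) <= (48 * B)%:E)%E.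
Proof.
move=> B0 vB Iy; apply: ge_ereal_sup => _ [n _ <-].
apply: (@le_trans _ _ ((2 ^+ n)%:E * (\int[mu]_(x in I01 `&` near_arc n (zeta y)) (cst B%:E) x))%E).
  apply: lee_wpmul2l; first by rewrite lee_fin ltW.
  apply: ge0_integral_le_patch => x.
  - by move=> _; rewrite lee_fin; case/andP: (vB x).
  - by move=> _; rewrite /= lee_fin.
  by move=> hx; split=> //=; rewrite lee_fin; case/andP: (vB x).
have mA : measurable (I01 `&` near_arc n (zeta y)) by apply: measurableI; [exact: mI01|exact: measurable_near_arc].
rewrite (@integral_cst _ _ _ mu _ mA).
have h : (mu (I01 `&` near_arc n (zeta y)) <= (6 * (8 / 2 ^+ n))%:E)%E.
  apply: le_trans (arc_measure_le Iy _); last by rewrite divr_ge0 ?ltW.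
  apply: le_measure; rewrite ?inE //.
    apply: measurableI; first exact: mI01.
    apply: measurable_le_set; last exact: measurable_cst.
    by apply: measurable_rnorm; apply: cmeasB; [exact: cmeas_zetaR|exact: cmeas_cst].
  by move=> x [Ix nx]; split=> //=; rewrite ler_pdivlMr// ltW.
apply: (@le_trans _ _ ((2 ^+ n)%:E * (B%:E * (6 * (8 / 2 ^+ n))%:E))%E).
  by apply: lee_wpmul2l; [rewrite lee_fin ltW|apply: lee_wpmul2l; rewrite ?lee_fin].
rewrite -!EFinM lee_fin le_eqVlt; apply/orP; left; apply/eqP; field; by rewrite gt_eqF.
Qed.

Lemma dyadic_depth (d : R) : 0 < d -> d <= 1 -> exists N : nat, (2 ^+ N.+1)^-1 < d /\ d <= (2 ^+ N)^-1.
Proof.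
move=> d0 d1; have ex : exists n : nat, (2 ^+ n.+1)^-1 < d.
  have [n hn] := pow2_big d^-1; exists n.
  rewrite -[ltRHS]invrK ltf_pV2 ?posrE ?invr_gt0//.
  by apply: (lt_le_trans hn); rewrite exprS ler_peMl ?(ltW (p2 n))//; lra.
case: (ex_minnP ex) => -[|n] h1 hmin; first by exists 0%N; split=> //; rewrite expr0 invr1.
by exists n.+1; split=> //; rewrite leNgt; apply/negP => /hmin; rewrite ltnn.
Qed.

Variable X : normedModType (CC R).

(** With [v] the power [p / 2] of the modulus on the circle, the majorant [phi] is [400 * Mc v + t]
    to the power [q / eta]; its power [p / q] is then a square, and the L^2 bound for [Mc] applies
    uniformly in [r] and [n]. *)
Lemma trunc_int_dilate_le (s q p : R) : s < 0 -> 0 < p -> 1 <= q -> exists2 C : R, 0 < C &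
  forall (h : CC R -> X) (K : R) (g : CC R -> CC R) (r M : R) n,
    analytic h -> 0 < K ->
    (forall j k, (k < 2 ^ j)%N -> (tent_mass s q h (dyadic_arc j k) <= (K / 2 ^+ j)%:E)%E) ->
    analytic g -> 0 < r < 1 ->
    (\int[mu]_(x in I01) (powR (rnorm (dilate r g (zeta x))) p)%:E <= M%:E)%E ->
    (\int[mu]_(x in I01) (trunc_int s q h (dilate r g) n x `^ (p / q)) <=
      (C * powR K (p / q) * M)%:E)%E.
Proof.
move=> s0 p0 q1; have q0 : 0 < q := lt_le_trans ltr01 q1.
have r0 : 0 < p / q by rewrite divr_gt0.
have [Kt Kt0 tree] := @tree_power R (p / q) r0.
have [CM CM0 hCM] := @Mc_L2 R.
have [c ec] : exists c : R, c = 400 by eexists.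
have c0 : 0 <= c by rewrite ec ler0n.
pose A := Kt * powR (packing_const s q) (p / q).
have pk0 := @packing_const_gt0 R s q.
have A0 : 0 < A by rewrite mulr_gt0 ?powR_gt0.
exists (A * (2 * c ^+ 2 * CM + 1)).
  by rewrite mulr_gt0//; have : 0 <= 2 * c ^+ 2 * CM by [rewrite !mulr_ge0 ?sqr_ge0// ltW]; lra.
move=> h K g r M n ah K0 hK ag /andP[rr0 rr1] hM.
pose k := dilate r g; have rho1 : 1 < r^-1 by rewrite invf_gt1.
have kd := dilate_cderiv ag rr0.
have ak : analytic k.
  move=> z dz; have [|d hd] := kd z; first exact: (lt_trans dz).
  exact: has_cderiv_derivable hd.
pose eta := p / 2; have eta0 : 0 < eta by rewrite divr_gt0.
pose v x := powR (rnorm (k (zeta x))) eta.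
have v0 x : 0 <= v x by exact: powR_ge0.
have mk := rnorm_circle_measurable rho1 kd.
have mv : measurable_fun setT (v : RM -> R) by exact: (measurableT_comp (measurable_powR eta) mk).
have [B B0 hB] := rnorm_circle_bounded rho1 kd.
have vB x : 0 <= v x <= powR B eta.
  rewrite v0 /=; apply: ge0_ler_powR; rewrite ?nnegrE ?(ltW eta0) ?rnorm_ge0//.
  by apply: hB; rewrite rnorm_zeta.
have iv : itg v by exact: (itg_pow_circle rho1 kd eta0).
have v2 x : v x ^+ 2 = powR (rnorm (k (zeta x))) p.
  by rewrite /v -powR_mulrn ?powR_ge0// -powRrM /eta divfK.
have iv2 : itg (fun x => v x ^+ 2).
  have -> : (fun x => v x ^+ 2) = (fun x => powR (rnorm (k (zeta x))) p).
    by apply/funext => x; exact: v2.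
  exact: (itg_pow_circle rho1 kd p0).
have Iv2 : Int (fun x => v x ^+ 2) <= M.
  rewrite -lee_fin Int_EFin//; apply: le_trans hM; apply: ge0_integral_le_patch => x.
  - by move=> _; rewrite lee_fin sqr_ge0.
  - by move=> _; rewrite lee_fin powR_ge0.
  by move=> Ix; rewrite v2.
pose Th y := fine (Mc v (zeta y)).
have ThE y : I01 y -> (Th y)%:E = Mc v (zeta y).
  move=> Iy; rewrite fineK// ge0_fin_numE ?Mc_ge0//.
  by apply: le_lt_trans (Mc_bounded (powR_ge0 B eta) vB Iy) _; rewrite ltry.
have Th0 y : 0 <= Th y by rewrite fine_ge0// Mc_ge0.
have mTh : measurable_fun setT (Th : RM -> R).
  by apply: measurableT_comp; [exact: fine_measurable|exact: measurable_Mc].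
apply/lee_addgt0Pr => e e0.
pose Ae := A * powR K (p / q); have Ae0 : 0 < Ae by rewrite mulr_gt0 ?powR_gt0.
(* The tree argument wants positive nodes, so [t] keeps [phi] away from 0; its contribution
   [Ae * (2 * t ^+ 2)] equals the allowed error [e]. *)
pose t := Num.sqrt (e / (2 * Ae)).
have t0 : 0 < t by rewrite sqrtr_gt0 divr_gt0// mulr_gt0.
have t2 : t ^+ 2 = e / (2 * Ae) by rewrite sqr_sqrtr// divr_ge0 ?ltW// mulr_gt0.
pose phi y := powR (c * Th y + t) (q / eta).
have base0 y : t <= c * Th y + t by rewrite lerDr mulr_ge0.
have qe0 : 0 < q / eta by rewrite divr_gt0.
have phi_ge y : powR t (q / eta) <= phi y.
  by apply: ge0_ler_powR; rewrite ?nnegrE ?(ltW qe0) ?(ltW t0)//; apply: le_trans (base0 y); exact: ltW.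
have mphi : measurable_fun setT (phi : RM -> R).
  apply: (measurableT_comp (measurable_powR _)); apply: measurable_funD; last exact: measurable_cst.
  by apply: measurable_funM => //; exact: measurable_cst.
have phi_dom y z : I01 y -> disc z -> rnorm (z - zeta y) <= 38 * (1 - rnorm z) -> powR (rnorm (k z)) q <= phi y.
  move=> Iy dz zy; have z1 : rnorm z < 1 by [].
  have [N [N1 N2]] := @dyadic_depth (1 - rnorm z) ltac:(by rewrite subr_gt0) ltac:(by have := rnorm_ge0 z; lra).
  have MT : (Mc v (zeta y) <= (Th y)%:E)%E by rewrite ThE.
  have h1 := Int_poisson_le_Mc mv v0 (rnorm_zeta y) z1 N1 N2 zy MT.
  have h2 := power_subharmonic rho1 kd eta0 z1.
  have h3 : powR (rnorm (k z)) eta <= c * Th y by apply: (le_trans h2); rewrite ec.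
  rewrite (_ : q = eta * (q / eta)); last by rewrite mulrC divfK// gt_eqF.
  rewrite powRrM; apply: ge0_ler_powR; rewrite ?nnegrE ?(ltW qe0) ?powR_ge0//.
    by apply: le_trans (base0 y); exact: ltW.
  by apply: (le_trans h3); rewrite lerDl ltW.
have tq0 : 0 < powR t (q / eta) by rewrite powR_gt0.
have main := integral_trunc_le s0 q1 ah (ltW K0) hK ak tq0 phi_ge phi_dom n r0 K0 mphi tree Kt0.
apply: (le_trans main).
have hphi : (\int[mu]_(x in I01) (powR (phi x) (p / q))%:E <= (2 * c ^+ 2 * CM * M + 2 * t ^+ 2)%:E)%E.
  have pe y : powR (phi y) (p / q) = (c * Th y + t) ^+ 2.
    rewrite /phi -powRrM (_ : q / eta * (p / q) = 2%:R); last by rewrite /eta; field; rewrite !gt_eqF.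
    by rewrite powR_mulrn// (le_trans _ (base0 y))// ltW.
  apply: (@le_trans _ _ (\int[mu]_(x in I01) ((2 * c ^+ 2)%:E * (Th x * Th x)%:E + (2 * t ^+ 2)%:E))%E).
    apply: ge0_integral_le_patch => x.
    - by move=> _; rewrite lee_fin powR_ge0.
    - move=> _; rewrite -EFinM -EFinD lee_fin; apply: addr_ge0.
        by apply: mulr_ge0; apply: mulr_ge0; rewrite ?sqr_ge0.
      by rewrite mulr_ge0 ?sqr_ge0.
    move=> Ix; split=> //; rewrite pe -EFinM -EFinD lee_fin.
    have := sqr_ge0 (c * Th x - t); rewrite !expr2; lra.
  have mT2 : measurable_fun I01 (fun x : RM => (Th x * Th x)%:E).
    by apply/measurable_EFinP; apply: measurable_funTS; exact: measurable_funM.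
  rewrite ge0_integralD//; last 4 first.
  - exact: mI01.
  - move=> x _; rewrite -EFinM lee_fin; apply: mulr_ge0; apply: mulr_ge0 => //.
    exact: sqr_ge0.
  - by apply: emeasurable_funM => //; exact: measurable_cst.
  - by move=> x _; rewrite lee_fin mulr_ge0 ?sqr_ge0.
  rewrite ge0_integralZl_EFin//; last 3 first.
  - exact: mI01.
  - by move=> x _; rewrite lee_fin mulr_ge0.
  - by rewrite mulr_ge0 ?sqr_ge0.
  have mu1 : (mu I01 = 1)%E by rewrite lebesgue_measure_itv /= lte_fin ltr01 -EFinB subr0.
  have -> : (\int[mu]_(x in I01) (2 * t ^+ 2)%:E = (2 * t ^+ 2)%:E)%E.
    rewrite (@integral_cst _ _ _ mu _ (@mI01 R)).
    by transitivity ((2 * t ^+ 2)%:E * 1)%E; [congr (_ * _)%E; exact: mu1|rewrite mule1].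
  rewrite (EFinD (_ * M)) leeD2r// -(mulrA (2 * c ^+ 2)) (EFinM (2 * c ^+ 2)).
  apply: lee_wpmul2l; first by rewrite lee_fin mulr_ge0 ?sqr_ge0.
  rewrite (_ : (\int[mu]_(x in I01) _)%E = (\int[mu]_(x in I01) (Mc v (zeta x) * Mc v (zeta x)))%E); last first.
    by apply: eq_integral => x /set_mem Ix; rewrite EFinM ThE.
  by apply: (le_trans (hCM v mv v0 iv iv2)); rewrite lee_fin ler_wpM2l// ltW.
apply: (le_trans (lee_wpmul2l _ hphi)); first by rewrite lee_fin mulr_ge0 ?powR_ge0// ltW.
rewrite -EFinM -EFinD lee_fin powRM ?(ltW pk0) ?(ltW K0)// mulrA -/A -/Ae mulrDr t2.
have M0 : 0 <= M.
  by apply: le_trans Iv2; apply: Int_ge0 => x _; rewrite sqr_ge0.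
have -> : Ae * (2 * (e / (2 * Ae))) = e by field; rewrite gt_eqF.
rewrite lerD2r /Ae; have := mulr_ge0 (ltW Ae0) M0; rewrite /Ae; lra.
Qed.

End circle_bound.

(** * The first inclusion *)

Section inferior_limits.
Context {R : realType}.
Local Open Scope ereal_scope.

Lemma le_limn_einf (u : nat -> \bar R) (y : \bar R) N : (forall n, (N <= n)%N -> y <= u n) -> y <= limn_einf u.
Proof.
move=> h; rewrite limn_einf_lim; apply: lime_ge; first exact: is_cvg_einfs.
near=> n; apply: le_ereal_inf_tmp => _ [m /= nm <-]; apply: h; apply: leq_trans nm.
by near: n; exists N.
Unshelve. all: end_near. Qed.

Lemma limn_einf_le (u : nat -> \bar R) (y : \bar R) : (forall n, u n <= y) -> limn_einf u <= y.
Proof.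
move=> h; rewrite limn_einf_lim; apply: lime_le; first exact: is_cvg_einfs.
by near=> n; apply: le_trans (h n); apply: ereal_inf_lbound; exists n => /=.
Unshelve. all: end_near. Qed.

Lemma poweR_limn_einf (u : nat -> \bar R) (r : R) : (0 < r)%R -> (forall n, 0 <= u n) ->
  limn_einf u `^ r <= limn_einf (fun n => u n `^ r).
Proof.
move=> r0 u0; pose L := limn_einf (fun n => u n `^ r); rewrite -/L.
have e0 n : 0 <= einfs u n by apply: le_ereal_inf_tmp => _ [m _ <-].
have L0 : 0 <= limn_einf u by apply: (@le_limn_einf _ _ 0).
have LL0 : 0 <= L by apply: (@le_limn_einf _ _ 0) => n _; exact: poweR_ge0.
have h : limn_einf u <= L `^ r^-1.
  rewrite limn_einf_lim; apply: lime_le; first exact: is_cvg_einfs.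
  near=> n.
  have hn : einfs u n `^ r <= L.
    apply: (@le_limn_einf _ _ n) => m nm; apply: ler_poweR; rewrite ?(ltW r0)//.
    by apply: ereal_inf_lbound; exists m.
  rewrite -[einfs u n]poweRe1// -(divff (lt0r_neq0 r0)) poweRrM.
  by apply: ler_poweR; rewrite ?invr_ge0 ?(ltW r0) ?poweR_ge0.
apply: (le_trans (ler_poweR (ltW r0) L0 h)).
by rewrite -poweRrM mulVf ?gt_eqF// poweRe1.
Unshelve. all: end_near. Qed.

End inferior_limits.

Section product_bound.
Context {R : realType}.
Local Notation RM := (measurableTypeR R).
Local Notation mu := (@lebesgue_measure R).
Local Notation I01 := (@I01 R).
Variable X : normedModType (CC R).
Let p2 n : 0 < (2 : R) ^+ n. Proof. by rewrite exprn_gt0. Qed.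
Let rad n : R := 1 - (2 ^+ n.+1)^-1.

Let rad01 n : 0 < rad n < 1.
Proof.
have h : (2 ^+ n.+1)^-1 <= 1 / 2 :> R.
  by rewrite div1r lef_pV2 ?posrE// exprS ler_peMr//; rewrite exprn_ege1//; lra.
have : 0 < (2 ^+ n.+1)^-1 :> R by rewrite invr_gt0.
by rewrite /rad; lra.
Qed.

Let rad_cvg (g : CC R -> CC R) z (e : R) : analytic g -> disc z -> 0 < e -> exists N, forall n, (N <= n)%N ->
  (2 ^+ n.+1)^-1 < e /\ rnorm (g z) - e <= rnorm (dilate (rad n) g z).
Proof.
move=> ag dz e0; have [d d0 hd] := has_cderiv_cont (derivable_has_cderiv (ag z dz)) e0.
have m0 : 0 < Num.min d e by rewrite lt_min d0.
have [N hN] := pow2_big (Num.min d e)^-1; exists N => n Nn.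
have hn : (2 ^+ n.+1)^-1 < Num.min d e.
  rewrite -[ltRHS]invrK ltf_pV2 ?posrE ?invr_gt0//; apply: (lt_le_trans hN).
  by rewrite ler_eXn2l//; [exact: leqW|lra].
move: hn; rewrite lt_min => /andP[h1 h2]; split=> //.
have zz : rC (rad n) * z = z + (- (rC ((2 ^+ n.+1)^-1) * z)).
  by rewrite /rad rC_1B mulrBl mul1r.
have hz : rnorm (- (rC ((2 ^+ n.+1)^-1) * z)) < d.
  rewrite rnormN rnormM rnorm_rC_ge0 ?invr_ge0 ?(ltW (p2 _))//; apply: le_lt_trans h1.
  by rewrite ler_piMr ?invr_ge0 ?(ltW (p2 _))// ltW.
have := hd _ hz; rewrite -zz -/(dilate (rad n) g z) => h3.
have := ler_rnormB (g z) (dilate (rad n) g z).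
by rewrite -[rnorm (g z - _)]rnormN opprB; lra.
Qed.

(** Fatou, with the pointwise limit inferior bounded up to an arbitrary factor [c < 1]: where [g]
    does not vanish, the dilated modulus eventually exceeds [powR c q^-1] times that of [g], and the
    truncation eventually lets the point in. *)
Lemma cone_int_le_liminf (s q : R) (g : CC R -> CC R) (h : CC R -> X) x : 1 <= q -> analytic g -> analytic h ->
  (cone_int s q (fun z => g z *: h z) x <= limn_einf (fun n => trunc_int s q h (dilate (rad n) g) n x))%E.
Proof.
move=> q1 ag ah; have q0 : 0 < q := lt_le_trans ltr01 q1.
have adn n : analytic (dilate (rad n) g).
  move=> z dz; have /andP[r0 r1] := rad01 n.
  have [|d hd] := dilate_cderiv ag r0 (z := z); last exact: has_cderiv_derivable hd.
  by apply: (lt_trans dz); rewrite invf_gt1.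
have := @fatou _ _ R area setT measurableT (fun n p => (trunc_kernel s q h (dilate (rad n) g) n x p)%:E).
have mt n : measurable_fun setT (fun p : RM * RM => (trunc_kernel s q h (dilate (rad n) g) n x p)%:E).
  by apply/measurable_EFinP; exact: (measurable_trunc_kernel s q ah (adn n) n x).
have t0 n (p : RM * RM) : [set: RM * RM] p -> (0 <= (trunc_kernel s q h (dilate (rad n) g) n x p)%:E)%E.
  by move=> _; rewrite lee_fin trunc_kernel_ge0.
move=> /(_ mt t0); apply: le_trans; rewrite /cone_int.
apply: ge0_integral_le_patch => p.
- by move=> _; rewrite lee_fin cone_kernel_ge0.
- by move=> _; apply: (@le_limn_einf _ _ _ 0) => n _; exact: t0.
move=> _; split=> //; apply/lee_mul01Pr; first by rewrite lee_fin cone_kernel_ge0.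
move=> c /andP[c0 c1]; rewrite -EFinM.
have [dp|dp] := pselect (disc (toC p)); last first.
  rewrite /cone_kernel weight_out ?gt_eqF// mul0r mulr0.
  by apply: (@le_limn_einf _ _ _ 0) => n _; exact: t0.
have dep0 : 0 < 1 - rnorm (toC p) by rewrite subr_gt0.
have [g0|g0] := eqVneq (rnorm (g (toC p))) 0.
  rewrite /cone_kernel weightE// /TLweight rnormZ g0 mul0r mulr0 powR0 ?gt_eqF// !mul0r mulr0.
  by apply: (@le_limn_einf _ _ _ 0) => n _; exact: t0.
have gp : 0 < rnorm (g (toC p)) by rewrite lt_neqAle eq_sym g0 rnorm_ge0.
pose c' := powR c q^-1; have c'0 : 0 <= c' by exact: powR_ge0.
have c'1 : c' < 1.
  have e1 : powR 1 q^-1 = 1 :> R by rewrite powR1.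
  by rewrite -[ltRHS]e1; apply: gt0_ltr_powR; rewrite ?nnegrE ?invr_gt0// ltW.
have cE : powR c' q = c by rewrite -powRrM mulVf ?gt_eqF// powRr1// ltW.
have e0 : 0 < Num.min (1 - rnorm (toC p)) ((1 - c') * rnorm (g (toC p))).
  by rewrite lt_min dep0 mulr_gt0// subr_gt0.
have [N hN] := rad_cvg ag dp e0.
apply: (@le_limn_einf _ _ _ N) => n Nn; have [h1 h2] := hN n Nn.
rewrite lt_min in h1; case/andP: h1 => h1 _.
have h3 : c' * rnorm (g (toC p)) <= rnorm (dilate (rad n) g (toC p)).
  apply: le_trans h2; have : Num.min (1 - rnorm (toC p)) ((1 - c') * rnorm (g (toC p))) <= (1 - c') * rnorm (g (toC p)).
    by rewrite ge_min lexx orbT.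
  lra.
rewrite lee_fin /trunc_kernel [X in _ <= _ * X]indicE mem_set//= mulr1.
rewrite /cone_kernel mulrA; apply: ler_wpM2r => //.
rewrite !weight_prod// mulrA; apply: ler_wpM2r; first exact: weight_ge0.
rewrite -{1}cE -powRM ?rnorm_ge0//; apply: ge0_ler_powR; rewrite ?nnegrE ?(ltW q0) ?rnorm_ge0//.
by rewrite mulr_ge0 ?rnorm_ge0.
Qed.

Lemma inTL_mul (s p q : R) : s < 0 -> 0 < p -> 1 <= q -> exists C : R, forall (g : CC R -> CC R) (h : CC R -> X),
  inHp p g -> inTL_inf s q h ->
  inTL s p q (fun z => g z *: h z) /\
  (TL_norm s p q (fun z => g z *: h z) <= C%:E * (Hp_norm p g * TL_norm_inf s q h))%E.
Proof.
move=> s0 p0 q1; have q0 : 0 < q := lt_le_trans ltr01 q1.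
have r0 : 0 < p / q by rewrite divr_gt0.
have [C C0 hC] := trunc_int_dilate_le X s0 p0 q1.
exists (powR C p^-1) => g h [ag Hg] [ah Hh].
have Hg0 : (0 <= Hp_norm p g)%E.
  apply: le_trans (ereal_sup_ubound _); last by exists (1 / 2); split; [lra|reflexivity].
  exact: poweR_ge0.
pose N := fine (Hp_norm p g); have NE : N%:E = Hp_norm p g by rewrite fineK// ge0_fin_numE.
have N0 : 0 <= N by rewrite fine_ge0.
have hN (r : R) : 0 < r < 1 -> (\int[mu]_(x in I01) (powR (rnorm (dilate r g (zeta x))) p)%:E <= (powR N p)%:E)%E.
  move=> r01; set I := (\int[mu]_(x in I01) _)%E.
  have I0 : (0 <= I)%E by apply: integral_ge0 => x _; rewrite lee_fin powR_ge0.
  have hI : (I `^ p^-1 <= N%:E)%E.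
    by rewrite NE; apply: ereal_sup_ubound; exists r; split.
  rewrite -[I]poweRe1// -(mulVf (lt0r_neq0 p0)) poweRrM -poweR_EFin.
  by apply: ler_poweR; rewrite ?poweR_ge0 ?(ltW p0).
pose S : \bar R := ereal_sup [set y : \bar R | exists j k : nat, (k < 2 ^ j)%N /\
  y = ((2 ^+ j)%:E * tent_mass s q h (dyadic_arc j k))%E].
have tm0 j k : (0 <= tent_mass s q h (dyadic_arc j k))%E.
  by apply: integral_ge0 => u _; rewrite lee_fin mulr_ge0 ?powR_ge0.
have S0 : (0 <= S)%E.
  apply: le_trans (ereal_sup_ubound _); last by exists 0%N, 0%N; split; [|reflexivity].
  by rewrite mule_ge0 ?lee_fin ?(ltW (p2 _)).
have TE : TL_norm_inf s q h = (S `^ q^-1)%E by [].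
have Slt : (S < +oo)%E.
  rewrite ltey; apply/eqP => SE; move: Hh; by rewrite TE SE poweRyr ?gt_eqF ?invr_gt0.
pose K := fine S; have KE : K%:E = S by rewrite fineK// ge0_fin_numE.
have K0 : 0 <= K by rewrite fine_ge0.
have hK K' : K <= K' -> forall j k, (k < 2 ^ j)%N -> (tent_mass s q h (dyadic_arc j k) <= (K' / 2 ^+ j)%:E)%E.
  move=> KK j k kj.
  have : ((2 ^+ j)%:E * tent_mass s q h (dyadic_arc j k) <= K'%:E)%E.
    by apply: (@le_trans _ _ K%:E); rewrite ?lee_fin// KE; apply: ereal_sup_ubound; exists j, k.
  have [t ht] : exists t : R, tent_mass s q h (dyadic_arc j k) = t%:E \/ tent_mass s q h (dyadic_arc j k) = +oo%E.
    by case: (tent_mass s q h (dyadic_arc j k)) (tm0 j k) => [t _|_|//]; [exists t; left|exists 0; right].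
  case: ht => ->; last by rewrite gt0_muley ?lte_fin.
  by rewrite -EFinM !lee_fin ler_pdivlMr// mulrC.
set f := fun z => g z *: h z.
have af : analytic f by exact: analyticZ.
set J : \bar R := (\int[mu]_(x in I01) (cone_int s q f x `^ (p / q)))%E.
have TLE : TL_norm s p q f = (J `^ p^-1)%E.
  rewrite /TL_norm /tent_norm /arc_int; congr (_ `^ _)%E; apply: eq_integral => x _.
  by rewrite AqE// -poweRrM mulrC.
have J0 : (0 <= J)%E by apply: integral_ge0 => x _; exact: poweR_ge0.
have adn n : analytic (dilate (rad n) g).
  move=> z dz; have /andP[rr0 rr1] := rad01 n.
  have [|d hd] := dilate_cderiv ag rr0 (z := z); last exact: has_cderiv_derivable hd.
  by apply: (lt_trans dz); rewrite invf_gt1.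
have hJ K' : K <= K' -> 0 < K' -> (J <= (C * powR K' (p / q) * powR N p)%:E)%E.
  move=> KK K'0.
  have mF n : measurable_fun I01 (fun x : RM => (trunc_int s q h (dilate (rad n) g) n x `^ (p / q))%E).
    apply: measurable_funTS; apply: (measurableT_comp (measurable_poweR _)).
    exact: (measurable_trunc_int s q ah (adn n) n).
  have F0 n x : I01 x -> (0 <= trunc_int s q h (dilate (rad n) g) n x `^ (p / q))%E.
    by move=> _; exact: poweR_ge0.
  have fat := @fatou _ _ R mu I01 (@mI01 R) _ mF F0.
  apply: (@le_trans _ _ (\int[mu]_(x in I01) limn_einf (fun n => (trunc_int s q h (dilate (rad n) g) n x `^ (p / q))%E))%E).
    apply: ge0_integral_le_patch => x.
    - by move=> _; exact: poweR_ge0.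
    - by move=> Ix; apply: (@le_limn_einf _ _ _ 0) => n _; exact: poweR_ge0.
    move=> Ix; split=> //; apply: le_trans (poweR_limn_einf r0 _); last by move=> n; exact: trunc_int_ge0.
    by apply: ler_poweR; [exact: ltW|exact: cone_int_ge0|exact: cone_int_le_liminf].
  apply: (le_trans fat); apply: limn_einf_le => n.
  by apply: hC => //; [exact: hK|apply: hN; exact: rad01].
have hJK : (J <= (C * powR K (p / q) * powR N p)%:E)%E.
  (* The tree bound wants a positive constant. For [K = 0] it is used with some [K' > 0] chosen so
     that the resulting bound is at most [e]. *)
  have [K00|K1] := eqVneq K 0; last by apply: hJ => //; rewrite lt_neqAle eq_sym K1.
  rewrite K00 powR0 ?gt_eqF// mulr0 mul0r; apply/lee_addgt0Pr => e e0; rewrite add0e.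
  have CN0 : 0 < C * powR N p + 1 by have := mulr_ge0 (ltW C0) (powR_ge0 N p); lra.
  pose K' := powR (e / (C * powR N p + 1)) (p / q)^-1.
  have K'0 : 0 < K' by rewrite powR_gt0// divr_gt0.
  apply: (le_trans (hJ K' _ K'0)); first by rewrite K00 ltW.
  rewrite lee_fin /K' -powRrM mulVf ?gt_eqF// powRr1; last by rewrite divr_ge0// ltW.
  rewrite (_ : C * _ * _ = e * (C * powR N p / (C * powR N p + 1))); last by ring.
  by rewrite ler_piMr ?(ltW e0)// ler_pdivrMr// mul1r lerDl.
have final : (TL_norm s p q f <= (powR C p^-1)%:E * (Hp_norm p g * TL_norm_inf s q h))%E.
  rewrite TLE TE -NE -KE poweR_EFin -!EFinM.
  apply: (le_trans (ler_poweR _ J0 hJK)); first by rewrite invr_ge0 ltW.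
  rewrite poweR_EFin lee_fin !powRM ?mulr_ge0 ?powR_ge0 ?(ltW C0)//.
  rewrite -!powRrM mulfV ?gt_eqF// powRr1// (_ : p / q / p = q^-1); last by field; rewrite !gt_eqF.
  by rewrite -mulrA [powR K _ * N]mulrC.
split=> //; split=> //; apply: (le_lt_trans final).
by rewrite -NE TE -KE poweR_EFin -!EFinM ltry.
Qed.

End product_bound.

(* F^s_{p,q}(X) = H^p . F^s_{oo,q}(X), with outer first factor. *)
Theorem mainTheorem1 (R : realType) (X : completeNormedModType (CC R)) (s p q : R) :
  s < 0 -> 0 < p -> 1 <= q ->
  (* H^p . F^s_{oo,q}(X) ⊂ F^s_{p,q}(X) *)
  (exists C : R, forall (g : CC R -> CC R) (h : CC R -> X),
     inHp p g -> inTL_inf s q h ->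
     inTL s p q (fun z => g z *: h z) /\
     (TL_norm s p q (fun z => g z *: h z) <= C%:E * (Hp_norm p g * TL_norm_inf s q h))%E)
  /\
  (* F^s_{p,q}(X) ⊂ H^p . F^s_{oo,q}(X), with g outer *)
  (exists C : R, forall f : CC R -> X, inTL s p q f ->
     exists (g : CC R -> CC R) (h : CC R -> X),
       outer g /\ inHp p g /\ inTL_inf s q h /\
       (forall z : CC R, disc z -> f z = g z *: h z) /\
       (Hp_norm p g * TL_norm_inf s q h <= C%:E * TL_norm s p q f)%E).
Proof.
move=> s0 p0 q1; split; first exact: inTL_mul.
exact: outer_factorization.
Qed.
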